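(* Fix $p>0$. Consider on $\mathbb T^2$ the equation $$\mathrm i\,u_t-\Delta u+V(\omega t+\mathbf Kx)\,u+(\partial_{y_2}P)(\omega t+\mathbf Kx,u,\bar u)=0,\qquad x\in\mathbb T^2, \qquad (\ast)$$ where $V$ satisfies assumption (H$V$) and $P$ satisfies assumption (H$P$) (both spelled out in the context). Let $\mathtt R:=[-1,1]^d$. There exist $\gamma_*,\epsilon_*>0$ and a constant $C>0$ such that for any $\gamma\in(0,\gamma_* )$ and any potential $V$ satisfying $$\epsilon:=\gamma^{-1}\|V\|_{\mathtt a,\mathtt p}<\epsilon_*,$$ there exist a (Cantor-like, measurable) set $\mathcal C\subset\mathtt R$ with $\mathrm{meas}(\mathtt R\setminus\mathcal C)\le C\gamma$ and $r_*,T_*>0$ such that for any $\omega\in\mathcal C$ and any $r\in(0,r_* )$ the following holds: for any initial datum $u(0)\in\mathfrak H^p$ with $\|u(0)\|_p\le r$, the solution $u(t)\in\mathfrak H^p$ of $(\ast)$ fulfills $$\|u(t)\|_p\le 2r\qquad\text{for all } |t|\le \frac{T_*}{r^2}.$$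
   Context: $\mathbb T=\mathbb R/2\pi\mathbb Z$. The vectors $\mathbf k^{(1)},\dots,\mathbf k^{(d)}\in\mathbb Z^2$ are fixed and $\mathbf K$ is the $d\times 2$ integer matrix with rows $\mathbf k^{(1)},\dots,\mathbf k^{(d)}$, assumed of maximal rank. For $\ell\in\mathbb Z^d$, $\pi(\ell):=\sum_{i=1}^d\ell_i\mathbf k^{(i)}\in\mathbb Z^2$. $\langle x\rangle:=\max\{1,|x|\}$. Fix $\mathtt a>0$, $\mathtt p>d/2$. $\vec 1=(1,\dots,1)\in\mathbb Z^d$. Function space: a function $u=\sum_{j\in\mathbb Z^2}u_je^{\mathrm ij\cdot x}$ is identified with $(u_j)_{j\in\mathbb Z^2}$; $\mathfrak H^p:=\ell^1(\mathbb Z^2)\cap h^p(\mathbb Z^2)$ with norm $\|u\|_p:=\|u\|_{\ell^1}+\|u\|_{h^p}$, $\|u\|_{h^p}^2=\sum_j\langle j\rangle^{2p}|u_j|^2$. Assumption (H$V$): $V(\varphi)=\sum_{\ell\in\mathbb Z^d}V(\ell)e^{\mathrm i\ell\cdot\varphi}$ is a real-valued function on $\mathbb T^d$ with $\|V\|_{\mathtt a,\mathtt p}^2:=\sum_\ell e^{2\mathtt a|\ell|}|V(\ell)|^2\langle\ell\rangle^{2\mathtt p}<\infty$ and $V(\ell)=0$ for every $\ell$ such that $\pi(\ell)=0$ or $\sum_i\ell_i\ne0$. Assumption (H$P$): $P(\varphi,y_1,y_2)=\sum_{\ell\in\mathbb Z^d,\,d_1,d_2\ge0}P_{\ell,d_1,d_2}e^{\mathrm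 i\ell\cdot\varphi}y_1^{d_1}y_2^{d_2}$ is analytic on $\mathbb T^d\times B_{\mathtt r_0}(0)$ for some $\mathtt r_0>0$, with $\sum_{\ell,d_1,d_2}|P_{\ell,d_1,d_2}|e^{\mathtt a|\ell|}\mathtt r_0^{d_1+d_2}<\infty$; $P(\varphi,y,\bar y)$ is real; $P_{\ell,d_1,d_2}=0$ if $d_1+d_2\le2$ (so that the nonlinearity $\partial_{y_2}P$ has a zero of order at least two at $y=0$); and $P(\varphi+t\vec 1,e^{\mathrm it}y_1,e^{-\mathrm it}y_2)=P(\varphi,y_1,y_2)$ for all $t\in\mathbb R$. *)

(* Defs.v *)
From mathcomp Require Import all_boot all_order all_algebra.
From mathcomp Require Import complex.
From mathcomp Require Import all_classical all_reals all_analysis.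
From mathcomp.analysis.showcase Require summability.

Set Implicit Arguments.
Unset Strict Implicit.
Unset Printing Implicit Defensive.

Import Order.TTheory GRing.Theory Num.Theory.
Import numFieldNormedType.Exports.

Local Open Scope classical_set_scope.
Local Open Scope ring_scope.
Local Open Scope complex_scope.

Section Defs.
Variable R : realType.

Definition cabs (z : R[i]) : R :=
  Num.sqrt (complex.Re z ^+ 2 + complex.Im z ^+ 2).

(* e^{i theta} *)
Definition expi (theta : R) : R[i] := cos theta +i* sin theta.

(* Limit of the partial sums over the directed set of finite subsets of I; the
   usual sum of an absolutely summable family. *)
Definition csum (I : choiceType) (f : I -> R[i]) : R[i] :=
  summability.sum (f : I -> R[i]^o).

(* Euclidean norm of an integer vector *)
Definition enorm n (l : 'rV[int]_n) : R :=
  Num.sqrt (\sum_i (l 0 i)%:~R ^+ 2).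

Definition japanese n (l : 'rV[int]_n) : R := Num.max 1 (enorm l).

(* l . phi *)
Definition idot n (l : 'rV[int]_n) (phi : 'rV[R]_n) : R :=
  \sum_i (l 0 i)%:~R * phi 0 i.

(* pi(l) = sum_i l_i k^(i), the k^(i) being the rows of K *)
Definition momentum d (K : 'M[int]_(d, 2)) (l : 'rV[int]_d) : 'rV[int]_2 :=
  l *m K.

(* K x, as a row vector *)
Definition Kapp d (K : 'M[int]_(d, 2)) (x : 'rV[R]_2) : 'rV[R]_d :=
  x *m (map_mx intr K)^T.

(** Functions are given by their Fourier coefficients; functions on a torus are
    2 pi-periodic functions of real variables. *)

Definition hp_norm (p : R) (u : 'rV[int]_2 -> R[i]) : \bar R :=
  (\esum_(j in [set: 'rV[int]_2]) (cabs (u j))%:E +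
   (\esum_(j in [set: 'rV[int]_2])
      (japanese j `^ (2 * p) * cabs (u j) ^+ 2)%:E) `^ (2^-1))%E.

Definition torus_fun (u : 'rV[int]_2 -> R[i]) (x : 'rV[R]_2) : R[i] :=
  csum (fun j => u j * expi (idot j x)).

Definition potential d (V : 'rV[int]_d -> R[i]) (phi : 'rV[R]_d) : R[i] :=
  csum (fun l => V l * expi (idot l phi)).

Definition V_norm d (a q : R) (V : 'rV[int]_d -> R[i]) : \bar R :=
  ((\esum_(l in [set: 'rV[int]_d])
      (expR (2 * a * enorm l) * cabs (V l) ^+ 2
       * japanese l `^ (2 * q))%:E) `^ (2^-1))%E.

Record hypV d (K : 'M[int]_(d, 2)) (a q : R) (V : 'rV[int]_d -> R[i]) : Prop :=
  HypV {
    hypV_norm : (V_norm a q V < +oo)%E;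
    hypV_real : forall phi, complex.Im (potential V phi) = 0;
    hypV_supp : forall l, momentum K l = 0 \/ \sum_i l 0 i <> 0 -> V l = 0
  }.

Definition Pfun d (P : 'rV[int]_d -> nat -> nat -> R[i])
    (phi : 'rV[R]_d) (y1 y2 : R[i]) : R[i] :=
  csum (fun k : 'rV[int]_d * nat * nat =>
    P k.1.1 k.1.2 k.2 * expi (idot k.1.1 phi) * y1 ^+ k.1.2 * y2 ^+ k.2).

(* complex derivative in the last variable *)
Definition dPfun d (P : 'rV[int]_d -> nat -> nat -> R[i])
    (phi : 'rV[R]_d) (y1 y2 : R[i]) : R[i] :=
  derive1 (fun z : R[i]^o => Pfun P phi y1 z : R[i]^o) y2.

(* Analyticity of Pfun P on T^d x B_{r0}(0), where B_{r0}(0) is the polydisc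
   |y1|, |y2| < r0, is a consequence of the summability condition. *)
Record hypP d (a r0 : R) (P : 'rV[int]_d -> nat -> nat -> R[i]) : Prop :=
  HypP {
    hypP_radius : 0 < r0;
    hypP_summable :
      (\esum_(k in [set: 'rV[int]_d * nat * nat])
         (cabs (P k.1.1 k.1.2 k.2) * expR (a * enorm k.1.1)
          * r0 ^+ (k.1.2 + k.2))%:E < +oo)%E;
    hypP_real : forall phi y, cabs y < r0 ->
      complex.Im (Pfun P phi y (conjc y)) = 0;
    hypP_order : forall l d1 d2, (d1 + d2 <= 2)%N -> P l d1 d2 = 0;
    hypP_gauge : forall phi y1 y2 (t : R), cabs y1 < r0 -> cabs y2 < r0 ->
      Pfun P (phi + const_mx t) (expi t * y1) (expi (- t) * y2) =
      Pfun P phi y1 y2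
  }.

Definition row2 (x : R * R) : 'rV[R]_2 := \row_(i < 2) [:: x.1; x.2]`_i.

(* (2 pi)^-2 \int_{[0, 2 pi]^2} f(x) e^{-i j.x} dx *)
Definition fourier_coef (f : 'rV[R]_2 -> R[i]) (j : 'rV[int]_2) : R[i] :=
  let g (x : R * R) := f (row2 x) * expi (- idot j (row2 x)) in
  let mu := (@lebesgue_measure R \x @lebesgue_measure R)%E in
  let Q := `[0, 2 * pi] `*` `[0, 2 * pi] in
  (((2 * pi) ^- 2)%:C) *
  ((\int[mu]_(x in Q) complex.Re (g x)) +i*
   (\int[mu]_(x in Q) complex.Im (g x))).

(* V(omega t + K x) u + (d_{y2} P)(omega t + K x, u, conj u) as a function of x *)
Definition forcing d (K : 'M[int]_(d, 2)) (V : 'rV[int]_d -> R[i])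
    (P : 'rV[int]_d -> nat -> nat -> R[i]) (omega : 'rV[R]_d) (t : R)
    (w : 'rV[int]_2 -> R[i]) (x : 'rV[R]_2) : R[i] :=
  let theta := t *: omega + Kapp K x in
  let y := torus_fun w x in
  potential V theta * y + dPfun P theta y (conjc y).

Definition is_cderive (f : R -> R[i]) (t : R) (v : R[i]) : Prop :=
  is_derive t 1 (fun s => complex.Re (f s)) (complex.Re v) /\
  is_derive t 1 (fun s => complex.Im (f s)) (complex.Im v).

(* u is a solution on [-T, T]: u lies in C([-T, T]; H^p), takes values in the
   disc where P is defined, and satisfies the equation Fourier coefficient by
   Fourier coefficient, i.e. in the sense of distributions on T^2 (for small p
   the function Laplacian u need not be defined pointwise; - Laplacian acts on
   the j-th coefficient as |j|^2). *)
Record is_solution d (K : 'M[int]_(d, 2)) (V : 'rV[int]_d -> R[i])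
    (P : 'rV[int]_d -> nat -> nat -> R[i]) (r0 p : R) (omega : 'rV[R]_d)
    (T : R) (u : R -> 'rV[int]_2 -> R[i]) : Prop := IsSolution {
  sol_space : forall t, `|t| <= T -> (hp_norm p (u t) < +oo)%E;
  sol_continuous : forall t, `|t| <= T ->
    hp_norm p (fun j => u s j - u t j)
      @[s --> within [set s | `|s| <= T] (nbhs t)] --> (0 : \bar R)%E;
  sol_domain : forall t x, `|t| <= T -> cabs (torus_fun (u t) x) < r0;
  sol_equation : forall t, `|t| < T -> forall j, exists2 v,
    is_cderive (fun s => u s j) t v &
    (0 +i* 1) * v + ((enorm j) ^+ 2)%:C * u t j
      + fourier_coef (forcing K V P omega t (u t)) j = 0
}.

(* d-dimensional Lebesgue measure, as an iterated integral: the d-fold product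
   of lebesgue_measure. d.-tuple carries the product sigma-algebra. *)
Fixpoint lebesgue_tuple (d : nat) : set (d.-tuple (measurableTypeR R)) -> \bar R :=
  match d with
  | 0 => fun A => dirac [tuple] A
  | d'.+1 => fun A =>
      (\int[@lebesgue_measure R]_x
        lebesgue_tuple [set w : d'.-tuple _ | A [tuple of x :: w]])%E
  end.

Definition cube d : set (d.-tuple (measurableTypeR R)) :=
  [set w | forall i, -1 <= tnth w i <= 1].

Definition tuple_row d (w : d.-tuple (measurableTypeR R)) : 'rV[R]_d :=
  \row_i tnth w i.

End Defs.

(* Main.v *)
(** The site [j] of the lattice carries the frequency [|j|^2], and Fourier modes
    [l] of the forcing connect [j] to [j + pi(l)]; the divisors of the linear
    problem are [omega.l + |j + pi(l)|^2 - |j|^2 + O(epsilon)].  A Newton iteration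
    with regularized divisors conjugates the linear part to a diagonal one, and is
    exact for nonresonant [omega].  At each scale, the divisors met along the
    orbit of [j] depend, up to an error much smaller than the required lower
    bound, only on the small scalar products [j.v]; since [j] is determined up to
    large scalar products by two of them, only finitely many slabs of frequencies
    have to be excised for each [l], with total measure [O(gamma)], and the same
    holds for the divisors involving three sites.

    Gauge invariance forces the total mode [l] of every quadratic term of the
    conjugated nonlinearity to have nonzero sum, hence to be nonzero, so that none
    of these terms is resonant.  In the variable corrected by the corresponding
    bilinear sums with divided coefficients the field has size [r^3] as long as
    the solution has size [O(r)]; a continuity argument gives the bound [2 r] up
    to times of order [r^-2]. *)

Require Import Defs.
From HB Require Import structures.
From mathcomp Require Import all_boot all_order all_algebra.
From mathcomp Require Import complex finmap.
From mathcomp Require Import all_classical all_reals all_analysis.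
From mathcomp.analysis.showcase Require summability.
From mathcomp Require Import measurable_realfun.
From mathcomp Require Import ring lra zify.

Set Implicit Arguments.
Unset Strict Implicit.
Unset Printing Implicit Defensive.

Import Order.TTheory GRing.Theory Num.Theory.
Import numFieldNormedType.Exports.

Local Open Scope classical_set_scope.
Local Open Scope ring_scope.
Local Open Scope complex_scope.

(** Infinitely many sites enter the divisors, so the corrected eigenvalues must be compared between
    frequencies and also between sites. Both comparisons are one estimate: a site and a frequency
    form a single point, and [sbd] propagates a Lipschitz bound along the orbits of an arbitrary
    pair of points, at distance [rho]. Since [1/z - 1/w = (w - z)/(z w)], this distance is weighted
    by the sizes of the divisors: two sites with large divisors count as close, however far apart
    these divisors are. The linear equation is divided by [gam1], a fixed multiple of [gamma], so
    that smallness of [V / gamma] becomes a smallness independent of [gamma]. For small [p] a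
    solution is not differentiable in the norm, only coefficient by coefficient: the norm is
    therefore written by duality as a supremum of weighted [l^1] sums, and mean value estimates are
    made for one test function at a time. A radial retraction makes the nonlinear field globally
    Lipschitz, so that a curve exists for all times before any bound on it is known. *)

Lemma ler_eq (R : numDomainType) (x y : R) : x = y -> x <= y.
Proof. by move->. Qed.

(** * The modulus of complex numbers and the unit phases *)

Section ComplexModulus.
Variable R : realType.
Implicit Types z w : R[i].

Lemma cabsE z : cabs z = ComplexField.Normc.normc z.
Proof. by case: z. Qed.

Lemma normCE z : `|z| = (cabs z)%:C.
Proof. by rewrite normc_def. Qed.

Lemma cabs0 : cabs (0 : R[i]) = 0.
Proof. by rewrite cabsE ComplexField.Normc.normc0. Qed.

Lemma cabs1 : cabs (1 : R[i]) = 1.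
Proof. by rewrite cabsE ComplexField.Normc.normc1. Qed.

Lemma cabsM z w : cabs (z * w) = cabs z * cabs w.
Proof. by rewrite !cabsE ComplexField.Normc.normcM. Qed.

Lemma cabsV z : cabs z^-1 = (cabs z)^-1.
Proof. by rewrite !cabsE ComplexField.Normc.normcV. Qed.

Lemma cabsN z : cabs (- z) = cabs z.
Proof. by case: z => a b; rewrite /cabs /= !sqrrN. Qed.

Lemma cabs_ge0 z : 0 <= cabs z. Proof. exact: sqrtr_ge0. Qed.
Hint Resolve cabs_ge0 : core.

Lemma cabsD z w : cabs (z + w) <= cabs z + cabs w.
Proof. by rewrite !cabsE le_normcD. Qed.

Lemma cabsB z w : cabs (z - w) <= cabs z + cabs w.
Proof. by rewrite -(cabsN w) cabsD. Qed.

Lemma cabsBC z w : cabs (z - w) = cabs (w - z).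
Proof. by rewrite -cabsN opprB. Qed.

Lemma cabs_eq0 z : cabs z = 0 -> z = 0.
Proof. by rewrite cabsE => /ComplexField.Normc.eq0_normc. Qed.

Lemma cabs_eq0P z : (cabs z == 0) = (z == 0).
Proof. by apply/eqP/eqP => [/cabs_eq0//|->]; rewrite cabs0. Qed.

Lemma cabs_gt0 z : (0 < cabs z) = (z != 0).
Proof. by rewrite lt_neqAle cabs_ge0 andbT eq_sym cabs_eq0P. Qed.

Lemma cabs_small z : (forall e : R, 0 < e -> cabs z <= e) -> z = 0.
Proof.
move=> h; apply: cabs_eq0; apply/eqP; rewrite eq_le cabs_ge0 andbT.
by apply/ler_addgt0Pr => e e0; rewrite add0r h.
Qed.

Lemma cabs_conj z : cabs (conjc z) = cabs z.
Proof. by case: z => a b; rewrite /cabs /= sqrrN. Qed.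

Lemma cabs_real (x : R) : cabs x%:C = `|x|.
Proof. by rewrite /cabs /= expr0n addr0 sqrtr_sqr. Qed.

Lemma cabs_Re z : `|complex.Re z| <= cabs z.
Proof.
by case: z => a b; rewrite /cabs /= -sqrtr_sqr ler_sqrt ?lerDl ?addr_ge0 ?sqr_ge0.
Qed.

Lemma cabs_Im z : `|complex.Im z| <= cabs z.
Proof.
by case: z => a b; rewrite /cabs /= -sqrtr_sqr ler_sqrt ?lerDr ?addr_ge0 ?sqr_ge0.
Qed.

Lemma cabs_le_ReIm z : cabs z <= `|complex.Re z| + `|complex.Im z|.
Proof.
case: z => a b /=; have -> : a +i* b = a%:C + b%:C * (0 +i* 1).
  by apply/eqP; rewrite eq_complex /=; apply/andP; split; apply/eqP; ring.
apply: le_trans (cabsD _ _) _; rewrite cabsM !cabs_real.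
suff -> : cabs (0 +i* 1 : R[i]) = 1 by rewrite mulr1.
by rewrite /cabs /= expr0n expr1n add0r sqrtr1.
Qed.

Lemma cabs_i : cabs (0 +i* 1 : R[i]) = 1.
Proof. by rewrite /cabs /= expr0n expr1n add0r sqrtr1. Qed.

Lemma cabs_sum (I : Type) (s : seq I) (f : I -> R[i]) :
  cabs (\sum_(i <- s) f i) <= \sum_(i <- s) cabs (f i).
Proof.
elim: s => [|i s ih]; first by rewrite !big_nil cabs0.
by rewrite !big_cons; apply: le_trans (cabsD _ _) _; rewrite lerD2l.
Qed.

Lemma cabsX z n : cabs (z ^+ n) = cabs z ^+ n.
Proof. by elim: n => [|n ih]; rewrite ?cabs1 // !exprS cabsM ih. Qed.

Lemma cabs_sqr z : cabs z ^+ 2 = complex.Re z ^+ 2 + complex.Im z ^+ 2.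
Proof. by rewrite sqr_sqrtr ?addr_ge0 ?sqr_ge0. Qed.

Lemma mulJc z : z * conjc z = (cabs z ^+ 2)%:C.
Proof. by rewrite cabs_sqr; case: z => a b; simpc; rewrite /=; congr Complex; ring. Qed.

Lemma cabs_nat n : cabs (n%:R : R[i]) = n%:R.
Proof. by rewrite -(rmorph_nat (real_complex R)) cabs_real normr_nat. Qed.

Lemma expiD (a b : R) : expi (a + b) = expi a * expi b.
Proof. by rewrite /expi cosD sinD; simpc; congr Complex; ring. Qed.

Lemma expi0 : expi (0 : R) = 1.
Proof. by rewrite /expi cos0 sin0. Qed.

Lemma expiN (a : R) : expi (- a) = conjc (expi a).
Proof. by rewrite /expi cosN sinN. Qed.

Lemma cabs_expi (a : R) : cabs (expi a) = 1.
Proof. by rewrite /cabs /= cos2Dsin2 sqrtr1. Qed.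

Lemma expiNK (a : R) : expi (- a) * expi a = 1.
Proof. by rewrite -expiD addNr expi0. Qed.

Lemma expiKN (a : R) : expi a * expi (- a) = 1.
Proof. by rewrite -expiD addrN expi0. Qed.

End ComplexModulus.
#[global] Hint Extern 0 (is_true (@Order.le _ _ _ (cabs _))) => exact: cabs_ge0 : core.

(** * Absolutely summable families *)

Section Sums.
Variable R : realType.

(** A bound on all finite partial sums stands for a bound on the total of a nonnegative family;
    duplicate-free sequences play the finite subsets, so that neither an enumeration nor extended
    reals are needed. *)
Definition sumle (I : eqType) (g : I -> R) (M : R) :=
  forall s : seq I, uniq s -> \sum_(i <- s) g i <= M.

Definition summ (I : eqType) (f : I -> R[i]) :=
  exists M, sumle (fun i => cabs (f i)) M.

Definition hassum (I : eqType) (f : I -> R[i]) (z : R[i]) :=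
  forall e : R, 0 < e -> exists2 s : seq I, uniq s &
    forall s', uniq s' -> {subset s <= s'} -> cabs (z - \sum_(i <- s') f i) <= e.

Lemma sum_subset (V : zmodType) (I : eqType) (f : I -> V) (s s' : seq I) :
  uniq s -> uniq s' -> {subset s <= s'} ->
  \sum_(i <- s') f i =
  \sum_(i <- s) f i + \sum_(i <- [seq i <- s' | i \notin s]) f i.
Proof.
move=> us us' ss'; rewrite (bigID (mem s)) /= -big_filter; congr (_ + _).
  apply: perm_big; apply: uniq_perm; rewrite ?filter_uniq// => i.
  by rewrite mem_filter; case: (boolP (i \in s)) => //= /ss' ->.
by rewrite -big_filter.
Qed.

Lemma uniq_cover (I : eqType) (s1 s2 : seq I) : exists s, [/\ uniq s,
  {subset s1 <= s} & {subset s2 <= s}].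
Proof.
exists (undup (s1 ++ s2)); split; first exact: undup_uniq.
  by move=> i; rewrite mem_undup mem_cat => ->.
by move=> i; rewrite mem_undup mem_cat orbC => ->.
Qed.

Lemma sumle_ge0 (I : eqType) (g : I -> R) M : sumle g M -> 0 <= M.
Proof. by move=> /(_ [::] isT); rewrite big_nil. Qed.

Lemma sumle_le (I : eqType) (g h : I -> R) M M' :
  sumle g M -> (forall i, h i <= g i) -> M <= M' -> sumle h M'.
Proof.
move=> gM hg MM' s us; apply: le_trans MM'; apply: le_trans (gM s us).
by apply: ler_sum => i _.
Qed.

Lemma sumle_term (I : eqType) (g : I -> R) M i : sumle g M -> g i <= M.
Proof. by move=> /(_ [:: i] isT); rewrite big_seq1. Qed.

Lemma sumleD (I : eqType) (g h : I -> R) M N :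
  sumle g M -> sumle h N -> sumle (fun i => g i + h i) (M + N).
Proof. by move=> gM hN s us; rewrite big_split lerD ?gM ?hN. Qed.

Lemma sumleZ (I : eqType) (g : I -> R) M c :
  0 <= c -> sumle g M -> sumle (fun i => c * g i) (c * M).
Proof. by move=> c0 gM s us; rewrite -mulr_sumr ler_wpM2l ?gM. Qed.

Lemma sumle_inj (I J : eqType) (h : J -> I) (g : I -> R) M :
  injective h -> sumle g M -> sumle (g \o h) M.
Proof.
move=> hi gM s us; have := gM (map h s); rewrite big_map; apply.
by rewrite map_inj_uniq.
Qed.

(** A finite family of pairs lies in the rectangle of its two projections, where the sum is taken
    row by row; positivity allows the enlargement. *)
Lemma sumle_pair (I J : eqType) (F : I * J -> R) (c : I -> R) M :
  (forall x, 0 <= F x) ->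
  (forall i, sumle (fun j => F (i, j)) (c i)) -> sumle c M -> sumle F M.
Proof.
move=> F0 Fc cM s us.
set s1 := undup (map fst s); set s2 := undup (map snd s).
have u12 : uniq [seq (i, j) | i <- s1, j <- s2].
  by apply: allpairs_uniq; rewrite ?undup_uniq// => -[? ?] [? ?].
have sub : {subset s <= [seq (i, j) | i <- s1, j <- s2]}.
  move=> [i j] ijs; apply/allpairsP; exists (i, j); split=> //=.
    by rewrite mem_undup; apply/mapP; exists (i, j).
  by rewrite mem_undup; apply/mapP; exists (i, j).
apply: (@le_trans _ _ (\sum_(x <- [seq (i, j) | i <- s1, j <- s2]) F x)).
  by rewrite (sum_subset _ us u12 sub) lerDl sumr_ge0.
rewrite big_allpairs_dep /=; apply: le_trans (cM s1 (undup_uniq _)).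
by apply: ler_sum => i _; apply: Fc; apply: undup_uniq.
Qed.

Lemma sumle_pairl (I J : eqType) (F : I * J -> R) M i :
  sumle F M -> sumle (fun j => F (i, j)) M.
Proof. by move=> FM; apply: (sumle_inj (h := fun j => (i, j))) FM => ? ? []. Qed.

Lemma sumle_sw (I J : eqType) (F : I * J -> R) M :
  sumle F M -> sumle (fun x : J * I => F (x.2, x.1)) M.
Proof. by move=> FM; apply: (sumle_inj (h := fun x : J * I => (x.2, x.1))) FM => -[? ?] [? ?] [-> ->]. Qed.

Lemma sumleM (I J : eqType) (f : I -> R) (g : J -> R) A B :
  (forall i, 0 <= f i) -> (forall i, 0 <= g i) ->
  sumle f A -> sumle g B -> sumle (fun x : I * J => f x.1 * g x.2) (A * B).
Proof.
move=> f0 g0 fA gB; apply: (@sumle_pair _ _ _ (fun i => f i * B)) => [x|i|].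
- exact: mulr_ge0.
- exact: (sumleZ (f0 i) gB).
- move=> s us; rewrite -mulr_suml; apply: ler_wpM2r (fA _ us).
  exact: sumle_ge0 gB.
Qed.

Lemma sumle_fin (I : eqType) (g : I -> R) (t : seq I) : uniq t ->
  (forall i, 0 <= g i) ->
  (forall i, i \notin t -> g i = 0) -> sumle g (\sum_(i <- t) g i).
Proof.
move=> ut g0 gt s us.
rewrite (bigID (mem t)) /= [X in _ + X]big1 ?addr0; last by move=> i; apply: gt.
have u : uniq [seq i <- s | i \in t] by rewrite filter_uniq.
rewrite -big_filter (sum_subset _ u ut) ?lerDl ?sumr_ge0//.
by move=> i; rewrite mem_filter => /andP[].
Qed.

(** Some finite family comes within [e] of the supremum of the partial sums; a disjoint family can
    then add at most the missing [e]. *)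
Lemma sumle_tail (I : eqType) (g : I -> R) M (e : R) : (forall i, 0 <= g i) ->
  sumle g M -> 0 < e -> exists2 s, uniq s &
    forall s', uniq s' -> (forall i, i \in s' -> i \notin s) ->
      \sum_(i <- s') g i <= e.
Proof.
move=> g0 gM e0.
set S := [set x | exists2 s, uniq s & x = \sum_(i <- s) g i].
have hS : has_sup S.
  split; first by exists 0, [::]; rewrite ?big_nil.
  by exists M => x [s us ->]; apply: gM.
have [x [s us ->] hx] := sup_adherent e0 hS.
exists s => // s' us' ds.
have : \sum_(i <- s ++ s') g i <= sup S.
  apply: ub_le_sup; first by case: hS.
  exists (s ++ s') => //; rewrite cat_uniq us us' andbT /=.
  by apply/hasPn => i /ds.
rewrite big_cat /=; lra.
Qed.

Lemma sum_split_le (I : Type) (s : seq I) (e : R) : 0 <= e ->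
  \sum_(i <- s) e / (size s).+1%:R <= e.
Proof.
move=> e0; rewrite big_const_seq count_predT iter_addr addr0 -[leLHS]mulr_natr mulrAC.
by rewrite ler_pdivrMr// ler_wpM2l// ler_nat.
Qed.

Lemma hassum_csum (I : choiceType) (f : I -> R[i]) z : hassum f z -> csum f = z.
Proof.
move=> h; rewrite /csum /summability.sum.
have PF := @summability.totally_filter I.
apply: (@cvg_lim (R[i]^o)); first exact: norm_hausdorff.
apply/cvgrPdist_le => e e0.
(* Positive elements of [R[i]] are real, so the complex tolerance reduces to a real one. *)
have [r r0 re] : exists2 r : R, 0 < r & e = r%:C.
  by case: e e0 => a b; rewrite ltcE /= => /andP[/eqP -> a0]; exists a.
have [s us hs] := h _ r0.
exists [fset x in s]%fset => //= A sA.
rewrite /= /summability.partial_sum -[X in _ - X](big_seq_fsetE _ _ predT f) /=.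
rewrite re normCE lecR; apply: hs; first exact: fset_uniq.
by move=> i si; apply: (fsubsetP sA); rewrite in_fset.
Qed.

Lemma hassumD (I : eqType) (f g : I -> R[i]) z w :
  hassum f z -> hassum g w -> hassum (fun i => f i + g i) (z + w).
Proof.
move=> hz hw e e0; have e2 : 0 < e / 2 by rewrite divr_gt0.
have [s1 _ h1] := hz _ e2; have [s2 _ h2] := hw _ e2.
have [s [us s1s s2s]] := uniq_cover s1 s2.
exists s => // s' us' ss'; rewrite big_split /= opprD addrACA.
apply: le_trans (cabsD _ _) _; rewrite [e]splitr lerD ?h1 ?h2// => i.
  by move=> /s1s/ss'.
by move=> /s2s/ss'.
Qed.

Lemma hassumZ (I : eqType) (f : I -> R[i]) z (c : R[i]) :
  hassum f z -> hassum (fun i => c * f i) (c * z).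
Proof.
move=> hz e e0; have d0 : 0 < e / (1 + cabs c).
  by rewrite divr_gt0// ltr_pwDl ?cabs_ge0.
have [s us hs] := hz _ d0; exists s => // s' us' ss'.
rewrite -mulr_sumr -mulrBr cabsM; apply: le_trans (ler_wpM2l _ (hs _ us' ss')) _ => //.
rewrite mulrA ler_pdivrMr ?ltr_pwDl ?cabs_ge0// mulrC ler_wpM2l ?(ltW e0)//.
by rewrite lerDr.
Qed.

Lemma hassum_nneg (I : eqType) (g : I -> R) M : (forall i, 0 <= g i) ->
  sumle g M -> exists z, hassum (fun i => (g i)%:C) z.
Proof.
move=> g0 gM.
set S := [set x | exists2 s, uniq s & x = \sum_(i <- s) g i].
have hS : has_sup S.
  split; first by exists 0, [::]; rewrite ?big_nil.
  by exists M => x [s us ->]; apply: gM.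
exists (sup S)%:C => e e0; have [x [s us ->] hx] := sup_adherent e0 hS.
exists s => // s' us' ss'.
rewrite -rmorph_sum -rmorphB cabs_real ler_norml.
have -> /= : \sum_(i <- s') g i <= sup S -> - e <= sup S - \sum_(i <- s') g i.
  by lra.
  rewrite (sum_subset g us us' ss').
  have : 0 <= \sum_(i <- [seq i <- s' | i \notin s]) g i by rewrite sumr_ge0.
  lra.
apply: ub_le_sup; first by case: hS.
by exists s'.
Qed.

(** The real and the imaginary part are differences of the nonnegative families [|g| + g] and [|g|],
    whose sums are suprema of partial sums. *)
Lemma summ_hassum (I : eqType) (f : I -> R[i]) : summ f -> exists z, hassum f z.
Proof.
move=> [M fM].
have pos (g : I -> R) : (forall i, `|g i| <= cabs (f i)) ->
    exists z, hassum (fun i => (g i)%:C) z.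
  move=> gf.
  have [z1 h1] : exists z, hassum (fun i => (`|g i| + g i)%:C) z.
    apply: (@hassum_nneg _ _ (2 * M)) => [i|]; first by have := ler_norm (- g i); rewrite normrN; lra.
    apply: sumle_le (sumleZ _ fM) _ (lexx _) => // i.
    by rewrite mulr_natl mulr2n lerD// ?gf// (le_trans (ler_norm _)).
  have [z2 h2] : exists z, hassum (fun i => (`|g i|)%:C) z.
    by apply: (@hassum_nneg _ _ M) => //; apply: sumle_le fM _ (lexx _).
  exists (z1 + (-1) * z2).
  have -> : (fun i => (g i)%:C) = fun i => (`|g i| + g i)%:C + (-1) * (`|g i|)%:C.
    by apply/funext => i; rewrite rmorphD /=; ring.
  by apply: hassumD => //; apply: hassumZ.
have [a ha] := pos (fun i => complex.Re (f i)) (fun i => cabs_Re _).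
have [b hb] := pos (fun i => complex.Im (f i)) (fun i => cabs_Im _).
exists (a + 'i * b).
have -> : f = fun i => (complex.Re (f i))%:C + 'i * (complex.Im (f i))%:C.
  by apply/funext => i; rewrite -complexE.
by apply: hassumD => //; apply: hassumZ.
Qed.

Lemma csumP (I : choiceType) (f : I -> R[i]) : summ f -> hassum f (csum f).
Proof. by move=> /summ_hassum[z hz]; rewrite (hassum_csum hz). Qed.

Lemma summ_le (I : eqType) (f : I -> R[i]) (g : I -> R) M :
  sumle g M -> (forall i, cabs (f i) <= g i) -> summ f.
Proof. by move=> gM fg; exists M; apply: sumle_le gM fg (lexx _). Qed.

Lemma summD (I : eqType) (f g : I -> R[i]) :
  summ f -> summ g -> summ (fun i => f i + g i).
Proof.
move=> [M fM] [N gN]; apply: summ_le (sumleD fM gN) _ => i; exact: cabsD.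
Qed.

Lemma summZ (I : eqType) (f : I -> R[i]) (c : R[i]) : summ f -> summ (fun i => c * f i).
Proof.
move=> [M fM]; apply: summ_le (sumleZ (cabs_ge0 c) fM) _ => i.
by rewrite cabsM.
Qed.

Lemma csumD (I : choiceType) (f g : I -> R[i]) : summ f -> summ g ->
  csum (fun i => f i + g i) = csum f + csum g.
Proof. by move=> /csumP sf /csumP sg; apply: hassum_csum; apply: hassumD. Qed.

Lemma csumZ (I : choiceType) (f : I -> R[i]) (c : R[i]) : summ f ->
  csum (fun i => c * f i) = c * csum f.
Proof. by move=> /csumP sf; apply: hassum_csum; apply: hassumZ. Qed.

Lemma csumZr (I : choiceType) (f : I -> R[i]) (c : R[i]) : summ f ->
  csum (fun i => f i * c) = csum f * c.
Proof.
move=> sf; rewrite mulrC -csumZ//; congr csum; apply/funext => i; exact: mulrC.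
Qed.

Lemma csumN (I : choiceType) (f : I -> R[i]) : summ f ->
  csum (fun i => - f i) = - csum f.
Proof.
move=> sf; rewrite -mulN1r -csumZ//; congr csum; apply/funext => i.
by rewrite mulN1r.
Qed.

Lemma summN (I : eqType) (f : I -> R[i]) : summ f -> summ (fun i => - f i).
Proof. by move=> [M fM]; exists M; apply: sumle_le fM _ (lexx _) => i; rewrite cabsN. Qed.

Lemma summB (I : eqType) (f g : I -> R[i]) :
  summ f -> summ g -> summ (fun i => f i - g i).
Proof. by move=> sf sg; apply: summD => //; apply: summN. Qed.

Lemma csumB (I : choiceType) (f g : I -> R[i]) : summ f -> summ g ->
  csum (fun i => f i - g i) = csum f - csum g.
Proof. by move=> sf sg; rewrite csumD ?csumN//; apply: summN. Qed.

Lemma csum_conj (I : choiceType) (f : I -> R[i]) : summ f ->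
  csum (fun i => conjc (f i)) = conjc (csum f).
Proof.
move=> /csumP h; apply: hassum_csum => e e0; have [s us hs] := h _ e0.
by exists s => // s' us' ss'; rewrite -rmorph_sum -rmorphB cabs_conj hs.
Qed.

Lemma csum_le (I : choiceType) (f : I -> R[i]) M :
  sumle (fun i => cabs (f i)) M -> cabs (csum f) <= M.
Proof.
move=> fM; have /csumP h : summ f by exists M.
apply/ler_addgt0Pr => e e0; have [s us hs] := h _ e0.
have -> : csum f = (csum f - \sum_(i <- s) f i) + \sum_(i <- s) f i by rewrite subrK.
apply: le_trans (cabsD _ _) _; rewrite addrC lerD ?hs//.
by apply: le_trans (cabs_sum _ _) _; apply: fM.
Qed.

Lemma csum_fin (I : choiceType) (f : I -> R[i]) (t : seq I) : uniq t ->
  (forall i, i \notin t -> f i = 0) -> csum f = \sum_(i <- t) f i.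
Proof.
move=> ut ft; apply: hassum_csum => e e0; exists t => // s' us' ts'.
rewrite (sum_subset f ut us' ts') [X in cabs (_ - (_ + X))]big1_seq.
  by rewrite addr0 subrr cabs0 ltW.
by move=> i; rewrite mem_filter => /andP[_ /andP[/ft]].
Qed.

Lemma summ_fin (I : eqType) (f : I -> R[i]) (t : seq I) : uniq t ->
  (forall i, i \notin t -> f i = 0) -> summ f.
Proof.
move=> ut ft; exists (\sum_(i <- t) cabs (f i)); apply: sumle_fin => // i /ft ->.
by rewrite cabs0.
Qed.

Lemma csum1 (I : choiceType) (f : I -> R[i]) i0 :
  (forall i, i != i0 -> f i = 0) -> csum f = f i0.
Proof.
move=> h; rewrite (@csum_fin _ _ [:: i0]) ?big_seq1// => i.
by rewrite inE => /h.
Qed.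

Lemma csum0 (I : choiceType) : csum (fun _ : I => 0 : R[i]) = 0.
Proof. by rewrite (@csum_fin _ _ [::]) ?big_nil. Qed.

Lemma eq_csum (I : choiceType) (f g : I -> R[i]) : f =1 g -> csum f = csum g.
Proof. by move=> /funext ->. Qed.

Lemma csum_reindex (I J : choiceType) (h : J -> I) (h' : I -> J) (f : I -> R[i]) :
  cancel h h' -> cancel h' h -> summ f -> csum (fun j => f (h j)) = csum f.
Proof.
move=> hh' h'h /csumP sf; apply: hassum_csum => e e0.
have [s us hs] := sf _ e0; exists (map h' s).
  by rewrite map_inj_uniq//; apply: can_inj h'h.
move=> s' us' ss'; rewrite -(big_map h predT f); apply: hs.
  by rewrite map_inj_uniq//; apply: can_inj hh'.
by move=> i si; rewrite -(h'h i) map_f// ss'// map_f.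
Qed.

Lemma summ_inj (I J : eqType) (h : J -> I) (f : I -> R[i]) :
  injective h -> summ f -> summ (fun j => f (h j)).
Proof. by move=> hi [M fM]; exists M; apply: (sumle_inj hi fM). Qed.

Lemma summ_pairl (I J : eqType) (F : I * J -> R[i]) i :
  summ F -> summ (fun j => F (i, j)).
Proof. by move=> sF; apply: (summ_inj (h := fun j => (i, j))) sF => ? ? []. Qed.

(** Each of the finitely many inner sums is replaced by a finite one up to an equal share of [e];
    what remains is a finite family of pairs. *)
Lemma sumle_csum (I : eqType) (J : choiceType) (F : I -> J -> R[i]) M :
  sumle (fun x : I * J => cabs (F x.1 x.2)) M ->
  sumle (fun i => cabs (csum (F i))) M.
Proof.
move=> FM s us; apply/ler_addgt0Pr => e e0.
have d0 : 0 < e / (size s).+1%:R by rewrite divr_gt0.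
have sF i : summ (F i).
  by exists M; apply: (sumle_pairl (F := fun x => cabs (F x.1 x.2)) i FM).
have [t tP] : exists t : I -> seq J, forall i, uniq (t i) /\
    cabs (csum (F i)) <= \sum_(j <- t i) cabs (F i j) + e / (size s).+1%:R.
  suff h i : exists t, uniq t /\
    cabs (csum (F i)) <= \sum_(j <- t) cabs (F i j) + e / (size s).+1%:R.
    by exists (fun i => sval (cid (h i))) => i; case: cid.
  have [t ut ht] := csumP (sF i) d0; exists t; split=> //.
  rewrite -[csum _](subrK (\sum_(j <- t) F i j)) addrC.
  apply: le_trans (cabsD _ _) _; apply: lerD; first exact: cabs_sum.
  exact: ht.
apply: (@le_trans _ _ (\sum_(i <- s) (\sum_(j <- t i) cabs (F i j) + e / (size s).+1%:R))).
  by apply: ler_sum => i _; case: (tP i).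
rewrite big_split /= lerD//.
  have := FM [seq (i, j) | i <- s, j <- t i]; rewrite big_allpairs_dep /=; apply.
  apply: allpairs_uniq_dep => //; first by move=> i _; case: (tP i).
  by move=> [? ?] [? ?] _ _ [-> ->].
by apply: sum_split_le; apply: ltW.
Qed.

(** Fubini. Up to [e / 2] the mass sits on a finite set: for the restriction [F1] both sides are
    finite sums, and the rest [F2] contributes at most [e / 2] to each side. *)
Lemma csum_pair (I J : choiceType) (F : I * J -> R[i]) : summ F ->
  csum (fun i => csum (fun j => F (i, j))) = csum F.
Proof.
move=> sF; case: (sF) => M FM.
apply/eqP; rewrite -subr_eq0; apply/eqP/cabs_small => e e0.
have e2 : 0 < e / 2 by rewrite divr_gt0.
have [s us hs] := sumle_tail (fun _ => cabs_ge0 _) FM e2.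
pose F1 x := if x \in s then F x else 0.
pose F2 x := if x \in s then 0 else F x.
have F12 x : F x = F1 x + F2 x by rewrite /F1 /F2; case: ifP; rewrite ?addr0 ?add0r.
have F1M : sumle (fun x => cabs (F1 x)) M.
  by apply: sumle_le FM _ (lexx _) => x; rewrite /F1; case: ifP; rewrite ?cabs0 ?cabs_ge0.
have F2e : sumle (fun x => cabs (F2 x)) (e / 2).
  move=> t ut; rewrite (bigID (mem s)) /= big1 ?add0r => [|i].
    rewrite -big_filter; apply: le_trans (hs _ (filter_uniq _ ut) _).
      by apply: ler_sum => x _; rewrite /F2; case: ifP; rewrite ?cabs0 ?cabs_ge0.
    by move=> x; rewrite mem_filter => /andP[].
  by rewrite /F2 => ->; rewrite cabs0.
have s1 : summ F1 by exists M.
have s2 : summ F2 by exists (e / 2).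
have g1 : sumle (fun i => cabs (csum (fun j => F1 (i, j)))) M.
  by apply: (@sumle_csum _ _ (fun i j => F1 (i, j))); apply: sumle_le F1M _ (lexx _) => -[].
have g2 : sumle (fun i => cabs (csum (fun j => F2 (i, j)))) (e / 2).
  by apply: (@sumle_csum _ _ (fun i j => F2 (i, j))); apply: sumle_le F2e _ (lexx _) => -[].
have -> : csum F = csum F1 + csum F2.
  by rewrite -csumD//; apply: eq_csum.
have -> : csum (fun i => csum (fun j => F (i, j))) =
    csum (fun i => csum (fun j => F1 (i, j))) + csum (fun i => csum (fun j => F2 (i, j))).
  rewrite -csumD; [|by exists M|by exists (e / 2)].
  apply: eq_csum => i; rewrite -csumD; [|exact: summ_pairl..].
  by apply: eq_csum => j.
have <- : csum (fun i => csum (fun j => F1 (i, j))) = csum F1.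
  set t1 := undup (map fst s); set t2 := undup (map snd s).
  have nt i j : (i \notin t1) || (j \notin t2) -> F1 (i, j) = 0.
    rewrite /F1; case: ifP => // ijs.
    rewrite !mem_undup => /orP[] /negP[]; apply/mapP; by exists (i, j).
  have u1 : uniq t1 by apply: undup_uniq.
  have u2 : uniq t2 by apply: undup_uniq.
  rewrite (@csum_fin _ _ t1)// => [|i it1]; last first.
    rewrite -[RHS](csum0 J); apply: eq_csum => j.
    by rewrite nt ?it1.
  rewrite (@csum_fin _ F1 [seq (i, j) | i <- t1, j <- t2]).
  - rewrite big_allpairs_dep /=; apply: eq_bigr => i _.
    by rewrite (@csum_fin _ _ t2)// => j jt2; rewrite nt// jt2 orbT.
  - by apply: allpairs_uniq => // -[? ?] [? ?].
  - move=> [i j] h; apply: nt; rewrite -negb_and; apply: contra h => /andP[h1 h2].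
    by apply/allpairsP; exists (i, j).
rewrite opprD addrACA subrr add0r.
by apply: le_trans (cabsB _ _) _; rewrite [e]splitr lerD// csum_le.
Qed.

Lemma csum_exchange (I J : choiceType) (F : I * J -> R[i]) : summ F ->
  csum (fun i => csum (fun j => F (i, j))) = csum (fun j => csum (fun i => F (i, j))).
Proof.
move=> sF; rewrite csum_pair//.
have sF' : summ (fun x : J * I => F (x.2, x.1)).
  by apply: (summ_inj (h := fun x : J * I => (x.2, x.1))) sF => -[? ?] [? ?] [-> ->].
rewrite (csum_pair sF').
by rewrite (csum_reindex (h := fun x : J * I => (x.2, x.1)) (h' := fun x => (x.2, x.1)) (f := F))// => -[].
Qed.

Lemma summM (I J : eqType) (f : I -> R[i]) (g : J -> R[i]) :
  summ f -> summ g -> summ (fun x : I * J => f x.1 * g x.2).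
Proof.
move=> [A fA] [B gB]; exists (A * B).
by apply: sumle_le (sumleM _ _ fA gB) _ (lexx _) => // x; rewrite cabsM.
Qed.

Lemma csumM (I J : choiceType) (f : I -> R[i]) (g : J -> R[i]) :
  summ f -> summ g -> csum (fun x : I * J => f x.1 * g x.2) = csum f * csum g.
Proof.
move=> sf sg; rewrite -csum_pair; last exact: summM.
rewrite -csumZr//.
by apply: eq_csum => i /=; rewrite csumZ.
Qed.

(** Dominated convergence for series along an arbitrary filter: the tails outside the finite set
    [s'] cost [e / 3] each, and on [s'] finitely many terms converge. *)
Lemma csum_tannery (T : Type) (F : set_system T) {FF : Filter F} (I : choiceType)
    (f : T -> I -> R[i]) (l : I -> R[i]) (g : I -> R) M :
  (forall t i, cabs (f t i) <= g i) -> sumle g M ->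
  (forall i (e : R), 0 < e -> \forall t \near F, cabs (f t i - l i) <= e) ->
  summ l -> forall e : R, 0 < e -> \forall t \near F, cabs (csum (f t) - csum l) <= e.
Proof.
move=> fg gM fl sl e e0; have e3 : 0 < e / 3 by rewrite divr_gt0.
have [s us hs] := csumP sl e3.
have g0 i : 0 <= `|g i| by [].
(* The dominating family is known to be nonnegative only if [T] is inhabited; over an empty [T] the
   claim is void. *)
have gM' : sumle (fun i => `|g i|) M \/ (T -> False).
  case: (pselect (inhabited T)) => [[t]|h]; last by right => t; apply: h.
  left; apply: sumle_le gM _ (lexx _) => i.
  by rewrite ger0_norm//; apply: le_trans (fg t i); apply: cabs_ge0.
case: gM' => [gM'|hT]; last by apply: (filterS _ filterT) => t; case: (hT t).
have [s2 us2 hs2] := sumle_tail g0 gM' e3.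
have [s' [us' ss' s2s']] := uniq_cover s s2.
have d0 : 0 < e / 3 / (size s').+1%:R by rewrite !divr_gt0.
have near_s (u : seq I) : \forall t \near F, forall i, i \in u ->
    cabs (f t i - l i) <= e / 3 / (size s').+1%:R.
  elim: u => [|i u ih]; first by apply: (filterS _ filterT).
  near=> t => j; rewrite inE => /orP[/eqP->|]; first by near: t; apply: fl.
  by move: j; near: t.
apply: filterS (near_s s') => t ht.
have -> : csum (f t) - csum l = (csum (f t) - \sum_(i <- s') f t i) +
   \sum_(i <- s') (f t i - l i) + (\sum_(i <- s') l i - csum l).
  by rewrite sumrB; ring.
have -> : e = e / 3 + e / 3 + e / 3 by field.
apply: le_trans (cabsD _ _) _; apply: lerD; last first.
  by rewrite cabsBC hs.
apply: le_trans (cabsD _ _) _; apply: lerD; last first.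
  apply: le_trans (cabs_sum _ _) _.
  apply: (@le_trans _ _ (\sum_(i <- s') e / 3 / (size s').+1%:R)).
    by rewrite big_seq [leRHS]big_seq; apply: ler_sum.
  by apply: sum_split_le; apply: ltW.
have sft : summ (f t) by apply: summ_le gM (fg t).
apply/ler_addgt0Pr => e' e'0; have [u uu hu] := csumP sft e'0.
have [v [uv uv1 sv]] := uniq_cover u s'.
have := hu v uv uv1; rewrite (sum_subset (f t) us' uv sv) => h.
have -> : csum (f t) - \sum_(i <- s') f t i = \sum_(i <- [seq i <- v | i \notin s']) f t i +
   (csum (f t) - (\sum_(i <- s') f t i + \sum_(i <- [seq i <- v | i \notin s']) f t i)) by ring.
apply: le_trans (cabsD _ _) _; apply: lerD => //.
apply: le_trans (cabs_sum _ _) _.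
apply: le_trans (hs2 [seq i <- v | i \notin s'] (filter_uniq _ uv) _).
  by apply: ler_sum => i _; apply: le_trans (fg t i) (ler_norm _).
by move=> i; rewrite mem_filter => /andP[h1 _]; apply: contra h1 => /s2s'.
Unshelve. all: end_near.
Qed.

Lemma sumle_esum (I : choiceType) (g : I -> R) (M : R) : (forall i, 0 <= g i) ->
  (\esum_(i in [set: I]) (g i)%:E <= M%:E)%E <-> sumle g M.
Proof.
move=> g0; split => [h s us|h].
  rewrite -lee_fin -sumEFin; apply: le_trans h.
  rewrite (fsbig_seq _ _ us); apply: esum_ge; exists [set` s] => //.
apply: ge_ereal_sup => _ [A [fA _] <-].
by rewrite fsbig_finite//= sumEFin lee_fin h// fset_uniq.
Qed.

End Sums.

(** * Weights on the lattice *)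

(** The [l^1] norm with values in [nat] replaces the Euclidean one inside the proof: decay becomes a
    power [q ^+ n1 l], and lattice sums factor over the coordinates. *)
Definition n1 d (l : 'rV[int]_d) : nat := (\sum_(i < d) absz (l 0%R i))%N.

Lemma n1_0 d : n1 (0 : 'rV[int]_d) = 0%N.
Proof. by rewrite /n1 big1// => i _; rewrite mxE. Qed.

Lemma n1N d (l : 'rV[int]_d) : n1 (- l) = n1 l.
Proof. by apply: eq_bigr => i _; rewrite mxE abszN. Qed.

Lemma n1D d (l m : 'rV[int]_d) : (n1 (l + m) <= n1 l + n1 m)%N.
Proof.
rewrite /n1 -big_split /=; apply: leq_sum => i _; rewrite mxE.
by move: (l 0 i) (m 0 i) => a b; lia.
Qed.

Lemma n1_split d (l k : 'rV[int]_d) : (n1 l <= n1 (l - k) + n1 k)%N.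
Proof. by rewrite -{1}(subrK k l) n1D. Qed.

Section Geometric.
Variable R : realType.
Implicit Types q k : R.

Lemma geometric_le q n : 0 <= q -> q < 1 -> \sum_(i < n) q ^+ i <= (1 - q)^-1.
Proof.
move=> q0 q1; rewrite -[leRHS]mul1r ler_pdivlMr ?subr_gt0//.
have <- : 1 - q ^+ n = (\sum_(i < n) q ^+ i) * (1 - q).
  rewrite -{1}(expr1n R n) subrXX mulrC; congr (_ * _).
  by apply: eq_bigr => i _; rewrite expr1n mul1r.
by rewrite gerBl exprn_ge0.
Qed.

Lemma sumle_nat (g : nat -> R) M : (forall n, 0 <= g n) ->
  (forall N, \sum_(i < N) g i <= M) -> sumle g M.
Proof.
move=> g0 gM s us; pose N := (\max_(i <- s) i).+1.
apply: le_trans (gM N); rewrite -(big_mkord xpredT g).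
rewrite (sum_subset _ us (iota_uniq 0 N)) ?lerDl ?sumr_ge0// => i si.
by rewrite mem_iota /= ltnS; apply: leq_bigmax_seq.
Qed.

Lemma sumle_geometric_nat q : 0 <= q -> q < 1 ->
  sumle (fun n : nat => q ^+ n) (1 - q)^-1.
Proof.
move=> q0 q1; apply: sumle_nat => [n|N]; [exact: exprn_ge0|exact: geometric_le].
Qed.

(** Telescoping: the induction carries the sharper bound [2 - N^-1] for [N > 0] terms. *)
Lemma sumle_inverse_squares : sumle (fun n : nat => n.+1%:R^-1 ^+ 2 : R) 2.
Proof.
apply: sumle_nat => [n|[|N]]; first by rewrite exprn_ge0// invr_ge0.
  by rewrite big_ord0.
suff : \sum_(i < N.+1) (i.+1%:R^-1 ^+ 2 : R) <= 2 - N.+1%:R^-1.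
  by move/le_trans; apply; rewrite gerBl invr_ge0.
elim: N => [|N ih]; first by rewrite big_ord1 /= invr1 expr1n; lra.
rewrite big_ord_recr /=; apply: le_trans (lerD ih (lexx _)) _.
have x0 : 0 < N.+1%:R :> R by [].
rewrite -[N.+2%:R]natr1; move: (N.+1%:R : R) x0 => x x0.
have x1 : 0 < x + 1 by lra.
rewrite -subr_ge0 (_ : _ - _ = (x * (x + 1) ^+ 2)^-1); last by field; apply/andP; split; lra.
by rewrite invr_ge0 mulr_ge0 ?exprn_ge0// ltW.
Qed.

Lemma sumle_int (g : nat -> R) M : (forall n, 0 <= g n) -> sumle g M ->
  sumle (fun n : int => g `|n|%N) (2 * M).
Proof.
move=> g0 gM; pose h (n : int) := match n with Posz n => (true, n) | Negz n => (false, n.+1) end.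
have hi : injective h by move=> [a|a] [b|b] //= [->].
have : sumle (fun x : bool * nat => g x.2) (2 * M).
  apply: (@sumle_pair _ _ _ _ (fun=> M)) => // s us.
  rewrite big_const_seq count_predT iter_addr addr0 -[leLHS]mulr_natl.
  rewrite ler_wpM2r ?(sumle_ge0 gM)// ler_nat.
  by have := @uniq_leq_size _ s [:: true; false] us; apply=> -[]; rewrite !inE.
by move=> /(sumle_inj hi)/sumle_le; apply => // -[n|n].
Qed.

Lemma sumle_prod d (g : int -> R) M : (forall n, 0 <= g n) -> sumle g M ->
  sumle (fun l : 'rV[int]_d => \prod_i g (l 0 i)) (M ^+ d).
Proof.
move=> g0 gM; elim: d => [|d ih].
  case=> [|x [|y s]] us.
  - by rewrite big_nil expr0.
  - by rewrite big_seq1 big_ord0 expr0.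
  - by move: us; rewrite (thinmx0 x) (thinmx0 y) /= inE eqxx.
pose h (l : 'rV[int]_d.+1) := (l 0 ord0, \row_(i < d) l 0 (lift ord0 i)).
have hi : injective h.
  move=> l m [h0 h1]; apply/rowP => i; case: (unliftP ord0 i) => [j|] -> //.
  by move/rowP/(_ j): h1; rewrite !mxE.
have pos2 (x : 'rV[int]_d) : 0 <= \prod_i g (x 0 i) by apply: prodr_ge0.
have := sumleM g0 pos2 gM ih.
rewrite -exprS => /(sumle_inj hi)/sumle_le; apply => // l /=.
rewrite big_ord_recl.
by under [X in _ <= _ * X]eq_bigr do rewrite mxE.
Qed.

Lemma sumle_geometric d q : 0 <= q -> q < 1 ->
  sumle (fun l : 'rV[int]_d => q ^+ n1 l) ((2 / (1 - q)) ^+ d).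
Proof.
move=> q0 q1; have pos n : 0 <= q ^+ n by apply: exprn_ge0.
have := @sumle_prod d (fun n => q ^+ `|n|%N) _ (fun n => pos _) (sumle_int pos (sumle_geometric_nat q0 q1)).
by move/sumle_le; apply=> // l; rewrite prodrXr.
Qed.

(** Every [|l_i| + 1] is at most [n1 l + 1], which reduces the sum to a product of one-dimensional
    series; the exponent [2 * d] allots a convergent inverse square to each coordinate. *)
Lemma sumle_inverse_power d :
  sumle (fun l : 'rV[int]_d => (n1 l).+1%:R^-1 ^+ (2 * d) : R) (4 ^+ d).
Proof.
have pos n : 0 <= n.+1%:R^-1 ^+ 2 :> R by rewrite exprn_ge0// invr_ge0.
have := @sumle_prod d (fun n => `|n|%N.+1%:R^-1 ^+ 2) _ (fun n => pos _) (sumle_int pos sumle_inverse_squares).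
rewrite (_ : 2 * 2 = 4); last by rewrite -natrM.
move/sumle_le; apply=> // l; rewrite exprM -[X in _ ^+ 2 ^+ X]card_ord -prodr_const.
apply: ler_prod => i _; rewrite exprn_ge0 ?invr_ge0//= lerXn2r ?nnegrE ?invr_ge0//.
by rewrite lef_pV2 ?posrE// ler_nat ltnS /n1 (bigD1 i)//= leq_addr.
Qed.

(** The bound of [sumle_geometric] on the sum of [k ^+ n1 l] over the lattice: the price of one
    convolution of symbols. *)
Definition Zg d k : R := (2 / (1 - k)) ^+ d.

Lemma Zg_ge1 d k : 0 <= k -> k < 1 -> 1 <= Zg d k.
Proof.
move=> k0 k1; apply: exprn_ege1; rewrite ler_pdivlMr ?subr_gt0// mul1r; lra.
Qed.

Lemma poly_geometric k n : 0 <= k -> k < 1 -> n.+1%:R * k ^+ n <= (1 - k)^-1.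
Proof.
move=> k0 k1; apply: le_trans (geometric_le n.+1 k0 k1).
have -> : n.+1%:R * k ^+ n = \sum_(i < n.+1) k ^+ n.
  by rewrite big_const_ord iter_addr addr0 mulr_natl.
by apply: ler_sum => i _; rewrite ler_wiXn2l ?(ltW k1)// -ltnS.
Qed.

(** Polynomial factors, produced by the small divisors, are traded for a slower decay: [q] weakens
    to [q / k ^+ t]. *)
Lemma poly_geometricX k q n t : 0 < k -> k < 1 -> 0 <= q ->
  n.+1%:R ^+ t * q ^+ n <= (1 - k)^-1 ^+ t * (q / k ^+ t) ^+ n.
Proof.
move=> k0 k1 q0; have -> : q ^+ n = (q / k ^+ t) ^+ n * (k ^+ n) ^+ t.
  by rewrite -exprM mulnC exprM -exprMn divfK// expf_neq0// gt_eqF.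
rewrite mulrCA mulrC [leRHS]mulrC -exprMn.
rewrite [leLHS]mulrC ler_wpM2l ?exprn_ge0 ?divr_ge0 ?exprn_ge0 ?(ltW k0)//.
apply: lerXn2r (poly_geometric n (ltW k0) k1); rewrite ?nnegrE ?invr_ge0 ?subr_ge0 ?(ltW k1)//.
by rewrite mulr_ge0// exprn_ge0// ltW.
Qed.

Section Conv.
Variables (d : nat) (q1 q2 q k : R).
Hypotheses (q10 : 0 <= q1) (q20 : 0 <= q2) (q0 : 0 <= q) (qle1 : q <= 1)
  (k0 : 0 <= k) (k1 : k < 1).

(** A strict margin in one factor suffices: its surplus [k ^+ n1 (l - m)] is summable over [m], and
    the remaining powers of [q <= 1] combine by the triangle inequality for [n1]. *)
Lemma convl (l : 'rV[int]_d) : q1 <= k * q -> q2 <= q ->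
  sumle (fun m => q1 ^+ n1 (l - m) * q2 ^+ n1 m) (Zg d k * q ^+ n1 l).
Proof.
move=> h1 h2.
have inj : injective (fun m : 'rV[int]_d => l - m) by move=> a b /addrI/oppr_inj.
have := sumleZ (exprn_ge0 (n1 l) q0) (sumle_inj inj (sumle_geometric k0 k1)).
move=> /sumle_le; apply; last by rewrite mulrC.
move=> m /=; rewrite mulrC.
apply: (@le_trans _ _ (q ^+ n1 m * (k * q) ^+ n1 (l - m))).
  by apply: ler_pM; rewrite ?exprn_ge0// lerXn2r// nnegrE ?mulr_ge0.
rewrite exprMn mulrCA mulrC -exprD ler_wpM2r ?exprn_ge0//.
by rewrite ler_wiXn2l// addnC n1_split.
Qed.

Lemma convr (l : 'rV[int]_d) : q1 <= q -> q2 <= k * q ->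
  sumle (fun m => q1 ^+ n1 (l - m) * q2 ^+ n1 m) (Zg d k * q ^+ n1 l).
Proof.
move=> h1 h2.
have := sumleZ (exprn_ge0 (n1 l) q0) (@sumle_geometric d _ k0 k1).
move=> /sumle_le; apply; last by rewrite mulrC.
move=> m /=.
apply: (@le_trans _ _ (q ^+ n1 (l - m) * (k * q) ^+ n1 m)).
  by apply: ler_pM; rewrite ?exprn_ge0// lerXn2r// nnegrE ?mulr_ge0.
rewrite exprMn mulrCA mulrC -exprD ler_wpM2r ?exprn_ge0//.
by rewrite ler_wiXn2l// n1_split.
Qed.
End Conv.
End Geometric.

(** * Covariant symbols *)

Section Symbols.
Variables (R : realType) (d : nat) (X : Type) (T : 'rV[int]_d -> X -> X).
Hypothesis TD : forall k m x, T (k + m) x = T k (T m x).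
Notation Z := 'rV[int]_d.
Notation sym := (Z -> X -> R[i]).
Implicit Types M N P : sym.

(* [M l x] is the entry from the site [x] to the site [T l x] of a quasi-periodic operator,
   in the Fourier mode [l]; [smul] is the composition. *)
Definition smul M N : sym := fun l x => csum (fun k => M (l - k) (T k x) * N k x).
Definition sdiag (D : X -> R[i]) : sym := fun l x => if l == 0 then D x else 0.
Definition sadd M N : sym := fun l x => M l x + N l x.
Definition sopp M : sym := fun l x => - M l x.

Variables (x0 y0 : X) (rho sig : R).
Hypotheses (rho0 : 0 <= rho) (sig1 : 1 <= sig).

(* Sup bound together with a Lipschitz bound along the orbit of the pair (x0, y0). *)
Definition sbd (A q : R) M :=
  (forall l x, cabs (M l x) <= A * q ^+ n1 l) /\
  (forall l m, cabs (M l (T m x0) - M l (T m y0)) <=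
     A * rho * sig ^+ n1 m * (sig * q) ^+ n1 l).

Let sig0 : 0 <= sig. Proof. exact: le_trans sig1. Qed.
Let sigX n : 0 <= sig ^+ n. Proof. exact: exprn_ge0. Qed.

Lemma sbd_ge0 A q M : sbd A q M -> 0 <= A.
Proof.
by move=> [h _]; have := h 0 x0; rewrite n1_0 expr0 mulr1; apply: le_trans.
Qed.

Lemma sbd_le A q A' q' M : 0 <= q -> q <= q' -> A <= A' -> sbd A q M -> sbd A' q' M.
Proof.
move=> q0 qq AA h; have A0 := sbd_ge0 h; case: h => h1 h2; split=> [l x|l m].
  apply: le_trans (h1 l x) _; apply: ler_pM => //; first exact: exprn_ge0.
  by apply: lerXn2r; rewrite // nnegrE (le_trans q0).
apply: le_trans (h2 l m) _; apply: ler_pM => //.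
- by rewrite !mulr_ge0.
- by rewrite exprn_ge0// mulr_ge0.
- by apply: ler_wpM2r => //; apply: ler_wpM2r.
- apply: lerXn2r; rewrite ?nnegrE ?mulr_ge0//; last by apply: ler_wpM2l.
  exact: le_trans qq.
Qed.

Lemma sbdD A B q M N : sbd A q M -> sbd B q N -> sbd (A + B) q (sadd M N).
Proof.
move=> [M1 M2] [N1 N2]; split=> [l x|l m].
  by apply: le_trans (cabsD _ _) _; rewrite mulrDl lerD.
rewrite /sadd opprD addrACA; apply: le_trans (cabsD _ _) _.
by rewrite !mulrDl lerD.
Qed.

Lemma sbdN A q M : sbd A q M -> sbd A q (sopp M).
Proof.
move=> [M1 M2]; split=> [l x|l m]; first by rewrite cabsN.
by rewrite /sopp -opprD cabsN.
Qed.

Lemma sbd_diag A q M : 0 <= q -> sbd A q M -> sbd A 0 (sdiag (M 0)).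
Proof.
move=> q0 h; have A0 := sbd_ge0 h; case: h => [M1 M2]; split=> [l x|l m].
  rewrite /sdiag; case: eqP => [->|_]; last by rewrite cabs0 mulr_ge0 ?exprn_ge0.
  by have := M1 0 x; rewrite n1_0 !expr0.
rewrite /sdiag; case: eqP => [->|_].
  by have := M2 0 m; rewrite n1_0 !expr0.
by rewrite subrr cabs0 !mulr_ge0// exprn_ge0// mulr_ge0.
Qed.

Section MulBound.
Variables (A B q1 q2 q k : R) (M N : sym).
Hypotheses (q10 : 0 <= q1) (q20 : 0 <= q2) (q0 : 0 <= q) (k0 : 0 <= k) (k1 : k < 1)
  (sq : sig * q <= 1) (hM : sbd A q1 M) (hN : sbd B q2 N)
  (gap : (q1 <= k * q) /\ (q2 <= q) \/ (q1 <= q) /\ (q2 <= k * q)).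

Let qle1 : q <= 1.
Proof. by apply: le_trans sq; rewrite ler_peMl. Qed.

Let conv1 (l : Z) : sumle (fun m => q1 ^+ n1 (l - m) * q2 ^+ n1 m) (Zg d k * q ^+ n1 l).
Proof. by case: gap => -[g1 g2]; [apply: convl|apply: convr]. Qed.

Let conv2 (l : Z) : sumle (fun m => (sig * q1) ^+ n1 (l - m) * (sig * q2) ^+ n1 m)
  (Zg d k * (sig * q) ^+ n1 l).
Proof.
by case: gap => -[g1 g2]; [apply: convl|apply: convr]; rewrite ?mulr_ge0//
  1?mulrCA ler_wpM2l.
Qed.

Lemma smul_sumle l x : sumle (fun m => cabs (M (l - m) (T m x) * N m x))
  (A * B * Zg d k * q ^+ n1 l).
Proof.
have A0 := sbd_ge0 hM; have B0 := sbd_ge0 hN; case: hM hN => M1 M2 [N1 N2].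
rewrite -mulrA; apply: sumle_le (sumleZ (mulr_ge0 A0 B0) (conv1 l)) _ (lexx _) => m.
rewrite cabsM mulrACA; exact: ler_pM.
Qed.

Lemma smul_summ l x : summ (fun m => M (l - m) (T m x) * N m x).
Proof. by eexists; apply: smul_sumle. Qed.

(** A difference of products telescopes into two terms, whence the factor 2. The base point of the
    left factor is moved by [j], which costs [sig ^+ n1 j]; this is why the Lipschitz part of [sbd]
    decays only with the rate [sig * q]. *)
Lemma sbdM : sbd (2 * (A * B * Zg d k)) q (smul M N).
Proof.
have A0 := sbd_ge0 hM; have B0 := sbd_ge0 hN.
have Z0 : 0 <= Zg d k by apply: le_trans (Zg_ge1 d k0 k1).
split=> [l x|l m].
  apply: le_trans (csum_le (smul_sumle l x)) _; rewrite ler_wpM2r ?exprn_ge0//.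
  by rewrite ler_peMl ?mulr_ge0// ler1n.
rewrite /smul -csumB; [|exact: smul_summ|exact: smul_summ].
have c0 : 0 <= 2 * (A * B * rho * sig ^+ n1 m) by rewrite !mulr_ge0.
have -> : 2 * (A * B * Zg d k) * rho * sig ^+ n1 m * (sig * q) ^+ n1 l =
  2 * (A * B * rho * sig ^+ n1 m) * (Zg d k * (sig * q) ^+ n1 l).
  by move: (Zg d k) (sig ^+ _) ((sig * q) ^+ _) => *; ring.
apply: csum_le; apply: sumle_le (sumleZ c0 (conv2 l)) _ (lexx _) => j.
case: hM hN => M1 M2 [N1 N2].
rewrite -!TD.
have -> : M (l - j) (T (j + m) x0) * N j (T m x0) - M (l - j) (T (j + m) y0) * N j (T m y0)
  = (M (l - j) (T (j + m) x0) - M (l - j) (T (j + m) y0)) * N j (T m x0) +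
    M (l - j) (T (j + m) y0) * (N j (T m x0) - N j (T m y0)) by ring.
apply: le_trans (cabsD _ _) _; rewrite !cabsM.
rewrite -[leRHS]mulrA [leRHS]mulr_natl mulr2n; apply: lerD.
  apply: le_trans (ler_pM _ _ (M2 _ _) (N1 _ _)) _ => //.
  have -> : A * B * rho * sig ^+ n1 m * ((sig * q1) ^+ n1 (l - j) * (sig * q2) ^+ n1 j) =
    A * rho * (sig ^+ n1 m * sig ^+ n1 j) * (sig * q1) ^+ n1 (l - j) * (B * q2 ^+ n1 j).
    rewrite [(sig * q2) ^+ _]exprMn.
    by move: (sig ^+ n1 m) ((sig * q1) ^+ _) (sig ^+ n1 j) (q2 ^+ n1 j) => *; ring.
  apply: ler_wpM2r; first by rewrite mulr_ge0// exprn_ge0.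
  apply: ler_wpM2r; first by rewrite exprn_ge0// mulr_ge0.
  apply: ler_wpM2l; first by rewrite mulr_ge0.
  by rewrite -exprD ler_weXn2l// addnC n1D.
apply: le_trans (ler_pM _ _ (M1 _ _) (N2 _ _)) _ => //.
have -> : A * B * rho * sig ^+ n1 m * ((sig * q1) ^+ n1 (l - j) * (sig * q2) ^+ n1 j) =
    A * (sig * q1) ^+ n1 (l - j) * (B * rho * sig ^+ n1 m * (sig * q2) ^+ n1 j).
  by move: (sig ^+ n1 m) ((sig * q1) ^+ _) ((sig * q2) ^+ _) => *; ring.
apply: ler_wpM2r; first by rewrite !mulr_ge0// exprn_ge0// mulr_ge0.
apply: ler_wpM2l => //; apply: lerXn2r; rewrite ?nnegrE ?mulr_ge0//.
by rewrite ler_peMl.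
Qed.

End MulBound.

Lemma smul_diagr M D l x : T 0 x = x -> smul M (sdiag D) l x = M l x * D x.
Proof.
move=> T0; rewrite /smul (@csum1 _ _ _ 0) => [|k k0].
  by rewrite /sdiag eqxx subr0 T0.
by rewrite /sdiag (negbTE k0) mulr0.
Qed.

Lemma smul_diagl M D l x : smul (sdiag D) M l x = D (T l x) * M l x.
Proof.
rewrite /smul (@csum1 _ _ _ l) => [|k k0].
  by rewrite /sdiag subrr eqxx.
by rewrite /sdiag subr_eq0 eq_sym (negbTE k0) mul0r.
Qed.

(** A diagonal factor involves no convolution, so there is neither a gap between the rates nor a
    factor [Zg] to pay. *)
Lemma sbd_muldiag A B q M D : (forall x, T 0 x = x) -> 0 <= q -> sbd A q M ->
  sbd B 0 (sdiag D) -> sbd (2 * A * B) q (smul M (sdiag D)).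
Proof.
move=> T0 q0 hM hD; have A0 := sbd_ge0 hM; have B0 := sbd_ge0 hD.
case: hM hD => M1 M2 [D1 D2].
have D1' x : cabs (D x) <= B.
  by have := D1 0 x; rewrite /sdiag eqxx n1_0 expr0 mulr1.
split=> [l x|l m]; rewrite !smul_diagr//.
  rewrite cabsM; apply: le_trans (ler_pM _ _ (M1 _ _) (D1' _)) _ => //.
  rewrite mulrAC ler_wpM2r ?exprn_ge0// ler_wpM2r//.
  by rewrite ler_peMl// ler1n.
have D2' : cabs (D (T m x0) - D (T m y0)) <= B * rho * sig ^+ n1 m.
  by have := D2 0 m; rewrite /sdiag eqxx n1_0 expr0 mulr1.
have -> : M l (T m x0) * D (T m x0) - M l (T m y0) * D (T m y0) =
  (M l (T m x0) - M l (T m y0)) * D (T m x0) + M l (T m y0) * (D (T m x0) - D (T m y0)) by ring.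
apply: le_trans (cabsD _ _) _; rewrite !cabsM.
have sX : 0 <= (sig * q) ^+ n1 l by rewrite exprn_ge0// mulr_ge0.
have -> : 2 * A * B * rho * sig ^+ n1 m * (sig * q) ^+ n1 l =
  A * rho * sig ^+ n1 m * (sig * q) ^+ n1 l * B +
  A * (sig * q) ^+ n1 l * (B * rho * sig ^+ n1 m) by move: (sig ^+ _) ((sig * q) ^+ _) => *; ring.
apply: lerD; first exact: ler_pM.
apply: ler_pM => //; apply: le_trans (M1 _ _) _; apply: ler_wpM2l => //.
by apply: lerXn2r; rewrite ?nnegrE ?mulr_ge0// ler_peMl.
Qed.

Section Assoc.
Variables (A B C q1 q2 q3 : R) (M N P : sym).
Hypotheses (q10 : 0 <= q1) (q11 : q1 <= 1) (q20 : 0 <= q2) (q21 : q2 < 1)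
 (q30 : 0 <= q3) (q31 : q3 < 1)
 (hM : sbd A q1 M) (hN : sbd B q2 N) (hP : sbd C q3 P).

Lemma smul3_summ l x : summ (fun km : Z * Z =>
  M (l - km.1 - km.2) (T (km.2 + km.1) x) * N km.2 (T km.1 x) * P km.1 x).
Proof.
have A0 := sbd_ge0 hM; have B0 := sbd_ge0 hN; have C0 := sbd_ge0 hP.
have pos (q : R) : 0 <= q -> forall m : Z, 0 <= q ^+ n1 m by move=> q0 m; apply: exprn_ge0.
have g := sumleM (pos _ q30) (pos _ q20) (@sumle_geometric R d _ q30 q31)
  (@sumle_geometric R d _ q20 q21).
have c0 : 0 <= A * B * C by rewrite !mulr_ge0.
apply: (summ_le (sumleZ c0 g)) => -[k m] /=; rewrite !cabsM.
have -> : A * B * C * (q3 ^+ n1 k * q2 ^+ n1 m) = A * (B * q2 ^+ n1 m) * (C * q3 ^+ n1 k).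
  by move: (q2 ^+ _) (q3 ^+ _) => *; ring.
case: hM hN hP => M1 _ [N1 _] [P1 _].
apply: ler_pM => //; first by rewrite mulr_ge0.
apply: ler_pM => //; apply: le_trans (M1 _ _) _.
by rewrite -[leRHS]mulr1 ler_wpM2l// exprn_ile1.
Qed.

(** Both sides rearrange one absolutely convergent sum over pairs of modes; for its convergence two
    of the three factors need a rate below 1. *)
Lemma smulA l x : smul (smul M N) P l x = smul M (smul N P) l x.
Proof.
have A0 := sbd_ge0 hM; have B0 := sbd_ge0 hN; have C0 := sbd_ge0 hP.
have s3 := smul3_summ l x.
pose F (km : Z * Z) := M (l - km.1 - km.2) (T (km.2 + km.1) x) * N km.2 (T km.1 x) * P km.1 x.
transitivity (csum F).
  rewrite -csum_pair//; apply: eq_csum => k; rewrite /smul -csumZr.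
    by apply: eq_csum => m; rewrite /F /= TD.
  case: hM hN => M1 _ [N1 _].
  apply: (summ_le (sumleZ (mulr_ge0 A0 B0) (@sumle_geometric R d _ q20 q21))) => m.
  rewrite cabsM -mulrA; apply: ler_pM => //; apply: le_trans (M1 _ _) _.
  by rewrite -[leRHS]mulr1 ler_wpM2l// exprn_ile1.
pose h (jk : Z * Z) := (jk.2, jk.1 - jk.2); pose h' (km : Z * Z) := (km.2 + km.1, km.1).
have hK : cancel h h' by move=> [j k]; rewrite /h /h' /= subrK.
have h'K : cancel h' h by move=> [k m]; rewrite /h /h' /= addrK.
rewrite -(csum_reindex hK h'K)// -csum_pair; last exact: (summ_inj (can_inj hK)).
apply: eq_csum => j; rewrite /smul /F /h /=.
have sNP : summ (fun k => N (j - k) (T k x) * P k x).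
  case: hN hP => N1 _ [P1 _].
  apply: (summ_le (sumleZ (mulr_ge0 B0 C0) (@sumle_geometric R d _ q30 q31))) => m.
  rewrite cabsM -mulrA; apply: ler_pM => //; apply: le_trans (N1 _ _) _.
  by rewrite -[leRHS]mulr1 ler_wpM2l// exprn_ile1// ltW.
rewrite -csumZ//; apply: eq_csum => k; rewrite subrK mulrA; congr (M _ _ * _ * _).
by rewrite opprB addrA subrK.
Qed.
End Assoc.

Lemma sbd_csum (F : nat -> sym) (a : nat -> R) A q : 0 <= q ->
  (forall i, sbd (a i) q (F i)) -> sumle a A ->
  sbd A q (fun l x => csum (fun i => F i l x)).
Proof.
move=> q0 hF aA; have sX l : 0 <= q ^+ n1 (l : Z) by rewrite exprn_ge0.
have sF l x : sumle (fun i => cabs (F i l x)) (A * q ^+ n1 l).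
  rewrite mulrC; apply: sumle_le (sumleZ (sX l) aA) _ (lexx _) => i.
  by rewrite mulrC; case: (hF i).
split=> [l x|l m]; first exact: csum_le.
rewrite -csumB; [|by eexists; apply: sF..]; apply: csum_le.
have c0 : 0 <= rho * sig ^+ n1 m * (sig * q) ^+ n1 l.
  by rewrite !mulr_ge0// exprn_ge0// mulr_ge0.
rewrite -2!mulrA mulrC !mulrA.
apply: sumle_le (sumleZ c0 aA) _ (lexx _) => i.
by case: (hF i) => _ h; apply: le_trans (h _ _) _; rewrite [leRHS]mulrC !mulrA.
Qed.

Fixpoint spow (S B : sym) n : sym :=
  if n is n'.+1 then sopp (smul S (spow S B n')) else B.

(* The Neumann solution of X = B - S X *)
Definition neumann S B : sym := fun l x => csum (fun i => spow S B i l x).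

Lemma csum_nat_recl (f : nat -> R[i]) : summ f ->
  csum f = f 0%N + csum (fun i => f i.+1).
Proof.
move=> sf.
pose f0 i := if i is 0%N then f 0%N else 0.
pose f1 i := if i is 0%N then 0 else f i.
have s0 : summ f0 by apply: (@summ_fin _ _ _ [:: 0%N]) => // -[].
have s1 : summ f1.
  case: sf => A fA; apply: summ_le fA _ => -[|i] //=; by rewrite cabs0.
have -> : csum f = csum f0 + csum f1.
  by rewrite -csumD//; apply: eq_csum => -[|i]; rewrite /= ?addr0 ?add0r.
congr (_ + _); first by rewrite (@csum1 _ _ _ 0%N)// => -[].
apply: hassum_csum => e e0.
have sg : summ (fun i => f i.+1) by apply: (summ_inj (h := succn)) sf => ? ? [].
have [s us hs] := csumP sg e0; exists (0%N :: map succn s).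
  rewrite /= map_inj_uniq ?us ?andbT//; last by move=> ? ? [].
  by apply/mapP => -[].
move=> s' us' ss'.
pose t := map predn [seq i <- s' | i != 0%N].
have -> : \sum_(i <- s') f1 i = \sum_(i <- t) f i.+1.
  rewrite big_map big_filter [LHS](bigID (fun i => i == 0%N)) /= big1 ?add0r.
    by apply: eq_bigr => -[].
  by move=> i /eqP ->.
apply: hs.
  rewrite map_inj_in_uniq ?filter_uniq// => -[|i] [|j]; rewrite !mem_filter//=.
  by move=> _ _ ->.
move=> i si; apply/mapP; exists i.+1 => //; rewrite mem_filter /=.
by apply: ss'; rewrite inE /= map_f.
Qed.

Section Neumann.
Variables (a b q1 q k : R) (S B : sym).
Hypotheses (q10 : 0 <= q1) (q0 : 0 <= q) (q1lt : q < 1) (k0 : 0 <= k) (k1 : k < 1)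
  (sq : sig * q <= 1) (gap : q1 <= k * q) (hS : sbd a q1 S) (hB : sbd b q B)
  (small : 2 * (a * Zg d k) <= 2^-1).

(** Smallness makes each composition with [S] halve the size. The rate [q] is not degraded by the
    iteration, because the whole gap is carried by [S]. *)
Lemma sbd_spow i : sbd (b * 2^-1 ^+ i) q (spow S B i).
Proof.
elim: i => [|i ih] /=; first by rewrite expr0 mulr1.
have := sbdM q10 q0 q0 k0 k1 sq hS ih (or_introl (conj gap (lexx _))).
move=> /sbdN; apply: sbd_le => //.
have -> : 2 * (a * (b * 2^-1 ^+ i) * Zg d k) = (b * 2^-1 ^+ i) * (2 * (a * Zg d k)) by ring.
rewrite exprSr [leRHS]mulrA ler_wpM2l// mulr_ge0 ?(sbd_ge0 hB)//.
Qed.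

Lemma sumle_half (c : R) : 0 <= c -> sumle (fun i : nat => c * 2^-1 ^+ i) (2 * c).
Proof.
move=> c0; rewrite mulrC; apply: sumleZ => //.
have := @sumle_geometric_nat R 2^-1 _ _.
have -> : (1 - 2^-1 : R)^-1 = 2 by field.
by apply; lra.
Qed.

Lemma sbd_neumann : sbd (2 * b) q (neumann S B).
Proof. by apply: (sbd_csum q0 sbd_spow); apply: sumle_half (sbd_ge0 hB). Qed.

Lemma neumannE l x : neumann S B l x = B l x - smul S (neumann S B) l x.
Proof.
have b0 := sbd_ge0 hB; have a0 := sbd_ge0 hS.
have half0 i : 0 <= b * 2^-1 ^+ i by rewrite mulr_ge0// exprn_ge0// invr_ge0.
have bnd i l' y : cabs (spow S B i l' y) <= b * 2^-1 ^+ i * q ^+ n1 l'.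
  by case: (sbd_spow i).
have ss l' y : summ (fun i => spow S B i l' y).
  apply: (summ_le (sumle_half b0)) => i.
  apply: le_trans (bnd _ _ _) _; rewrite -[leRHS]mulr1 ler_wpM2l//.
  by rewrite exprn_ile1// ltW.
rewrite /neumann csum_nat_recl//=; congr (_ + _).
rewrite /sopp csumN; last first.
  have : summ (fun i => - spow S B i.+1 l x).
    by apply: summN; apply: (summ_inj (h := succn) _ (ss l x)) => ? ? [].
  by congr summ; apply/funext => i /=; rewrite /sopp opprK.
congr (- _); rewrite /smul.
pose F (ik : nat * Z) := S (l - ik.2) (T ik.2 x) * spow S B ik.1 ik.2 x.
have sF : summ F.
  have pos (m : Z) : 0 <= q ^+ n1 m by rewrite exprn_ge0.
  have g := sumleM half0 pos (sumle_half b0) (@sumle_geometric R d _ q0 q1lt).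
  apply: (summ_le (sumleZ a0 g)) => -[i m] /=; rewrite cabsM; apply: ler_pM => //.
  case: hS => S1 _; apply: le_trans (S1 _ _) _; rewrite -[leRHS]mulr1 ler_wpM2l//.
  rewrite exprn_ile1//; apply: le_trans gap _; apply: le_trans (ltW q1lt).
  by rewrite ler_piMl// ltW.
rewrite (csum_exchange sF); apply: eq_csum => m; rewrite /F /=.
by rewrite csumZ//.
Qed.
End Neumann.

End Symbols.

(** * Reducibility by a Newton iteration *)

Section RegularizedInverse.
Variable R : realType.
Implicit Types (z w : R[i]) (eta : R).

(* A globally Lipschitz substitute for 1/z, equal to it when |z| >= eta. *)
Definition rinv eta z : R[i] := conjc z / ((Num.max (cabs z) eta) ^+ 2)%:C.

Lemma max_gt0 eta z : 0 < eta -> 0 < Num.max (cabs z) eta.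
Proof. by move=> e0; rewrite lt_max e0 orbT. Qed.

Lemma cabs_rinv eta z : 0 < eta -> cabs (rinv eta z) <= eta^-1.
Proof.
move=> e0; have m0 := max_gt0 z e0; rewrite /rinv cabsM cabsV cabs_conj cabs_real.
rewrite ger0_norm ?exprn_ge0 ?(ltW m0)// ler_pdivrMr ?exprn_gt0//.
have h1 : cabs z <= Num.max (cabs z) eta by rewrite le_max lexx.
have h2 : eta <= Num.max (cabs z) eta by rewrite le_max lexx orbT.
apply: le_trans h1 _; rewrite ler_pdivlMl// expr2 ler_wpM2r// ltW//.
Qed.

Lemma rinvE eta z : 0 < eta -> eta <= cabs z -> rinv eta z * z = 1.
Proof.
move=> e0 ez; have z0 : 0 < cabs z by apply: lt_le_trans ez.
rewrite /rinv max_l// mulrAC [conjc z * z]mulrC mulJc divff//.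
by rewrite -cabs_gt0 cabs_real normr_gt0 expf_neq0// gt_eqF.
Qed.

(** For true inverses this is [1/z - 1/w = (w - z)/(z w)]. With the cutoff, the numerator
    contributes one unit and the change of the squared denominator two. Both moduli stay in the
    denominator: this is what forgives differences of large divisors. *)
Lemma rinv_lip eta z w : 0 < eta -> cabs (rinv eta z - rinv eta w) <=
  3 * cabs (z - w) / (Num.max (cabs z) eta * Num.max (cabs w) eta).
Proof.
move=> e0; wlog : z w / Num.max (cabs w) eta <= Num.max (cabs z) eta.
  move=> th; have [h|/ltW h] := leP (Num.max (cabs w) eta) (Num.max (cabs z) eta).
    exact: th.
  by rewrite cabsBC (cabsBC z) [X in _ / X]mulrC th.
rewrite /rinv.
have := max_gt0 z e0; have := max_gt0 w e0.
have : cabs z <= Num.max (cabs z) eta by rewrite le_max lexx.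
have : cabs w <= Num.max (cabs w) eta by rewrite le_max lexx.
have : `|Num.max (cabs z) eta - Num.max (cabs w) eta| <= cabs (z - w).
  have h1 : cabs z <= cabs w + cabs (z - w).
    by rewrite -{1}(subrK w z) addrC cabsD.
  have h2 : cabs w <= cabs z + cabs (z - w).
    by rewrite -{1}(subrK z w) addrC cabsBC cabsD.
  rewrite ler_norml; apply/andP; split; rewrite /Num.max; case: ifP; case: ifP; lra.
move: (Num.max (cabs z) eta) (Num.max (cabs w) eta) => m n hmn hw hz n0 m0 nm.
have mC : m%:C != 0 :> R[i] by rewrite -cabs_gt0 cabs_real gtr0_norm.
have nC : n%:C != 0 :> R[i] by rewrite -cabs_gt0 cabs_real gtr0_norm.
have -> : conjc z / (m ^+ 2)%:C - conjc w / (n ^+ 2)%:C =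
  conjc (z - w) / m%:C ^+ 2 + conjc w * ((n - m) * (n + m) / (m ^+ 2 * n ^+ 2))%:C.
  rewrite !rmorphM fmorphV !rmorphM !rmorphB !rmorphD ?rmorphXn /=.
  by field; rewrite mC nC.
apply: le_trans (cabsD _ _) _.
rewrite !cabsM cabsV cabsX !cabs_conj !cabs_real (gtr0_norm m0).
rewrite normrM normfV normrM (gtr0_norm (addr_gt0 n0 m0)).
rewrite (gtr0_norm (mulr_gt0 (exprn_gt0 2 m0) (exprn_gt0 2 n0))) (distrC n m).
set c := cabs (z - w) in hmn *; have c0 : 0 <= c := le_trans (normr_ge0 _) hmn.
have -> : 3 * c / (m * n) = c / (m * n) + n * (c * (2 * m) / (m ^+ 2 * n ^+ 2)).
  by field; rewrite !gt_eqF.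
apply: lerD.
  by rewrite ler_wpM2l// lef_pV2 ?posrE ?mulr_gt0 ?exprn_gt0// expr2 ler_pM2l.
apply: ler_pM => //; first by rewrite !mulr_ge0 ?invr_ge0 ?mulr_ge0 ?exprn_ge0 ?addr_ge0 ?(ltW m0) ?(ltW n0).
apply: ler_wpM2r; first by rewrite invr_ge0 mulr_ge0 ?exprn_ge0 ?(ltW m0) ?(ltW n0).
apply: ler_pM => //; first by rewrite addr_ge0 ?(ltW m0) ?(ltW n0).
by rewrite mulr_natl mulr2n lerD2r.
Qed.
End RegularizedInverse.

Section Kam.
Variables (R : realType) (d : nat) (X : Type) (T : 'rV[int]_d -> X -> X).
Hypothesis TD : forall k m x, T (k + m) x = T k (T m x).
Hypothesis T0 : forall x, T 0 x = x.
Notation Z := 'rV[int]_d.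
Notation sym := (Z -> X -> R[i]).
Variables (tau : nat) (dv : Z -> X -> R) (V : sym).

(** The cutoff shrinks with the step [n] as well as with [l], so that the sets of frequencies
    excised at all steps have summable measure. *)
Definition keta n (l : Z) : R := ((2 ^+ n * (n1 l).+1%:R) ^+ tau)^-1.

Lemma keta_gt0 n l : 0 < keta n l.
Proof. by rewrite invr_gt0 exprn_gt0// mulr_gt0// exprn_gt0. Qed.

Lemma keta_ge1 n l : 1 <= (keta n l)^-1.
Proof.
rewrite invrK exprn_ege1// mulr_ege1// ?exprn_ege1// ?ler1n//.
Qed.

(* The step [n] replaces the operator [D + E] by its conjugate under [1 + kS], where [kS]
   solves the homological equation with divisors cut off at [keta n], so that it is defined,
   and Lipschitz, also at resonances; [kam n] is the pair [(D, E)] before step [n]. *)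
Definition kdiv (D : X -> R[i]) (l : Z) x := (dv l x)%:C + D (T l x) - D x.

Definition kS n (D : X -> R[i]) (E : sym) : sym := fun l x =>
  if l == 0 then 0 else - (rinv (keta n l) (kdiv D l x) * E l x).

(** Conjugation by [1 + S] leaves a remainder [E'] with [(1 + S) E' = E S - S diag(E 0)]; this is
    the right-hand side, and [neumann] solves [E' = kB - S E']. *)
Definition kB n D (E : sym) : sym :=
  sadd (smul T E (kS n D E)) (sopp (smul T (kS n D E) (sdiag (E 0)))).

Fixpoint kam n : (X -> R[i]) * sym :=
  if n is n'.+1 then let: (D, E) := kam n' in
    (fun x => D x + E 0 x, neumann T (kS n' D E) (kB n' D E))
  else (fun=> 0, V).

Notation kD n := (kam n).1.
Notation kE n := (kam n).2.
Notation kSn n := (kS n (kD n) (kE n)).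

Lemma kDS n x : kD n.+1 x = kD n x + kE n 0 x.
Proof. by rewrite /=; case: (kam n). Qed.

Lemma kES n : kE n.+1 = neumann T (kSn n) (kB n (kD n) (kE n)).
Proof. by rewrite /=; case: (kam n). Qed.

Variables (x0 y0 : X) (rho sig : R).
Hypotheses (rho0 : 0 <= rho) (sig1 : 1 <= sig).
Hypothesis dvL : forall l m, `|dv l (T m x0) - dv l (T m y0)| <=
  rho * sig ^+ (n1 l + n1 m) * (1 + `|dv l (T m x0)|) * (1 + `|dv l (T m y0)|).
Notation bnd := (sbd T x0 y0 rho sig).

Let sig0 : 0 <= sig. Proof. exact: le_trans sig1. Qed.
Let sigX n : 0 <= sig ^+ n. Proof. exact: exprn_ge0. Qed.

Section StepBound.
Variables (n : nat) (e q k K : R) (D : X -> R[i]) (E : sym).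
Hypotheses (q0 : 0 <= q) (k0 : 0 < k) (k1 : k < 1) (K2 : 2 ^+ n <= K)
  (kK : (1 - k)^-1 <= K) (hE : bnd e q E)
  (hD : forall x, cabs (D x) <= 2^-1)
  (hDL : forall m, cabs (D (T m x0) - D (T m y0)) <= 2^-1 * rho * sig ^+ n1 m).

Let K0 : 0 <= K. Proof. by apply: le_trans K2; rewrite exprn_ge0. Qed.

(** The factor [2 ^+ n] of the cutoff and the constant of [poly_geometricX] cost [K ^+ (2 * tau)]
    each; the power of [n1 l] is paid by the decay rate. *)
Let eta2 l : (keta n l)^-1 ^+ 2 * q ^+ n1 l <=
  K ^+ (4 * tau) * (q / k ^+ (2 * tau)) ^+ n1 l.
Proof.
rewrite /keta invrK -exprM mulnC exprMn -exprM.
have -> : (4 * tau = 2 * tau + 2 * tau)%N by lia.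
rewrite exprD -2!mulrA; apply: ler_pM.
- by rewrite exprn_ge0.
- by rewrite mulr_ge0// exprn_ge0.
- by rewrite exprM lerXn2r// nnegrE exprn_ge0.
- apply: le_trans (poly_geometricX _ _ k0 k1 q0) _; apply: ler_wpM2r.
    by rewrite exprn_ge0// divr_ge0// exprn_ge0// ltW.
  by apply: lerXn2r; rewrite // nnegrE ?invr_ge0 ?subr_ge0 ?(ltW k1).
Qed.

(** Since [|D| <= 1/2], each weight [1 + |dv|] is at most three times the cut-off modulus divided by
    the cutoff, so the weights of [dvL] cancel the denominator of [rinv_lip]. The constant is
    [3 * (3 * 3 + 1)], the last 1 being the variation of [D]. *)
Lemma kdiv_lip l m : 
  cabs (rinv (keta n l) (kdiv D l (T m x0)) - rinv (keta n l) (kdiv D l (T m y0))) <=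
  30 * (keta n l)^-1 ^+ 2 * rho * sig ^+ (n1 l + n1 m).
Proof.
set z := kdiv D l (T m x0); set w := kdiv D l (T m y0).
have e0 := keta_gt0 n l; have := keta_ge1 n l; move: e0.
move: (keta n l) => eta e0 e1.
apply: le_trans (rinv_lip _ _ e0) _.
have bd x : `|dv l x| <= cabs (kdiv D l x) + 1.
  rewrite -cabs_real; have -> : (dv l x)%:C = kdiv D l x + (D x - D (T l x)).
    by rewrite /kdiv; ring.
  apply: le_trans (cabsD _ _) _; rewrite lerD2l.
  apply: le_trans (cabsB _ _) _; have := hD x; have := hD (T l x); lra.
have bz x : 1 + `|dv l x| <= 3 * (Num.max (cabs (kdiv D l x)) eta * eta^-1).
  set mx := Num.max _ _.
  have h1 : 1 <= mx * eta^-1.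
    by rewrite ler_pdivlMr// mul1r /mx le_max lexx orbT.
  have h2 : cabs (kdiv D l x) <= mx * eta^-1.
    apply: (@le_trans _ _ mx); first by rewrite /mx le_max lexx.
    by rewrite ler_peMr// ltW// max_gt0.
  by have := bd x; lra.
have h : cabs (z - w) <= rho * sig ^+ (n1 l + n1 m) *
    (10 * ((Num.max (cabs z) eta * eta^-1) * (Num.max (cabs w) eta * eta^-1))).
  have -> : z - w = (dv l (T m x0) - dv l (T m y0))%:C +
     ((D (T (l + m) x0) - D (T (l + m) y0)) - (D (T m x0) - D (T m y0))).
    by rewrite /z /w /kdiv !TD rmorphB; ring.
  apply: le_trans (cabsD _ _) _; rewrite cabs_real.
  have h1 := hDL m; have h2 := hDL (l + m).
  have s1 : sig ^+ n1 m <= sig ^+ (n1 l + n1 m) by rewrite ler_weXn2l// leq_addl.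
  have s2 : sig ^+ n1 (l + m) <= sig ^+ (n1 l + n1 m) by rewrite ler_weXn2l// n1D.
  have := ler_wpM2l rho0 s1; have := ler_wpM2l rho0 s2.
  set s := sig ^+ (n1 l + n1 m) in s1 s2 *.
  move=> h3 h4; have := cabsB (D (T (l + m) x0) - D (T (l + m) y0)) (D (T m x0) - D (T m y0)).
  set A := cabs _ => hA; have {hA h1 h2 h3 h4} hA : A <= rho * s.
    apply: le_trans hA _; apply: le_trans (lerD h2 h1) _.
    by rewrite -!mulrA -mulrDr mulrC ler_pdivrMr// mulr_natr mulr2n; exact: lerD.
  have rs : 0 <= rho * s by rewrite mulr_ge0// /s.
  set mz := Num.max (cabs z) eta * eta^-1; set mw := Num.max (cabs w) eta * eta^-1.
  have mz1 : 1 <= mz by rewrite ler_pdivlMr// mul1r le_max lexx orbT.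
  have mw1 : 1 <= mw by rewrite ler_pdivlMr// mul1r le_max lexx orbT.
  have hz : 1 + `|dv l (T m x0)| <= 3 * mz := bz _.
  have hw : 1 + `|dv l (T m y0)| <= 3 * mw := bz _.
  apply: le_trans (lerD (dvL l m) hA) _.
  have : (1 + `|dv l (T m x0)|) * (1 + `|dv l (T m y0)|) <= (3 * mz) * (3 * mw).
    by apply: ler_pM; rewrite ?addr_ge0.
  have : 1 <= mz * mw by rewrite mulr_ege1.
  rewrite -/s; move: `|dv l (T m x0)| `|dv l (T m y0)| => u v h5 h6.
  have -> : rho * s * (1 + u) * (1 + v) + rho * s = rho * s * ((1 + u) * (1 + v) + 1) by ring.
  by apply: ler_wpM2l => //; apply: le_trans (lerD h6 h5) _; apply: ler_eq; ring.
have mz0 := max_gt0 z e0; have mw0 := max_gt0 w e0.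
rewrite ler_pdivrMr ?mulr_gt0//; apply: le_trans (ler_wpM2l _ h) _ => //.
by apply: ler_eq; field; rewrite gt_eqF.
Qed.

(** The 31 is the 30 of [kdiv_lip] plus 1 for the variation of [E]; in both terms the divisors cost
    at most the inverse square of the cutoff, to which [eta2] applies. *)
Lemma kS_bnd : bnd (31 * e * K ^+ (4 * tau)) (q / k ^+ (2 * tau)) (kS n D E).
Proof.
have ee := sbd_ge0 hE; case: hE => E1 E2.
set Q := q / _; have Q0 : 0 <= Q by rewrite divr_ge0// exprn_ge0// ltW.
have c0 : 0 <= 31 * e * K ^+ (4 * tau) by rewrite !mulr_ge0// exprn_ge0.
have i0 l : 0 <= (keta n l)^-1 by rewrite invr_ge0 ltW// keta_gt0.
have i12 l : (keta n l)^-1 <= (keta n l)^-1 ^+ 2.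
  by rewrite expr2 ler_peMl// keta_ge1.
split=> [l x|l m]; rewrite /kS.
  case: eqP => _; first by rewrite cabs0 mulr_ge0// exprn_ge0.
  rewrite cabsN cabsM; apply: le_trans (ler_pM _ _ (cabs_rinv _ (keta_gt0 _ _)) (E1 _ _)) _ => //.
  apply: (@le_trans _ _ (31 * e * ((keta n l)^-1 ^+ 2 * q ^+ n1 l))); last first.
    by rewrite -[leRHS]mulrA ler_wpM2l ?mulr_ge0// eta2.
  have -> : 31 * e * ((keta n l)^-1 ^+ 2 * q ^+ n1 l) = (31 * (keta n l)^-1 ^+ 2) * (e * q ^+ n1 l) by ring.
  apply: ler_wpM2r; first by rewrite mulr_ge0// exprn_ge0.
  by apply: le_trans (i12 l) _; rewrite ler_peMl ?exprn_ge0// ler1n.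
case: eqP => _.
  by rewrite subrr cabs0 !mulr_ge0// exprn_ge0// mulr_ge0.
rewrite -opprD cabsN.
set r1 := rinv _ _; set r2 := rinv _ _.
have -> : r1 * E l (T m x0) - r2 * E l (T m y0) =
  (r1 - r2) * E l (T m x0) + r2 * (E l (T m x0) - E l (T m y0)) by ring.
apply: le_trans (cabsD _ _) _; rewrite (cabsM (r1 - r2)) (cabsM r2).
have h1 : cabs (r1 - r2) * cabs (E l (T m x0)) <=
   (30 * (keta n l)^-1 ^+ 2 * rho * sig ^+ (n1 l + n1 m)) * (e * q ^+ n1 l).
  by apply: ler_pM => //; apply: kdiv_lip.
have h2 : cabs r2 * cabs (E l (T m x0) - E l (T m y0)) <=
   (keta n l)^-1 ^+ 2 * (e * rho * sig ^+ n1 m * (sig * q) ^+ n1 l).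
  apply: ler_pM => //; apply: le_trans (i12 l); exact: cabs_rinv (keta_gt0 _ _).
apply: le_trans (lerD h1 h2) _.
have -> : 30 * (keta n l)^-1 ^+ 2 * rho * sig ^+ (n1 l + n1 m) * (e * q ^+ n1 l) +
  (keta n l)^-1 ^+ 2 * (e * rho * sig ^+ n1 m * (sig * q) ^+ n1 l) =
  31 * e * rho * sig ^+ n1 m * sig ^+ n1 l * ((keta n l)^-1 ^+ 2 * q ^+ n1 l).
  by rewrite exprD exprMn; move: ((keta n l)^-1 ^+ 2) (sig ^+ _) (sig ^+ _) (q ^+ _) => *; ring.
have -> : 31 * e * K ^+ (4 * tau) * rho * sig ^+ n1 m * (sig * Q) ^+ n1 l =
  31 * e * rho * sig ^+ n1 m * sig ^+ n1 l * (K ^+ (4 * tau) * Q ^+ n1 l).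
  by rewrite exprMn; move: (K ^+ _) (sig ^+ n1 m) (sig ^+ n1 l) (Q ^+ _) => *; ring.
by apply: ler_wpM2l => //; rewrite !mulr_ge0.
Qed.

End StepBound.

Variables (qa qz e0 : R).
Hypotheses (qa0 : 0 < qa) (qaz : qa < qz) (qz1 : qz < 1) (sqz : sig * qz <= 1).

Let c := (2 * tau).+1.
(** The loss of decay is spread over the steps: at step [n] the rate is divided by
    [kk n ^+ (2 * tau).+1], of which [2 * tau] powers pay for the divisors and one for the gap in
    the convolutions ([kqS]). The width is such that the product of all these factors never carries
    the rate beyond [qz]. *)
Definition kwidth : R := (1 - qa / qz) / (2 * (2 * tau).+1)%:R.
Notation h := kwidth.
Definition kk n : R := 1 - h / 2 ^+ n.
Definition kq n : R := qa / (\prod_(i < n) kk i) ^+ (2 * tau).+1.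
Definition kK n : R := 2 * 2 ^+ n / h.
Let D := (4 * tau + d)%N.
Let b : R := 2^-1 ^+ D.+1.
Hypothesis small : 248 * (2 / h) ^+ D * e0 <= b.
Hypothesis hV : bnd e0 qa V.

Let qz0 : 0 < qz. Proof. exact: lt_trans qaz. Qed.

Lemma bernoulli_le (a : R) n : 0 <= a <= 1 -> 1 - n%:R * a <= (1 - a) ^+ n.
Proof.
move=> /andP[a0 a1]; elim: n => [|n ih]; first by rewrite mul0r subr0 expr0.
rewrite exprS; have := ler_wpM2l (_ : 0 <= 1 - a) ih; rewrite subr_ge0 => /(_ a1).
apply: le_trans; have -> : n.+1%:R = n%:R + 1 :> R by rewrite -natr1.
have : 0 <= n%:R * a * a by rewrite !mulr_ge0.
by lra.
Qed.

Lemma kh_bnd : 0 < h <= 2^-1.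
Proof.
have r0 : 0 < qa / qz by rewrite divr_gt0.
have r1 : qa / qz < 1 by rewrite ltr_pdivrMr ?mul1r.
rewrite /h; apply/andP; split; first by rewrite divr_gt0// subr_gt0.
rewrite ler_pdivrMr// natrM mulrA mulVf// mul1r.
by apply: (@le_trans _ _ 1); [lra|rewrite ler1n].
Qed.

Let h0 : 0 < h. Proof. by case/andP: kh_bnd. Qed.

Lemma kk_bnd n : 0 < kk n < 1.
Proof.
have /andP[_ h2] := kh_bnd; have p : 1 <= 2 ^+ n :> R by rewrite exprn_ege1// ler1n.
have p0 : 0 < 2 ^+ n :> R by apply: lt_le_trans p.
have : h / 2 ^+ n <= 2^-1.
  by rewrite ler_pdivrMr//; apply: le_trans h2 _; rewrite ler_peMr.
by have : 0 < h / 2 ^+ n; [rewrite divr_gt0|rewrite /kk => *; apply/andP; split; lra].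
Qed.

Let kk0 n : 0 < kk n. Proof. by case/andP: (kk_bnd n). Qed.
Let kk1 n : kk n < 1. Proof. by case/andP: (kk_bnd n). Qed.

Let prod0 n : 0 < \prod_(i < n) kk i.
Proof. by apply: prodr_gt0 => i _. Qed.

Lemma kq_gt0 n : 0 < kq n.
Proof. by rewrite divr_gt0// exprn_gt0. Qed.

Lemma kq0 : kq 0 = qa.
Proof. by rewrite /kq big_ord0 expr1n divr1. Qed.

Lemma kqS n : kq n / kk n ^+ (2 * tau) = kk n * kq n.+1.
Proof.
rewrite /kq big_ord_recr /= exprMn exprS.
rewrite [kk n ^+ (2 * tau).+1]exprS.
have := expf_neq0 (2 * tau) (lt0r_neq0 (kk0 n)); have := lt0r_neq0 (kk0 n).
have := expf_neq0 (2 * tau) (lt0r_neq0 (prod0 n)); have := lt0r_neq0 (prod0 n).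
move: (kk n ^+ (2 * tau)) (kk n) => w z.
move: ((\prod_(i < n) kk i) ^+ (2 * tau)) (\prod_(i < n) kk i) => u v u0 v0 w0 z0.
by field; rewrite u0 v0 w0 z0.
Qed.

(** The product of the [kk i] stays above [1 - 2 h], by induction on the sharper
    [1 - 2 h (1 - 2^-n)]; Bernoulli's inequality then gives exactly [qa / qz] for its power. *)
Lemma kq_le n : kq n <= qz.
Proof.
have hp : 1 - 2 * h <= \prod_(i < n) kk i.
  suff : 1 - 2 * h * (1 - 2^-1 ^+ n) <= \prod_(i < n) kk i.
    apply: le_trans; have : 0 <= h * 2^-1 ^+ n :> R by rewrite mulr_ge0 ?exprn_ge0 ?invr_ge0 ?(ltW h0).
    by lra.
  elim: n => [|n ih]; first by rewrite big_ord0 expr0 subrr mulr0 subr0.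
  rewrite big_ord_recr /= /kk -exprVn exprS.
  have p0 : 0 <= 2^-1 ^+ n :> R by rewrite exprn_ge0// invr_ge0.
  have p1 : 2^-1 ^+ n <= 1 :> R by rewrite exprn_ile1// ?invr_ge0// invf_le1// ler1n.
  have := ler_wpM2r (ltW (kk0 n)) ih; rewrite /kk -exprVn; apply: le_trans.
  set p := 2^-1 ^+ n in p0 p1 *.
  have : 0 <= (1 - p) * (h * p) * h.
    by apply: mulr_ge0 (mulr_ge0 _ (mulr_ge0 (ltW h0) p0)) (ltW h0); rewrite subr_ge0.
  by lra.
have /andP[_ h2] := kh_bnd.
have hc : qa / qz <= (\prod_(i < n) kk i) ^+ (2 * tau).+1.
  apply: le_trans (lerXn2r _ _ _ hp); rewrite ?nnegrE ?subr_ge0 ?(ltW (prod0 n))//; last by lra.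
  apply: le_trans (bernoulli_le _ _); last by apply/andP; split; [rewrite mulr_ge0// ltW|lra].
  rewrite /h natrM; have m0 : (2 * tau).+1%:R != 0 :> R by rewrite pnatr_eq0.
  move: (2 * tau).+1%:R m0 => m m0.
  by have -> : 1 - m * (2 * ((1 - qa / qz) / (2 * m))) = qa / qz by field; rewrite m0 gt_eqF.
rewrite /kq ler_pdivrMr ?exprn_gt0//; move: hc; rewrite ler_pdivrMr//.
by rewrite mulrC.
Qed.

Lemma kq_gap n : kq n <= kk n * kq n.+1.
Proof.
rewrite -kqS ler_pdivlMr ?exprn_gt0// ler_piMr ?(ltW (kq_gt0 n))//.
by rewrite exprn_ile1// ltW.
Qed.

Lemma kq_mono n : kq n <= kq n.+1.
Proof.
by apply: le_trans (kq_gap n) _; rewrite ler_piMl// ltW// kq_gt0.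
Qed.

Lemma kq_ge n : qa <= kq n.
Proof. by elim: n => [|n ih]; rewrite ?kq0// (le_trans ih)// kq_mono. Qed.

Lemma sig_kq n : sig * kq n <= 1.
Proof. by apply: le_trans sqz; rewrite ler_wpM2l ?kq_le. Qed.

Let Zgk n : Zg d (kk n) = kK n ^+ d.
Proof.
rewrite /Zg /kK /kk opprB addrC subrK; congr (_ ^+ _).
by field; rewrite expf_neq0// gt_eqF.
Qed.

Let K2 n : 2 ^+ n <= kK n.
Proof.
have /andP[_ h2] := kh_bnd; rewrite /kK ler_pdivlMr// mulrC ler_wpM2r ?exprn_ge0//.
lra.
Qed.

Let kK1 n : (1 - kk n)^-1 <= kK n.
Proof.
rewrite /kK /kk opprB addrC subrK invf_div -mulrA ler_peMl ?ler1n//.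
by rewrite divr_ge0 ?exprn_ge0// ltW.
Qed.

Let e00 : 0 <= e0. Proof. exact: sbd_ge0 hV. Qed.
Let b0 : 0 < b. Proof. by rewrite exprn_gt0// invr_gt0. Qed.
Let b1 : b <= 2^-1.
Proof. by rewrite /b exprS ler_piMr// ?invr_ge0// exprn_ile1 ?invr_ge0// invf_le1// ler1n. Qed.

(** The 248 is [8 * 31]: the 31 of [kS_bnd], a 4 from the two products in [kB], and a 2 from the
    Neumann series. *)
Definition kcst : R := 248 * (2 / h) ^+ (4 * tau + d).

Lemma kcst_ge1 : 248 <= kcst.
Proof.
rewrite /kcst ler_peMr// exprn_ege1// ler_pdivlMr//.
by have /andP[_] := kh_bnd; lra.
Qed.

Lemma kcst_small : kcst * e0 <= 2^-1. Proof. exact: le_trans small b1. Qed.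

Lemma ke0_small : e0 <= 4^-1.
Proof. by have := kcst_small; have := ler_wpM2r e00 kcst_ge1; lra. Qed.

(* The loss 2^n per step in the small divisors is absorbed by the choice of b. *)
Let eK' n : 248 * (e0 * b ^+ n * kK n ^+ D) <= 248 * (2 / h) ^+ D * e0 * 2^-1 ^+ n.
Proof.
rewrite -[leRHS]mulrA -[leRHS]mulrA ler_wpM2l//.
have -> : kK n = 2 / h * 2 ^+ n by rewrite /kK; field; rewrite gt_eqF.
have -> : e0 * b ^+ n * (2 / h * 2 ^+ n) ^+ D =
  (2 / h) ^+ D * (e0 * (b ^+ n * (2 ^+ n) ^+ D)) by rewrite exprMn; ring.
have c0 : 0 <= (2 / h) ^+ D by rewrite exprn_ge0// divr_ge0// ltW.
apply: ler_wpM2l => //; apply: ler_wpM2l => //.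
rewrite /b -!exprM mulSn exprD mulnC -mulrA -exprMn mulVf// expr1n mulr1.
by [].
Qed.

Let eK n : 248 * (e0 * b ^+ n * kK n ^+ D) <= b * 2^-1 ^+ n.
Proof.
by apply: le_trans (eK' n) _; rewrite ler_wpM2r// exprn_ge0// invr_ge0.
Qed.

Let sumb n := \sum_(i < n) b ^+ i.
Let sumb_le n : e0 * sumb n <= 2^-1.
Proof.
have : sumb n <= 2.
  apply: le_trans (geometric_le n (ltW b0) _) _; first by have := b1; lra.
  rewrite -[leLHS]mul1r ler_pdivrMr; have := b1; lra.
move=> /(ler_wpM2l e00); have := ke0_small; lra.
Qed.

(** Of the quadratic gain of a Newton step only a geometric decay with fixed ratio [b] is kept. This
    is enough, since the divisors lose no more than a fixed power of [2 ^+ n]; the corrections of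
    [D] then add up to at most [1/2], which keeps [kS_bnd] applicable at the next step. *)
Lemma kam_bnd n : [/\ bnd (e0 * b ^+ n) (kq n) (kE n),
  forall x, cabs (kD n x) <= e0 * sumb n &
  forall m, cabs (kD n (T m x0) - kD n (T m y0)) <= e0 * sumb n * rho * sig ^+ n1 m].
Proof.
elim: n => [|n [hE hD hL]].
  split=> [|x|m]; rewrite ?expr0 ?mulr1 ?kq0 ?/sumb ?big_ord0 ?mulr0 ?mul0r//=.
    by rewrite cabs0.
  by rewrite subrr cabs0.
have q0 := kq_gt0 n; have ee := sbd_ge0 hE.
have hS : bnd (31 * (e0 * b ^+ n) * kK n ^+ (4 * tau)) (kk n * kq n.+1) (kSn n).
  rewrite -kqS; apply: kS_bnd (kk0 n) (kk1 n) (K2 n) (kK1 n) hE _ _ => //.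
  - exact: ltW.
  - by move=> x; apply: le_trans (hD x) (sumb_le n).
  - move=> m; apply: le_trans (hL m) _; rewrite ler_wpM2r// ler_wpM2r//.
split=> [|x|m].
- rewrite kES.
  set e := e0 * b ^+ n in hE hS ee *; set s := 31 * e * kK n ^+ (4 * tau) in hS.
  have q0' := ltW q0; have q1 := ltW (kq_gt0 n.+1); have k0 := ltW (kk0 n).
  have kq0' : 0 <= kk n * kq n.+1 by rewrite mulr_ge0.
  have kqle : kk n * kq n.+1 <= kq n.+1 by rewrite ler_piMl// ltW.
  have Z0 : 0 <= Zg d (kk n) by rewrite Zgk exprn_ge0// (le_trans _ (K2 n))// exprn_ge0.
  have hB : bnd (4 * (e * s * Zg d (kk n))) (kq n.+1) (kB n (kD n) (kE n)).
    have h1 : bnd (2 * (e * s * Zg d (kk n))) (kq n.+1) (smul T (kE n) (kSn n)).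
      apply: (sbdM TD rho0 sig1 q0' kq0' q1 k0 (kk1 n) (sig_kq _) hE hS).
      by left; rewrite kq_gap.
    have h2 : bnd (2 * s * e) (kk n * kq n.+1) (smul T (kSn n) (sdiag (kE n 0))).
      exact: (sbd_muldiag sig1 T0 kq0' hS (sbd_diag rho0 sig1 q0' hE)).
    have h3 : bnd (2 * (e * s * Zg d (kk n))) (kq n.+1) (smul T (kSn n) (sdiag (kE n 0))).
      apply: sbd_le h2 => //.
      rewrite -mulrA [s * e]mulrC ler_wpM2l// ler_peMr ?(mulr_ge0 ee (sbd_ge0 hS))//.
      exact: Zg_ge1.
    apply: sbd_le (sbdD h1 (sbdN h3)) => //.
    by apply: ler_eq; ring.
  have sZ : s * Zg d (kk n) = 31 * (e * kK n ^+ D).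
    by rewrite Zgk /s /D exprD; ring.
  have eKn := eK n; rewrite -/e in eKn.
  have hsm : b * 2^-1 ^+ n <= 2^-1.
    apply: le_trans b1; rewrite ler_piMr ?(ltW b0)// exprn_ile1 ?invr_ge0//.
    by rewrite invf_le1// ler1n.
  apply: sbd_le (sbd_neumann TD rho0 sig1 kq0' q1 k0 (kk1 n) (sig_kq _) (lexx _) hS hB _) => //.
    have -> : 2 * (4 * (e * s * Zg d (kk n))) = e * (8 * (s * Zg d (kk n))) by ring.
    have -> : e0 * b ^+ n.+1 = e * b by rewrite /e exprSr mulrA.
    rewrite sZ ler_wpM2l//.
    have : b * 2^-1 ^+ n <= b.
      by rewrite ler_piMr ?(ltW b0)// exprn_ile1 ?invr_ge0// invf_le1// ler1n.
    by lra.
  by rewrite sZ; lra.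
- rewrite kDS; apply: le_trans (cabsD _ _) _.
  rewrite /sumb big_ord_recr /= mulrDr lerD//.
  by case: hE => /(_ 0 x); rewrite n1_0 expr0 mulr1.
- rewrite !kDS opprD addrACA; apply: le_trans (cabsD _ _) _.
  rewrite /sumb big_ord_recr /= mulrDr !mulrDl lerD//.
  by case: hE => _ /(_ 0 m); rewrite n1_0 expr0 mulr1.
Qed.

Lemma kam_small n (x : X) : cabs (kE n 0 x) <= e0 * 2^-1 ^+ n.
Proof.
have [[h _] _ _] := kam_bnd n; have := h 0 x; rewrite n1_0 expr0 mulr1.
move/le_trans; apply; apply: ler_wpM2l => //; apply: lerXn2r => //; rewrite nnegrE ?(ltW b0)//.
Qed.

Lemma kD_small n (x : X) : cabs (kD n x) <= 2^-1.
Proof. by have [_ h _] := kam_bnd n; apply: le_trans (h x) (sumb_le n). Qed.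

Lemma kD_lip n : cabs (kD n (T 0 x0) - kD n (T 0 y0)) <= 2 * e0 * rho.
Proof.
have [_ _ h] := kam_bnd n; apply: le_trans (h 0) _; rewrite n1_0 expr0 mulr1.
apply: ler_wpM2r => //; rewrite mulrC; apply: ler_wpM2r => //.
apply: le_trans (geometric_le n (ltW b0) _) _; first by have := b1; lra.
rewrite -[leLHS]mul1r ler_pdivrMr; have := b1; lra.
Qed.

Lemma kS_small n : exists s, bnd s (kk n * kq n.+1) (kSn n) /\
  8 * (s * Zg d (kk n)) <= kcst * e0 * 2^-1 ^+ n.
Proof.
have [hE hD hL] := kam_bnd n; have q0 := kq_gt0 n.
exists (31 * (e0 * b ^+ n) * kK n ^+ (4 * tau)); split.
  rewrite -kqS; apply: kS_bnd (kk0 n) (kk1 n) (K2 n) (kK1 n) hE _ _ => //.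
  - exact: ltW.
  - by move=> x; apply: le_trans (hD x) (sumb_le n).
  - by move=> m; apply: le_trans (hL m) _; rewrite ler_wpM2r// ler_wpM2r.
rewrite Zgk.
have -> : 8 * (31 * (e0 * b ^+ n) * kK n ^+ (4 * tau) * kK n ^+ d) =
  248 * (e0 * b ^+ n * kK n ^+ D) by rewrite /D exprD; ring.
exact: eK'.
Qed.

End Kam.

Section HalfPowers.
Variable R : realType.

Lemma conjcM (x y : R[i]) : conjc (x * y) = conjc x * conjc y.
Proof. exact: rmorphM. Qed.

Lemma conjcD (x y : R[i]) : conjc (x + y) = conjc x + conjc y.
Proof. exact: rmorphD. Qed.

Lemma half_small (K e : R) : 0 < e -> exists n, K * 2^-1 ^+ n <= e.
Proof.
move=> e0; have h0 : 0 <= `|K| / e by rewrite divr_ge0// ltW.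
exists (Num.bound (`|K| / e)); have h := archi_boundP h0; move: h.
set n := Num.bound _ => h.
rewrite exprVn ler_pdivrMr ?exprn_gt0//; apply: le_trans (ler_norm _) _.
move: h; rewrite ltr_pdivrMr// => /ltW/le_trans; apply.
rewrite mulrC ler_wpM2l ?(ltW e0)// -natrX ler_nat ltnW//.
exact: ltn_expl.
Qed.

Lemma le_half (a c K : R) : (forall n, a <= c + K * 2^-1 ^+ n) -> a <= c.
Proof.
move=> h; apply/ler_addgt0Pr => e e0; have [n hn] := half_small K e0.
by apply: le_trans (h n) _; rewrite lerD2l.
Qed.

Lemma csum_nat_split (f : nat -> R[i]) n : summ f ->
  csum f = \sum_(i < n) f i + csum (fun i => f (n + i)%N).
Proof.
elim: n => [|n ih] sf; first by rewrite big_ord0 add0r.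
rewrite ih// big_ord_recr /= -addrA; congr (_ + _).
rewrite csum_nat_recl; last by apply: (summ_inj _ sf) => ? ? /addnI.
by rewrite addn0; congr (_ + _); apply: eq_csum => i; rewrite addnS addSn.
Qed.
End HalfPowers.

(** * The limit of the iteration, its inverse, and reality of the eigenvalues *)

Section KamLimit.
Variables (R : realType) (d : nat) (X : Type) (T : 'rV[int]_d -> X -> X).
Hypothesis TD : forall k m x, T (k + m) x = T k (T m x).
Hypothesis T0 : forall x, T 0 x = x.
Notation Z := 'rV[int]_d.
Notation sym := (Z -> X -> R[i]).
Variables (tau : nat) (dv : Z -> X -> R) (V : sym) (qa qz qw e0 : R) (x0 : X).
Hypotheses (qa0 : 0 < qa) (qaz : qa < qz) (qzw : qz < qw) (qw1 : qw < 1).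
Hypothesis small : 248 * (2 / kwidth tau qa qz) ^+ (4 * tau + d) * e0 <= 2^-1 ^+ (4 * tau + d).+1.
Hypothesis hV0 : forall l x, cabs (V l x) <= e0 * qa ^+ n1 l.
Hypothesis dvD : forall l k x, dv (l + k) x = dv l (T k x) + dv k x.

(** With equal base points, [rho = 0] and [sig = 1], the Lipschitz half of [sbd] is void, and the
    estimates of the iteration become plain sup bounds. *)
Notation bnd := (sbd T x0 x0 0 1).
Notation kD n := (kam T tau dv V n).1.
Notation kE n := (kam T tau dv V n).2.
Notation kSn n := (kS T tau dv n (kD n) (kE n)).
Notation qn := (kq tau qa qz).
Notation kkn := (kk tau qa qz).
Notation cst := (kcst d tau qa qz).
Notation one := (sdiag (fun _ : X => 1 : R[i])).

Let qz0 : 0 < qz. Proof. exact: lt_trans qaz. Qed.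
Let qz1 : qz < 1. Proof. exact: lt_trans qw1. Qed.
Let qw0 : 0 < qw. Proof. exact: lt_trans qzw. Qed.

Lemma sbd_sup A q (M : sym) : 0 <= A -> 0 <= q ->
  (forall l x, cabs (M l x) <= A * q ^+ n1 l) -> bnd A q M.
Proof.
move=> A0 q0 h; split=> // l m; rewrite subrr cabs0 mulr0 mul0r mul0r//.
Qed.

Let e00 : 0 <= e0.
Proof. by have := hV0 0 x0; rewrite n1_0 expr0 mulr1; apply: le_trans. Qed.

Lemma kV_bnd : bnd e0 qa V.
Proof. by apply: sbd_sup => //; apply: ltW. Qed.

Let dv0 l m : `|dv l (T m x0) - dv l (T m x0)| <=
  0 * 1 ^+ (n1 l + n1 m) * (1 + `|dv l (T m x0)|) * (1 + `|dv l (T m x0)|).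
Proof. by rewrite subrr normr0 !mul0r. Qed.

Let sq : 1 * qz <= 1. Proof. by rewrite mul1r ltW. Qed.

Let qn0 n : 0 <= qn n. Proof. exact: ltW (kq_gt0 tau qa0 qaz n). Qed.
Let qnz n : qn n <= qz. Proof. exact: kq_le. Qed.
Let qn1 n : qn n < 1. Proof. exact: le_lt_trans (qnz n) qz1. Qed.
Let kk0 n : 0 <= kkn n. Proof. by case/andP: (kk_bnd tau qa0 qaz n) => /ltW. Qed.
Let kk1 n : kkn n < 1. Proof. by case/andP: (kk_bnd tau qa0 qaz n). Qed.
Let sqn n : 1 * qn n <= 1. Proof. by rewrite mul1r ltW. Qed.

Let kam_bnd0 n : bnd (e0 * (2^-1 ^+ (4 * tau + d).+1) ^+ n) (qn n) (kE n).
Proof. by have [] := kam_bnd TD T0 (lexx 0) (lexx 1) dv0 qa0 qaz sq small kV_bnd n. Qed.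

Let cst0 : 0 <= cst * e0.
Proof. by rewrite mulr_ge0// (le_trans _ (kcst_ge1 d tau qa0 qaz)). Qed.

Let cst_small : cst * e0 <= 2^-1.
Proof. exact: (kcst_small (d:=d) (tau:=tau) small). Qed.

Let kam_small0 n x : cabs (kE n 0 x) <= e0 * 2^-1 ^+ n.
Proof. exact: (kam_small TD T0 (lexx 0) (lexx 1) dv0 qa0 qaz sq small kV_bnd). Qed.

Let kD_small0 n x : cabs (kD n x) <= 2^-1.
Proof. exact: (kD_small TD T0 (lexx 0) (lexx 1) dv0 qa0 qaz sq small kV_bnd). Qed.

Fixpoint kU n : sym := if n is n'.+1 then sadd (kU n') (smul T (kU n') (kSn n')) else one.

Lemma sbd_one q : 0 <= q -> bnd 1 q one.
Proof.
move=> q0; apply: sbd_sup => // l x; rewrite /sdiag; case: eqP => [->|_].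
  by rewrite n1_0 expr0 cabs1 mul1r.
by rewrite cabs0 mul1r exprn_ge0.
Qed.

(** The factors [1 + kS] differ from 1 by summable amounts, so their products stay below 2. A
    product with such a factor costs 4, against the 8 of [kS_small]; the spare half gives the
    increments the decay [2 ^- n.+1]. *)
Lemma kU_bnd n : bnd (1 + cst * e0 * (1 - 2^-1 ^+ n)) (qn n) (kU n) /\
  bnd (cst * e0 * 2^-1 ^+ n.+1) (qn n.+1) (smul T (kU n) (kSn n)).
Proof.
have step m : bnd (1 + cst * e0 * (1 - 2^-1 ^+ m)) (qn m) (kU m) ->
    bnd (cst * e0 * 2^-1 ^+ m.+1) (qn m.+1) (smul T (kU m) (kSn m)).
  move=> hU; have [s [hS hs]] := kS_small TD T0 (lexx 0) (lexx 1) dv0 qa0 qaz sq small kV_bnd m.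
  have kq0 : 0 <= kkn m * qn m.+1 by rewrite mulr_ge0.
  have := sbdM TD (lexx 0) (lexx 1) (qn0 m) kq0 (qn0 m.+1) (kk0 m) (kk1 m) (sqn m.+1) hU hS.
  move=> /(_ (or_introl _)) h; have {}h := h (conj (kq_gap tau qa0 qaz m) _).
  have {}h := h (ler_piMl (qn0 _) (ltW (kk1 m))).
  apply: sbd_le h => //.
  have u2 : 1 + cst * e0 * (1 - 2^-1 ^+ m) <= 2.
    have p1 : 2^-1 ^+ m <= 1 :> R by rewrite exprn_ile1// ?invr_ge0// invf_le1// ler1n.
    have p0 : 0 <= 2^-1 ^+ m :> R by rewrite exprn_ge0// invr_ge0.
    have := mulr_ge0 cst0 p0; move: cst_small; lra.
  have sZ0 : 0 <= s * Zg d (kkn m).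
    by rewrite mulr_ge0// ?(sbd_ge0 hS)// (le_trans _ (Zg_ge1 d (kk0 m) (kk1 m))).
  have := ler_wpM2r sZ0 u2; rewrite exprS; move: hs.
  by move: (Zg _ _) => z; lra.
have hU : bnd (1 + cst * e0 * (1 - 2^-1 ^+ n)) (qn n) (kU n).
  elim: n => [|n ih] /=.
    by apply: sbd_le (sbd_one (qn0 0)) => //; rewrite expr0 subrr mulr0 addr0.
  have := sbdD (sbd_le (lexx 0) (lexx 1) (qn0 n) (kq_mono tau qa0 qaz n) (lexx _) ih) (step n ih).
  apply: sbd_le => //; rewrite ?exprS; lra.
by split=> //; apply: step.
Qed.

Definition kA : sym := fun l x => csum (fun n => smul T (kU n) (kSn n) l x).
Definition kUinf : sym := sadd one kA.
Definition kDinf : X -> R[i] := fun x => csum (fun n => kE n 0 x).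

Let kF_bnd n : bnd (cst * e0 * 2^-1 ^+ n.+1) qz (smul T (kU n) (kSn n)).
Proof. by apply: sbd_le (proj2 (kU_bnd n)). Qed.

Lemma kUE n l x : kU n l x = one l x + \sum_(i < n) smul T (kU i) (kSn i) l x.
Proof.
elim: n => [|n ih]; first by rewrite big_ord0 addr0.
by rewrite big_ord_recr /= addrA -ih.
Qed.

Let F_sumle n : sumle (fun i => cst * e0 * 2^-1 ^+ (n + i).+1) (cst * e0 * 2^-1 ^+ n).
Proof.
have c0 : 0 <= cst * e0 * 2^-1 ^+ n.+1 by rewrite mulr_ge0// exprn_ge0// invr_ge0.
have := sumle_half c0; rewrite exprS.
have -> : 2 * (cst * e0 * (2^-1 * 2^-1 ^+ n)) = cst * e0 * 2^-1 ^+ n by field.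
by move=> /sumle_le; apply => // i; rewrite -addSn exprD mulrA exprS.
Qed.

Lemma kA_bnd : bnd (cst * e0) qz kA.
Proof.
have := sbd_csum (lexx 0) (lexx 1) (ltW qz0) kF_bnd (F_sumle 0).
by rewrite expr0 mulr1.
Qed.

Lemma kUinf_bnd : bnd 2 qz kUinf.
Proof.
apply: sbd_le (sbdD (sbd_one (ltW qz0)) kA_bnd) => //; first exact: ltW.
by have := cst_small; lra.
Qed.

Lemma kU_cvg n : bnd (cst * e0 * 2^-1 ^+ n) qz (sadd kUinf (sopp (kU n))).
Proof.
have -> : sadd kUinf (sopp (kU n)) = fun l x => csum (fun i => smul T (kU (n + i)) (kSn (n + i)) l x).
  apply/funext => l; apply/funext => x; rewrite /sadd /sopp /kUinf /sadd kUE /kA.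
  rewrite (@csum_nat_split _ _ n); first by ring.
  have : sumle (fun i => (cst * e0 * 2^-1 ^+ i.+1) * qz ^+ n1 l) (cst * e0 * qz ^+ n1 l).
    move=> s us; rewrite -mulr_suml; apply: ler_wpM2r; first by rewrite exprn_ge0// ltW.
    by have := F_sumle 0 us; rewrite expr0 mulr1.
  by move=> h; apply: (summ_le h) => i; case: (kF_bnd i).
by apply: (sbd_csum (lexx 0) (lexx 1) (ltW qz0) _ (F_sumle n)) => i; apply: kF_bnd.
Qed.

Lemma kD_sum n x : kD n x = \sum_(i < n) kE i 0 x.
Proof. by elim: n => [|n ih]; rewrite ?big_ord0// big_ord_recr /= -ih kDS. Qed.

Lemma kD_cvg n x : cabs (kDinf x - kD n x) <= 2 * e0 * 2^-1 ^+ n.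
Proof.
have hs : summ (fun i => kE i 0 x).
  by apply: (summ_le (sumle_half e00)) => i; apply: kam_small0.
rewrite kD_sum /kDinf (csum_nat_split n hs) addrC addKr; apply: csum_le.
have c0 : 0 <= e0 * 2^-1 ^+ n by rewrite mulr_ge0// exprn_ge0// invr_ge0.
rewrite -mulrA; apply: sumle_le (sumle_half c0) _ (lexx _) => i.
by apply: le_trans (kam_small0 _ _) _; rewrite exprD mulrA.
Qed.

Lemma kDinf_small x : cabs (kDinf x) <= 2^-1.
Proof.
apply: (@le_half _ _ _ (2 * e0)) => n; rewrite -(subrK (kD n x) (kDinf x)) addrC.
by apply: le_trans (cabsD _ _) _; rewrite lerD ?kD_cvg.
Qed.

Let fin (M : sym) := exists A, bnd A qw M.

Let fin_le A q M : 0 <= q -> q <= qw -> bnd A q M -> fin M.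
Proof. by move=> ? ? h; exists A; apply: sbd_le h. Qed.

Let fin_summ M N l x : fin M -> fin N -> summ (fun m => M (l - m) (T m x) * N m x).
Proof.
move=> [A hM] [B hN]; have A0 := sbd_ge0 hM; have B0 := sbd_ge0 hN.
case: hM hN => M1 _ [N1 _].
apply: (summ_le (sumleZ (mulr_ge0 A0 B0) (@sumle_geometric R d _ (ltW qw0) qw1))) => m.
rewrite cabsM -mulrA; apply: ler_pM => //; apply: le_trans (M1 _ _) _.
by rewrite -[leRHS]mulr1 ler_wpM2l// exprn_ile1// ltW.
Qed.

Let qnw n : qn n <= qw. Proof. exact: le_trans (qnz n) (ltW qzw). Qed.

Let fV : fin V.
Proof. by apply: fin_le kV_bnd; rewrite ltW// (lt_trans qaz). Qed.

Let smulDr M N P l x : fin M -> fin N -> fin P ->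
  smul T M (sadd N P) l x = smul T M N l x + smul T M P l x.
Proof.
move=> hM hN hP; rewrite -csumD; [|exact: fin_summ..].
by apply: eq_csum => k; rewrite /sadd mulrDr.
Qed.

Let smulDl M N P l x : fin M -> fin N -> fin P ->
  smul T (sadd M N) P l x = smul T M P l x + smul T N P l x.
Proof.
move=> hM hN hP; rewrite -csumD; [|exact: fin_summ..].
by apply: eq_csum => k; rewrite /sadd mulrDl.
Qed.

Let smulNl M N l x : fin M -> fin N -> smul T (sopp M) N l x = - smul T M N l x.
Proof.
move=> hM hN; rewrite -csumN; last exact: fin_summ.
by apply: eq_csum => k; rewrite /sopp mulNr.
Qed.

Let smulNr M N l x : fin M -> fin N -> smul T M (sopp N) l x = - smul T M N l x.
Proof.
move=> hM hN; rewrite -csumN; last exact: fin_summ.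
by apply: eq_csum => k; rewrite /sopp mulrN.
Qed.

Let finD M N : fin M -> fin N -> fin (sadd M N).
Proof. by move=> [A ?] [B ?]; exists (A + B); apply: sbdD. Qed.

Let finN M : fin M -> fin (sopp M).
Proof. by move=> [A ?]; exists A; apply: sbdN. Qed.

Let smulA' M N P l x : fin M -> fin N -> fin P ->
  smul T (smul T M N) P l x = smul T M (smul T N P) l x.
Proof.
move=> [A hM] [B hN] [C hP].
exact: (smulA TD (ltW qw0) (ltW qw1) (ltW qw0) qw1 (ltW qw0) qw1 hM hN hP).
Qed.

Let gapl A B q1 n M N : 0 <= q1 -> q1 <= kkn n * qn n.+1 -> bnd A q1 M -> bnd B (qn n.+1) N ->
  exists C, bnd C (qn n.+1) (smul T M N).
Proof.
move=> q10 hq hM hN; exists (2 * (A * B * Zg d (kkn n))).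
exact: (sbdM TD (lexx 0) (lexx 1) q10 (qn0 _) (qn0 _) (kk0 n) (kk1 n) (sqn _) hM hN (or_introl (conj hq (lexx _)))).
Qed.

Lemma smul1l M l x : smul T one M l x = M l x.
Proof. by rewrite smul_diagl mul1r. Qed.

Lemma smul1r M l x : smul T M one l x = M l x.
Proof. by rewrite smul_diagr// mulr1. Qed.

Variable G : X -> Prop.
Hypothesis GT : forall k x, G x -> G (T k x).
Hypothesis nonres : forall n l x, l != 0 -> G x -> keta R tau n l <= cabs (kdiv T dv (kD n) l x).

Lemma dv_0 x : dv 0 x = 0.
Proof. by have := dvD 0 0 x; rewrite addr0 T0 => /eqP; rewrite -subr_eq subrr => /eqP. Qed.

(** [dv] is additive along composition of modes ([dvD]), so multiplication by it is a derivation of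
    [smul]: it is the commutator with the unperturbed diagonal operator. *)
Lemma leibniz M N DM DN l x : fin DM -> fin N -> fin M -> fin DN -> G x ->
  (forall k y, G y -> (dv k y)%:C * M k y = DM k y) ->
  (forall k y, G y -> (dv k y)%:C * N k y = DN k y) ->
  (dv l x)%:C * smul T M N l x = smul T DM N l x + smul T M DN l x.
Proof.
move=> h1 h2 h3 h4 Gx hM hN; rewrite -csumZ; last exact: fin_summ.
rewrite -csumD; [|exact: fin_summ..]; apply: eq_csum => k.
rewrite -hM; last exact: GT.
have -> : dv l x = dv (l - k) (T k x) + dv k x by rewrite -dvD subrK.
rewrite -hN// rmorphD /=; ring.
Qed.

(** In operator form, the product of the first [n] factors intertwines the original operator with
    [D + E]. Nonresonance enters only in [homS], where the cut-off inverse must be the true one;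
    everything else is algebra valid at all points. *)
Lemma kam_equation n l x : G x ->
  (dv l x)%:C * kU n l x + smul T V (kU n) l x =
  smul T (kU n) (sadd (sdiag (kD n)) (kE n)) l x.
Proof.
elim: n l x => [|n ih] l x Gx.
  rewrite smul1r /= smul1l /sadd /sdiag; case: eqP => [->|_]; last by rewrite mulr0.
  by rewrite dv_0 mul0r.
set U := kU n in ih *; set S := kSn n; set D := kD n; set E := kE n.
have [hU hF] := kU_bnd n; rewrite -/U -/S in hU hF.
have [s [hS _]] := kS_small TD T0 (lexx 0) (lexx 1) dv0 qa0 qaz sq small kV_bnd n.
rewrite -/S in hS.
have hE := kam_bnd0 n; have hE' := kam_bnd0 n.+1; rewrite -/E in hE.
have kq0 : 0 <= kkn n * qn n.+1 by rewrite mulr_ge0.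
have kqle : kkn n * qn n.+1 <= qn n.+1 by rewrite ler_piMl// ltW.
have kqz : kkn n * qn n.+1 <= qw by apply: le_trans kqle _.
have gap := kq_gap tau qa0 qaz n.
have diagb (D' : X -> R[i]) q : 0 <= q -> (forall y, cabs (D' y) <= 2^-1) -> bnd 2^-1 q (sdiag D').
  move=> q0 hD; apply: sbd_sup => // k y; rewrite /sdiag; case: eqP => [->|_].
    by rewrite n1_0 expr0 mulr1.
  by rewrite cabs0 mulr_ge0// exprn_ge0.
have lift A q M : 0 <= q -> q <= qn n.+1 -> bnd A q M -> bnd A (qn n.+1) M.
  by move=> ? ?; apply: sbd_le.
set W := sadd (sdiag D) E; set W' := sadd (sdiag (kD n.+1)) (kE n.+1).
have hW : bnd (2^-1 + e0 * (2^-1 ^+ (4 * tau + d).+1) ^+ n) (qn n) W.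
  by apply: sbdD => //; apply: diagb => // y; apply: kD_small0.
have hW' : bnd (2^-1 + e0 * (2^-1 ^+ (4 * tau + d).+1) ^+ n.+1) (qn n.+1) W'.
  by apply: sbdD => //; apply: diagb => // y; apply: kD_small0.
have fU := fin_le (qn0 _) (qnw _) hU; have fS := fin_le kq0 kqz hS.
have fW := fin_le (qn0 _) (qnw _) hW; have fW' := fin_le (qn0 _) (qnw _) hW'.
have fE := fin_le (qn0 _) (qnw _) hE; have fE' := fin_le (qn0 _) (qnw _) hE'.
have fD : fin (sdiag D).
  by apply: fin_le (diagb D 0 (lexx 0) _) => //; [exact: ltW|move=> y; apply: kD_small0].
have fE0 : fin (sdiag (E 0)).
  apply: (@fin_le (e0 * (2^-1 ^+ (4 * tau + d).+1) ^+ n) 0) => //; first exact: ltW.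
  exact: (sbd_diag (lexx 0) (lexx 1) (qn0 n) hE).
have fUW : fin (smul T U W).
  have [C hC] := gapl (qn0 n) gap hU (lift _ _ _ (qn0 n) (kq_mono tau qa0 qaz n) hW).
  exact: fin_le hC.
have fVU : fin (smul T V U).
  have [||C hC] := gapl (q1 := qa) _ _ kV_bnd (lift _ _ _ (qn0 n) (kq_mono tau qa0 qaz n) hU).
  - exact: ltW.
  - by apply: le_trans gap; apply: kq_ge.
  exact: fin_le hC.
have fWS : fin (smul T W S).
  have [C hC] := gapl (qn0 n) gap hW (lift _ _ _ kq0 kqle hS); exact: fin_le hC.
have fES : fin (smul T E S).
  have [C hC] := gapl (qn0 n) gap hE (lift _ _ _ kq0 kqle hS); exact: fin_le hC.
have fSW' : fin (smul T S W').
  have [C hC] := gapl kq0 (lexx _) hS hW'; exact: fin_le hC.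
have fSE' : fin (smul T S (kE n.+1)).
  have [C hC] := gapl kq0 (lexx _) hS hE'; exact: fin_le hC.
have fUS := fin_le (qn0 _) (qnw _) hF.
have hD1 : bnd 2^-1 0 (sdiag D) by apply: diagb => // y; apply: kD_small0.
have fSD : fin (smul T S (sdiag D)).
  exact: fin_le (sbd_muldiag (lexx 1) T0 kq0 hS hD1).
have fDS : fin (smul T (sdiag D) S).
  exists (2^-1 * s); apply: sbd_sup => //; [|exact: ltW|].
    by rewrite mulr_ge0// (sbd_ge0 hS).
  move=> k y; rewrite smul_diagl cabsM -mulrA; apply: ler_pM => //; first exact: kD_small0.
  case: hS => hS _; apply: le_trans (hS _ _) _; apply: ler_wpM2l.
    by have := hS 0 y; rewrite n1_0 expr0 mulr1; apply: le_trans.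
  by apply: lerXn2r; rewrite // nnegrE ltW.
pose DU := sadd (smul T U W) (sopp (smul T V U)).
pose DS := sadd (sadd (smul T S (sdiag D)) (sopp (smul T (sdiag D) S)))
  (sadd (sopp E) (sdiag (E 0))).
have fDU : fin DU by apply: finD => //; apply: finN.
have fDS' : fin DS.
  by apply: finD; apply: finD => //; apply: finN.
have homU k y : G y -> (dv k y)%:C * U k y = DU k y.
  by move=> Gy; have := ih k y Gy; rewrite /DU /sadd /sopp -/W => <-; ring.
have homS k y : G y -> (dv k y)%:C * S k y = DS k y.
  move=> Gy; rewrite /DS /sadd /sopp smul_diagr// smul_diagl /sdiag.
  case: (eqVneq k 0) => [->|k0].
    by rewrite dv_0 T0; ring.
  have := rinvE (keta_gt0 R tau n k) (nonres n k0 Gy).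
  have -> : S k y = - (rinv (keta R tau n k) (kdiv T dv D k y) * E k y).
    by rewrite /S /kS (negbTE k0).
  move: (rinv _ _) => r hr; apply/eqP; rewrite -subr_eq0.
  set lhs := _ - _; have -> : lhs = E k y * (1 - r * kdiv T dv D k y).
    by rewrite /lhs /kdiv; ring.
  by rewrite hr subrr mulr0.
have leib := leibniz l fDU fS fU fDS' Gx homU homS.
(* [1 + S] intertwines [W] and [W']: the off-diagonal part of [E] cancels against [DS], and what is
   left is the Neumann equation of the new remainder. *)
have key : sadd (sadd W (smul T W S)) DS = sadd W' (smul T S W').
  apply/funext => k; apply/funext => y; rewrite /sadd.
  rewrite (smulDl _ _ fD fE fS).
  have -> : smul T S W' k y = smul T S (sdiag (kD n.+1)) k y + smul T S (kE n.+1) k y.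
    apply: smulDr => //; exists 2^-1; apply: diagb; first exact: ltW.
    by move=> z; apply: kD_small0.
  have hEE : kE n.+1 k y = smul T E S k y - smul T S (sdiag (E 0)) k y - smul T S (kE n.+1) k y.
    have hB : exists b, bnd b (qn n.+1) (kB T tau dv n D E).
      have [C1 h1] := gapl (qn0 n) gap hE (lift _ _ _ kq0 kqle hS).
      have h2 := sbd_muldiag (lexx 1) T0 kq0 hS (sbd_diag (lexx 0) (lexx 1) (qn0 n) hE).
      eexists; apply: sbdD h1 (sbdN (lift _ _ _ kq0 kqle h2)).
    have [bb hB'] := hB.
    have [s' [hS' hs']] := kS_small TD T0 (lexx 0) (lexx 1) dv0 qa0 qaz sq small kV_bnd n.
    have hsm : 2 * (s' * Zg d (kkn n)) <= 2^-1.
      have p1 : 2^-1 ^+ n <= 1 :> R by rewrite exprn_ile1// ?invr_ge0// invf_le1// ler1n.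
      have := ler_wpM2l cst0 p1; move: cst_small hs'; rewrite mulr1; lra.
    have := neumannE TD (lexx 0) (lexx 1) kq0 (qn0 n.+1) (qn1 n.+1) (kk0 n) (kk1 n) (sqn _) (lexx _) hS' hB' hsm k y.
    by rewrite -kES.
  rewrite /DS /W /W' /sadd /sopp hEE !smul_diagr// !smul_diagl !kDS -/D -/E.
  rewrite /sdiag; case: (eqVneq k 0) => [->|k0]; rewrite ?kDS -/D -/E; ring.
rewrite /= -/U -/S /sadd mulrDr leib.
rewrite -/(sadd (sdiag (kD n.+1)) (kE n.+1)) -/W'.
rewrite (smulDr _ _ fV fU fUS) (smulDl _ _ fU fUS fW').
rewrite (smulA' _ _ fU fS fW') -(smulDr _ _ fU fW' fSW') -key.
rewrite (smulDr _ _ fU (finD fW fWS) fDS') (smulDr _ _ fU fW fWS).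
rewrite {1}/DU (smulDl _ _ fUW (finN fVU) fS) (smulNl _ _ fVU fS).
rewrite (smulA' _ _ fU fW fS) (smulA' _ _ fV fU fS) homU// /DU /sadd /sopp.
ring.
Qed.

(** For fixed [l] and [x] the identity of step [n] misses the one for the limits by five terms, each
    of size [O(2^-n)]. *)
Lemma kUinf_equation l x : G x ->
  (dv l x)%:C * kUinf l x + smul T V kUinf l x = kUinf l x * kDinf x.
Proof.
move=> Gx; apply/eqP; rewrite -subr_eq0; apply/eqP/cabs_small => e e0'.
have fU := fin_le (ltW qz0) (ltW qzw) kUinf_bnd.
suff hn n : cabs ((dv l x)%:C * kUinf l x + smul T V kUinf l x - kUinf l x * kDinf x) <=
   (`|dv l x| * (cst * e0) + 2 * (e0 * (cst * e0) * Zg d (qa / qz)) + cst * e0 + 4 * e0 + 2 * (Zg d qz * e0)) * 2^-1 ^+ n.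
  have [n hn'] := half_small (`|dv l x| * (cst * e0) + 2 * (e0 * (cst * e0) * Zg d (qa / qz)) + cst * e0 + 4 * e0 + 2 * (Zg d qz * e0)) e0'.
  exact: le_trans (hn n) hn'.
have hc := kU_cvg n.
have fUn : fin (kU n) by apply: fin_le (proj1 (kU_bnd n)).
have hE := kam_bnd0 n.
have fE : fin (kE n) by apply: fin_le hE.
have hD1 : bnd 2^-1 0 (sdiag (kD n)).
  apply: sbd_sup => // k y; rewrite /sdiag; case: eqP => [->|_].
    by rewrite n1_0 expr0 mulr1 kD_small0.
  by rewrite cabs0 mulr_ge0// exprn_ge0.
have fD : fin (sdiag (kD n)) by apply: fin_le hD1 => //; apply: ltW.
have := kam_equation n l Gx; rewrite (smulDr _ _ fUn fD fE) smul_diagr// => heq.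
set P := 2^-1 ^+ n in hc *; have P0 : 0 <= P by rewrite exprn_ge0// invr_ge0.
have dU : kUinf l x = kU n l x + sadd kUinf (sopp (kU n)) l x by rewrite /sadd /sopp; ring.
have dVU : smul T V kUinf l x = smul T V (kU n) l x + smul T V (sadd kUinf (sopp (kU n))) l x.
  by rewrite (smulDr _ _ fV fU (finN fUn)) (smulNr _ _ fV fUn); ring.
have -> : (dv l x)%:C * kUinf l x + smul T V kUinf l x - kUinf l x * kDinf x =
  (dv l x)%:C * sadd kUinf (sopp (kU n)) l x + smul T V (sadd kUinf (sopp (kU n))) l x
  - sadd kUinf (sopp (kU n)) l x * kD n x - kUinf l x * (kDinf x - kD n x)
  + smul T (kU n) (kE n) l x.
  have -> : smul T (kU n) (kE n) l x = (dv l x)%:C * kU n l x + smul T V (kU n) l x - kU n l x * kD n x.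
    by rewrite heq; ring.
  rewrite dVU dU; ring.
have q1 : qz ^+ n1 l <= 1 by rewrite exprn_ile1// ltW.
have hdU : cabs (sadd kUinf (sopp (kU n)) l x) <= cst * e0 * P.
  case: hc => /(_ l x) h _; apply: le_trans h _; rewrite ler_piMr//.
  by rewrite mulr_ge0.
have t1 : cabs ((dv l x)%:C * sadd kUinf (sopp (kU n)) l x) <= `|dv l x| * (cst * e0) * P.
  by rewrite cabsM cabs_real -mulrA ler_wpM2l.
have t2 : cabs (smul T V (sadd kUinf (sopp (kU n))) l x) <= 2 * (e0 * (cst * e0) * Zg d (qa / qz)) * P.
  have k1 : qa / qz < 1 by rewrite ltr_pdivrMr// mul1r.
  have k0 : 0 <= qa / qz by rewrite divr_ge0// ltW.
  have := sbdM TD (lexx 0) (lexx 1) (ltW qa0) (ltW qz0) (ltW qz0) k0 k1 sq kV_bnd hc.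
  rewrite divfK ?gt_eqF// => /(_ (or_introl (conj (lexx _) (lexx _)))) [/(_ l x) h _].
  apply: le_trans h _; apply: (@le_trans _ _ (2 * (e0 * (cst * e0 * P) * Zg d (qa / qz)))).
    rewrite ler_piMr// mulr_ge0// mulr_ge0//; last exact: le_trans (Zg_ge1 d k0 k1).
    exact: mulr_ge0 e00 (mulr_ge0 cst0 P0).
  by apply: ler_eq; ring.
have t3 : cabs (sadd kUinf (sopp (kU n)) l x * kD n x) <= cst * e0 * P.
  rewrite cabsM -[leRHS]mulr1; apply: ler_pM => //.
  by apply: le_trans (kD_small0 n x) _; rewrite invf_le1// ler1n.
have hU2 : cabs (kUinf l x) <= 2.
  by case: kUinf_bnd => /(_ l x) h _; apply: le_trans h _; rewrite ler_piMr.
have t4 : cabs (kUinf l x * (kDinf x - kD n x)) <= 4 * e0 * P.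
  rewrite cabsM; have -> : 4 * e0 * P = 2 * (2 * e0 * P) by ring.
  by apply: ler_pM => //; apply: kD_cvg.
have t5 : cabs (smul T (kU n) (kE n) l x) <= 2 * (Zg d qz * e0) * P.
  have -> : 2 * (Zg d qz * e0) * P = 2 * (e0 * P) * Zg d qz by ring.
  have eP : 0 <= 2 * (e0 * P) by rewrite !mulr_ge0.
  apply: csum_le; apply: sumle_le (sumleZ eP (@sumle_geometric R d _ (ltW qz0) qz1)) _ (lexx _) => k.
  rewrite cabsM -mulrA; have [hU _] := kU_bnd n; case: hU => /(_ (l - k) (T k x)) hU _.
  apply: ler_pM => //.
    apply: le_trans hU _; rewrite -[leRHS]mulr1; apply: ler_pM => //.
    - by rewrite addr_ge0// mulr_ge0// subr_ge0 exprn_ile1// ?invr_ge0// invf_le1// ler1n.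
    - by rewrite exprn_ge0.
    - by have := mulr_ge0 cst0 P0; rewrite -/P; move: cst_small; lra.
    - by rewrite exprn_ile1// ltW.
  case: hE => /(_ k x) hE _; apply: le_trans hE _; apply: ler_pM.
  - by rewrite mulr_ge0// !exprn_ge0// invr_ge0.
  - by rewrite exprn_ge0.
  - rewrite ler_wpM2l// /P; apply: lerXn2r; rewrite ?nnegrE ?exprn_ge0 ?invr_ge0//.
    by rewrite exprS ler_piMr ?invr_ge0// exprn_ile1// ?invr_ge0// invf_le1// ler1n.
  - by apply: lerXn2r; rewrite // nnegrE// ltW.
apply: le_trans (cabsD _ _) _; rewrite [leRHS]mulrDl; apply: lerD => //.
apply: le_trans (cabsB _ _) _; rewrite [leRHS]mulrDl; apply: lerD => //.
apply: le_trans (cabsB _ _) _; rewrite [leRHS]mulrDl; apply: lerD => //.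
by apply: le_trans (cabsD _ _) _; rewrite [leRHS]mulrDl; apply: lerD.
Qed.

Hypothesis small2 : 2 * (cst * e0 * Zg d (qz / qw)) <= 2^-1.
Hypothesis small3 : cst * e0 * Zg d qz <= 2^-1.
Hypothesis dvG : forall x, exists C, forall k, `|dv k x| * qw ^+ n1 k <= C.
Hypothesis herm : forall l x, conjc (V l x) = V (- l) (T l x).

Definition kW : sym := neumann T kA one.

Let rw0 : 0 <= qz / qw. Proof. by rewrite divr_ge0// ltW. Qed.
Let rw1 : qz / qw < 1. Proof. by rewrite ltr_pdivrMr// mul1r. Qed.
Let rww : qz <= qz / qw * qw. Proof. by rewrite divfK// gt_eqF. Qed.
Let sqw : 1 * qw <= 1. Proof. by rewrite mul1r ltW. Qed.

Lemma kW_bnd : bnd 2 qw kW.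
Proof.
have := sbd_neumann TD (lexx 0) (lexx 1) (ltW qz0) (ltW qw0) rw0 rw1 sqw rww
  kA_bnd (sbd_one (ltW qw0)) small2.
by rewrite mulr1.
Qed.

Lemma kWE l x : kW l x = one l x - smul T kA kW l x.
Proof.
exact: (neumannE TD (lexx 0) (lexx 1) (ltW qz0) (ltW qw0) qw1 rw0 rw1 sqw rww
  kA_bnd (sbd_one (ltW qw0)) small2).
Qed.

Lemma kW_close : bnd (2 * (cst * e0 * 2 * Zg d (qz / qw))) qw (sadd kW (sopp one)).
Proof.
have -> : sadd kW (sopp one) = sopp (smul T kA kW).
  by apply/funext => l; apply/funext => x; rewrite /sadd /sopp kWE; ring.
apply: sbdN; apply: (sbdM TD (lexx 0) (lexx 1) (ltW qz0) (ltW qw0) (ltW qw0) rw0 rw1 sqw kA_bnd kW_bnd).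
by left.
Qed.

Let fA : fin kA. Proof. exact: fin_le (ltW qz0) (ltW qzw) kA_bnd. Qed.
Let fU : fin kUinf. Proof. exact: fin_le (ltW qz0) (ltW qzw) kUinf_bnd. Qed.
Let fW : fin kW. Proof. exact: fin_le (ltW qw0) (lexx _) kW_bnd. Qed.
Let f1 : fin one. Proof. exact: fin_le (ltW qw0) (lexx _) (sbd_one (ltW qw0)). Qed.

Lemma kUW l x : smul T kUinf kW l x = one l x.
Proof. by rewrite (smulDl _ _ f1 fA fW) smul1l kWE; ring. Qed.

(** The identity plus [kA] acts on merely bounded sequences as a small perturbation of the identity
    in the sup norm ([small3]). This injectivity turns identities composed with [kUinf] on the left
    into identities without it. *)
Lemma kU_inj (x : X) (Y : Z -> R[i]) B : (forall k, cabs (Y k) <= B) ->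
  (forall l, csum (fun k => kUinf (l - k) (T k x) * Y k) = 0) -> forall l, Y l = 0.
Proof.
move=> YB hY.
have B0 : 0 <= B by apply: le_trans (YB 0).
have sA b l : 0 <= b -> (forall k, cabs (Y k) <= b) ->
    sumle (fun k => cabs (kA (l - k) (T k x) * Y k)) (b * (cst * e0) * Zg d qz).
  move=> b0 Yb; have inj : injective (fun m : Z => l - m) by move=> ? ? /addrI/oppr_inj.
  have g := sumle_inj inj (@sumle_geometric R d _ (ltW qz0) qz1).
  apply: sumle_le (sumleZ (mulr_ge0 b0 cst0) g) _ (lexx _) => k /=.
  rewrite cabsM mulrC -mulrA; apply: ler_pM => //.
  by case: kA_bnd.
have YE l : Y l = - csum (fun k => kA (l - k) (T k x) * Y k).
  apply/eqP; rewrite -addr_eq0 -[X in _ == X](hY l) /kUinf; apply/eqP.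
  have s1 : summ (fun k => one (l - k) (T k x) * Y k).
    apply: (@summ_fin _ _ _ [:: l]) => // k; rewrite inE => kl.
    by rewrite /sdiag subr_eq0 eq_sym (negbTE kl) mul0r.
  have -> : csum (fun k => sadd one kA (l - k) (T k x) * Y k) =
      csum (fun k => one (l - k) (T k x) * Y k + kA (l - k) (T k x) * Y k).
    by apply: eq_csum => k; rewrite /sadd mulrDl.
  rewrite csumD//; last by eexists; apply: (sA B).
  congr (_ + _); rewrite (@csum1 _ _ _ l) => [|k kl].
    by rewrite /sdiag subrr eqxx mul1r.
  by rewrite /sdiag subr_eq0 eq_sym (negbTE kl) mul0r.
have YB' n l : cabs (Y l) <= B * 2^-1 ^+ n.
  elim: n l => [|n ih] l; first by rewrite expr0 mulr1.
  have b0 : 0 <= B * 2^-1 ^+ n by rewrite mulr_ge0// exprn_ge0// invr_ge0.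
  rewrite YE cabsN; apply: le_trans (csum_le (sA _ l b0 ih)) _.
  rewrite exprSr [leRHS]mulrA -[leLHS]mulrA; exact: ler_wpM2l.
move=> l; apply: cabs_small => e e0'; have [n hn] := half_small B e0'.
exact: le_trans (YB' n l) hn.
Qed.

(** By associativity [kUinf] annihilates [kW kUinf - 1], the Neumann series being a right
    inverse. *)
Lemma kWU l x : smul T kW kUinf l x = one l x.
Proof.
have fWU : fin (smul T kW kUinf).
  eexists; apply: (sbdM TD (lexx 0) (lexx 1) (ltW qw0) (ltW qz0) (ltW qw0) rw0 rw1 sqw kW_bnd kUinf_bnd).
  by right.
have [C hC] := finD fWU (finN f1).
apply/eqP; rewrite -subr_eq0; apply/eqP.
apply: (@kU_inj x (fun k => smul T kW kUinf k x - one k x) C) => [k|k].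
  case: (hC) => /(_ k x) h _; apply: le_trans h _; rewrite ler_piMr ?exprn_ile1// ?(ltW qw0) ?(ltW qw1)//.
  exact: (sbd_ge0 hC).
have -> : csum (fun k0 => kUinf (k - k0) (T k0 x) * (smul T kW kUinf k0 x - one k0 x)) =
  smul T kUinf (sadd (smul T kW kUinf) (sopp one)) k x by [].
rewrite (smulDr _ _ fU fWU (finN f1)) (smulNr _ _ fU f1) smul1r -(smulA' _ _ fU fW fU).
rewrite (_ : smul T kUinf kW = one) ?smul1l ?subrr//.
by apply/funext => ?; apply/funext => ?; apply: kUW.
Qed.

Let fVU : fin (smul T V kUinf).
Proof.
have k1 : qa / qz < 1 by rewrite ltr_pdivrMr// mul1r.
have k0 : 0 <= qa / qz by rewrite divr_ge0// ltW.
have := sbdM TD (lexx 0) (lexx 1) (ltW qa0) (ltW qz0) (ltW qz0) k0 k1 sq kV_bnd kUinf_bnd.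
rewrite divfK ?gt_eqF// => /(_ (or_introl (conj (lexx _) (lexx _)))).
exact: fin_le (ltW qz0) (ltW qzw).
Qed.

Let fd : fin (sdiag kDinf).
Proof.
exists 2^-1; apply: sbd_sup => //; first exact: ltW.
move=> k y; rewrite /sdiag; case: eqP => [->|_].
  by rewrite n1_0 expr0 mulr1 kDinf_small.
by rewrite cabs0 mulr_ge0// exprn_ge0// ltW.
Qed.

Let diagb : bnd 2^-1 0 (sdiag kDinf).
Proof.
apply: sbd_sup => // k y; rewrite /sdiag; case: eqP => [->|_].
  by rewrite n1_0 expr0 mulr1 kDinf_small.
by rewrite cabs0 mulr_ge0// exprn_ge0.
Qed.

(** Applied to the defect [Y] of this equation, [kUinf] gives zero, by the Leibniz rule on
    [kUinf kW = 1] and by [kUinf_equation]; then [kU_inj] applies, since [dvG] keeps [dv * kW]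
    bounded. *)
Lemma kW_equation l x : G x ->
  (dv l x)%:C * kW l x + kDinf (T l x) * kW l x = smul T kW V l x.
Proof.
move=> Gx.
have fUd : fin (smul T kUinf (sdiag kDinf)).
  exact: fin_le (ltW qz0) (ltW qzw) (sbd_muldiag (lexx 1) T0 (ltW qz0) kUinf_bnd diagb).
have fdW : fin (smul T (sdiag kDinf) kW).
  exists (2^-1 * 2); apply: sbd_sup => //; [exact: ltW|move=> k y].
  rewrite smul_diagl cabsM -mulrA; apply: ler_pM => //; first exact: kDinf_small.
  by case: kW_bnd.
have fWV : fin (smul T kW V).
  eexists; apply: (sbdM TD (lexx 0) (lexx 1) (ltW qw0) (ltW qa0) (ltW qw0) rw0 rw1 sqw kW_bnd kV_bnd).
  by right; split=> //; apply: le_trans rww; apply: ltW.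
pose Y k := (dv k x)%:C * kW k x - (smul T kW V k x - kDinf (T k x) * kW k x).
have [C hC] := dvG x; have C0 : 0 <= C by apply: le_trans (hC 0); rewrite mulr_ge0// exprn_ge0// ltW.
have dW k : cabs ((dv k x)%:C * kW k x) <= 2 * C.
  rewrite cabsM cabs_real; apply: (@le_trans _ _ (`|dv k x| * (2 * qw ^+ n1 k))).
    by apply: ler_wpM2l => //; case: kW_bnd.
  by rewrite mulrCA ler_wpM2l.
suff : Y l = 0 by rewrite /Y => /eqP; rewrite opprB addrA subr_eq0 => /eqP.
have [B1 hB1] := fWV; have [B2 hB2] := fdW.
have sup1 B M k : bnd B qw M -> cabs (M k x) <= B.
  move=> h; case: (h) => /(_ k x) h' _; apply: le_trans h' _.
  by rewrite ler_piMr ?(sbd_ge0 h)// exprn_ile1// ltW.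
apply: (@kU_inj x Y (2 * C + (B1 + B2))) => [k|k].
  apply: le_trans (cabsB _ _) _; apply: lerD => //; apply: le_trans (cabsB _ _) _; apply: lerD.
    exact: sup1 hB1.
  by rewrite -smul_diagl; apply: sup1 hB2.
pose DU := sadd (smul T kUinf (sdiag kDinf)) (sopp (smul T V kUinf)).
have fDU : fin DU by apply: finD => //; apply: finN.
have hDU j y : G y -> (dv j y)%:C * kUinf j y = DU j y.
  move=> Gy; have := kUinf_equation j Gy; rewrite /DU /sadd /sopp smul_diagr// => <-.
  by ring.
have sUd : summ (fun j => kUinf (k - j) (T j x) * ((dv j x)%:C * kW j x)).
  have inj : injective (fun m : Z => k - m) by move=> ? ? /addrI/oppr_inj.
  have g := sumle_inj inj (@sumle_geometric R d _ (ltW qz0) qz1).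
  have c0 : 0 <= 2 * (2 * C) by rewrite !mulr_ge0.
  apply: (summ_le (sumleZ c0 g)) => j /=; rewrite cabsM mulrAC; apply: ler_pM => //.
  by case: kUinf_bnd.
have sUW : summ (fun j => kUinf (k - j) (T j x) * (smul T kW V j x - kDinf (T j x) * kW j x)).
  have -> : (fun j => kUinf (k - j) (T j x) * (smul T kW V j x - kDinf (T j x) * kW j x)) =
    fun j => kUinf (k - j) (T j x) * (sadd (smul T kW V) (sopp (smul T (sdiag kDinf) kW))) j x.
    by apply/funext => j; rewrite /sadd /sopp smul_diagl.
  by apply: fin_summ => //; apply: finD => //; apply: finN.
rewrite (eq_csum (g := fun j => kUinf (k - j) (T j x) * ((dv j x)%:C * kW j x) -
   kUinf (k - j) (T j x) * (smul T kW V j x - kDinf (T j x) * kW j x))); last first.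
  by move=> j; rewrite /Y mulrBr.
rewrite csumB//.
have -> : csum (fun j => kUinf (k - j) (T j x) * ((dv j x)%:C * kW j x)) =
   (dv k x)%:C * smul T kUinf kW k x - smul T DU kW k x.
  rewrite -csumZ; last exact: fin_summ.
  rewrite -csumB; [|by apply: summZ; apply: fin_summ|exact: fin_summ].
  apply: eq_csum => j; rewrite -hDU; last exact: GT.
  have -> : dv k x = dv (k - j) (T j x) + dv j x by rewrite -dvD subrK.
  by rewrite rmorphD /=; ring.
have -> : csum (fun j => kUinf (k - j) (T j x) * (smul T kW V j x - kDinf (T j x) * kW j x)) =
  smul T kUinf (sadd (smul T kW V) (sopp (smul T (sdiag kDinf) kW))) k x.
  by apply: eq_csum => j; rewrite /sadd /sopp smul_diagl.
have UW1 : smul T kUinf kW = one.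
  by apply/funext => ?; apply/funext => ?; apply: kUW.
rewrite (smulDr _ _ fU fWV (finN fdW)) (smulNr _ _ fU fdW) -(smulA' _ _ fU fW fV).
rewrite (smulDl _ _ fUd (finN fVU) fW) (smulNl _ _ fVU fW) (smulA' _ _ fU fd fW) (smulA' _ _ fV fU fW).
rewrite UW1 smul1l smul1r.
have -> : (dv k x)%:C * one k x = 0.
  by rewrite /sdiag; case: eqP => [->|_]; rewrite ?mulr0// dv_0 mul0r.
by ring.
Qed.

Lemma csum_ge_term (I : choiceType) (g : I -> R) i : (forall i, 0 <= g i) ->
  summ (fun i => (g i)%:C) -> g i <= complex.Re (csum (fun i => (g i)%:C)).
Proof.
move=> g0 /csumP h; apply/ler_addgt0Pr => e e0'; have [s us hs] := h _ e0'.
have [s' [us' ss' is']] := uniq_cover s [:: i].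
have := hs s' us' ss'; rewrite -rmorph_sum => /(le_trans (cabs_Re _)).
rewrite raddfB /= => h1; have : g i <= \sum_(j <- s') g j.
  rewrite (@sum_subset _ _ g [:: i] s')// big_seq1 lerDl sumr_ge0//.
move: h1; rewrite ler_norml => /andP[]; lra.
Qed.

(** The column [psi] of [kUinf] is a summable eigenvector, with eigenvalue [kDinf x], of an operator
    that is Hermitian by [herm]; pairing the equation with [psi] itself gives a real quotient. *)
Lemma kDinf_real x : G x -> complex.Im (kDinf x) = 0.
Proof.
move=> Gx; pose psi k := kUinf k x.
have psib k : cabs (psi k) <= 2 * qz ^+ n1 k by have [h _] := kUinf_bnd; apply: h.
have psib2 k : cabs (psi k) <= 2.
  by apply: le_trans (psib k) _; rewrite ler_piMr// exprn_ile1// ltW.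
have g := @sumle_geometric R d _ (ltW qz0) qz1.
have sN : summ (fun k => conjc (psi k) * psi k).
  have c0 : 0 <= 2 * 2 :> R by [].
  apply: (summ_le (sumleZ c0 g)) => k; rewrite cabsM cabs_conj -mulrA; exact: ler_pM.
have [C hC] := dvG x; have C0 : 0 <= C by apply: le_trans (hC 0); rewrite mulr_ge0// exprn_ge0// ltW.
have sD : summ (fun k => conjc (psi k) * ((dv k x)%:C * psi k)).
  have c0 : 0 <= 2 * (2 * C) by rewrite !mulr_ge0.
  apply: (summ_le (sumleZ c0 g)) => k; rewrite !cabsM cabs_conj cabs_real mulrAC.
  apply: ler_pM => //; first by rewrite mulr_ge0.
  apply: (@le_trans _ _ (`|dv k x| * (2 * qw ^+ n1 k))).
    apply: ler_wpM2l => //; apply: le_trans (psib k) _; apply: ler_wpM2l => //.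
    by apply: lerXn2r; rewrite ?nnegrE ?(ltW qw0) ?(ltW qz0) ?(ltW qzw).
  by rewrite mulrCA ler_wpM2l.
pose F (lk : Z * Z) := conjc (psi lk.1) * (V (lk.1 - lk.2) (T lk.2 x) * psi lk.2).
have sF : summ F.
  have p (m : Z) : 0 <= qz ^+ n1 m by rewrite exprn_ge0// ltW.
  have gg := sumleM p p g g.
  have c0 : 0 <= 2 * (e0 * 2) by rewrite !mulr_ge0.
  apply: (summ_le (sumleZ c0 gg)) => -[l k] /=; rewrite !cabsM cabs_conj.
  have -> : 2 * (e0 * 2) * (qz ^+ n1 l * qz ^+ n1 k) = (2 * qz ^+ n1 l) * (e0 * (2 * qz ^+ n1 k)).
    by move: (qz ^+ n1 l) (qz ^+ n1 k) => *; ring.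
  apply: ler_pM => //; first by rewrite mulr_ge0.
  apply: ler_pM => //; apply: le_trans (hV0 _ _) _; rewrite ler_piMr// exprn_ile1// ?ltW//.
  by rewrite (lt_trans qaz).
have eqn : csum (fun k => conjc (psi k) * ((dv k x)%:C * psi k)) + csum F =
    kDinf x * csum (fun k => conjc (psi k) * psi k).
  rewrite -(csum_pair sF) -csumZ// -csumD//; last first.
    case: sF => M FM; exists M.
    by apply: (@sumle_csum _ _ _ (fun i j => F (i, j))); apply: sumle_le FM _ (lexx _) => -[].
  apply: eq_csum => l; rewrite /F /= csumZ; last exact: (@fin_summ V kUinf).
  rewrite -mulrDr; have := kUinf_equation l Gx; rewrite -/(psi l) => ->.
  by ring.
have reD : conjc (csum (fun k => conjc (psi k) * ((dv k x)%:C * psi k))) =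
    csum (fun k => conjc (psi k) * ((dv k x)%:C * psi k)).
  rewrite -csum_conj//; apply: eq_csum => k; rewrite !conjcM conjcK conjc_real; ring.
have reF : conjc (csum F) = csum F.
  rewrite -csum_conj// -(csum_reindex (h := fun x : Z * Z => (x.2, x.1)) (h' := fun x => (x.2, x.1))); last first.
  - case: sF => M FM; exists M; apply: sumle_le FM _ (lexx _) => i; by rewrite cabs_conj.
  - by move=> -[].
  - by move=> -[].
  apply: eq_csum => -[l k]; rewrite /F /= !conjcM conjcK herm -TD opprB subrK; ring.
have reN : conjc (csum (fun k => conjc (psi k) * psi k)) = csum (fun k => conjc (psi k) * psi k).
  rewrite -csum_conj//; apply: eq_csum => k; rewrite !conjcM conjcK; ring.
(* [psi 0] is within [1/2] of 1, so the eigenvector does not vanish. *)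
have N0 : csum (fun k => conjc (psi k) * psi k) != 0.
  have eN : (fun k => conjc (psi k) * psi k) = fun k => (cabs (psi k) ^+ 2)%:C.
    by apply/funext => k; rewrite mulrC mulJc.
  rewrite eN; have := @csum_ge_term Z (fun k => cabs (psi k) ^+ 2) 0 (fun _ => exprn_ge0 _ (cabs_ge0 _)).
  rewrite -eN => /(_ sN) h; apply/eqP => h0; move: h; rewrite h0 /=.
  apply/negP; rewrite -ltNge exprn_gt0//.
  have hA : cabs (kA 0 x) <= 2^-1.
    by case: kA_bnd => /(_ 0 x) h _; apply: le_trans h _; rewrite n1_0 expr0 mulr1.
  have : 1 <= cabs (psi 0) + cabs (kA 0 x).
    rewrite -[leLHS](cabs1 R) (_ : 1 = psi 0 - kA 0 x); first exact: cabsB.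
    by rewrite /psi /kUinf /sadd /sdiag eqxx; ring.
  by move: hA; lra.
have : conjc (kDinf x) = kDinf x.
  apply: (mulIf N0); by rewrite -[in LHS]reN -conjcM -eqn conjcD reD reF.
by case: (kDinf x) => a b [] /eqP; rewrite eq_sym -addr_eq0 -mulr2n mulrn_eq0 /= => /eqP.
Qed.

End KamLimit.

(** * Lebesgue measure on tuples *)

Section TupleMeasure.
Variable R : realType.
Notation tR d := (d.-tuple (measurableTypeR R)).
Local Open Scope ereal_scope.

Definition consT d (x : measurableTypeR R * tR d) : tR d.+1 := [tuple of x.1 :: x.2].

Lemma measurable_consT d : measurable_fun [set: measurableTypeR R * tR d] (@consT d).
Proof. exact: measurable_cons. Qed.

Definition unconsT d (w : tR d.+1) : measurableTypeR R * tR d := (thead w, [tuple of behead w]).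

Lemma measurable_unconsT d : measurable_fun [set: tR d.+1] (@unconsT d).
Proof.
apply/measurable_fun_pairP; split; last exact: measurable_behead.
exact: measurable_tnth.
Qed.

Lemma unconsTK d : cancel (@consT d) (@unconsT d).
Proof. by move=> [x w]; congr pair; apply: val_inj. Qed.

Lemma integral_indic_le d (T : measurableType d) (mu : {measure set T -> \bar R})
    (f : T -> \bar R) (D : set T) (c : R) : measurable D -> (0 <= c)%R ->
  (forall x, 0 <= f x) -> measurable_fun setT f ->
  (forall x, D x -> f x <= c%:E) -> (forall x, ~ D x -> f x = 0) ->
  \int[mu]_x f x <= c%:E * mu D.
Proof.
move=> mD c0 f0 mf fc fz.
have mi : measurable_fun setT (fun x => (\1_D x)%:E : \bar R).
  by apply/measurable_EFinP; exact: measurable_indic.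
have -> : c%:E * mu D = \int[mu]_x (c%:E * (\1_D x)%:E).
  by rewrite ge0_integralZl_EFin// integral_indic// setIT.
apply: ge0_le_integral => //.
  exact: measurable_funeM.
move=> x _; rewrite indicE; case: (pselect (D x)) => Dx.
  by rewrite mem_set// mule1 fc.
by rewrite memNset// mule0 fz.
Qed.

Definition line_diam d (i : 'I_d) (A : set (tR d)) (eta : R) :=
  forall w w', A w -> A w' -> (forall j, j != i -> tnth w j = tnth w' j) ->
    (`|tnth w i - tnth w' i| <= eta)%R.

Lemma measurable_cube d : measurable (@cube R d).
Proof.
have -> : @cube R d = \bigcap_(i in [set: 'I_d]) ((fun w : tR d => tnth w i) @^-1` [set` `[-1, 1]%R]).
  apply/seteqP; split=> w h i.
    by move=> _; rewrite /= in_itv /=; apply: h.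
  by have := h i I; rewrite /= in_itv.
apply: fin_bigcap_measurable => // i _; rewrite -[X in measurable X]setTI.
by apply: measurable_tnth.
Qed.

Lemma lebesgue_diam (A : set (measurableTypeR R)) (eta : R) : measurable A -> (0 <= eta)%R ->
  (forall x y, A x -> A y -> (`|x - y| <= eta)%R) -> @lebesgue_measure R A <= (2 * eta)%:E.
Proof.
move=> mA eta0 dA; case: (pselect (A !=set0)) => [[x Ax]|/set0P/negP/negPn/eqP ->]; last first.
  by rewrite measure0 lee_fin mulr_ge0.
have mI : measurable [set` `[x - eta, x + eta]%R] by exact: measurable_itv.
apply: (@le_trans _ _ (@lebesgue_measure R [set` `[x - eta, x + eta]%R])).
  apply: le_measure; rewrite ?inE// => y Ay /=.
  have := dA x y Ax Ay; rewrite in_itv/= ler_norml => /andP[h1 h2].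
  by apply/andP; split; lra.
rewrite lebesgue_measure_itv /= lte_fin; case: ifP => _; rewrite -?EFinB lee_fin; lra.
Qed.

Section Step.
Variables (d : nat) (m : {sigma_finite_measure set (tR d) -> \bar R}).
Notation lm := (@lebesgue_measure R).

Definition mcons : set (tR d.+1) -> \bar R := pushforward (lm \x m) (@consT d).

Let mpre A : measurable A -> measurable (@consT d @^-1` A).
Proof. by move=> mA; rewrite -[X in measurable X]setTI; apply: measurable_consT. Qed.

Let mcons0 : mcons set0 = 0.
Proof. by rewrite /mcons /pushforward preimage_set0 measure0. Qed.

Let mcons_ge0 A : 0 <= mcons A.
Proof. rewrite /mcons /pushforward; exact: measure_ge0. Qed.

Let mcons_sigma_additive : semi_sigma_additive mcons.
Proof.
move=> F mF tF mUF; rewrite /mcons /pushforward preimage_bigcup.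
apply: measure_semi_sigma_additive.
- by move=> n; apply: mpre.
- apply/trivIsetP => /= i j _ _ ij; rewrite -preimage_setI.
  by move/trivIsetP : tF => /(_ _ _ _ _ ij) ->//; rewrite preimage_set0.
- by rewrite -preimage_bigcup; apply: mpre.
Qed.

HB.instance Definition _ := isMeasure.Build _ _ _ mcons
  mcons0 mcons_ge0 mcons_sigma_additive.

Lemma sigma_finite_mcons : sigma_finite [set: tR d.+1] mcons.
Proof.
have /sigma_finiteP[F [TF ndF Foo]] := sigma_finiteT lm.
have /sigma_finiteP[G [TG ndG Goo]] := sigma_finiteT m.
exists (fun n => @unconsT d @^-1` (F n `*` G n)).
  rewrite -preimage_bigcup (_ : \bigcup_n (F n `*` G n) = setT) ?preimage_setT//.
  apply/seteqP; split=> // -[x y] _.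
  have [i _ Fx] : (\bigcup_i F i) x by rewrite -TF.
  have [j _ Gy] : (\bigcup_i G i) y by rewrite -TG.
  exists (maxn i j) => //; split.
    by move: Fx; apply/subsetPset/ndF; rewrite leq_maxl.
  by move: Gy; apply/subsetPset/ndG; rewrite leq_maxr.
move=> n; have [mF oF] := Foo n; have [mG oG] := Goo n; split.
  by rewrite -[X in measurable X]setTI; apply: measurable_unconsT => //; exact: measurableX.
have -> : mcons (@unconsT d @^-1` (F n `*` G n)) = (lm \x m) (F n `*` G n).
  rewrite /mcons /pushforward; congr (product_measure1 _ _ _).
  by rewrite -comp_preimage (_ : _ \o _ = id)//; apply/funext => x; exact: unconsTK.
by rewrite product_measure1E// lte_mul_pinfty// ge0_fin_numE.
Qed.

HB.instance Definition _ := Measure_isSigmaFinite.Build _ _ _ mcons sigma_finite_mcons.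
End Step.

(** By induction on [d] the iterated integral is the image of a product measure under [consT], which
    makes it a sigma-finite measure. The bound on sets that are thin along one axis is carried by
    the same induction: inductively on the sections if the axis is not the first, by integrating
    along the axis if it is. *)
Lemma lebesgue_tupleP d : exists m : {sigma_finite_measure set (tR d) -> \bar R},
  [/\ forall A, measurable A -> lebesgue_tuple A = m A,
      m (@cube R d) <= (2 ^+ d)%:E &
      forall i A eta, measurable A -> A `<=` @cube R d -> (0 <= eta)%R ->
        line_diam i A eta -> m A <= (2 * eta * 2 ^+ d.-1)%:E].
Proof.
elim: d => [|d [m [mE mC mS]]].
  exists [the {sigma_finite_measure set (tR 0) -> \bar R} of @dirac _ (tR 0) [tuple] R].
  split=> [A mA //||[]//].
  by rewrite /= diracE lee_fin expr0; case: (_ \in _).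
pose lm := @lebesgue_measure R.
exists [the {sigma_finite_measure set (tR d.+1) -> \bar R} of mcons m].
have mpre A : measurable A -> measurable (@consT d @^-1` A).
  by move=> mA; rewrite -[X in measurable X]setTI; apply: measurable_consT.
have mI : measurable ([set` `[-1, 1]%R] : set (measurableTypeR R)) by exact: measurable_itv.
have lI : lm [set` `[(-1)%R, 1%R]] = 2%:E.
  rewrite /lm lebesgue_measure_itv /= lte_fin ifT; last by lra.
  by rewrite -EFinB; congr EFin; ring.
have inI x : ([set` `[-1, 1]%R] : set R) x <-> (-1 <= x <= 1)%R by rewrite /= in_itv.
have cubeS x w : @cube R d.+1 (consT (x, w)) -> (-1 <= x <= 1)%R /\ @cube R d w.
  by move=> h; split=> [|i]; [have := h ord0|have := h (lift ord0 i)]; rewrite ?tnth0 ?tnthS.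
split=> [A mA||i A eta mA Ac eta0 hA].
- rewrite /= /mcons /pushforward /product_measure1; apply: eq_integral => x _.
  rewrite -[RHS]mE; last by apply: measurable_xsection; exact: mpre.
  by congr lebesgue_tuple; apply/seteqP; split=> w; rewrite /xsection /= inE.
- rewrite /= /mcons /pushforward /product_measure1.
  have -> : (2 ^+ d.+1)%:E = (2 ^+ d)%:E * lm [set` `[(-1)%R, 1%R]] :> \bar R.
    by rewrite lI -EFinM -exprSr.
  apply: integral_indic_le => //.
  + by apply: measurable_fun_xsection; apply: mpre; exact: measurable_cube.
  + move=> x _; apply: le_trans mC; apply: le_measure; rewrite ?inE.
    * by apply: measurable_xsection; apply: mpre; exact: measurable_cube.
    * exact: measurable_cube.
    * by move=> w; rewrite /xsection /= inE => /cubeS[].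
  + move=> x nx /=; rewrite (_ : xsection _ _ = set0) ?measure0//.
    by apply/seteqP; split=> // w; rewrite /xsection /= inE => /cubeS[/inI].
have mX := mpre _ mA; rewrite /= /mcons /pushforward.
case: (unliftP ord0 i) hA => [j|] -> hA; last first.
  (* The thin direction is the first coordinate, so it has to be integrated first: the order of the
     product is exchanged. *)
  have -> : (lm \x m) (@consT d @^-1` A) = (lm \x^ m) (@consT d @^-1` A).
    by apply: product_measure_unique => // B C mB mC'; exact: product_measure2E.
  rewrite /product_measure2.
  apply: (@le_trans _ _ ((2 * eta)%:E * m (@cube R d))); last first.
    rewrite [leRHS]EFinM; apply: lee_wpmul2l => //.
    by rewrite lee_fin mulr_ge0.
  apply: integral_indic_le => //.
  + exact: measurable_cube.
  + by rewrite mulr_ge0.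
  + exact: measurable_fun_ysection.
  + move=> y cy /=; apply: lebesgue_diam => //; first exact: measurable_ysection.
    move=> x x'; rewrite /ysection /= !inE => Ax Ax'.
    have := hA _ _ Ax Ax'; rewrite !tnth0; apply => k.
    by case: (unliftP ord0 k) => [k'|] -> //; rewrite ?eqxx// !tnthS.
  + move=> y ny /=; rewrite (_ : ysection _ _ = set0) ?measure0//.
    by apply/seteqP; split=> // x; rewrite /ysection /= inE => /Ac/cubeS[].
rewrite /product_measure1.
have d0 : (0 < d)%N by exact: leq_ltn_trans (ltn_ord j).
have -> : (2 * eta * 2 ^+ d)%:E = (2 * eta * 2 ^+ d.-1)%:E * lm [set` `[(-1)%R, 1%R]] :> \bar R.
  by rewrite lI -EFinM /= -{1}(prednK d0) exprSr mulrA.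
apply: integral_indic_le => //.
+ by rewrite !mulr_ge0// exprn_ge0.
+ exact: measurable_fun_xsection.
+ move=> x _ /=; apply: (mS j) => //.
  * exact: measurable_xsection.
  * by move=> w; rewrite /xsection /= inE => /Ac/cubeS[].
  * move=> w w'; rewrite /xsection /= !inE => Aw Aw' h.
    have := hA _ _ Aw Aw'; rewrite !tnthS; apply => k.
    case: (unliftP ord0 k) => [k'|] ->; last by rewrite !tnth0.
    by rewrite !tnthS => kj; apply: h; apply: contra kj => /eqP ->.
+ move=> x nx /=; rewrite (_ : xsection _ _ = set0) ?measure0//.
  by apply/seteqP; split=> // w; rewrite /xsection /= inE => /Ac/cubeS[/inI].
Qed.

(** The sublevel set is open: it is a countable union of boxes with rational centre and half-width
    [1/(k+1)], namely those on which the value at the centre and the Lipschitz bound already force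
    [f < c]. *)
Lemma lipschitz_measurable d (f : tR d -> R) (L c : R) : (0 <= L)%R ->
  (forall w w', (`|f w - f w'| <= L * \sum_i `|tnth w i - tnth w' i|)%R) ->
  measurable [set w | (f w < c)%R].
Proof.
move=> L0 hf.
pose g (z : d.-tuple rat) : tR d := [tuple (ratr (tnth z i) : R) | i < d].
pose box (z : d.-tuple rat) (k : nat) : set (tR d) :=
  \bigcap_(i in [set: 'I_d]) ((fun w : tR d => tnth w i) @^-1`
     [set` `]ratr (tnth z i) - k.+1%:R^-1, ratr (tnth z i) + k.+1%:R^-1[%R]).
have boxE z k w : box z k w <-> forall i, (`|tnth w i - ratr (tnth z i)| < k.+1%:R^-1)%R.
  split=> h i.
    by have := h i I; rewrite /= in_itv /= ltr_distl.
  by move=> _; rewrite /= in_itv /= -ltr_distl.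
have mbox z k : measurable (box z k).
  apply: fin_bigcap_measurable => // i _; rewrite -[X in measurable X]setTI.
  by apply: measurable_tnth => //; exact: measurable_itv.
pose F (n : nat) : set (tR d) := if @choice.unpickle (d.-tuple rat * nat)%type n is Some (z, k) then
   (if (f (g z) + L * (d%:R * k.+1%:R^-1) < c)%R then box z k else set0) else set0.
have -> : [set w | (f w < c)%R] = \bigcup_n F n.
  apply/seteqP; split=> w /=; last first.
    move=> [n _]; rewrite /F; case: choice.unpickle => [[z k]|//]; case: ifP => // hz /boxE hw.
    apply: le_lt_trans hz; rewrite -lerBlDl; apply: le_trans (ler_norm _) _.
    apply: le_trans (hf _ _) _; apply: ler_wpM2l => //.
    apply: (@le_trans _ _ (\sum_(i < d) (k.+1%:R^-1 : R))%R).
      by apply: ler_sum => i _; rewrite tnth_mktuple ltW.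
    by rewrite big_const_ord iter_addr addr0 mulr_natl.
  move=> fc; pose e := ((c - f w) / 2)%R; have e0 : (0 < e)%R by rewrite divr_gt0// subr_gt0.
  have [k hk] : exists k : nat, (L * (d%:R * k.+1%:R^-1) <= e / 2)%R.
    have a0 : (0 <= L * d%:R / (e / 2))%R by apply: divr_ge0; [apply: mulr_ge0|apply/ltW; rewrite divr_gt0].
    exists (Num.bound (L * d%:R / (e / 2))); rewrite mulrA ler_pdivrMr//.
    have e20 : (0 < e / 2)%R by rewrite divr_gt0.
    have := ltW (archi_boundP a0); rewrite ler_pdivrMr// [leRHS]mulrC => /le_trans; apply.
    by rewrite ler_pM2l// ler_nat.
  have [z hz] : exists z : d.-tuple rat, forall i, (`|tnth w i - ratr (tnth z i)| < k.+1%:R^-1)%R.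
    have hq i : exists q : rat, (`|tnth w i - ratr q| < k.+1%:R^-1)%R.
      have [|q] := @rat_in_itvoo R (tnth w i - k.+1%:R^-1) (tnth w i + k.+1%:R^-1).
        by rewrite ltrD2l gtrN// invr_gt0.
      by rewrite in_itv /= => h; exists q; rewrite distrC ltr_distl.
    exists [tuple sval (cid (hq i)) | i < d] => i; rewrite tnth_mktuple.
    by case: cid.
  exists (choice.pickle (z, k)) => //; rewrite /F choice.pickleK.
  rewrite ifT; first by apply/boxE.
  have : (f (g z) - f w <= L * (d%:R * k.+1%:R^-1))%R.
    apply: le_trans (ler_norm _) _; apply: le_trans (hf _ _) _; apply: ler_wpM2l => //.
    apply: (@le_trans _ _ (\sum_(i < d) (k.+1%:R^-1 : R))%R).
      by apply: ler_sum => i _; rewrite tnth_mktuple distrC ltW.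
    by rewrite big_const_ord iter_addr addr0 mulr_natl.
  move: hk e0; rewrite /e; move: (L * _)%R (f (g z)) (f w) => X Y Z; lra.
apply: bigcup_measurable => n _; rewrite /F; case: choice.unpickle => [[z k]|//].
by case: ifP.
Qed.

Lemma lipschitz_measurable_abs d (f : tR d -> R) (L c : R) : (0 <= L)%R ->
  (forall w w', (`|f w - f w'| <= L * \sum_i `|tnth w i - tnth w' i|)%R) ->
  measurable [set w | (`|f w| < c)%R].
Proof.
move=> L0 hf; have -> : [set w | (`|f w| < c)%R] = [set w | (f w < c)%R] `&` [set w | (- f w < c)%R].
  apply/seteqP; split=> w /=; first by rewrite ltr_norml => /andP[? ?]; split; lra.
  by move=> [? ?]; rewrite ltr_norml; apply/andP; split; lra.
apply: measurableI; apply: (lipschitz_measurable _ L0) => // w w'.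
by rewrite -opprD normrN.
Qed.
End TupleMeasure.

(** * Integer vectors of the plane up to their small scalar products *)

Section PlaneVectors.
Implicit Types (j u v w : 'rV[int]_2).

Definition dot2 j v : int := j 0 0 * v 0 0 + j 0 1 * v 0 1.
Definition det2 v w : int := v 0 0 * w 0 1 - v 0 1 * w 0 0.

Lemma n1_2 v : n1 v = (`|v 0%R 0%R| + `|v 0%R 1%R|)%N.
Proof. by rewrite /n1 big_ord_recl big_ord1; congr (_ + `|v _ _|)%N; apply/val_inj. Qed.

Lemma vec2P v w : v 0 0 = w 0 0 -> v 0 1 = w 0 1 -> v = w.
Proof.
move=> h0 h1; apply/rowP => i; case: (unliftP ord0 i) => [k|] ->.
  by rewrite (_ : lift _ _ = 1)//; apply/val_inj; rewrite /= ord1.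
by rewrite (_ : ord0 = 0)//; apply/val_inj.
Qed.

Lemma dot2_0 j : dot2 j 0 = 0.
Proof. by rewrite /dot2 !mxE !mulr0. Qed.

Lemma vec2_neq0 v : v != 0 -> v 0 0 != 0 \/ v 0 1 != 0.
Proof.
move=> v0; case: (eqVneq (v 0 0) 0) => [h0|]; last by left.
right; apply: contra v0 => /eqP h1; apply/eqP/vec2P; by rewrite mxE.
Qed.

(** Cramer's rule: the scalar products with two independent vectors determine [j]. *)
Lemma det2_dot j v w : det2 v w * j 0 0 = dot2 j v * w 0 1 - dot2 j w * v 0 1.
Proof. rewrite /det2 /dot2; ring. Qed.

Lemma det2_dot1 j v w : det2 v w * j 0 1 = dot2 j w * v 0 0 - dot2 j v * w 0 0.
Proof. rewrite /det2 /dot2; ring. Qed.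

Lemma det2_expand j u v w : det2 v w * dot2 j u = det2 u w * dot2 j v + det2 v u * dot2 j w.
Proof. rewrite /det2 /dot2; ring. Qed.

Lemma det2_par j v w : det2 v w = 0 ->
  v 0 0 * dot2 j w = w 0 0 * dot2 j v /\ v 0 1 * dot2 j w = w 0 1 * dot2 j v.
Proof.
rewrite /det2 /dot2 => /eqP; rewrite subr_eq0 => /eqP h; split.
  transitivity (j 0 0 * (v 0 0 * w 0 0) + j 0 1 * (v 0 0 * w 0 1)); first ring.
  rewrite h; ring.
transitivity (j 0 0 * (v 0 1 * w 0 0) + j 0 1 * (v 0 1 * w 0 1)); first ring.
rewrite -h; ring.
Qed.

Lemma absz_det2 v w : (`|det2 v w| <= n1 v * n1 w)%N.
Proof.
rewrite /det2 !n1_2; apply: (@leq_trans (absz (v 0 0 * w 0 1)%R + absz (v 0 1 * w 0 0)%R)%N).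
  by lia.
rewrite !abszM; move: `|v 0%R 0%R|%N `|v 0%R 1%R|%N `|w 0%R 0%R|%N `|w 0%R 1%R|%N => x y z t.
rewrite mulnDl !mulnDr; lia.
Qed.

(* Two vectors which agree in this sense have the same small divisors
   [2 j . v + |v|^2] for [|v| <= B], up to divisors larger than [b]. *)
Definition same_type B b j j' := forall v, (n1 v <= B)%N ->
  dot2 j v = dot2 j' v \/ ((b <= `|dot2 j v|)%N /\ (b <= `|dot2 j' v|)%N).

(** The empty window [[a, b)] separates the small scalar products, which determine the type, from
    the large ones, whose values are irrelevant. *)
Definition gap B a b j := forall v, (n1 v <= B)%N -> (`|dot2 j v| < a)%N \/ (b <= `|dot2 j v|)%N.

Definition box2 B : seq 'rV[int]_2 :=
  [seq (\row_(i < 2) (if i == 0 then x else y)) | x <- [seq n%:Z - B%:Z | n <- iota 0 (2 * B).+1],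
     y <- [seq n%:Z - B%:Z | n <- iota 0 (2 * B).+1]].

Definition segz a : seq int := [seq n%:Z - a%:Z | n <- iota 0 (2 * a).+1].

Lemma mem_segz a (x : int) : (`|x| <= a)%N -> x \in segz a.
Proof.
move=> h; apply/mapP; exists (absz (x + a%:Z)); last by lia.
by rewrite mem_iota; lia.
Qed.

Lemma mem_box2 B v : (n1 v <= B)%N -> v \in box2 B.
Proof.
rewrite n1_2 => h; apply/allpairsP; exists (v 0 0, v 0 1); split => /=.
- by apply: (mem_segz (a := B)); lia.
- by apply: (mem_segz (a := B)); lia.
- by apply: vec2P; rewrite mxE.
Qed.

Lemma size_box2 B : size (box2 B) = ((2 * B).+1 ^ 2)%N.
Proof. by rewrite size_allpairs !size_map size_iota. Qed.

Definition codes B a : seq (option ('rV[int]_2 * int)) :=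
  None :: [seq Some (v, c) | v <- box2 B, c <- segz a].

Arguments codes : simpl never.

Lemma size_codes B a : size (codes B a) = ((2 * B).+1 ^ 2 * (2 * a).+1).+1.
Proof. by rewrite /codes -[LHS]/((size [seq Some (v, c) | v <- box2 B, c <- segz a]).+1) size_allpairs size_box2 size_map size_iota. Qed.

Definition coded B a b (o : option ('rV[int]_2 * int) * option ('rV[int]_2 * int)) j :=
  gap B a b j /\ match o with
  | (Some (v, c), Some (w, e)) => [/\ det2 v w != 0, dot2 j v = c & dot2 j w = e]
  | (Some (v, c), None) => [/\ v != 0, dot2 j v = c &
      forall u, (n1 u <= B)%N -> (`|dot2 j u| < a)%N -> det2 v u = 0]
  | _ => forall u, (n1 u <= B)%N -> (`|dot2 j u| < a)%N -> u = 0
  end.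

Lemma coded_same B a b o j j' : coded B a b o j -> coded B a b o j' -> same_type B b j j'.
Proof.
case: o => -[[v c]|] [[w e]|] [gj hj] [gj' hj'] u uB.
- case: hj hj' => D e1 e2 [_ e1' e2']; left; congr (dot2 _ u).
  apply: vec2P; apply: (mulfI D).
    by rewrite !det2_dot e1 e2 e1' e2'.
  by rewrite !det2_dot1 e1 e2 e1' e2'.
- case: hj hj' => v0 e1 e2 [_ e1' e2'].
  have [D|D] := eqVneq (det2 v u) 0.
    left; have [h0 h1] := det2_par j D; have [h0' h1'] := det2_par j' D.
    case: (vec2_neq0 v0) => vn; apply: (mulfI vn).
      by rewrite h0 h0' e1 e1'.
    by rewrite h1 h1' e1 e1'.
  right; split.
    by case: (gj u uB) => // /(e2 _ uB) /eqP; rewrite (negbTE D).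
  by case: (gj' u uB) => // /(e2' _ uB) /eqP; rewrite (negbTE D).
- have [->|u0] := eqVneq u 0; first by left; rewrite !dot2_0.
  right; split.
    by case: (gj u uB) => // /(hj _ uB) /eqP; rewrite (negbTE u0).
  by case: (gj' u uB) => // /(hj' _ uB) /eqP; rewrite (negbTE u0).
- have [->|u0] := eqVneq u 0; first by left; rewrite !dot2_0.
  right; split.
    by case: (gj u uB) => // /(hj _ uB) /eqP; rewrite (negbTE u0).
  by case: (gj' u uB) => // /(hj' _ uB) /eqP; rewrite (negbTE u0).
Qed.

Lemma coded_ex B a b j : gap B a b j ->
  exists2 o, coded B a b o j & (o.1 \in codes B a) /\ (o.2 \in codes B a).
Proof.
have inC v : (n1 v <= B)%N -> (`|dot2 j v| < a)%N -> Some (v, dot2 j v) \in codes B a.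
  move=> h1 h2; rewrite inE; apply/orP; right; apply: (allpairs_f (fun v c => Some (v, c))).
    exact: mem_box2.
  by apply: mem_segz; exact: ltnW.
have inN : None \in codes B a by rewrite inE eqxx.
move=> g; case: (pselect (exists v, [/\ (n1 v <= B)%N, (`|dot2 j v| < a)%N & v != 0])); last first.
  move=> no; exists (None, None) => //; split=> // u uB ua.
  by apply/eqP/negPn/negP => u0; apply: no; exists u.
move=> [v [vB va v0]].
case: (pselect (exists w, [/\ (n1 w <= B)%N, (`|dot2 j w| < a)%N & det2 v w != 0])); last first.
  move=> no; exists (Some (v, dot2 j v), None); last by split => //; exact: inC.
  split=> //; split=> // u uB ua.
  by apply/eqP/negPn/negP => u0; apply: no; exists u.
move=> [w [wB wa D]]; exists (Some (v, dot2 j v), Some (w, dot2 j w)); last by split; exact: inC.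
by split.
Qed.

(** One vector is chosen for each code that occurs, with 0 as a default for the others; equal codes
    give equal types, so the number of codes bounds the number of types. *)
Lemma representatives B a b : exists A : seq 'rV[int]_2,
  (size A <= (((2 * B).+1 ^ 2 * (2 * a).+1).+1) ^ 2)%N /\
  forall j, gap B a b j -> exists2 j', j' \in A & same_type B b j j'.
Proof.
pose f o := if pselect (exists j, coded B a b o j) is left h then sval (cid h) else 0.
exists [seq f (x, y) | x <- codes B a, y <- codes B a]; split.
  by rewrite size_allpairs size_codes -mulnn.
move=> j /coded_ex[[x y] cj [xC yC]]; exists (f (x, y)).
  by apply: (allpairs_f (fun x y => f (x, y))).
apply: (coded_same cj); rewrite /f; case: pselect => [h|no]; last by case: no; exists j.
by case: cid.
Qed.

(** A window that is not a gap contains [|j . v|] for some small [v]. Three such vectors in the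
    plane are linearly dependent with coefficients at most [B ^ 2], so one of the products is
    bounded by smaller ones, against the separation of the windows. *)
Lemma two_gaps B (a b : nat -> nat) j (k0 k1 k2 : nat) : (0 < B)%N ->
  (forall k l, (k < l)%N -> (2 * B ^ 2 * b k <= a l)%N) -> (forall k, (0 < a k <= b k)%N) ->
  (k0 < k1)%N -> (k1 < k2)%N ->
  [\/ gap B (a k0) (b k0) j, gap B (a k1) (b k1) j | gap B (a k2) (b k2) j].
Proof.
move=> B0 hab hb k01 k12.
have ng k : ~ gap B (a k) (b k) j -> exists v, [/\ (n1 v <= B)%N, (a k <= `|dot2 j v|)%N & (`|dot2 j v| < b k)%N].
  move=> h; apply: contrapT => no; apply: h => v vB.
  have [h1|h1] := ltnP `|dot2 j v| (a k); first by left.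
  by right; rewrite leqNgt; apply/negP => h2; apply: no; exists v.
case: (pselect (gap B (a k0) (b k0) j)) => [|/ng[v0 [v0B v0a v0b]]]; first by constructor 1.
case: (pselect (gap B (a k1) (b k1) j)) => [|/ng[v1 [v1B v1a v1b]]]; first by constructor 2.
case: (pselect (gap B (a k2) (b k2) j)) => [|/ng[v2 [v2B v2a v2b]]]; first by constructor 3.
have BB : (B <= B ^ 2)%N by rewrite -mulnn leq_pmull.
have B1 : (0 < B ^ 2)%N by rewrite expn_gt0 B0.
exfalso; have [D|D] := eqVneq (det2 v0 v1) 0.
  have v00 : v0 != 0.
    apply/eqP => z; move: v0a; rewrite z dot2_0 leqn0 => /eqP a0.
    by have := hb k0; rewrite a0.
  have [h0 h1] := det2_par j D.
  have c : (`|dot2 j v1| <= B * `|dot2 j v0|)%N.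
    have red (x : int) (y : int) : x != 0 -> (`|y| <= B)%N -> x * dot2 j v1 = y * dot2 j v0 ->
        (`|dot2 j v1| <= B * `|dot2 j v0|)%N.
      move=> x0 yB xy; have : (`|x| * `|dot2 j v1| = `|y| * `|dot2 j v0|)%N by rewrite -!abszM xy.
      move=> h; apply: (@leq_trans (`|x| * `|dot2 j v1|)%N); first by rewrite leq_pmull// absz_gt0.
      by rewrite h leq_mul2r yB orbT.
    move: v1B; rewrite n1_2 => v1B.
    case: (vec2_neq0 v00) => vn; [apply: (red _ _ vn _ h0)|apply: (red _ _ vn _ h1)]; lia.
  have : (a k1 <= B ^ 2 * b k0)%N.
    apply: (leq_trans v1a); apply: (leq_trans c); apply: leq_mul => //; exact: ltnW.
  have := hab _ _ k01; rewrite -mulnA; have : (0 < B ^ 2 * b k0)%N.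
    by rewrite muln_gt0 B1; have /andP[? ?] := hb k0; lia.
  lia.
have e := det2_expand j v2 v0 v1.
have e1 : (`|det2 v0 v1| * `|dot2 j v2| <= `|det2 v2 v1| * `|dot2 j v0| + `|det2 v0 v2| * `|dot2 j v1|)%N.
  by rewrite -!abszM e; lia.
have d1 : (0 < `|det2 v0 v1|)%N by rewrite absz_gt0.
have m1 : (`|det2 v2 v1| <= B ^ 2)%N by apply: leq_trans (absz_det2 _ _) _; rewrite -mulnn leq_mul.
have m2 : (`|det2 v0 v2| <= B ^ 2)%N by apply: leq_trans (absz_det2 _ _) _; rewrite -mulnn leq_mul.
have b01 : (b k0 <= b k1)%N.
  have := hab _ _ k01; have /andP[_] := hb k1.
  have : (b k0 <= B ^ 2 * b k0)%N by rewrite leq_pmull.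
  rewrite -mulnA; lia.
have h2 := hab _ _ k12.
have e2 : (`|dot2 j v2| <= B ^ 2 * `|dot2 j v0| + B ^ 2 * `|dot2 j v1|)%N.
  apply: (@leq_trans (`|det2 v0 v1| * `|dot2 j v2|)%N); first by rewrite leq_pmull.
  by apply: leq_trans e1 _; rewrite leq_add// leq_mul.
have f1 : (B ^ 2 * `|dot2 j v0| < B ^ 2 * b k1)%N by rewrite ltn_pmul2l//; exact: leq_trans b01.
have f2 : (B ^ 2 * `|dot2 j v1| < B ^ 2 * b k1)%N by rewrite ltn_pmul2l.
move: h2; rewrite -mulnA; lia.
Qed.

End PlaneVectors.

(** * Small divisor estimates *)

Section Exponents.

(* The [k]-th gap is [M^(gap_lo k), M^(gap_hi k)). The at most
   [M^(75 + 6 gap_lo k)] resonances distinguishable at its lower end are excised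
   with precision [M^-(gap_hi k)]; [gap_lo] leaves room for [two_gaps]. *)
Definition gap_off d := (77 + 2 * d)%N.
Definition gap_lo d k := iter k (fun x => 6 * x + gap_off d + 5)%N 1%N.
Definition gap_hi d k := (6 * gap_lo d k + gap_off d)%N.

Lemma gap_loS d k : gap_lo d k.+1 = (gap_hi d k + 5)%N.
Proof. by []. Qed.

Lemma gap_lo_hi d k : (gap_lo d k <= gap_hi d k)%N.
Proof. rewrite /gap_hi; lia. Qed.

Lemma gap_hi_lo d k l : (k < l)%N -> (gap_hi d k + 5 <= gap_lo d l)%N.
Proof.
elim: l => // l ih; rewrite ltnS leq_eqVlt => /orP[/eqP ->|kl]; first by rewrite gap_loS.
by apply: leq_trans (ih kl) _; rewrite gap_loS; have := gap_lo_hi d l; lia.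
Qed.

Lemma gap_hi_bounded d : exists tau, forall k, (k < 7)%N -> (gap_hi d k <= tau)%N.
Proof.
exists (\max_(k < 7) gap_hi d k)%N => k k7; exact: (leq_bigmax (Ordinal k7)).
Qed.

(** By [two_gaps] each site spoils at most two of the seven windows, hence three sites spoil at most
    six. *)
Lemma common_gap d M j1 j2 j3 : (2 <= M)%N -> exists2 k, (k < 7)%N &
  [/\ gap (M ^ 2) (M ^ gap_lo d k) (M ^ gap_hi d k) j1,
      gap (M ^ 2) (M ^ gap_lo d k) (M ^ gap_hi d k) j2 &
      gap (M ^ 2) (M ^ gap_lo d k) (M ^ gap_hi d k) j3].
Proof.
move=> M2; have M0 : (0 < M)%N by apply: leq_trans M2.
pose G j k := gap (M ^ 2) (M ^ gap_lo d k) (M ^ gap_hi d k) j.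
pose F j : {set 'I_7} := finset (fun k : 'I_7 => ~~ `[< G j k >]).
have three j (x y z : nat) : (x < y)%N -> (y < z)%N -> [\/ G j x, G j y | G j z].
  apply: (@two_gaps (M ^ 2)%N (fun k => M ^ gap_lo d k)%N (fun k => M ^ gap_hi d k)%N).
  - by rewrite expn_gt0 M0.
  (* With [B = M ^ 2] the required separation is [2 * M ^ 4 <= M ^ 5], which explains the 5 in
     [gap_lo]. *)
  - move=> k l kl; apply: leq_trans (leq_pexp2l M0 (gap_hi_lo d kl)).
    by rewrite addnC expnD leq_mul2r -expnM (expnS M 4) leq_mul ?orbT.
  - by move=> k; rewrite expn_gt0 M0 /= leq_pexp2l// gap_lo_hi.
have card2 j : (#|F j| <= 2)%N.
  rewrite leqNgt; apply/negP => /card_gt2P[x [y [z [[]]]]].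
  rewrite !inE => /asboolP nx /asboolP ny /asboolP nz [xy yz zx].
  have t (u v w : 'I_7) : ~ G j u -> ~ G j v -> ~ G j w -> (u < v)%N -> (v < w)%N -> False.
    by move=> nu nv nw uv vw; case: (three j _ _ _ uv vw).
  move: xy yz zx; rewrite -!val_eqE /= !neq_ltn.
  by move=> /orP[a|a] /orP[b|b] /orP[c|c]; 
    [apply: (t x y z)|apply: (t x y z)|apply: (t z x y)|apply: (t x z y)|
     apply: (t y z x)|apply: (t y x z)|apply: (t z y x)|apply: (t z y x)] => //; lia.
have : (#|F j1 :|: F j2 :|: F j3| < #|'I_7|)%N.
  rewrite card_ord ltnS; apply: leq_trans (leq_card_setU _ _) _.
  apply: leq_trans (leq_add (leq_card_setU _ _) (leqnn _)) _.
  by rewrite (leq_add (leq_add (card2 _) (card2 _)) (card2 _)).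
rewrite ltnNge => /negP h; have [k hk] : exists k, k \notin F j1 :|: F j2 :|: F j3.
  apply: contrapT => no; apply: h; apply/subset_leq_card/fintype.subsetP => k _.
  by apply: contrapT => /negP hk; apply: no; exists k.
exists k => //; move: hk; rewrite !inE !negb_or !negbK => /andP[/andP[]].
by move=> /asboolP ? /asboolP ? /asboolP ?.
Qed.

End Exponents.

Section Measure.
Variables (R : realType) (d0 : measure_display) (T : measurableType d0).
Variable m : {measure set T -> \bar R}.

Lemma measure_union_seq (I : eqType) (s : seq I) (A : I -> set T) (c : R) :
  (forall x, measurable (A x)) -> (forall x, x \in s -> (m (A x) <= c%:E)%E) ->
  (m (\big[setU/set0]_(x <- s) A x) <= ((size s)%:R * c)%:E)%E.
Proof.
move=> mA; elim: s => [|x s ih] hA; first by rewrite big_nil measure0 mul0r.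
rewrite big_cons; apply: le_trans (measureU2 _ _ _) _ => //; first exact: bigsetU_measurable.
rewrite -natr1 [(_ + 1)%R]addrC mulrDl mul1r EFinD leeD//.
  by apply: hA; rewrite inE eqxx.
by apply: ih => y ys; apply: hA; rewrite inE ys orbT.
Qed.

Lemma measure_union_count (I : countType) (A : I -> set T) (c : I -> R) (C : R) :
  (forall x, measurable (A x)) -> (forall x, 0 <= c x) -> (forall x, (m (A x) <= (c x)%:E)%E) ->
  sumle c C -> (m (\bigcup_x A x) <= C%:E)%E.
Proof.
move=> mA c0 hA hC.
(* The test [pickle x == n] ensures that every index is counted once. *)
pose F n := if @choice.unpickle I n is Some x then
   (if choice.pickle x == n then A x else set0) else set0.
pose g n := if @choice.unpickle I n is Some x then
   (if choice.pickle x == n then c x else 0) else 0.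
have mF n : measurable (F n) by rewrite /F; case: choice.unpickle => [x|//]; case: ifP.
have -> : \bigcup_x A x = \bigcup_n F n.
  apply/seteqP; split=> w [x _]; last first.
    by rewrite /F; case: choice.unpickle => [y|//]; case: ifP => // _ Ay; exists y.
  by move=> Ax; exists (choice.pickle x) => //; rewrite /F choice.pickleK eqxx.
have Fg n : (m (F n) <= (g n)%:E)%E.
  by rewrite /F /g; case: choice.unpickle => [x|]; rewrite ?measure0//; case: ifP; rewrite ?measure0.
apply: le_trans (generalized_Boole_inequality _ mF (bigcup_measurable (fun n _ => mF n))) _.
apply: lime_le; first by apply: is_cvg_nneseries => n _ _; exact: measure_ge0.
apply: nearW => n.
apply: (@le_trans _ _ (\sum_(0 <= k < n) (g k)%:E)%E); first by apply: lee_sum.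
rewrite sumEFin lee_fin.
pose s := pmap (fun k => if @choice.unpickle I k is Some x then
   (if choice.pickle x == k then Some x else None) else None) (index_iota 0 n).
apply: le_trans (hC s _); last first.
  apply: (@pmap_uniq _ _ _ choice.pickle); last exact: iota_uniq.
  by move=> k /=; case: choice.unpickle => [x|]//=; case: ifP => //= /eqP.
rewrite /s; elim: (index_iota 0 n) => [|k t ih]; first by rewrite !big_nil.
rewrite big_cons /= /g; case: choice.unpickle => [x|] /=; last by rewrite add0r.
by case: ifP => //= _; rewrite ?big_cons ?lerD2l// add0r.
Qed.

End Measure.

(** * Excision of frequencies for one mode at one scale *)

Section Level.
Variables (R : realType) (d tau : nat).
Hypothesis gap_tau : forall k, (k < 7)%N -> (gap_hi d k <= tau)%N.
Notation tR := (d.-tuple (measurableTypeR R)).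
Notation J := 'rV[int]_2.
Variable m : {sigma_finite_measure set tR -> \bar R}.
Hypothesis slab : forall i A eta, measurable A -> A `<=` @cube R d -> 0 <= eta ->
  line_diam i A eta -> (m A <= (2 * eta * 2 ^+ d.-1)%:E)%E.
Variables (gam : R) (f : J -> tR -> R) (M : nat) (l : 'rV[int]_d).
Hypotheses (gam0 : 0 < gam) (gam1 : gam <= 1) (M2 : (2 <= M)%N) (Ml : ((n1 l).+1 <= M)%N).
Hypothesis l0 : l != 0.
Hypothesis fb : forall j w, `|f j w| <= 2^-1.
Hypothesis flip : forall j w w', `|f j w - f j w'| <= 6^-1 * \sum_i `|tnth w i - tnth w' i|.
Hypothesis ftype : forall k j j', (k < 7)%N -> same_type (M ^ 2) (M ^ gap_hi d k) j j' ->
  forall w, @cube R d w -> `|f j w - f j' w| <= gam * (3^-1 * (M%:R ^+ gap_hi d k)^-1).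

(** The integer [n] stands for the combination of the unperturbed frequencies. Left free, it is
    decoupled from the sites, which then enter only through the corrections [f]. *)
Definition divisor (j1 j2 j3 : J) (s1 s2 s3 n : int) (w : tR) : R :=
  idot l (tuple_row w) + n%:~R + s1%:~R * f j1 w + s2%:~R * f j2 w + s3%:~R * f j3 w.

Let M0 : (0 < M)%N. Proof. exact: leq_trans M2. Qed.
Let MR : 0 < M%:R :> R. Proof. by rewrite ltr0n. Qed.
Let MR1 : 1 <= M%:R :> R. Proof. by rewrite ler1n. Qed.

Lemma normz_le1 (s : int) : `|s| <= 1 -> `|s%:~R : R| <= 1.
Proof. by move=> h; rewrite -intr_norm -[1]/(1%:~R : R) ler_int. Qed.

Lemma idot_cube w : @cube R d w -> `|idot l (tuple_row w)| <= (n1 l)%:R.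
Proof.
move=> cw; apply: le_trans (ler_norm_sum _ _ _) _; rewrite /n1 natr_sum; apply: ler_sum => i _.
rewrite mxE normrM -[leRHS]mulr1; apply: ler_pM => //.
  by rewrite -intr_norm -abszE.
by have := cw i; rewrite ler_norml.
Qed.

Lemma idot_diff (w w' : tR) : idot l (tuple_row w) - idot l (tuple_row w') =
  \sum_i (l 0 i)%:~R * (tnth w i - tnth w' i).
Proof. by rewrite /idot -sumrB; apply: eq_bigr => i _; rewrite !mxE mulrBr. Qed.

Lemma divisor_perturb j1 j2 j3 j1' j2' j3' (s1 s2 s3 n : int) (w w' : tR) e :
  `|s1| <= 1 -> `|s2| <= 1 -> `|s3| <= 1 ->
  `|f j1 w - f j1' w'| <= e -> `|f j2 w - f j2' w'| <= e -> `|f j3 w - f j3' w'| <= e ->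
  `|divisor j1 j2 j3 s1 s2 s3 n w - divisor j1' j2' j3' s1 s2 s3 n w' -
    (idot l (tuple_row w) - idot l (tuple_row w'))| <= 3 * e.
Proof.
move=> h1 h2 h3 e1 e2 e3.
have -> : divisor j1 j2 j3 s1 s2 s3 n w - divisor j1' j2' j3' s1 s2 s3 n w' -
    (idot l (tuple_row w) - idot l (tuple_row w')) =
    s1%:~R * (f j1 w - f j1' w') + s2%:~R * (f j2 w - f j2' w') + s3%:~R * (f j3 w - f j3' w').
  rewrite /divisor; ring.
have k (s : int) x : `|s| <= 1 -> `|x| <= e -> `|s%:~R * x| <= e.
  move=> hs hx; rewrite normrM -[leRHS]mul1r; apply: ler_pM => //; exact: normz_le1.
apply: le_trans (ler_normD _ _) _; apply: le_trans (lerD (ler_normD _ _) (lexx _)) _.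
have := k _ _ h1 e1; have := k _ _ h2 e2; have := k _ _ h3 e3; lra.
Qed.

(** Along an axis with a nonzero component of [l], the linear part has slope at least 1 and the
    three corrections change it by at most [3 / 6 = 1/2]; a variation below [2 * eta] thus confines
    the coordinate to [4 * eta]. *)
Lemma divisor_line j1 j2 j3 (s1 s2 s3 n : int) i eta : l 0 i != 0 ->
  `|s1| <= 1 -> `|s2| <= 1 -> `|s3| <= 1 -> 
  line_diam i [set w | `|divisor j1 j2 j3 s1 s2 s3 n w| < eta] (4 * eta).
Proof.
move=> li h1 h2 h3 w w' /= hw hw' ww'.
have S : \sum_k `|tnth w k - tnth w' k| = `|tnth w i - tnth w' i|.
  by rewrite (bigD1 i)//= big1 ?addr0// => k ki; rewrite ww'// subrr normr0.
have fl j := flip j w w'; rewrite S in fl.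
have := divisor_perturb n h1 h2 h3 (fl j1) (fl j2) (fl j3).
rewrite idot_diff (bigD1 i)//= [\sum_(k < d | _) _]big1 ?addr0; last by move=> k ki; rewrite ww'// subrr mulr0.
set D := divisor _ _ _ _ _ _ _ w; set D' := divisor _ _ _ _ _ _ _ w'.
set x := tnth w i - tnth w' i; move=> h.
have k1 : `|x| <= `|(l 0 i)%:~R * x|.
  rewrite normrM -[leLHS]mul1r ler_wpM2r// -intr_norm -[1]/(1%:~R : R) ler_int.
  by rewrite -gtz0_ge1 normr_gt0.
have : `|(l 0 i)%:~R * x| <= `|D - D' - (l 0 i)%:~R * x| + `|D| + `|D'|.
  rewrite -[X in `|X|](subKr (D - D')) -[X in _ <= X]addrA addrC.
  by apply: le_trans (ler_normB _ _) _; rewrite lerD2r ler_normB.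
move: hw hw'; rewrite -/D -/D'; lra.
Qed.

Lemma divisor_measurable j1 j2 j3 (s1 s2 s3 n : int) eta :
  `|s1| <= 1 -> `|s2| <= 1 -> `|s3| <= 1 -> 
  measurable [set w : tR | `|divisor j1 j2 j3 s1 s2 s3 n w| < eta].
Proof.
move=> h1 h2 h3; apply: (@lipschitz_measurable_abs _ _ _ ((n1 l)%:R + 2^-1)).
  by rewrite addr_ge0.
move=> w w'; set S := \sum_i _.
have := divisor_perturb n h1 h2 h3 (flip j1 w w') (flip j2 w w') (flip j3 w w').
have : `|idot l (tuple_row w) - idot l (tuple_row w')| <= (n1 l)%:R * S.
  rewrite idot_diff /S mulr_sumr; apply: le_trans (ler_norm_sum _ _ _) _.
  apply: ler_sum => i _; rewrite normrM ler_wpM2r// -intr_norm -abszE ler_nat.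
  by rewrite /n1 (bigD1 i)//= leq_addr.
rewrite -/S; move: (idot _ _ - _) (divisor _ _ _ _ _ _ _ w) (divisor _ _ _ _ _ _ _ w').
move=> I D D' hI; have : `|D - D'| <= `|D - D' - I| + `|I|.
  by rewrite -{1}(subrK I (D - D')) ler_normD.
rewrite mulrDl; lra.
Qed.

Definition signs : seq int := [:: -1; 0; 1].

Lemma mem_signs (s : int) : (s \in signs) = (`|s| <= 1).
Proof. by apply/idP/idP; rewrite !inE; lia. Qed.

(** For each of the seven windows the slabs are cut for representatives of the sites only. Any three
    sites have a common gap, and are replaced by the representatives belonging to it. *)
Lemma level_set : exists Bd : set tR, [/\ measurable Bd,
  (m Bd <= (7 * (2 ^+ d.+4 * gam * (M%:R ^+ (2 * d).+2)^-1))%:E)%E &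
  forall w, @cube R d w -> ~ Bd w -> forall j1 j2 j3 (s1 s2 s3 n : int),
    `|s1| <= 1 -> `|s2| <= 1 -> `|s3| <= 1 ->
    gam * (M%:R ^+ tau)^-1 <= `|divisor j1 j2 j3 s1 s2 s3 n w|].
Proof.
have [i li] : exists i, l 0 i != 0.
  apply: contrapT => no; move/eqP: l0; apply; apply/rowP => i; rewrite mxE.
  by apply/eqP/negPn/negP => h; apply: no; exists i.
have [A hA] := choice (fun k => representatives (M ^ 2) (M ^ gap_lo d k) (M ^ gap_hi d k)).
pose Ix k := [seq (x, y) | x <- [seq (a, c) | a <- [seq (a, b) | a <- A k, b <- A k], c <- A k],
  y <- [seq (a, c) | a <- [seq (a, b) | a <- [seq (a, b) | a <- signs, b <- signs], b <- signs],
       c <- segz (n1 l + 2)]].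
pose E k (x : (J * J * J) * (int * int * int * int)) : set tR :=
  if [&& `|x.2.1.1.1| <= 1, `|x.2.1.1.2| <= 1 & `|x.2.1.2| <= 1] then
  @cube R d `&` [set w | `|divisor x.1.1.1 x.1.1.2 x.1.2 x.2.1.1.1 x.2.1.1.2 x.2.1.2 x.2.2 w|
       < 2 * gam * (M%:R ^+ gap_hi d k)^-1] else set0.
have hpos k : 0 <= 2 * gam * (M%:R ^+ gap_hi d k)^-1.
  by rewrite mulr_ge0 ?invr_ge0 ?exprn_ge0 ?mulr_ge0// ltW.
have mE k x : measurable (E k x).
  rewrite /E; case: ifP => // /and3P[h1 h2 h3]; apply: measurableI; first exact: measurable_cube.
  exact: divisor_measurable.
have bE k x : (m (E k x) <= (2 * (4 * (2 * gam * (M%:R ^+ gap_hi d k)^-1)) * 2 ^+ d.-1)%:E)%E.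
  have h4 : 0 <= 4 * (2 * gam * (M%:R ^+ gap_hi d k)^-1) by rewrite mulr_ge0.
  have := mE k x; rewrite /E; case: ifP => [/and3P[h1 h2 h3]|_] mm; last first.
    by rewrite measure0 lee_fin mulr_ge0 ?exprn_ge0// mulr_ge0.
  apply: (slab (i := i)) => // w w' [_ hw] [_ hw']; exact: (divisor_line li h1 h2 h3 hw hw').
(* Each site has at most [M ^ (22 + 2 * al)] representatives, which gives [66 + 6 * al] for three;
   the signs and the integers [n] account for the remaining exponent 9. *)
have sIx k : (size (Ix k) <= M ^ (75 + 6 * gap_lo d k))%N.
  rewrite !size_allpairs size_map size_iota /=.
  have MM : (M <= M ^ 2)%N by rewrite -mulnn leq_pmull.
  set al := gap_lo d k.
  have Ma : (1 <= M ^ al)%N by rewrite expn_gt0 M0.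
  have c1 : (((2 * M ^ 2).+1 ^ 2 * (2 * M ^ al).+1).+1 <= M ^ (11 + al))%N.
    have P2 : (((2 * M ^ 2).+1) <= M ^ 4)%N.
      rewrite (expnD M 2 2); have : (4 <= M ^ 2)%N by rewrite (@leq_exp2r 2 M 2). nia.
    have P3 : ((2 * M ^ al).+1 <= M ^ (2 + al))%N.
      rewrite expnD; have : (4 <= M ^ 2)%N by rewrite (@leq_exp2r 2 M 2). nia.
    apply: (@leq_trans (M ^ (10 + al)).+1%N).
      rewrite ltnS (_ : 10 + al = 4 * 2 + (2 + al))%N; last by lia.
      by rewrite expnD expnM leq_mul// leq_exp2r.
    rewrite -[(11 + al)%N]/((10 + al).+1) expnS.
    have : (1 <= M ^ (10 + al))%N by rewrite expn_gt0 M0.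
    nia.
  have sA : (size (A k) <= M ^ (22 + 2 * al))%N.
    have [h _] := hA k; apply: leq_trans h _.
    rewrite (_ : 22 + 2 * al = (11 + al) * 2)%N; last by lia.
    by rewrite expnM leq_exp2r.
  have sS : (3 * 3 * 3 * (2 * (n1 l + 2)).+1 <= M ^ 9)%N.
    have e5 : (27 <= M ^ 5)%N by apply: (@leq_trans (2 ^ 5)); rewrite // leq_exp2r.
    have e3 : (8 <= M ^ 3)%N by apply: (@leq_trans (2 ^ 3)); rewrite // leq_exp2r.
    rewrite (_ : 9 = 5 + (3 + 1))%N// !expnD expn1 -[X in (X * _ <= _)%N]/27%N.
    apply: leq_mul => //; apply: (@leq_trans (8 * M)%N); last by rewrite leq_mul2r e3 orbT.
    move: Ml; lia.
  rewrite (_ : 75 + 6 * al = (22 + 2 * al) + (22 + 2 * al) + (22 + 2 * al) + 9)%N; last by lia.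
  rewrite 3!expnD; apply: leq_mul => //; first by rewrite !leq_mul.
exists (\big[setU/set0]_(k <- iota 0 7) \big[setU/set0]_(x <- Ix k) E k x); split.
- by apply: bigsetU_measurable => k _; apply: bigsetU_measurable.
- rewrite -[7]/((size (iota 0 7))%:R); apply: measure_union_seq => [k|k _].
    by apply: bigsetU_measurable.
  apply: le_trans (measure_union_seq (mE k) (fun x _ => bE k x)) _.
  rewrite lee_fin; apply: (@le_trans _ _ ((M ^ (75 + 6 * gap_lo d k))%:R *
     (2 * (4 * (2 * gam * (M%:R ^+ gap_hi d k)^-1)) * 2 ^+ d.-1))).
    apply: ler_wpM2r; last by rewrite ler_nat.
    by apply: mulr_ge0; [do 2 (apply: mulr_ge0 => //)|exact: exprn_ge0].
  (* The precision beats the number of slabs by [M ^ (2 * d + 2)]: this is the choice of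
     [gap_off]. *)
  rewrite (_ : gap_hi d k = (75 + 6 * gap_lo d k) + (2 * d).+2)%N; last by rewrite /gap_hi /gap_off; lia.
  rewrite exprD invfM natrX.
  have -> : 2 ^+ d.+4 = 16 * (2 ^+ d) :> R by rewrite !exprS; ring.
  have : M%:R ^+ (75 + 6 * gap_lo d k) != 0 :> R by rewrite expf_neq0// gt_eqF.
  have : 0 <= (M%:R ^+ (2 * d).+2)^-1 :> R by rewrite invr_ge0 exprn_ge0.
  have : 2 ^+ d.-1 <= 2 ^+ d :> R by rewrite ler_eXn2l ?leq_pred// ltr1n.
  have : 0 <= 2 ^+ d.-1 :> R by rewrite exprn_ge0.
  move: (M%:R ^+ _) ((_ ^+ (2 * d).+2)^-1) (2 ^+ d) (2 ^+ d.-1) => y z u v v0 uv z0 y0.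
  rewrite (_ : _ * _ = 16 * v * gam * z); last by field.
  by rewrite ler_wpM2r// ler_wpM2r ?(ltW gam0)// ler_wpM2l.
move=> w cw nw j1 j2 j3 s1 s2 s3 n h1 h2 h3.
have small k : (k < 7)%N -> gam * (M%:R ^+ tau)^-1 <= gam * (M%:R ^+ gap_hi d k)^-1.
  move=> k7; rewrite ler_wpM2l ?(ltW gam0)// lef_pV2 ?posrE ?exprn_gt0// ler_weXn2l//.
  exact: gap_tau.
(* On the cube [|omega . l| <= n1 l] and the corrections total at most [3/2], so for
   [|n| >= n1 l + 3] the divisor exceeds 1 and nothing has to be excised. *)
have [nbig|nsmall] := leqP (n1 l + 3) `|n|%N.
  apply: (@le_trans _ _ 1).
    rewrite -[leRHS]mulr1; apply: ler_pM => //; rewrite ?(ltW gam0) ?invr_ge0 ?exprn_ge0//.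
    by rewrite invf_le1 ?exprn_gt0// exprn_ege1.
  have k (s : int) j : `|s| <= 1 -> `|s%:~R * f j w| <= 2^-1.
    move=> hs; rewrite normrM -[leRHS]mul1r; apply: ler_pM => //; exact: normz_le1.
  have n3 : (n1 l)%:R + 3 <= `|n%:~R : R|.
    by rewrite -intr_norm -abszE -(natrD _ _ 3) ler_nat.
  have := idot_cube cw; have := k _ j1 h1; have := k _ j2 h2; have := k _ j3 h3.
  rewrite /divisor; move: (idot _ _) (s1%:~R * _) (s2%:~R * _) (s3%:~R * _) => I a b c ha hb hc hI.
  have : `|n%:~R : R| <= `|I + n%:~R + a + b + c| + `|I| + `|a| + `|b| + `|c|.
    rewrite -{1}[n%:~R](_ : (I + n%:~R + a + b + c) - I - a - b - c = _); last by ring.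
    do 3 (apply: le_trans (ler_normB _ _) _; rewrite lerD2r); exact: ler_normB.
  lra.
have [k k7 [g1 g2 g3]] := common_gap d j1 j2 j3 M2.
have [_ hk] := hA k.
have [j1' A1 t1] := hk _ g1; have [j2' A2 t2] := hk _ g2; have [j3' A3 t3] := hk _ g3.
apply: le_trans (small k k7) _; rewrite leNgt; apply/negP => lt; apply: nw.
have kI : k \in iota 0 7 by rewrite mem_iota.
rewrite -bigcup_seq; exists k; first exact: kI.
rewrite -bigcup_seq; exists ((j1', j2', j3'), (s1, s2, s3, n)).
  apply: (allpairs_f (fun x y => (x, y))).
    by apply: (allpairs_f (fun x y => (x, y))) => //; apply: (allpairs_f (fun x y => (x, y))).
  apply: (allpairs_f (fun x y => (x, y))); last by apply: mem_segz; lia.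
  by do 2 (apply: (allpairs_f (fun x y => (x, y))); rewrite ?mem_signs//).
rewrite /E /= h1 h2 h3 /=; split=> //=.
(* The three replacements of sites cost [gam * M ^- gap_hi] together; the slabs were therefore cut
   at twice this height. *)
have := divisor_perturb n h1 h2 h3 (ftype k7 t1 cw) (ftype k7 t2 cw) (ftype k7 t3 cw).
rewrite subrr subr0 mulrCA (mulrA 3) divff ?mul1r//.
move: (divisor _ _ _ _ _ _ _ w) (divisor _ _ _ _ _ _ _ w) lt => D D' lt h.
have : `|D| <= `|D' - D| + `|D'| by rewrite distrC -{1}(subrK D' D) ler_normD.
rewrite -mulrA; lra.
Qed.
End Level.

Section Nonresonance.
Variables (R : realType) (d : nat).
Notation tR := (d.-tuple (measurableTypeR R)).
Notation J := 'rV[int]_2.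

Definition lev (M0 i n : nat) := (M0 * 2 ^ i * n.+1)%N.

Definition nonres_const : R := 7 * 2 ^+ d.+4 * (2 * 4 ^+ d).

Lemma nonres_const_ge0 : 0 <= nonres_const.
Proof.
rewrite /nonres_const; apply: mulr_ge0; apply: mulr_ge0 => //; exact: exprn_ge0.
Qed.

(** The measure lost at step [i] and mode [l] is of order [M ^- (2 * d + 2)] with
    [M = M0 * 2 ^ i * (n1 l + 1)]. It is at most [2 ^- i * (n1 l + 1) ^- (2 * d)], up to constants,
    hence summable over both; the factors [2] and [4 ^+ d] of [nonres_const] are these two sums. *)
Lemma nonresonant_set (tau : nat) (gam : R) (M0 : nat) (f : nat -> J -> tR -> R) :
  (forall k, (k < 7)%N -> (gap_hi d k <= tau)%N) ->
  0 < gam -> gam <= 1 -> (2 <= M0)%N ->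
  (forall i j w, `|f i j w| <= 2^-1) ->
  (forall i j w w', `|f i j w - f i j w'| <= 6^-1 * \sum_k `|tnth w k - tnth w' k|) ->
  (forall i M k j j', (M0 <= M)%N -> (k < 7)%N -> same_type (M ^ 2) (M ^ gap_hi d k) j j' ->
    forall w, @cube R d w -> `|f i j w - f i j' w| <= gam * (3^-1 * (M%:R ^+ gap_hi d k)^-1)) ->
  exists Bd : set tR, [/\ measurable Bd, (lebesgue_tuple Bd <= (nonres_const * gam)%:E)%E &
    forall w, @cube R d w -> ~ Bd w -> forall i l, l != 0 ->
    forall j1 j2 j3 (s1 s2 s3 n : int),
      `|s1| <= 1 -> `|s2| <= 1 -> `|s3| <= 1 ->
      gam * ((lev M0 i (n1 l))%:R ^+ tau)^-1 <= `|divisor (f i) l j1 j2 j3 s1 s2 s3 n w|].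
Proof.
move=> gtau g0 g1 M02 fb flip ftype.
have [m [mE _ slab]] := lebesgue_tupleP R d.
have levM i n : (M0 <= lev M0 i n)%N.
  by rewrite /lev -mulnA leq_pmulr// muln_gt0 expn_gt0.
pose c (x : nat * 'rV[int]_d) : R := 7 * (2 ^+ d.+4 * gam * ((lev M0 x.1 (n1 x.2))%:R ^+ (2 * d).+2)^-1).
have c0 x : 0 <= c x.
  by rewrite /c; repeat (apply: mulr_ge0 || apply: exprn_ge0 || rewrite invr_ge0) => //; exact: ltW.
pose Q (x : nat * 'rV[int]_d) (Bx : set tR) := [/\ measurable Bx,
    (m Bx <= (c x)%:E)%E & x.2 != 0 -> forall w, @cube R d w -> ~ Bx w ->
    forall j1 j2 j3 (s1 s2 s3 n : int), `|s1| <= 1 -> `|s2| <= 1 -> `|s3| <= 1 ->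
    gam * ((lev M0 x.1 (n1 x.2))%:R ^+ tau)^-1 <= `|divisor (f x.1) x.2 j1 j2 j3 s1 s2 s3 n w|].
have [Bd hB] : exists Bd : nat * 'rV[int]_d -> set tR, forall x, Q x (Bd x).
  suff /choice[Bd hB] : forall x, exists Bx, Q x Bx by exists Bd.
  move=> [i l]; have [->|l0] := eqVneq l 0.
    exists set0; split=> //=; last by rewrite eqxx.
    by rewrite measure0 lee_fin.
  have [||k j j'|B [mB bB hB]] := level_set gtau slab (f := f i) (M := lev M0 i (n1 l)) (l := l) g0 g1 _ _ l0 (fb i) (flip i).
  - exact: leq_trans M02 (levM _ _).
  - by rewrite /lev leq_pmull// muln_gt0 expn_gt0 andbT; apply: leq_trans M02.
  - by apply: ftype; exact: levM.
  by exists B.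
have mB : measurable (\bigcup_x Bd x).
  by apply: countable_bigcupT_measurable => [|x]; [exact: countableP|have [] := hB x].
exists (\bigcup_x Bd x); split=> //.
- rewrite mE//.
  apply: (measure_union_count (c := c)) => // [x|x|]; try by have [] := hB x.
  have h2 : (0 : R) <= 2^-1 by []. have h3 : (2^-1 : R) < 1 by lra.
  have p1 (i : nat) : 0 <= (2^-1 : R) ^+ i by apply: exprn_ge0.
  have p2 (l : 'rV[int]_d) : 0 <= ((n1 l).+1%:R^-1 : R) ^+ (2 * d) by rewrite exprn_ge0 ?invr_ge0.
  have c70 : 0 <= 7 * 2 ^+ d.+4 * gam by repeat (apply: mulr_ge0 || apply: exprn_ge0) => //; exact: ltW.
  have := sumleZ c70 (sumleM p1 p2 (sumle_geometric_nat h2 h3) (@sumle_inverse_power R d)).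
  rewrite (_ : 7 * 2 ^+ d.+4 * gam * ((1 - 2^-1)^-1 * 4 ^+ d) = nonres_const * gam); last first.
    rewrite (_ : 1 - 2^-1 = 2^-1 :> R) ?invrK; last by field.
    by rewrite /nonres_const; ring.
  move/sumle_le; apply=> // -[i l]; rewrite /c -[(i, l).1]/i -[(i, l).2]/l [leLHS]mulrA (mulrA 7); apply: ler_wpM2l => //.
  rewrite !exprVn -invfM; set n := n1 l.
  have lv : (2 ^ i * n.+1 <= lev M0 i n)%N by rewrite /lev -mulnA leq_pmull//; exact: leq_trans M02.
  have l1 : (0 < lev M0 i n)%N by apply: leq_trans lv; rewrite muln_gt0 expn_gt0.
  have x0 : 0 < (lev M0 i n)%:R ^+ (2 * d).+2 :> R by rewrite exprn_gt0// ltr0n.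
  have y0 : 0 < 2 ^+ i * n.+1%:R ^+ (2 * d) :> R by rewrite mulr_gt0// exprn_gt0// ltr0n.
  rewrite lef_pV2 ?posrE//.
  rewrite -!natrX -natrM ler_nat -[X in (_ <= X)%N]/(_ ^ _)%N !expnS mulnA leq_mul//; last first.
    case: (posnP (2 * d)) => [->//|d0]; rewrite leq_exp2r//.
    by apply: leq_trans lv; rewrite leq_pmull// expn_gt0.
  apply: (@leq_trans (lev M0 i n)); last by rewrite leq_pmulr.
  by apply: leq_trans lv; rewrite leq_pmulr.
move=> w cw nw i l l0 j1 j2 j3 s1 s2 s3 n h1 h2 h3.
have [_ _ h] := hB (i, l); apply: h => //= Bw; apply: nw; exists (i, l) => //.
Qed.
End Nonresonance.

(** * Reduction of the linear equation to constant coefficients *)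

Section Lattice.
Variables (R : realType) (d : nat) (K : 'M[int]_(d, 2)).
Notation Z := 'rV[int]_d.
Notation J := 'rV[int]_2.

Definition sq2 (j : J) : int := j 0 0 ^+ 2 + j 0 1 ^+ 2.

Lemma sq2D j v : sq2 (j + v) = sq2 j + (2 * dot2 j v + sq2 v).
Proof. by rewrite /sq2 /dot2 !mxE; ring. Qed.

Lemma dot2Dl (u v w : J) : dot2 (u + v) w = dot2 u w + dot2 v w.
Proof. by rewrite /dot2 !mxE; ring. Qed.

Lemma momentumD (l m : Z) : momentum K (l + m) = momentum K l + momentum K m.
Proof. exact: mulmxDl. Qed.

Lemma momentumN (l : Z) : momentum K (- l) = - momentum K l.
Proof. exact: mulNmx. Qed.

Lemma momentum0 : momentum K 0 = 0.
Proof. exact: mul0mx. Qed.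

Lemma idotD (l m : Z) (w : 'rV[R]_d) : idot (l + m) w = idot l w + idot m w.
Proof. by rewrite /idot -big_split; apply: eq_bigr => i _; rewrite !mxE rmorphD mulrDl. Qed.

Lemma idot0l (w : 'rV[R]_d) : idot 0 w = 0.
Proof. by rewrite /idot big1// => i _; rewrite mxE mul0r. Qed.

Lemma absz_dot2 (u v : J) : (`|dot2 u v| <= n1 u * n1 v)%N.
Proof.
rewrite /dot2 !n1_2; apply: (@leq_trans (absz (u 0 0 * v 0 0)%R + absz (u 0 1 * v 0 1)%R)%N).
  by lia.
rewrite !abszM; move: `|u 0%R 0%R|%N `|u 0%R 1%R|%N `|v 0%R 0%R|%N `|v 0%R 1%R|%N => x y z t.
rewrite mulnDl !mulnDr; lia.
Qed.

Lemma sq2_dot (v : J) : sq2 v = dot2 v v. Proof. by rewrite /sq2 /dot2 !expr2. Qed.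

Definition mom_bound := (\sum_i \sum_j `|K i j|)%N.

Lemma n1_momentum (l : Z) : (n1 (momentum K l) <= mom_bound * n1 l)%N.
Proof.
rewrite /n1 /momentum /mom_bound exchange_big big_distrl /=; apply: leq_sum => j _.
rewrite mxE; apply: (@leq_trans (\sum_i `|l 0%R i| * `|K i j|)%N).
  elim/big_rec2: _ => [|i x y _ h]; first by rewrite absz0.
  by rewrite -abszM; move: (l 0 i * K i j) h => z h; lia.
rewrite big_distrl /=; apply: leq_sum => i _; rewrite mulnC leq_mul2l.
by rewrite (bigD1 i)//= leq_addr orbT.
Qed.

Variable gam1 : R.
Hypothesis gam10 : 0 < gam1.
Notation X := (J * 'rV[R]_d)%type.

Definition shiftX (k : Z) (x : X) : X := (x.1 + momentum K k, x.2).
(** The divisor of the unperturbed problem in units of [gam1], as an additive cocycle over the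
    orbits of [shiftX] ([freqD]), which move the site and keep the frequency. *)
Definition freq (l : Z) (x : X) : R :=
  ((sq2 (x.1 + momentum K l) - sq2 x.1)%:~R - idot l x.2) / gam1.

Lemma shiftXD k m x : shiftX (k + m) x = shiftX k (shiftX m x).
Proof. by rewrite /shiftX momentumD /= -addrA [momentum K k + _]addrC. Qed.

Lemma shiftX0 x : shiftX 0 x = x.
Proof. by case: x => j w; rewrite /shiftX momentum0 addr0. Qed.

Lemma freqD l k x : freq (l + k) x = freq l (shiftX k x) + freq k x.
Proof.
rewrite /freq -mulrDl; congr (_ / _); rewrite /= idotD momentumD [momentum K l + _]addrC addrA.
rewrite !rmorphB; ring.
Qed.

Lemma freqE l m (j : J) w : freq l (shiftX m (j, w)) * gam1 =
  (2 * dot2 j (momentum K l))%:~R + ((2 * dot2 (momentum K m) (momentum K l) +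
    sq2 (momentum K l))%:~R - idot l w).
Proof.
rewrite /freq divfK ?gt_eqF//=.
have -> : sq2 (j + momentum K m + momentum K l) - sq2 (j + momentum K m) =
  2 * dot2 j (momentum K l) + (2 * dot2 (momentum K m) (momentum K l) + sq2 (momentum K l)).
  by rewrite (sq2D _ (momentum K l)) dot2Dl; ring.
by rewrite (intrD _ (2 * dot2 j _)) -addrA.
Qed.

Definition free_const : R := mom_bound%:R ^+ 2 + 1.

Lemma free_bound l m (w : 'rV[R]_d) : (forall i, `|w 0 i| <= 1) ->
  `|(2 * dot2 (momentum K m) (momentum K l) + sq2 (momentum K l))%:~R - idot l w|
    <= free_const * (n1 l + n1 m).+1%:R ^+ 2.
Proof.
move=> hw; have i1 : `|idot l w| <= (n1 l)%:R.
  apply: le_trans (ler_norm_sum _ _ _) _; rewrite /n1 natr_sum; apply: ler_sum => i _.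
  rewrite normrM -[leRHS]mulr1; apply: ler_pM => //; by rewrite -intr_norm -abszE.
apply: le_trans (ler_normB _ _) _; apply: le_trans (lerD (lexx _) i1) _.
rewrite -intr_norm -abszE.
have : (absz (2 * dot2 (momentum K m) (momentum K l) + sq2 (momentum K l))%R <=
   2 * (mom_bound * n1 m * (mom_bound * n1 l)) + (mom_bound * n1 l) * (mom_bound * n1 l))%N.
  have h1 := absz_dot2 (momentum K m) (momentum K l).
  have h2 := absz_dot2 (momentum K l) (momentum K l).
  have g1 := leq_trans h1 (leq_mul (n1_momentum m) (n1_momentum l)).
  have g2 := leq_trans h2 (leq_mul (n1_momentum l) (n1_momentum l)).
  rewrite sq2_dot; lia.
rewrite -(ler_nat R) => /(fun h => lerD h (lexx _))/le_trans; apply.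
rewrite -natrD.
have -> : free_const * (n1 l + n1 m).+1%:R ^+ 2 = ((mom_bound ^ 2 + 1) * (n1 l + n1 m).+1 ^ 2)%:R.
  by rewrite natrM natrD !natrX.
rewrite ler_nat.
move: (n1 l) (n1 m) mom_bound => a b c; rewrite -!mulnn.
rewrite addn1 mulSn; apply: (@leq_trans (c * c * ((a + b).+1 * (a + b).+1) + (a + b).+1 * (a + b).+1)%N); last by rewrite addnC.
apply: leq_add; last by rewrite mulSn -[leqLHS]addn0 leq_add// ltnW// ltnS leq_addr.
have -> : (2 * (c * b * (c * a)) + c * a * (c * a) = (c * c) * (2 * a * b + a * a))%N by ring.
by rewrite leq_mul2l; apply/orP; right; nia.
Qed.

Lemma freq_growth (qw : R) x : 0 < qw -> qw < 1 ->
  exists C, forall k, `|freq k x| * qw ^+ n1 k <= C.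
Proof.
move=> q0 q1; case: x => j w; pose S := \sum_i `|w 0 i|.
have S0 : 0 <= S by apply: sumr_ge0.
pose kp := (1 + qw) / 2; have kp0 : 0 < kp by rewrite /kp; lra.
have kp1 : kp < 1 by rewrite /kp; lra.
have kpq : qw <= kp ^+ 2.
  by rewrite -subr_ge0 (_ : _ - _ = ((1 - qw) / 2) ^+ 2) ?sqr_ge0// /kp; field.
pose c := (2 * n1 j * mom_bound + mom_bound * mom_bound)%:R + S : R.
have c0 : 0 <= c by rewrite addr_ge0.
exists (gam1^-1 * (c * ((1 - kp)^-1 ^+ 2))) => k.
have h : `|freq k (j, w)| <= gam1^-1 * (c * (n1 k).+1%:R ^+ 2).
  rewrite /freq normrM normfV (gtr0_norm gam10) mulrC ler_wpM2l ?invr_ge0 ?(ltW gam10)//=.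
  rewrite sq2D [sq2 _ + _]addrC addrK; apply: le_trans (ler_normB _ _) _.
  rewrite /c [leRHS]mulrDl; apply: lerD.
    rewrite -intr_norm -abszE -natrX -natrM ler_nat sq2_dot.
    have h1 := leq_trans (absz_dot2 j (momentum K k)) (leq_mul (leqnn _) (n1_momentum k)).
    have h2 := leq_trans (absz_dot2 (momentum K k) (momentum K k)) (leq_mul (n1_momentum k) (n1_momentum k)).
    apply: (@leq_trans (2 * (n1 j * (mom_bound * n1 k)) + mom_bound * n1 k * (mom_bound * n1 k))%N).
      by move: h1 h2; lia.
    move: (n1 k) (n1 j) mom_bound => a b m; rewrite mulnDl leq_add// -mulnn.
      by rewrite mulnA -!mulnA leq_mul2l /= leq_mul2l leq_mul2l; apply/orP; right; apply/orP; right; nia.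
    by rewrite mulnACA leq_mul2l leq_mul ?orbT.
  apply: le_trans (ler_norm_sum _ _ _) _; rewrite /S mulr_suml; apply: ler_sum => i _.
  rewrite normrM mulrC ler_wpM2l// -intr_norm -abszE -natrX ler_nat.
  apply: (@leq_trans (n1 k)); first by rewrite /n1 (bigD1 i)//= leq_addr.
  by rewrite -mulnn mulSn; apply: leq_trans (leqnSn _) (leq_addr _ _).
apply: le_trans (ler_wpM2r _ h) _; first by rewrite exprn_ge0// ltW.
rewrite -mulrA; apply: ler_wpM2l; first by rewrite invr_ge0 ltW.
rewrite -mulrA; apply: ler_wpM2l => //; apply: le_trans (poly_geometricX _ _ kp0 kp1 (ltW q0)) _.
rewrite ler_piMr ?exprn_ge0 ?invr_ge0 ?subr_ge0 ?(ltW kp1)// exprn_ile1//.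
  by rewrite divr_ge0 ?exprn_ge0// ltW.
by rewrite ler_pdivrMr ?exprn_gt0// mul1r.
Qed.

Variables (kap : R).
Hypotheses (kap0 : 0 < kap) (kap1 : kap < 1).
(** Powers of [sigk] dominate quadratic polynomials in [n1] ([square_sigk]); they absorb the part of
    the divisor that does not involve the site. *)
Definition sigk : R := kap ^- 2.
Definition sqc : R := (1 - kap)^-1 ^+ 2.

Lemma sigk_ge1 : 1 <= sigk.
Proof. by rewrite /sigk -exprVn exprn_ege1// invf_ge1// ltW. Qed.

Lemma square_sigk n : n.+1%:R ^+ 2 <= sqc * sigk ^+ n.
Proof.
have h := @poly_geometric R kap n (ltW kap0) kap1.
rewrite /sigk /sqc -exprVn -exprM mulnC exprM -exprMn lerXn2r ?nnegrE//.
  by rewrite mulr_ge0 ?exprn_ge0 ?invr_ge0 ?subr_ge0// ltW.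
by rewrite exprVn ler_pdivlMr ?exprn_gt0.
Qed.

(** For two frequencies at one site only [omega . l] changes, and the weights are simply bounded
    below by 1. *)
Lemma freq_lip_w l m (j : J) (w w' : 'rV[R]_d) x y :
  x = shiftX m (j, w) -> y = shiftX m (j, w') ->
  `|freq l x - freq l y| <= sqc * (\sum_i `|w 0 i - w' 0 i|) / gam1 * sigk ^+ (n1 l + n1 m) *
    (1 + `|freq l x|) * (1 + `|freq l y|).
Proof.
move=> xE yE; set S := \sum_i _.
have S0 : 0 <= S by apply: sumr_ge0.
have h : `|freq l x - freq l y| <= S / gam1 * (n1 l)%:R.
  rewrite -[X in `|X|](mulfK (lt0r_neq0 gam10)) normrM normfV (gtr0_norm gam10).
  rewrite mulrBl xE yE !freqE mulrAC ler_wpM2r ?invr_ge0 ?(ltW gam10)//.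
  set A := _%:~R; set B := _%:~R; have -> : A + (B - idot l w) - (A + (B - idot l w')) = idot l w' - idot l w by ring.
  rewrite /idot -sumrB; apply: le_trans (ler_norm_sum _ _ _) _; rewrite mulr_suml; apply: ler_sum => i _.
  rewrite -mulrBr normrM distrC mulrC ler_wpM2l// -intr_norm -abszE ler_nat.
  by rewrite /n1 (bigD1 i)//= leq_addr.
have h2 : (n1 l)%:R <= sqc * sigk ^+ (n1 l + n1 m).
  apply: (le_trans _ (square_sigk _)); rewrite -natrX ler_nat.
  by apply: (@leq_trans (n1 l + n1 m).+1); [rewrite ltnW// ltnS leq_addr|rewrite -mulnn leq_pmull].
have c0 : 0 <= S / gam1 by rewrite divr_ge0// ltW.
have c1 : 0 <= sqc * S / gam1 * sigk ^+ (n1 l + n1 m).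
  have -> : sqc * S / gam1 * sigk ^+ (n1 l + n1 m) = S / gam1 * (sqc * sigk ^+ (n1 l + n1 m)) by ring.
  by apply: mulr_ge0 => //; apply: le_trans h2.
have hx : 1 <= 1 + `|freq l x| by rewrite lerDl.
have hy : 1 <= 1 + `|freq l y| by rewrite lerDl.
apply: le_trans h _; apply: (@le_trans _ _ (sqc * S / gam1 * sigk ^+ (n1 l + n1 m))).
  by apply: le_trans (ler_wpM2l c0 h2) _; apply: ler_eq; ring.
by rewrite -[leRHS]mulrA ler_peMr// mulr_ege1.
Qed.

(** Beyond [N] the weights alone dominate the difference, at the price [sigk ^- N]. Up to [N] the
    momentum lies in the box: either the scalar products coincide and so do the divisors, or both
    are at least [b], and then large divisors make the weights large. *)
Lemma freq_lip_type l m (j j' : J) (w : 'rV[R]_d) N B b x y : (forall i, `|w 0 i| <= 1) ->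
  gam1 <= 1 -> (mom_bound * N <= B)%N -> (0 < b)%N -> same_type B b j j' ->
  x = shiftX m (j, w) -> y = shiftX m (j', w) ->
  `|freq l x - freq l y| <= (2 * (1 + free_const) * sqc / b%:R + sigk ^- N) * sigk ^+ (n1 l + n1 m) *
    (1 + `|freq l x|) * (1 + `|freq l y|).
Proof.
move=> hw g1 NB b0 tp xE yE.
have s1 := sigk_ge1; have s0 : 0 < sigk by apply: lt_le_trans s1.
have q0 : 0 <= sqc by rewrite exprn_ge0// invr_ge0 subr_ge0 ltW.
have f0 : 0 <= free_const by rewrite addr_ge0// exprn_ge0.
have bR : 0 < b%:R :> R by rewrite ltr0n.
have t0 : 0 <= 2 * (1 + free_const) * sqc / b%:R.
  by rewrite divr_ge0// mulr_ge0// mulr_ge0// addr_ge0.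
have N0 : 0 <= sigk ^- N by rewrite invr_ge0 exprn_ge0// ltW.
set s := n1 l + n1 m; have sX : 0 <= sigk ^+ s by rewrite exprn_ge0// ltW.
set u := `|freq l x|; set v := `|freq l y|.
have u0 : 0 <= u := normr_ge0 _. have v0 : 0 <= v := normr_ge0 _.
have uv : 0 <= (1 + u) * (1 + v) by rewrite mulr_ge0// addr_ge0.
have tri : `|freq l x - freq l y| <= u + v by apply: ler_normB.
have [lN|lN] := leqP (n1 l) N; last first.
  apply: le_trans tri _; apply: (@le_trans _ _ (1 * ((1 + u) * (1 + v)))).
    rewrite mul1r; have := mulr_ge0 u0 v0; lra.
  rewrite -[leRHS]mulrA; apply: ler_wpM2r => //; rewrite mulrDl -[leLHS]add0r; apply: lerD; first exact: mulr_ge0.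
  rewrite mulrC ler_pdivlMr ?exprn_gt0// mul1r ler_weXn2l// /s.
  by apply: leq_trans (ltnW lN) _; rewrite leq_addr.
have lB : (n1 (momentum K l) <= B)%N.
  by apply: leq_trans (n1_momentum l) _; apply: leq_trans NB; rewrite leq_mul2l lN orbT.
case: (tp _ lB) => [e|[bj bj']].
  have -> : freq l x = freq l y.
    by apply: (mulIf (lt0r_neq0 gam10)); rewrite xE yE !freqE e.
  by rewrite subrr normr0 mulr_ge0 ?addr_ge0// mulr_ge0 ?addr_ge0// mulr_ge0// addr_ge0.
(* A large scalar product forces a large divisor unless the free part is as large; in that case the
   quadratic factor in [s] exceeds [b] up to a constant. *)
have key (i : J) : (b <= `|dot2 i (momentum K l)|)%N ->
    1 <= (1 + `|freq l (shiftX m (i, w))|) * ((1 + free_const) * s.+1%:R ^+ 2 / b%:R).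
  move=> bi; set D := freq l _; have hf := free_bound l m hw; rewrite -/s in hf.
  have e := freqE l m i w; rewrite -/D in e; move: hf e; set F := (_ - _) => hf e.
  have bi' : 2 * b%:R <= `|D| + `|F|.
    have h : 2 * b%:R <= `|(2 * dot2 i (momentum K l))%:~R : R|.
      rewrite intrM normrM ger0_norm; last by rewrite ler0z.
      by rewrite ler_wpM2l// -intr_norm -abszE ler_nat.
    apply: le_trans h _; have -> : (2 * dot2 i (momentum K l))%:~R = D * gam1 - F :> R by rewrite e; ring.
    apply: le_trans (ler_normB _ _) _; rewrite lerD2r normrM (gtr0_norm gam10) ler_piMr//.
  have S1 : 1 <= s.+1%:R ^+ 2 :> R by rewrite exprn_ege1// ler1n.
  rewrite mulrA ler_pdivlMr// mul1r.
  move: (s.+1%:R ^+ 2 : R) hf S1 => S hf S1; move: (b%:R : R) bi' => br bi'.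
  have D0 : 0 <= `|D| by [].
  have p1 := mulr_ge0 f0 (ler0n R 0); have cS : free_const <= free_const * S by rewrite ler_peMr.
  have [h|h] := leP br (free_const * S).
    apply: le_trans h _; have : 0 <= (1 + `|D|) * S by rewrite mulr_ge0// ?addr_ge0//; lra.
    have : free_const * S <= (1 + `|D|) * (free_const * S) by rewrite ler_peMl ?lerDl// mulr_ge0//; lra.
    lra.
  have bD : br <= `|D| by lra.
  apply: (@le_trans _ _ ((1 + `|D|) * 1)); first by lra.
  by rewrite ler_wpM2l ?addr_ge0//; have := mulr_ge0 f0 (le_trans ler01 S1); lra.
have hx := key _ bj; have hy := key _ bj'; rewrite -xE -/u in hx; rewrite -yE -/v in hy.
apply: le_trans tri _; rewrite -[leRHS]mulrA.
set c := (1 + free_const) * s.+1%:R ^+ 2 / b%:R in hx hy.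
have c0 : 0 <= c by rewrite divr_ge0// mulr_ge0 ?exprn_ge0// addr_ge0.
apply: (@le_trans _ _ (2 * c * ((1 + u) * (1 + v)))).
  have := ler_wpM2l (addr_ge0 ler01 u0) hy; have := ler_wpM2l (addr_ge0 ler01 v0) hx.
  lra.
apply: ler_wpM2r => //; rewrite [leRHS]mulrDl -[leLHS]addr0; apply: lerD; last exact: mulr_ge0.
have -> : 2 * c = 2 * (1 + free_const) / b%:R * s.+1%:R ^+ 2 by rewrite /c; ring.
have -> : 2 * (1 + free_const) * sqc / b%:R * sigk ^+ s = 2 * (1 + free_const) / b%:R * (sqc * sigk ^+ s) by ring.
apply: ler_wpM2l (square_sigk _); by rewrite divr_ge0// mulr_ge0// addr_ge0.
Qed.
End Lattice.

(** * Gauge invariance along the iteration *)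

Section Support.
Variables (R : realType) (d : nat) (X : Type) (T : 'rV[int]_d -> X -> X).
Notation Z := 'rV[int]_d.
Notation sym := (Z -> X -> R[i]).
Implicit Types M N : sym.

(** The symbols supported on modes of zero sum form an algebra that the iteration does not leave;
    this later determines the sum of the total mode of a quadratic term. *)
Definition gauge_supp M := forall (l : Z) (x : X), \sum_i l 0 i <> 0 -> M l x = 0.

Lemma supp_smul M N : gauge_supp M -> gauge_supp N -> gauge_supp (smul T M N).
Proof.
move=> hM hN l x hl; rewrite /smul -(csum0 _ Z); apply: eq_csum => k.
have [k0|k0] := eqVneq (\sum_i k 0 i) 0; last by rewrite (hN k) ?mulr0//; apply/eqP.
have e : \sum_i l 0 i = \sum_i (l - k) 0 i + \sum_i k 0 i.
  rewrite -big_split /=; apply: eq_bigr => i _; rewrite !mxE; ring.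
by rewrite hM ?mul0r// => h; apply: hl; rewrite e h k0.
Qed.

Lemma supp_diag D : gauge_supp (sdiag D).
Proof.
move=> l x hl; rewrite /sdiag; case: eqP => // l0; case: hl.
by rewrite l0 big1// => i _; rewrite mxE.
Qed.

Lemma supp_add M N : gauge_supp M -> gauge_supp N -> gauge_supp (sadd M N).
Proof. by move=> hM hN l x hl; rewrite /sadd hM// hN// addr0. Qed.

Lemma supp_opp M : gauge_supp M -> gauge_supp (sopp M).
Proof. by move=> hM l x hl; rewrite /sopp hM// oppr0. Qed.

Lemma supp_neumann S B : gauge_supp S -> gauge_supp B -> gauge_supp (neumann T S B).
Proof.
move=> hS hB l x hl; rewrite /neumann -(csum0 _ nat); apply: eq_csum => n.
suff : gauge_supp (spow T S B n) by apply.
by elim: n => [|n ih] //=; apply: supp_opp; apply: supp_smul.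
Qed.

Variables (tau : nat) (dv : Z -> X -> R) (V : sym).
Hypothesis hV : gauge_supp V.

Lemma supp_kS n D (E : sym) : gauge_supp E -> gauge_supp (kS T tau dv n D E).
Proof. by move=> hE l x hl; rewrite /kS hE// mulr0 oppr0 if_same. Qed.

Lemma supp_kE n : gauge_supp (kam T tau dv V n).2.
Proof.
elim: n => [//|n ih]; rewrite kES; apply: supp_neumann; first exact: supp_kS.
apply: supp_add; first by apply: supp_smul => //; exact: supp_kS.
by apply: supp_opp; apply: supp_smul; [exact: supp_kS|exact: supp_diag].
Qed.

Lemma supp_kA : gauge_supp (kA T tau dv V).
Proof.
move=> l x hl; rewrite /kA -(csum0 _ nat); apply: eq_csum => n.
suff h m : gauge_supp (kU T tau dv V m).
  suff : gauge_supp (smul T (kU T tau dv V n) (kS T tau dv n (kam T tau dv V n).1 (kam T tau dv V n).2)) by apply.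
  by apply: supp_smul => //; apply: supp_kS; exact: supp_kE.
elim: m => [|m ih] /=; first exact: supp_diag.
by apply: supp_add => //; apply: supp_smul => //; apply: supp_kS; exact: supp_kE.
Qed.

Lemma supp_kUinf : gauge_supp (kUinf T tau dv V).
Proof. apply: supp_add supp_kA; exact: supp_diag. Qed.

Lemma supp_kW : gauge_supp (kW T tau dv V).
Proof. apply: supp_neumann supp_kA _; exact: supp_diag. Qed.
End Support.

Section Small.
Variable R : realType.

(** Collects the finitely many smallness conditions on the perturbation, all linear in it, into one
    threshold. *)
Lemma common_small (s : seq (R * R)) : (forall x, x \in s -> 0 < x.2) ->
  exists2 e : R, 0 < e & forall x, x \in s -> x.1 * e <= x.2.
Proof.
elim: s => [|[A B] s ih] hs; first by exists 1.
have [|e e0 he] := ih; first by move=> x xs; apply: hs; rewrite inE xs orbT.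
have B0 : 0 < B by have := hs (A, B); rewrite inE eqxx; apply.
have A1 : 0 < 1 + `|A| by rewrite ltr_pwDl.
exists (Num.min e (B / (1 + `|A|))); first by rewrite lt_min e0 divr_gt0.
move=> [a b]; rewrite inE => /orP[/eqP[-> ->] /=|xs].
  apply: (@le_trans _ _ ((1 + `|A|) * Num.min e (B / (1 + `|A|)))).
    apply: ler_wpM2r; first by rewrite le_min (ltW e0) divr_ge0// ltW.
    by apply: le_trans (ler_norm _) _; rewrite lerDr.
  rewrite mulrC -ler_pdivlMr// ge_min lexx orbT//.
have [a0|a0] := leP 0 a.
  by apply: le_trans (he _ xs) => /=; apply: ler_wpM2l => //; rewrite ge_min lexx.
apply: (@le_trans _ _ 0); last by apply: ltW; apply: (hs (a, b)); rewrite inE xs orbT.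
by rewrite nmulr_rle0// le_min (ltW e0) divr_ge0// ltW.
Qed.

Lemma pow_half (k : R) : 0 <= k -> k < 1 -> exists n : nat, k ^+ n <= 2^-1.
Proof.
move=> k0 k1; have k2 : 0 < 1 - k by rewrite subr_gt0.
have a0 : 0 <= 2 / (1 - k) by rewrite divr_ge0// ltW.
exists (Num.bound (2 / (1 - k))); set n := Num.bound _.
have hn : 2 / (1 - k) <= n.+1%:R.
  by apply: le_trans (ltW (archi_boundP a0)) _; rewrite ler_nat.
have := poly_geometric n k0 k1; have kn : 0 <= k ^+ n by apply: exprn_ge0.
have := ler_wpM2r kn hn; move: (k ^+ n) kn => y y0 h1 h2.
have := le_trans h1 h2; rewrite mulrAC -[leRHS]mul1r ler_pM2r ?invr_gt0// => h.
by rewrite -[2^-1]mul1r ler_pdivlMr// mulrC.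
Qed.
End Small.

(** * Choice of parameters and assembly of the linear reduction *)

Section Reduction.
Variables (R : realType) (d : nat) (K : 'M[int]_(d, 2)).
Notation Z := 'rV[int]_d.
Notation J := 'rV[int]_2.
Notation X := (J * 'rV[R]_d)%type.
Notation T := (@shiftX R d K).

Lemma linear_reduction (qa qw eps1 : R) : 0 < qa -> qa < qw -> qw < 1 -> 0 < eps1 ->
  exists (eps0 C : R) (tau : nat), [/\ 0 < eps0, 0 <= C &
  forall (gam : R) (V : Z -> R[i]), 0 < gam -> gam <= 1 ->
  (forall l, cabs (V l) <= gam * eps0 * qa ^+ n1 l) ->
  (forall l, conjc (V l) = V (- l)) ->
  (forall l : Z, \sum_i l 0 i <> 0 -> V l = 0) ->
  exists good : set (d.-tuple (measurableTypeR R)), [/\ measurable good, good `<=` @cube R d,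
    (lebesgue_tuple (@cube R d `\` good) <= (C * gam)%:E)%E &
  exists (gam1 : R) (lam : X -> R) (U W : Z -> X -> R[i]), [/\ 0 < gam1,
    gauge_supp U, gauge_supp W,
    (forall l x, cabs (U l x - (l == 0)%:R) <= eps1 * qw ^+ n1 l /\
                 cabs (W l x - (l == 0)%:R) <= eps1 * qw ^+ n1 l) &
  [/\ (forall l x, smul T U W l x = (l == 0)%:R),
    (forall l x, smul T W U l x = (l == 0)%:R),
    (forall x, `|lam x - (sq2 x.1)%:~R| <= 1) &
  forall om, good om -> 
    (forall l j, let x := (j, tuple_row om) in
      (idot l x.2 + (sq2 j)%:~R)%:C * W l x + smul T W (fun l _ => V l) l x =
      (lam (T l x))%:C * W l x) /\
    (forall l j1 j2 j3 (s1 s2 s3 : int), l != 0 -> `|s1| <= 1 -> `|s2| <= 1 -> `|s3| <= 1 ->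
      gam1 * ((n1 l).+1%:R ^+ tau)^-1 <=
      `|idot l (tuple_row om) + s1%:~R * lam (j1, tuple_row om) +
         s2%:~R * lam (j2, tuple_row om) + s3%:~R * lam (j3, tuple_row om)|)]]]].
Proof.
move=> qa0 qaw qw1 eps10.
pose qz := (qa + qw) / 2; have qaz : qa < qz by rewrite /qz; lra.
have qzw : qz < qw by rewrite /qz; lra.
have qz0 : 0 < qz by apply: lt_trans qaz.
have qw0 : 0 < qw by apply: lt_trans qzw.
have qz1 : qz < 1 by apply: lt_trans qw1.
(* Then [kap ^+ 2 >= qz], so that [sig = kap ^- 2] respects [sig * qz <= 1], the budget of the
   Lipschitz bounds. *)
pose kap := (1 + qz) / 2; have kap0 : 0 < kap by rewrite /kap; lra.
have kap1 : kap < 1 by rewrite /kap; lra.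
have kapz : qz <= kap ^+ 2.
  by rewrite -subr_ge0 (_ : _ - _ = ((1 - qz) / 2) ^+ 2) ?sqr_ge0//; rewrite /kap; field.
pose sig := sigk kap; have sig1 : 1 <= sig by apply: sigk_ge1.
have sig0 : 0 < sig by apply: lt_le_trans sig1.
have sqz : sig * qz <= 1.
  by rewrite /sig /sigk mulrC ler_pdivrMr ?exprn_gt0// mul1r.
(* This makes [sig ^- (c2 * tau * M)] at most [2 ^- (tau * M)], hence at most [M ^- tau]: modes
   beyond [c2 * tau * M] do not disturb the comparison of two sites. *)
have [c2 hc2] : exists n, (kap ^+ 2) ^+ n <= 2^-1.
  by apply: pow_half; rewrite ?exprn_ge0 ?(ltW kap0)// expr_lt1 ?(ltW kap0).
have [tau gtau] := gap_hi_bounded d.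
(* From this scale on, the modes up to [c2 * tau * M] have their momentum in the box of size [M ^ 2]
   on which types are compared. *)
pose M0 := (mom_bound K * (c2 * tau) + 2)%N.
pose cst := kcst d tau qa qz; pose sc := sqc kap.
(* In this order: the iteration, the inverse [kW], the injectivity of [kUinf], the slope [1/6] in
   the frequency, the share [1/3] in the comparison of sites, and the closeness of [U] and of [W] to
   the identity. *)
have [e0 e00 he0] := @common_small R [:: (cst, 2^-1 ^+ (4 * tau + d).+1);
   (2 * (cst * Zg d (qz / qw)), 2^-1); (cst * Zg d qz, 2^-1); (2 * sc, 6^-1);
   (2 * (2 * (1 + free_const R K) * sc + 1), 3^-1); (cst, eps1); (2 * (cst * 2 * Zg d (qz / qw)), eps1)] ltac:(
   by move=> x; rewrite !inE => /or4P[/eqP->|/eqP->|/eqP->|/or4P[/eqP->|/eqP->|/eqP->|/eqP->]] //=; rewrite exprn_gt0).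
have small : 248 * (2 / kwidth tau qa qz) ^+ (4 * tau + d) * e0 <= 2^-1 ^+ (4 * tau + d).+1.
  by apply: (he0 (_, _)); rewrite !inE eqxx.
have small2 : 2 * (cst * e0 * Zg d (qz / qw)) <= 2^-1.
  have := he0 (2 * (cst * Zg d (qz / qw)), 2^-1); rewrite !inE eqxx ?orbT => /(_ isT) /=; lra.
have small3 : cst * e0 * Zg d qz <= 2^-1.
  have := he0 (cst * Zg d qz, 2^-1); rewrite !inE eqxx ?orbT => /(_ isT) /=; lra.
have small4 : 2 * sc * e0 <= 6^-1.
  by have := he0 (2 * sc, 6^-1); rewrite !inE eqxx ?orbT => /(_ isT).
have small5 : 2 * (2 * (1 + free_const R K) * sc + 1) * e0 <= 3^-1.
  by have := he0 (2 * (2 * (1 + free_const R K) * sc + 1), 3^-1); rewrite !inE eqxx ?orbT => /(_ isT).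
have small6 : cst * e0 <= eps1.
  by have := he0 (cst, eps1); rewrite !inE eqxx ?orbT => /(_ isT).
have small7 : 2 * (cst * e0 * 2 * Zg d (qz / qw)) <= eps1.
  have := he0 (2 * (cst * 2 * Zg d (qz / qw)), eps1); rewrite !inE eqxx ?orbT => /(_ isT) /=; lra.
have M02 : (2 <= M0)%N by rewrite /M0 leq_addl.
have M00 : 0 < (M0%:R ^+ tau : R) by rewrite exprn_gt0// ltr0n; apply: leq_trans M02.
have M01 : 1 <= (M0%:R ^+ tau : R) by rewrite exprn_ege1// ler1n; apply: leq_trans M02.
exists (e0 * (M0%:R ^+ tau)^-1), (nonres_const R d + nonres_const R d), tau; split.
- by rewrite mulr_gt0// invr_gt0.
- by rewrite addr_ge0// nonres_const_ge0.
move=> gam V g0 g1 hV herm hsupp.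
(* The factor [M0] in the scales is absorbed here, so that [gam * lev ^- tau] becomes [gam1 * keta]
   ([lvE]). *)
pose gam1 := gam * (M0%:R ^+ tau)^-1.
have gam10 : 0 < gam1 by rewrite mulr_gt0// invr_gt0.
have gam1g : gam1 <= gam by rewrite /gam1 ler_piMr ?(ltW g0)// invf_le1.
have gam11 : gam1 <= 1 by apply: le_trans g1.
pose V1 : Z -> X -> R[i] := fun l _ => (gam1^-1)%:C * V l.
pose dv := @freq R d K gam1.
have dvD l k x : dv (l + k) x = dv l (T k x) + dv k x by apply: freqD.
have TD : forall k m x, T (k + m) x = T k (T m x) by move=> *; apply: shiftXD.
have T0 : forall x, T 0 x = x by apply: shiftX0.
have hV0 l x : cabs (V1 l x) <= e0 * qa ^+ n1 l.
  rewrite /V1 (cabsM _ (V l)) cabs_real gtr0_norm ?invr_gt0//.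
  rewrite ler_pdivrMl//; apply: le_trans (hV l) _.
  by apply: ler_eq; rewrite /gam1; ring.
have sqc0 : 0 <= sc by rewrite exprn_ge0// invr_ge0 subr_ge0 ltW.
pose kD n := (kam T tau dv V1 n).1.
pose kI := kDinf T tau dv V1.
have hVb x y rho : 0 <= rho -> sbd T x y rho sig e0 qa V1.
  move=> r0; split=> // l m; rewrite /V1 subrr cabs0.
  by rewrite !mulr_ge0 ?exprn_ge0 ?(ltW e00) ?(ltW sig0) ?(ltW qa0)// mulr_ge0// ltW.
have lip x y rho n : 0 <= rho -> (forall l m, `|dv l (T m x) - dv l (T m y)| <=
    rho * sig ^+ (n1 l + n1 m) * (1 + `|dv l (T m x)|) * (1 + `|dv l (T m y)|)) ->
    cabs (kD n x - kD n y) <= 2 * e0 * rho.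
  move=> r0 hd; have := kD_lip TD T0 r0 sig1 hd qa0 qaz sqz small (hVb x y rho r0) n.
  by rewrite !T0.
have limlip x y c : (forall n, cabs (kD n x - kD n y) <= c) -> cabs (kI x - kI y) <= c.
  move=> h; apply: (@le_half _ _ _ (4 * e0)) => n.
  have hx := kD_cvg TD T0 dv x qa0 qaz qzw qw1 small hV0 n x.
  have hy := kD_cvg TD T0 dv x qa0 qaz qzw qw1 small hV0 n y.
  have -> : kI x - kI y = (kD n x - kD n y) + ((kI x - kD n x) - (kI y - kD n y)) by ring.
  apply: le_trans (cabsD _ _) _; apply: lerD => //; apply: le_trans (cabsB _ _) _.
  move: hx hy; rewrite /kI /kD; lra.
have lipw n j w w' : cabs (kD n (j, w) - kD n (j, w')) <= 2 * e0 * (sc * (\sum_i `|w 0 i - w' 0 i|) / gam1).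
  apply: lip => [|l m].
    by rewrite divr_ge0 ?(ltW gam10)// mulr_ge0//; apply: sumr_ge0.
  exact: (freq_lip_w gam10 kap0 kap1).
have typ n M k j j' (w : 'rV[R]_d) : (M0 <= M)%N -> (k < 7)%N -> same_type (M ^ 2) (M ^ gap_hi d k) j j' ->
    (forall i, `|w 0 i| <= 1) ->
    cabs (kD n (j, w) - kD n (j', w)) <= (3 * M%:R ^+ gap_hi d k)^-1.
  move=> MM k7 tp hw; have Mp : (0 < M)%N by apply: leq_trans MM; apply: leq_trans M02.
  have b0 : (0 < M ^ gap_hi d k)%N by rewrite expn_gt0 Mp.
  have NB : (mom_bound K * (c2 * tau * M) <= M ^ 2)%N.
    rewrite mulnA -mulnn leq_mul2r; apply/orP; right; apply: leq_trans MM.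
    by rewrite /M0 leq_addr.
  set g := gap_hi d k in b0 tp *; have gE : (g <= tau)%N by apply: gtau.
  have MR : 0 < M%:R ^+ g :> R by rewrite exprn_gt0// ltr0n.
  have sN : sig ^- (c2 * tau * M) <= (M%:R ^+ g)^-1.
    rewrite /sig /sigk exprVn invrK -mulnA exprM; apply: (@le_trans _ _ ((2^-1) ^+ (tau * M))).
      by apply: lerXn2r; rewrite ?nnegrE// exprn_ge0// exprn_ge0// ltW.
    rewrite mulnC exprM exprVn; apply: (@le_trans _ _ (M%:R^-1 ^+ tau)).
      apply: lerXn2r; rewrite ?nnegrE ?invr_ge0 ?exprn_ge0//.
      by rewrite lef_pV2 ?posrE ?exprn_gt0// ?ltr0n// -natrX ler_nat ltnW// ltn_expl.
    by rewrite exprVn lef_pV2 ?posrE ?exprn_gt0 ?ltr0n// ler_weXn2l// ler1n.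
  have fc0 : 0 <= free_const R K by rewrite addr_ge0// exprn_ge0.
  have bR : (M ^ g)%:R = M%:R ^+ g :> R by rewrite natrX.
  apply: le_trans (lip _ _ (2 * (1 + free_const R K) * sc / (M ^ g)%:R + sig ^- (c2 * tau * M)) n _ _) _.
  - rewrite addr_ge0 ?divr_ge0 ?invr_ge0 ?exprn_ge0 ?(ltW sig0)//.
    by rewrite mulr_ge0// mulr_ge0// addr_ge0.
  - by move=> l m; apply: (freq_lip_type gam10 kap0 kap1 l hw gam11 NB b0 tp).
  rewrite bR; apply: (@le_trans _ _ (2 * e0 * ((2 * (1 + free_const R K) * sc + 1) * (M%:R ^+ g)^-1))).
    apply: ler_wpM2l; first by rewrite mulr_ge0// ltW.
    by rewrite [leRHS]mulrDl mul1r lerD2l.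
  rewrite invfM [leLHS]mulrA; apply: ler_wpM2r; first by rewrite invr_ge0 ltW.
  by apply: le_trans small5; apply: ler_eq; ring.
have bnd w (cw : @cube R d w) i : `|tuple_row w 0 i| <= 1 by rewrite mxE ler_norml; apply: cw.
(* To be used twice: for the iterates, where it makes all inverses exact, and for the constant
   sequence of the limit, which yields the three-site divisors of the conclusion. *)
have nr (F : nat -> X -> R[i]) : (forall n x, cabs (F n x) <= 2^-1) ->
    (forall n j (w w' : 'rV[R]_d), cabs (F n (j, w) - F n (j, w')) <= 2 * e0 * (sc * (\sum_i `|w 0 i - w' 0 i|) / gam1)) ->
    (forall n M k j j' (w : 'rV[R]_d), (M0 <= M)%N -> (k < 7)%N -> same_type (M ^ 2) (M ^ gap_hi d k) j j' ->
      (forall i, `|w 0 i| <= 1) -> cabs (F n (j, w) - F n (j', w)) <= (3 * M%:R ^+ gap_hi d k)^-1) ->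
    exists Bd : set (d.-tuple (measurableTypeR R)), [/\ measurable Bd,
      (lebesgue_tuple Bd <= (nonres_const R d * gam)%:E)%E &
    forall w, @cube R d w -> ~ Bd w -> forall i l, l != 0 ->
    forall j1 j2 j3 (s1 s2 s3 n : int),
      `|s1| <= 1 -> `|s2| <= 1 -> `|s3| <= 1 ->
      gam * ((lev M0 i (n1 l))%:R ^+ tau)^-1 <=
        `|divisor (fun j w => gam1 * complex.Re (F i (j, tuple_row w))) l j1 j2 j3 s1 s2 s3 n w|].
  move=> F1 F2 F3.
  have ReF x y n : `|gam1 * complex.Re (F n x) - gam1 * complex.Re (F n y)| <= gam1 * cabs (F n x - F n y).
    rewrite -mulrBr normrM (gtr0_norm gam10) ler_wpM2l ?(ltW gam10)//.
    have <- : complex.Re (F n x - F n y) = complex.Re (F n x) - complex.Re (F n y) by rewrite raddfB.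
    exact: cabs_Re.
  apply: (nonresonant_set gtau (f := fun i j w => gam1 * complex.Re (F i (j, tuple_row w)))) => //.
  - move=> i j w; rewrite normrM (gtr0_norm gam10) -[leRHS]mul1r; apply: ler_pM; rewrite ?(ltW gam10)//.
    by apply: le_trans (cabs_Re _) (F1 _ _).
  - move=> i j w w'; apply: le_trans (ReF _ _ _) _.
    apply: le_trans (ler_wpM2l (ltW gam10) (F2 _ _ _ _)) _.
    set S := \sum_i _; set S' := \sum_k _.
    have -> : S = S' by apply: eq_bigr => k _; rewrite !mxE.
    have -> : gam1 * (2 * e0 * (sc * S' / gam1)) = (2 * sc * e0) * S'.
      by field; rewrite gt_eqF.
    by apply: ler_wpM2r => //; apply: sumr_ge0.
  - move=> i M k j j' MM k7 tp w cw; apply: le_trans (ReF _ _ _) _.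
    rewrite -invfM; apply: ler_pM; rewrite ?(ltW gam10)//.
    exact: F3 (bnd w cw).
have kDs n x : cabs (kD n x) <= 2^-1.
  apply: (kD_small TD T0 (lexx 0) sig1 _ qa0 qaz sqz small (hVb x x 0 (lexx 0))) => l m.
  by rewrite subrr normr0 !mul0r.
have [Bd1 [mB1 bB1 hB1]] := nr kD kDs lipw typ.
have [Bd2 [mB2 bB2 hB2]] := nr (fun=> kI) (fun _ x => kDinf_small TD T0 dv x qa0 qaz qzw qw1 small hV0 x)
  (fun _ j w w' => limlip _ _ _ (fun n => lipw n j w w'))
  (fun _ M k j j' w h1 h2 h3 h4 => limlip _ _ _ (fun n => typ n M k j j' w h1 h2 h3 h4)).
pose good := @cube R d `\` (Bd1 `|` Bd2).
have mgood : measurable good by apply: measurableD; [exact: measurable_cube|exact: measurableU].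
exists good; split=> //; first by move=> w [].
  have [m [mE _ _]] := lebesgue_tupleP R d.
  have mD : measurable (@cube R d `\` good) by apply: measurableD => //; exact: measurable_cube.
  rewrite mE// mulrDl EFinD; apply: (@le_trans _ _ (m (Bd1 `|` Bd2))).
    apply: le_measure; rewrite ?inE//; first exact: measurableU.
    by move=> w [cw nw]; apply: contrapT => h; apply: nw.
  rewrite mE// in bB1; rewrite mE// in bB2.
  by apply: le_trans (measureU2 _ mB1 mB2) _; apply: leeD.
pose G (x : X) := exists2 w, good w & x.2 = tuple_row w.
have GT k x : G x -> G (T k x) by case=> w gw e; exists w.
have lvE n l : gam * ((lev M0 n (n1 l))%:R ^+ tau)^-1 = gam1 * keta R tau n l.
  rewrite /gam1 /keta -mulrA -invfM; congr (_ * _^-1).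
  by rewrite /lev !natrM natrX -mulrA exprMn.
have nonres n l x : l != 0 -> G x -> keta R tau n l <= cabs (kdiv T dv (kD n) l x).
  move=> l0; case: x => j om [w [cw nw] /= ->].
  have nw1 : ~ Bd1 w by move=> h; apply: nw; left.
  have := hB1 w cw nw1 n l l0 (j + momentum K l) j 0 (-1) 1 0 (- (sq2 (j + momentum K l) - sq2 j)) isT isT isT.
  rewrite lvE -ler_pdivlMl// => /le_trans; apply.
  apply: le_trans (cabs_Re _).
  have -> : complex.Re (kdiv T dv (kD n) l (j, tuple_row w)) =
     dv l (j, tuple_row w) + complex.Re (kD n (T l (j, tuple_row w))) - complex.Re (kD n (j, tuple_row w)).
    by rewrite /kdiv raddfB raddfD.
  rewrite -[X in X * _](gtr0_norm (_ : 0 < gam1^-1)) ?invr_gt0// -normrM -normrN /divisor.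
  apply: ler_eq; congr `|_|.
  rewrite /dv /freq /T /shiftX /= intrN; field.
  by rewrite gt_eqF.
have dvG x : exists C, forall k, `|dv k x| * qw ^+ n1 k <= C by apply: freq_growth.
have herm1 l x : conjc (V1 l x) = V1 (- l) (T l x).
  by rewrite /V1 conjcM herm conjc_real.
have supp1 : gauge_supp V1 by move=> l x hl; rewrite /V1 hsupp ?mulr0.
exists gam1, (fun x => (sq2 x.1)%:~R + gam1 * complex.Re (kI x)), (kUinf T tau dv V1), (kW T tau dv V1).
have oneE l (x : X) : sdiag (fun _ : X => 1 : R[i]) l x = (l == 0)%:R.
  by rewrite /sdiag; case: eqP.
split=> //.
- exact: supp_kUinf.
- exact: supp_kW.
- move=> l x; split.
    have [h _] := kA_bnd TD T0 dv x qa0 qaz qzw qw1 small hV0.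
    rewrite /kUinf /sadd oneE addrAC subrr add0r; apply: le_trans (h l x) _.
    apply: ler_pM => //; rewrite ?exprn_ge0 ?(ltW qz0)//.
      by rewrite mulr_ge0 ?(ltW e00)// (le_trans _ (kcst_ge1 d tau qa0 qaz)).
    by rewrite lerXn2r ?nnegrE ?(ltW qz0) ?(ltW qw0)// ltW.
  have [h _] := kW_close TD T0 dv x qa0 qaz qzw qw1 small hV0 small2.
  have := h l x; rewrite /sadd /sopp oneE => /le_trans; apply.
  by apply: ler_wpM2r => //; rewrite exprn_ge0// ltW.
split.
- by move=> l x; rewrite (kUW TD T0 dv x qa0 qaz qzw qw1 small hV0 small2) oneE.
- by move=> l x; rewrite (kWU TD T0 dv x qa0 qaz qzw qw1 small hV0 small2 small3) oneE.
- move=> x; rewrite addrAC subrr add0r normrM (gtr0_norm gam10) -[leRHS]mul1r.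
  apply: ler_pM; rewrite ?(ltW gam10)//; apply: le_trans (cabs_Re _) _.
  by apply: le_trans (kDinf_small TD T0 dv x qa0 qaz qzw qw1 small hV0 x) _; lra.
move=> om gom; split.
- move=> l j x; have Gx : G x by exists om.
  have hk := kW_equation TD T0 x qa0 qaz qzw qw1 small hV0 dvD GT nonres small2 small3 dvG l Gx.
  have kre y : G y -> kI y = (complex.Re (kI y))%:C.
    move=> Gy; have := kDinf_real TD T0 y qa0 qaz qzw qw1 small hV0 dvD GT nonres dvG herm1 Gy.
    by rewrite -/kI; case: (kI y) => a b /= ->.
  have -> : smul T (kW T tau dv V1) (fun l _ => V l) l x = gam1%:C * smul T (kW T tau dv V1) V1 l x.
    rewrite /smul -csumZ.
      apply: eq_csum => k; rewrite /V1 [RHS]mulrCA; congr (_ * _).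
      by rewrite mulrA -rmorphM /= divff ?gt_eqF// mul1r.
    have rw0 : 0 <= qa / qw by rewrite divr_ge0 ?(ltW qa0) ?(ltW qw0).
    have rw1 : qa / qw < 1 by rewrite ltr_pdivrMr// mul1r.
    have s1w : 1 * qw <= 1 by rewrite mul1r ltW.
    apply: (smul_summ (lexx 1) (ltW qw0) (ltW qa0) (ltW qw0) rw0 rw1 s1w
      (kW_bnd TD T0 dv x qa0 qaz qzw qw1 small hV0 small2) (kV_bnd T x qa0 hV0) _ l x).
    by right; split=> //; rewrite divfK// gt_eqF.
  rewrite -hk -/kI (kre (T l x)); last by apply: GT.
  rewrite mulrDr !mulrA -!rmorphM /= -!mulrDl; congr (_ * _).
  rewrite -!rmorphD /=; congr (_%:C).
  by rewrite /dv /freq /x /T /shiftX /= rmorphB /=; field; rewrite gt_eqF.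
move=> l j1 j2 j3 s1 s2 s3 l0 h1 h2 h3; case: gom => cw nw.
have nw2 : ~ Bd2 om by move=> h; apply: nw; right.
(* The sequence of eigenvalues is constant here, so step 0 is enough, with
   [keta 0 l = (n1 l + 1) ^- tau]; the integer gathers the unperturbed frequencies of the three
   sites. *)
have := hB2 om cw nw2 0%N l l0 j1 j2 j3 s1 s2 s3 (s1 * sq2 j1 + s2 * sq2 j2 + s3 * sq2 j3) h1 h2 h3.
rewrite lvE /keta expr0 mul1r => /le_trans; apply.
apply: ler_eq; congr `|_|.
rewrite /divisor -[(j1, _).1]/j1 -[(j2, _).1]/j2 -[(j3, _).1]/j3.
move: (sq2 j1) (sq2 j2) (sq2 j3) => q1 q2 q3; rewrite !intrD !intrM; ring.
Qed.
End Reduction.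

(** * Weighted sequence spaces *)

Section Weighted.
Variable R : realType.
Notation J := 'rV[int]_2.
Notation seqs := (J -> R[i]).
Variables (w : J -> R) (c : R).
Hypotheses (w1 : forall j, 1 <= w j) (c1 : 1 <= c).
Hypothesis wD : forall a b, w (a + b) <= c * (w a + w b).
Hypothesis wN : forall a, w (- a) = w a.
Implicit Types (u v : seqs) (g : J -> R).

Let w0 j : 0 <= w j. Proof. exact: le_trans (w1 j). Qed.
Let c0 : 0 <= c. Proof. exact: le_trans c1. Qed.

Definition test g := (forall j, 0 <= g j) /\ sumle (fun j => g j ^+ 2) 1.

(* The norm [|u|_{l^1} + |w u|_{l^2}] by duality: [u] has norm at most [M]. *)
Definition hle u M := forall g, test g -> sumle (fun j => (1 + w j * g j) * cabs (u j)) M.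

Lemma test0 : test (fun=> 0).
Proof.
split=> // s us; rewrite big1 ?ler01// => i _; by rewrite expr0n.
Qed.

Lemma test_ge0 g j : test g -> 0 <= 1 + w j * g j.
Proof. by case=> g0 _; rewrite addr_ge0// mulr_ge0. Qed.

Lemma hle_l1 u M : hle u M -> sumle (fun j => cabs (u j)) M.
Proof.
by move=> /(_ _ test0) h; apply: sumle_le h _ (lexx _) => j; rewrite mulr0 addr0 mul1r.
Qed.

Lemma hle_ge0 u M : hle u M -> 0 <= M.
Proof. by move/hle_l1/sumle_ge0. Qed.

Lemma hle_term u M j : hle u M -> cabs (u j) <= M.
Proof. by move/hle_l1/sumle_term. Qed.

Lemma hle_summ u M : hle u M -> summ u.
Proof. by move/hle_l1; exists M. Qed.

Lemma hle_solid u v M : (forall j, cabs (u j) <= cabs (v j)) -> hle v M -> hle u M.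
Proof.
move=> uv hv g tg; apply: sumle_le (hv g tg) _ (lexx _) => j.
by apply: ler_wpM2l => //; exact: test_ge0.
Qed.

Lemma hle_le u M M' : M <= M' -> hle u M -> hle u M'.
Proof. by move=> MM h g tg; apply: sumle_le (h g tg) _ MM. Qed.

Lemma hle_ext u v M : (forall j, u j = v j) -> hle v M -> hle u M.
Proof. by move=> e h g tg; apply: sumle_le (h g tg) _ (lexx _) => j; rewrite e. Qed.

Lemma hle0 M : 0 <= M -> hle (fun=> 0) M.
Proof. by move=> M0 g _ s _; rewrite big1// => j _; rewrite cabs0 mulr0. Qed.

Lemma hleD u v M N : hle u M -> hle v N -> hle (fun j => u j + v j) (M + N).
Proof.
move=> hu hv g tg; apply: sumle_le (sumleD (hu g tg) (hv g tg)) _ (lexx _) => j.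
by rewrite -mulrDr ler_wpM2l ?cabsD//; exact: test_ge0.
Qed.

Lemma hleZ (z : R[i]) u M : hle u M -> hle (fun j => z * u j) (cabs z * M).
Proof.
move=> hu g tg; apply: sumle_le (sumleZ (cabs_ge0 z) (hu g tg)) _ (lexx _) => j.
by rewrite cabsM mulrCA.
Qed.

Lemma hleN u M : hle u M -> hle (fun j => - u j) M.
Proof. by apply: hle_solid => j; rewrite cabsN. Qed.

Lemma hleB u v M N : hle u M -> hle v N -> hle (fun j => u j - v j) (M + N).
Proof. by move=> hu /hleN hv; apply: hleD. Qed.

Lemma hleBC u v M : hle (fun j => u j - v j) M -> hle (fun j => v j - u j) M.
Proof. by apply: hle_solid => j; rewrite cabsBC. Qed.

Lemma hle_limit u M : (forall s, uniq s -> forall e : R, 0 < e ->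
  exists2 v, hle v M & forall j, j \in s -> cabs (u j - v j) <= e) -> hle u M.
Proof.
move=> h g tg s us; set W := \sum_(j <- s) (1 + w j * g j).
have W0 : 0 <= W by apply: sumr_ge0 => j _; exact: test_ge0.
apply/ler_addgt0Pr => e e0; have d0 : 0 < e / (W + 1) by rewrite divr_gt0// ltr_wpDl.
have [v hv uv] := h s us _ d0.
apply: (@le_trans _ _ (\sum_(j <- s) ((1 + w j * g j) * cabs (v j) + (1 + w j * g j) * (e / (W + 1))))).
  rewrite big_seq [leRHS]big_seq; apply: ler_sum => j js; rewrite -mulrDr.
  apply: ler_wpM2l; first exact: test_ge0.
  rewrite -[u j](subrK (v j)) addrC; apply: le_trans (cabsD _ _) _; by rewrite lerD2l uv.
rewrite big_split /= -mulr_suml; apply: lerD; first exact: hv.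
by rewrite -/W mulrCA ler_piMr ?(ltW e0)// ler_pdivrMr ?mul1r ?lerDl// ltr_wpDl.
Qed.

(** Minkowski's inequality for series. For a fixed test function the norm is a weighted [l^1] sum,
    so only an exchange of sums is left. *)
Lemma hle_csum (I : choiceType) (F : I -> seqs) (a : I -> R) A :
  (forall i, hle (F i) (a i)) -> sumle a A -> hle (fun j => csum (fun i => F i j)) A.
Proof.
move=> hF ha g tg; have g0 j := test_ge0 j tg.
have h : sumle (fun x : I * J => cabs ((1 + w x.2 * g x.2)%:C * F x.1 x.2)) A.
  apply: (@sumle_pair _ _ _ _ a) => [x|i|]; [exact: cabs_ge0| |exact: ha].
  apply: sumle_le (hF i g tg) _ (lexx _) => j.
  by rewrite cabsM cabs_real ger0_norm.
have := sumle_csum (F := fun j i => (1 + w j * g j)%:C * F i j) (sumle_sw h).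
move/sumle_le; apply => // j; rewrite csumZ.
  by rewrite cabsM cabs_real ger0_norm.
exists A; apply: sumle_le ha _ (lexx _) => i; exact: (hle_term _ (hF i)).
Qed.

Lemma weight_shift a m : w (a + m) <= 2 * c * w m * w a.
Proof.
apply: le_trans (wD a m) _; rewrite [2 * c]mulrC -!mulrA; apply: ler_wpM2l => //.
have := mulr_ge0 (_ : 0 <= w a - 1) (_ : 0 <= w m - 1); rewrite !subr_ge0 => /(_ (w1 a) (w1 m)).
have := w1 a; have := w1 m; move: (w a) (w m) => x y; lra.
Qed.

Lemma test_shift g m : test g -> test (fun j => g (j + m)).
Proof.
move=> [g0 g1]; split=> //.
by have := sumle_inj (@addIr _ m) g1.
Qed.

Lemma hle_shift u M m : hle u M -> hle (fun k => u (k - m)) (2 * c * w m * M).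
Proof.
move=> hu g tg; have C1 : 1 <= 2 * c * w m.
  by rewrite -[1]mulr1; apply: ler_pM => //; have := c1; lra.
have C0 : 0 <= 2 * c * w m by apply: le_trans C1.
have := sumleZ C0 (hu _ (test_shift m tg)).
move=> /(sumle_inj (@addIr _ (- m)))/sumle_le; apply => // k /=; rewrite subrK mulrA.
apply: ler_wpM2r; first exact: cabs_ge0.
rewrite mulrDr mulr1 lerD// mulrA; apply: ler_wpM2r; first by case: tg.
by have := weight_shift (k - m) m; rewrite subrK.
Qed.

Lemma hle_conj u M : hle u M -> hle (fun k => conjc (u (- k))) M.
Proof.
move=> hu g [g0 g1].
have tg : test (fun j => g (- j)) by split=> //; exact: (sumle_inj (@oppr_inj _) g1).
have := sumle_inj (@oppr_inj _) (hu _ tg).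
by move/sumle_le; apply => // j /=; rewrite wN opprK cabs_conj.
Qed.

Definition cconv u v : seqs := fun k => csum (fun j => u (k - j) * v j).

Definition Cc := 1 + 2 * c.

Lemma Cc_ge1 : 1 <= Cc. Proof. by rewrite /Cc; have := c0; lra. Qed.
Let Cc0 : 0 <= Cc. Proof. exact: le_trans Cc_ge1. Qed.

(** The weight at [k] is split between [k - j] and [j], and the test function is translated onto the
    factor that receives it. The [l^1] part counts 1 and each position of the weight counts [c],
    whence [Cc = 1 + 2 c]. *)
Lemma cconv_sumle u v A B g : hle u A -> hle v B -> test g ->
  sumle (fun x : J * J => (1 + w x.1 * g x.1) * (cabs (u (x.1 - x.2)) * cabs (v x.2))) (Cc * (A * B)).
Proof.
move=> hu hv tg; have [g0 g1] := tg.
have A0 := hle_ge0 hu; have B0 := hle_ge0 hv.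
have hs (x y : seqs) X Y : hle x X -> hle y Y ->
    sumle (fun p : J * J => g p.2 * w (p.2 - p.1) * cabs (x (p.2 - p.1)) * cabs (y p.1)) (X * Y).
  move=> hx hy; have X0 := hle_ge0 hx.
  apply: (@sumle_pair _ _ _ _ (fun j => X * cabs (y j))).
  - by move=> p; rewrite !mulr_ge0 ?cabs_ge0.
  - move=> j /=; have := hx _ (test_shift j tg) => /(sumle_inj (@addIr _ (- j))).
    move=> /(sumleZ (cabs_ge0 (y j))); rewrite mulrC => /sumle_le; apply => // k /=.
    rewrite subrK mulrC; apply: ler_wpM2l; first exact: cabs_ge0.
    apply: ler_wpM2r; first exact: cabs_ge0.
    by rewrite mulrC lerDr.
  - exact: sumleZ X0 (hle_l1 hy).
have h1 : sumle (fun x : J * J => cabs (u (x.1 - x.2)) * cabs (v x.2)) (A * B).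
  apply: (sumle_sw (F := fun x : J * J => cabs (u (x.2 - x.1)) * cabs (v x.1))).
  apply: (@sumle_pair _ _ _ _ (fun j => A * cabs (v j))).
  - by move=> x; rewrite mulr_ge0 ?cabs_ge0.
  - move=> j /=; have := sumle_inj (@addIr _ (- j)) (hle_l1 hu).
    by move=> /(sumleZ (cabs_ge0 (v j))); rewrite mulrC => /sumle_le; apply => // k /=; rewrite mulrC.
  - exact: sumleZ A0 (hle_l1 hv).
have h2 : sumle (fun x : J * J => g x.1 * w (x.1 - x.2) * cabs (u (x.1 - x.2)) * cabs (v x.2)) (A * B).
  exact: (sumle_sw (hs _ _ _ _ hu hv)).
have h3 : sumle (fun x : J * J => g x.1 * w x.2 * cabs (v x.2) * cabs (u (x.1 - x.2))) (B * A).
  pose h (x : J * J) := (x.1, x.1 - x.2).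
  have hi : injective h by move=> [a b] [a' b'] [<-] /subrI ->.
  have := sumle_inj hi (sumle_sw (hs _ _ _ _ hv hu)).
  by move/sumle_le; apply => // -[a b] /=; rewrite subKr.
have := sumleD h1 (sumleZ c0 (sumleD h2 h3)).
rewrite (mulrC B A) (_ : A * B + c * (A * B + A * B) = Cc * (A * B)); last by rewrite /Cc; ring.
move/sumle_le; apply => // -[k j] /=.
have hw : w k <= c * (w (k - j) + w j) by have := wD (k - j) j; rewrite subrK.
set a := cabs _; set b := cabs _; have ab : 0 <= a * b by rewrite mulr_ge0 ?cabs_ge0.
have := ler_wpM2r ab (ler_wpM2l (g0 k) hw).
move: (g k) (w k) (w _) (w _) => x y z t; lra.
Qed.

Lemma hle_cconv u v A B : hle u A -> hle v B -> hle (cconv u v) (Cc * (A * B)).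
Proof.
move=> hu hv g tg; have g0 j := test_ge0 j tg.
have h := cconv_sumle hu hv tg.
have h' : sumle (fun x : J * J => cabs ((1 + w x.1 * g x.1)%:C * (u (x.1 - x.2) * v x.2))) (Cc * (A * B)).
  apply: sumle_le h _ (lexx _) => x.
  by rewrite cabsM cabs_real ger0_norm// cabsM.
have := sumle_csum (F := fun k j => (1 + w k * g k)%:C * (u (k - j) * v j)) h'.
move/sumle_le; apply => // k; rewrite csumZ.
  by rewrite cabsM cabs_real ger0_norm.
apply: (summ_le (g := fun j => A * cabs (v j)) (M := A * B)).
  exact: sumleZ (hle_ge0 hu) (hle_l1 hv).
move=> j; rewrite cabsM; apply: ler_wpM2r; first exact: cabs_ge0.
exact: hle_term hu.
Qed.

Lemma cconv_summ u v A B k : hle u A -> hle v B -> summ (fun j => u (k - j) * v j).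
Proof.
move=> hu hv; apply: (summ_le (g := fun j => A * cabs (v j)) (M := A * B)).
  exact: sumleZ (hle_ge0 hu) (hle_l1 hv).
move=> j; rewrite cabsM; apply: ler_wpM2r; first exact: cabs_ge0.
exact: hle_term hu.
Qed.

Lemma cconvBl u u' v A A' B k : hle u A -> hle u' A' -> hle v B ->
  cconv u v k - cconv u' v k = cconv (fun j => u j - u' j) v k.
Proof.
move=> hu hu' hv; rewrite /cconv -(csumB (cconv_summ k hu hv) (cconv_summ k hu' hv)).
by apply: eq_csum => j; rewrite mulrBl.
Qed.

Lemma cconvBr u v v' A B B' k : hle u A -> hle v B -> hle v' B' ->
  cconv u v k - cconv u v' k = cconv u (fun j => v j - v' j) k.
Proof.
move=> hu hv hv'; rewrite /cconv -(csumB (cconv_summ k hu hv) (cconv_summ k hu hv')).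
by apply: eq_csum => j; rewrite mulrBr.
Qed.

Definition delta0 : seqs := fun j => (j == 0)%:R.

Lemma hle_delta0 : hle delta0 (1 + w 0).
Proof.
move=> g [g0 g1]; have g01 : g 0 <= 1.
  have := sumle_term 0 g1; rewrite -[X in _ <= X](expr1n R 2) ler_pXn2r// ?nnegrE//.
have W : 0 <= w 0 * g 0 by rewrite mulr_ge0.
apply: sumle_le (sumle_fin (t := [:: 0 : J]) (g := fun j => (1 + w j * g j) * cabs (delta0 j)) _ _ _) _ _ => //.
- by move=> j; rewrite mulr_ge0 ?cabs_ge0// addr_ge0// mulr_ge0.
- by move=> j; rewrite inE /delta0 => /negbTE ->; rewrite cabs0 mulr0.
rewrite big_seq1 /delta0 eqxx cabs1 mulr1 lerD2l ler_piMr//.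
Qed.

(** This is the extremal of the Cauchy-Schwarz inequality on a finite set, the step by which the
    dual bound controls the true [l^2] norm. *)
Lemma normalized_test u (s : seq J) : uniq s ->
  let S := \sum_(j <- s) (w j * cabs (u j)) ^+ 2 in
  exists2 g, test g & \sum_(j <- s) (1 + w j * g j) * cabs (u j) =
    \sum_(j <- s) cabs (u j) + Num.sqrt S.
Proof.
move=> us S; have S0 : 0 <= S by apply: sumr_ge0 => j _; exact: sqr_ge0.
have [S1|S1] := eqVneq S 0.
  exists (fun=> 0); first exact: test0.
  rewrite S1 sqrtr0 addr0; apply: eq_bigr => j _; by rewrite mulr0 addr0 mul1r.
have Sp : 0 < S by rewrite lt_def S1.
have q0 : 0 < Num.sqrt S by rewrite sqrtr_gt0.
exists (fun j => if j \in s then w j * cabs (u j) / Num.sqrt S else 0).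
  split=> [j|].
    by case: ifP => // _; rewrite divr_ge0 ?sqrtr_ge0// mulr_ge0 ?cabs_ge0.
  have -> : 1 = \sum_(j <- s) (if j \in s then w j * cabs (u j) / Num.sqrt S else 0) ^+ 2 :> R.
    rewrite big_seq; under eq_bigr => j js do rewrite js expr_div_n sqr_sqrtr//.
    by rewrite -big_seq -mulr_suml divff.
  apply: sumle_fin => // [j|j]; first exact: sqr_ge0.
  by move=> /negbTE ->; rewrite expr0n.
have e : Num.sqrt S = \sum_(j <- s) (w j * cabs (u j)) ^+ 2 / Num.sqrt S.
  by rewrite -mulr_suml -/S -[X in X / _](sqr_sqrtr S0) expr2 mulfK// gt_eqF.
rewrite [in RHS]e -big_split /= big_seq [RHS]big_seq; apply: eq_bigr => j ->.
rewrite expr2; ring.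
Qed.

Lemma hle_l2 u M : hle u M -> sumle (fun j => (w j * cabs (u j)) ^+ 2) (M ^+ 2).
Proof.
move=> hu s us; have [g tg e] := normalized_test u us.
have := hu g tg s us; rewrite e => h; set S := (X in X <= _).
have S0 : 0 <= S by apply: sumr_ge0 => j _; exact: sqr_ge0.
rewrite -(sqr_sqrtr S0) lerXn2r ?nnegrE ?sqrtr_ge0 ?(hle_ge0 hu)//.
by apply: le_trans h; rewrite lerDr; apply: sumr_ge0 => j _; exact: cabs_ge0.
Qed.

Lemma hle_l12 u A B : sumle (fun j => cabs (u j)) A -> 0 <= B ->
  sumle (fun j => (w j * cabs (u j)) ^+ 2) (B ^+ 2) -> hle u (A + B).
Proof.
move=> hA B0 hB g [g0 g1] s us; apply/ler_addgt0Pr => e e0.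
under eq_bigr do rewrite mulrDl mul1r; rewrite big_split /= -addrA; apply: lerD; first exact: hA.
(* [g a <= ((B + e) g^2 + a^2 / (B + e)) / 2] *)
have Be : 0 < B + e by rewrite ltr_wpDl.
apply: (@le_trans _ _ (\sum_(j <- s) ((B + e) / 2 * g j ^+ 2 + (2 * (B + e))^-1 * (w j * cabs (u j)) ^+ 2))).
  apply: ler_sum => j _; rewrite mulrAC; move: (w j * _) (g j) => a x.
  rewrite -subr_ge0 (_ : _ - _ = ((B + e) * x - a) ^+ 2 / (2 * (B + e))).
    by rewrite divr_ge0 ?sqr_ge0// mulr_ge0// ltW.
  by field; rewrite gt_eqF.
rewrite big_split /= -!mulr_sumr.
apply: (@le_trans _ _ ((B + e) / 2 * 1 + (2 * (B + e))^-1 * (B + e) ^+ 2)).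
  apply: lerD; (apply: ler_wpM2l; first by rewrite ?divr_ge0 ?invr_ge0 ?mulr_ge0// ltW).
    exact: g1.
  apply: le_trans (hB s us) _; rewrite lerXn2r ?nnegrE ?(ltW Be)// lerDl ltW//.
by apply: ler_eq; field; rewrite gt_eqF.
Qed.

Lemma hle_tail u M (e : R) : hle u M -> 0 < e -> exists2 s : seq J, uniq s &
  hle (fun j => if j \in s then 0 else u j) e.
Proof.
move=> hu e0; have e2 : 0 < e / 2 by rewrite divr_gt0.
have e3 : 0 < (e / 2) ^+ 2 by rewrite exprn_gt0.
have [s1 us1 h1] := sumle_tail (fun j => cabs_ge0 (u j)) (hle_l1 hu) e2.
have [s2 us2 h2] := sumle_tail (fun j => sqr_ge0 (w j * cabs (u j))) (hle_l2 hu) e3.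
have [s [us ss1 ss2]] := uniq_cover s1 s2; exists s => //.
rewrite [e](splitr e).
have fil (f : J -> R) t : \sum_(j <- t) (if j \in s then 0 else f j) = \sum_(j <- [seq j <- t | j \notin s]) f j.
  by rewrite big_filter [RHS]big_mkcond; apply: eq_bigr => j _; case: (j \in s).
apply: hle_l12; last 1 first.
- move=> t ut; apply: le_trans (h2 [seq j <- t | j \notin s] _ _).
  + rewrite -fil; apply: ler_sum => j _; case: ifP => // _; by rewrite cabs0 mulr0 expr0n.
  + by rewrite filter_uniq.
  + by move=> j; rewrite mem_filter => /andP[js _]; apply: contra js; exact: ss2.
- move=> t ut; apply: le_trans (h1 [seq j <- t | j \notin s] _ _).
  + rewrite -fil; apply: ler_sum => j _; case: ifP => // _; by rewrite cabs0.
  + by rewrite filter_uniq.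
  + by move=> j; rewrite mem_filter => /andP[js _]; apply: contra js; exact: ss1.
exact: ltW.
Qed.

Lemma hle_finite u s : uniq s -> hle (fun j => if j \in s then u j else 0)
  (\sum_(j <- s) (1 + w j) * cabs (u j)).
Proof.
move=> us g [g0 g1]; have gle j : g j <= 1.
  have := sumle_term j g1; rewrite -[X in _ <= X](expr1n R 2) ler_pXn2r// ?nnegrE//.
have := @sumle_fin R _ (fun j => (1 + w j) * cabs (if j \in s then u j else 0)) s us.
move=> /(_ _ _)/sumle_le; apply.
- by move=> j; rewrite mulr_ge0 ?cabs_ge0// addr_ge0.
- by move=> j /negbTE ->; rewrite cabs0 mulr0.
- move=> j; apply: ler_wpM2r; first exact: cabs_ge0.
  by rewrite lerD2l ler_piMr.
- by rewrite big_seq [leRHS]big_seq; apply: ler_sum => j ->.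
Qed.

Definition nrm u : R := inf [set M | hle u M].

Lemma nrm_le u M : hle u M -> nrm u <= M.
Proof.
move=> h; apply: ge_inf => //; exists 0 => x hx; exact: hle_ge0 hx.
Qed.

Lemma nrmP u M : hle u M -> hle u (nrm u).
Proof.
move=> h g tg s us; apply/ler_addgt0Pr => e e0.
have hi : has_inf [set M | hle u M] by split; [exists M|exists 0 => x hx; exact: hle_ge0 hx].
have [x hx xe] := inf_adherent e0 hi.
by apply: le_trans (hx g tg s us) (ltW xe).
Qed.

Lemma nrm_ge0 u M : hle u M -> 0 <= nrm u.
Proof. by move/nrmP/hle_ge0. Qed.

Lemma nrm_diff u v M N D : hle u M -> hle v N -> hle (fun j => u j - v j) D ->
  `|nrm u - nrm v| <= D.
Proof.
move=> /nrmP hu /nrmP hv hD; rewrite ler_norml; apply/andP; split.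
  rewrite lerBrDr addrC lerBlDr addrC; apply: nrm_le.
  by rewrite addrC; apply: hle_ext (hleD hu (hleBC hD)) => j; ring.
rewrite lerBlDr addrC; apply: nrm_le.
by apply: hle_ext (hleD hv hD) => j; ring.
Qed.

Definition retract (rho : R) u : seqs := fun j => (rho / Num.max (nrm u) rho)%:C * u j.

Lemma retract_hle rho u M : 0 < rho -> hle u M -> hle (retract rho u) rho.
Proof.
move=> r0 hu; have := hleZ (rho / Num.max (nrm u) rho)%:C (nrmP hu); apply: hle_le.
have m0 : 0 < Num.max (nrm u) rho by rewrite lt_max r0 orbT.
rewrite cabs_real ger0_norm; last by rewrite divr_ge0// ltW.
by rewrite mulrAC ler_pdivrMr// ler_wpM2l ?(ltW r0)// le_max lexx.
Qed.

Lemma retract_id rho u M : 0 < rho -> hle u M -> M <= rho -> forall j, retract rho u j = u j.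
Proof.
move=> r0 hu Mr j; rewrite /retract max_r; last by apply: le_trans (nrm_le hu) Mr.
by rewrite divff ?gt_eqF// mul1r.
Qed.

(** In a general norm a radial retraction has Lipschitz constant 2: one unit from the difference of
    the vectors and one from that of the scaling factors. *)
Lemma retract_lip rho u v M N D : 0 < rho -> hle u M -> hle v N -> hle (fun j => u j - v j) D ->
  hle (fun j => retract rho u j - retract rho v j) (2 * D).
Proof.
move=> r0 hu hv hD; have D0 := hle_ge0 hD; have nd := nrm_diff hu hv hD.
set a := Num.max (nrm u) rho; set b := Num.max (nrm v) rho.
have a0 : 0 < a by rewrite lt_max r0 orbT.
have b0 : 0 < b by rewrite lt_max r0 orbT.
have ra : rho <= a by rewrite le_max lexx orbT.
have nb : nrm v <= b by rewrite le_max lexx.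
have ab : `|a - b| <= D.
  have mx x y : Num.max x rho - Num.max y rho <= `|x - y|.
    rewrite lerBlDr ge_max; apply/andP; split; last by rewrite ler_wpDl// le_max lexx orbT.
    by rewrite -{1}(subrK y x) lerD ?ler_norm// le_max lexx.
  apply: le_trans nd; rewrite ler_norml mx andbT lerNl opprB distrC; exact: mx.
have h1 := hleZ (rho / a)%:C hD; have h2 := hleZ (rho / a - rho / b)%:C (nrmP hv).
have e j : retract rho u j - retract rho v j =
    (rho / a)%:C * (u j - v j) + (rho / a - rho / b)%:C * v j.
  by rewrite /retract -/a -/b rmorphB /=; ring.
apply: hle_ext (e) _; apply: hle_le (hleD h1 h2); rewrite mulr2n mulrDl mul1r; apply: lerD.
  rewrite cabs_real ger0_norm ?divr_ge0 ?(ltW r0) ?(ltW a0)//.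
  by rewrite ler_piMl// ler_pdivrMr// mul1r.
rewrite cabs_real; apply: le_trans ab.
have -> : rho / a - rho / b = - (rho / (a * b)) * (a - b).
  by field; rewrite (gt_eqF a0) (gt_eqF b0).
rewrite normrM normrN mulrAC -[leRHS]mul1r; apply: ler_wpM2r => //.
rewrite ger0_norm; last by rewrite divr_ge0 ?mulr_ge0// ltW.
rewrite mulrAC ler_pdivrMr ?mulr_gt0// mul1r; apply: ler_pM => //; first exact: ltW.
exact: nrm_ge0 hv.
Qed.

End Weighted.

(** * The spaces of the statement *)

Section Japanese.
Variable R : realType.

Lemma enorm_ge0 n (l : 'rV[int]_n) : 0 <= enorm R l.
Proof. exact: sqrtr_ge0. Qed.

Lemma enorm_sqr n (l : 'rV[int]_n) : enorm R l ^+ 2 = \sum_i (l 0 i)%:~R ^+ 2.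
Proof. by rewrite sqr_sqrtr//; apply: sumr_ge0 => i _; exact: sqr_ge0. Qed.

Lemma enorm_le_n1 n (l : 'rV[int]_n) : enorm R l <= (n1 l)%:R.
Proof.
rewrite -(@ler_pXn2r _ 2)// ?nnegrE ?enorm_ge0// enorm_sqr expr2 {1}/n1 natr_sum mulr_suml.
apply: ler_sum => i _; rewrite -real_normK ?num_real// -intr_norm -abszE expr2 ler_wpM2l// -natr_sum ler_nat.
by rewrite /n1 (bigD1 i)//= leq_addr.
Qed.

Lemma coord_le_enorm n (l : 'rV[int]_n) i : `|(l 0 i)%:~R| <= enorm R l.
Proof.
rewrite -(@ler_pXn2r _ 2)// ?nnegrE ?enorm_ge0// enorm_sqr real_normK ?num_real//.
by rewrite (bigD1 i)//= lerDl; apply: sumr_ge0 => k _; exact: sqr_ge0.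
Qed.

Lemma n1_le_enorm n (l : 'rV[int]_n) : (n1 l)%:R <= n%:R * enorm R l.
Proof.
rewrite /n1 natr_sum; apply: (@le_trans _ _ (\sum_(i < n) enorm R l)).
  apply: ler_sum => i _; apply: le_trans (coord_le_enorm l i); by rewrite -intr_norm -abszE.
by rewrite big_const_ord iter_addr addr0 mulr_natl.
Qed.

Lemma enormN n (l : 'rV[int]_n) : enorm R (- l) = enorm R l.
Proof. by congr Num.sqrt; apply: eq_bigr => i _; rewrite mxE rmorphN sqrrN. Qed.

Lemma enorm_le_max n (a b : 'rV[int]_n) : enorm R (a + b) <= 2 * Num.max (enorm R a) (enorm R b).
Proof.
set m := Num.max _ _; have m0 : 0 <= m by rewrite le_max enorm_ge0.
rewrite -(@ler_pXn2r _ 2)// ?nnegrE ?enorm_ge0 ?mulr_ge0// enorm_sqr.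
apply: (@le_trans _ _ (2 * enorm R a ^+ 2 + 2 * enorm R b ^+ 2)).
  rewrite !enorm_sqr !mulr_sumr -big_split /=; apply: ler_sum => i _; rewrite mxE rmorphD /=.
  move: (_%:~R) (_%:~R) => x y; have := sqr_ge0 (x - y); rewrite sqrrB sqrrD; lra.
have am : enorm R a ^+ 2 <= m ^+ 2 by rewrite lerXn2r ?nnegrE ?enorm_ge0// le_max lexx.
have bm : enorm R b ^+ 2 <= m ^+ 2 by rewrite lerXn2r ?nnegrE ?enorm_ge0// le_max lexx orbT.
rewrite exprMn; lra.
Qed.

Lemma japanese_ge1 n (l : 'rV[int]_n) : 1 <= japanese R l.
Proof. by rewrite le_max lexx. Qed.

Lemma japanese_n1 n (l : 'rV[int]_n) : japanese R l <= (n1 l).+1%:R.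
Proof.
rewrite ge_max ler1n /=; apply: le_trans (enorm_le_n1 _) _; by rewrite ler_nat.
Qed.

Lemma japanese_le_max n (a b : 'rV[int]_n) :
  japanese R (a + b) <= 2 * Num.max (japanese R a) (japanese R b).
Proof.
have j1 := japanese_ge1 a; have m1 : 1 <= Num.max (japanese R a) (japanese R b).
  by apply: le_trans j1 _; rewrite le_max lexx.
rewrite ge_max; apply/andP; split; first by lra.
apply: le_trans (enorm_le_max a b) _; rewrite ler_wpM2l// ge_max; apply/andP; split.
  by rewrite le_max /japanese le_max lexx orbT.
by rewrite le_max orbC /japanese le_max lexx orbT.
Qed.

Variables (p : R).
Hypothesis p0 : 0 < p.

Definition wt (j : 'rV[int]_2) : R := japanese R j `^ p.
Definition wc : R := 2 `^ p.

Let jp (j : 'rV[int]_2) : 0 <= japanese R j. Proof. exact: le_trans (japanese_ge1 j). Qed.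

Lemma wt_ge1 j : 1 <= wt j.
Proof. by rewrite -[1](powRr0 (japanese R j)) ler_powR ?japanese_ge1// ltW. Qed.

Lemma wc_ge1 : 1 <= wc.
Proof. by rewrite -[1](powRr0 2) ler_powR// ?ler1n// ltW. Qed.

Lemma wtD a b : wt (a + b) <= wc * (wt a + wt b).
Proof.
have ga := wt_ge1 a; have gb := wt_ge1 b.
have pw x y : 0 <= x -> x <= y -> x `^ p <= y `^ p.
  by move=> x0 xy; apply: ge0_ler_powR; rewrite ?nnegrE ?(ltW p0)// (le_trans x0).
apply: (le_trans (pw _ _ (jp _) (japanese_le_max a b))).
rewrite powRM//; last by rewrite le_max jp.
apply: ler_wpM2l; first exact: powR_ge0.
by rewrite maxEle; case: ifP => _; [rewrite lerDr|rewrite lerDl]; [exact: le_trans ler01 ga|exact: le_trans ler01 gb].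
Qed.

Lemma wtN a : wt (- a) = wt a.
Proof. by rewrite /wt /japanese enormN. Qed.

Lemma wt_poly : exists P : nat, forall j, wt j <= (n1 j).+1%:R ^+ P.
Proof.
exists (Num.bound p) => j; rewrite -powR_mulrn//; apply: (@le_trans _ _ ((n1 j).+1%:R `^ p)).
  by apply: ge0_ler_powR; rewrite ?nnegrE ?(ltW p0)// japanese_n1.
by rewrite ler_powR ?ler1n// ltW// archi_boundP// ltW.
Qed.

Lemma poly_bounded (P : nat) (k : R) : 0 < k -> k < 1 ->
  exists C, 0 <= C /\ forall n, n.+1%:R ^+ P * k ^+ n <= C.
Proof.
(* With this [a], Bernoulli's inequality gives [k <= (1 - a) ^+ P], so the geometric decay pays for
   [P] polynomial factors. *)
move=> k0 k1; pose a := (1 - k) / P.+1%:R; have P0 : 0 < P.+1%:R :> R by [].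
have a0 : 0 < a by rewrite divr_gt0// subr_gt0.
have a1 : a < 1.
  by rewrite ltr_pdivrMr// mul1r (@lt_le_trans _ _ 1) ?ler1n//; lra.
have r0 : 0 < 1 - a by rewrite subr_gt0.
have r1 : 1 - a < 1 by rewrite gtrBl.
have kr : k <= (1 - a) ^+ P.
  apply: le_trans (bernoulli_le P _); last by rewrite (ltW a0) ltW.
  rewrite lerBrDr -lerBrDl; have -> : 1 - k = P.+1%:R * a by rewrite mulrC divfK// gt_eqF.
  by rewrite ler_wpM2r ?(ltW a0)// ler_nat.
have C0 : 0 <= (1 - (1 - a))^-1 ^+ P by rewrite exprn_ge0// invr_ge0 subr_ge0 ltW.
exists ((1 - (1 - a))^-1 ^+ P); split=> // n.
apply: le_trans (poly_geometricX _ _ r0 r1 (ltW k0)) _; rewrite ler_piMr// exprn_ile1//.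
  by rewrite divr_ge0 ?exprn_ge0// ltW.
by rewrite ler_pdivrMr ?exprn_gt0// mul1r.
Qed.

Lemma wt_momentum d (K : 'M[int]_(d, 2)) (k : R) : 0 < k -> k < 1 ->
  exists C, 0 <= C /\ forall l, wt (momentum K l) * k ^+ n1 l <= C.
Proof.
move=> k0 k1; have [P hP] := wt_poly; pose c := (mom_bound K).+1%:R : R.
have [C [C0 hC]] := poly_bounded P k0 k1.
exists (c ^+ P * C); split=> [|l]; first by rewrite mulr_ge0 ?exprn_ge0.
apply: le_trans (ler_wpM2l _ (hC (n1 l))); last by rewrite exprn_ge0.
rewrite mulrA -exprMn; apply: ler_wpM2r; first by rewrite exprn_ge0// ltW.
apply: le_trans (hP _) _; rewrite lerXn2r ?nnegrE ?mulr_ge0// /c -natrM ler_nat.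
apply: leq_trans (_ : (mom_bound K * n1 l).+1 <= _)%N; first by rewrite ltnS n1_momentum.
by rewrite mulSn mulnS; lia.
Qed.

(** One direction is [hle_l12]. For the other, an [l^1] partial sum and an [l^2] partial sum are
    compared on a common finite set, where [normalized_test] bounds their total by [M]. *)
Lemma hle_hp_norm u M : (hp_norm p u <= M%:E)%E <-> hle wt u M.
Proof.
have sq j : japanese R j `^ (2 * p) * cabs (u j) ^+ 2 = (wt j * cabs (u j)) ^+ 2.
  by rewrite mulrC [RHS]exprMn mulrC; congr (_ * _); rewrite mulrC powRrM powR_mulrn ?powR_ge0.
have -> : hp_norm p u = (\esum_(j in [set: 'rV[int]_2]) (cabs (u j))%:E +
    (\esum_(j in [set: 'rV[int]_2]) ((wt j * cabs (u j)) ^+ 2)%:E) `^ (2^-1))%E.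
  by rewrite /hp_norm; congr (_ + _ `^ _)%E; apply: eq_esum => j _; rewrite sq.
set a := esum _ _; set b := esum _ _.
have a0 : (0 <= a)%E by apply: esum_ge0 => j _; rewrite lee_fin cabs_ge0.
have b0 : (0 <= b)%E by apply: esum_ge0 => j _; rewrite lee_fin sqr_ge0.
have hA N := sumle_esum N (fun j => cabs_ge0 (u j)).
have hB N := sumle_esum N (fun j => sqr_ge0 (wt j * cabs (u j))).
split=> [h|hu].
  have afin : a \is a fin_num.
    rewrite ge0_fin_numE//; apply: le_lt_trans (ltry M); apply: le_trans h.
    by rewrite leeDl// poweR_ge0.
  have bfin : b \is a fin_num.
    rewrite ge0_fin_numE// ltey; apply/eqP => be; move: h; rewrite be poweRyr ?invr_eq0 ?pnatr_eq0//.
    by rewrite addey ?leye_eq//; case: (a) a0.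
  move: h; rewrite -(fineK afin) -(fineK bfin) poweR_EFin -EFinD lee_fin => h.
  have fb : 0 <= fine b by apply: fine_ge0.
  apply: hle_le h _; apply: hle_l12.
  - by apply/hA; rewrite fineK.
  - exact: powR_ge0.
  - by apply/hB; rewrite powR12_sqrt// sqr_sqrtr// fineK.
have ha : (a <= M%:E)%E by apply/hA; exact: hle_l1 hu.
have afin : a \is a fin_num by rewrite ge0_fin_numE//; apply: le_lt_trans ha (ltry M).
have part s : uniq s -> Num.sqrt (\sum_(j <- s) (wt j * cabs (u j)) ^+ 2) <= M - fine a.
  move=> us; rewrite lerBrDl -lerBrDr -lee_fin fineK//; apply/hA => t ut.
  have [s' [us' ss ts]] := uniq_cover s t.
  have [g tg e] := normalized_test wt_ge1 u us'; have := hu g tg s' us'; rewrite e => h.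
  rewrite lerBrDr; apply: le_trans h; apply: lerD.
    by rewrite (sum_subset (fun j => cabs (u j)) ut us' ts) lerDl sumr_ge0// => j _; exact: cabs_ge0.
  rewrite ler_wsqrtr// (sum_subset (fun j => (wt j * cabs (u j)) ^+ 2) us us' ss) lerDl.
  by rewrite sumr_ge0// => j _; exact: sqr_ge0.
have Ma : 0 <= M - fine a by apply: le_trans (part [::] isT); exact: sqrtr_ge0.
have hb : (b <= ((M - fine a) ^+ 2)%:E)%E.
  apply/hB => s us; have S0 : 0 <= \sum_(j <- s) (wt j * cabs (u j)) ^+ 2.
    by apply: sumr_ge0 => j _; exact: sqr_ge0.
  by rewrite -[leLHS](sqr_sqrtr S0) lerXn2r ?nnegrE ?sqrtr_ge0// part.
have bfin : b \is a fin_num by rewrite ge0_fin_numE//; apply: le_lt_trans hb (ltry _).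
move: hb; rewrite -(fineK afin) -(fineK bfin) poweR_EFin -EFinD !lee_fin => hb.
have fb : 0 <= fine b by apply: fine_ge0.
rewrite powR12_sqrt// -lerBrDl -(ger0_norm Ma) -sqrtr_sqr; apply: ler_wsqrtr; exact: hb.
Qed.
End Japanese.

(** * The nonlinearity on Fourier coefficients *)

Section Phases.
Variable R : realType.

Lemma sin_lip (a b : R) : `|sin a - sin b| <= `|a - b|.
Proof.
wlog ab : a b / b <= a => [h|].
  by have [/h|/ltW/h] := leP b a; rewrite // distrC (distrC a b).
have [c _ ->] := @MVT_segment R sin cos b a ab (fun x _ => is_derive_sin x)
  (continuous_subspaceT (@continuous_sin R)).
by rewrite normrM ler_piMl// ler_norml cos_geN1 cos_le1.
Qed.

Lemma cos_lip (a b : R) : `|cos a - cos b| <= `|a - b|.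
Proof.
wlog ab : a b / b <= a => [h|].
  by have [/h|/ltW/h] := leP b a; rewrite // distrC (distrC a b).
have [c _ ->] := @MVT_segment R cos (fun x => - sin x) b a ab (fun x _ => is_derive_cos x)
  (continuous_subspaceT (@continuous_cos R)).
by rewrite normrM normrN ler_piMl// ler_norml sin_geN1 sin_le1.
Qed.

Lemma expi_lip (a b : R) : cabs (expi a - expi b) <= 2 * `|a - b|.
Proof.
apply: le_trans (cabs_le_ReIm _) _; rewrite mulr2n mulrDl mul1r.
exact: lerD (cos_lip a b) (sin_lip a b).
Qed.

Lemma csum_phase_cont (I : choiceType) (c : I -> R[i]) (th : I -> R) (t e : R) : summ c -> 0 < e ->
  \forall s \near t, cabs (csum (fun i => c i * expi (s * th i)) - csum (fun i => c i * expi (t * th i))) <= e.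
Proof.
move=> [M hM] e0; apply: (@csum_tannery R R (nbhs t) _ I (fun s i => c i * expi (s * th i))
  (fun i => c i * expi (t * th i)) (fun i => cabs (c i)) M _ hM _ _ e e0).
- by move=> s i; rewrite cabsM cabs_expi mulr1.
- move=> i d d0; pose r := d / (1 + 2 * cabs (c i) * `|th i|).
  have b0 : 0 < 1 + 2 * cabs (c i) * `|th i| by rewrite ltr_pwDl// !mulr_ge0 ?cabs_ge0.
  have r0 : 0 < r by rewrite divr_gt0.
  near=> s; rewrite -mulrBr cabsM.
  apply: le_trans (ler_wpM2l (cabs_ge0 _) (expi_lip _ _)) _; rewrite -mulrBl normrM.
  have h : `|s - t| <= r.
    by near: s; apply: filterS (nbhsx_ballx t r r0) => s; rewrite /ball /= distrC => /ltW.
  have := ler_wpM2r (_ : 0 <= 2 * cabs (c i) * `|th i|) h; rewrite !mulr_ge0 ?cabs_ge0// => /(_ isT).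
  rewrite (_ : cabs (c i) * _ = `|s - t| * (2 * cabs (c i) * `|th i|)); last by ring.
  move/le_trans; apply; rewrite /r mulrAC ler_pdivrMr// ler_wpM2l ?(ltW d0)// lerDr//.
- by exists M; apply: sumle_le hM _ (lexx _) => i; rewrite cabsM cabs_expi mulr1.
Unshelve. all: by end_near.
Qed.
End Phases.

Section Nonlinear.
Variable R : realType.
Notation J := 'rV[int]_2.
Notation seqs := (J -> R[i]).
Variables (w : J -> R) (c : R).
Hypotheses (w1 : forall j, 1 <= w j) (c1 : 1 <= c).
Hypothesis wD : forall a b, w (a + b) <= c * (w a + w b).
Hypothesis wN : forall a, w (- a) = w a.
Notation Cc := (Cc c).
Notation hle := (hle w).
Implicit Types (u v y : seqs) (t M N D B : R) (a b n : nat) (k : J).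

Let c0 : 0 <= c. Proof. exact: le_trans c1. Qed.
Let Cc0 : 0 <= Cc. Proof. exact: le_trans (Cc_ge1 c1). Qed.
Let w0 j : 0 <= w j. Proof. exact: le_trans (w1 j). Qed.

Lemma conjcB (x y : R[i]) : conjc (x - y) = conjc x - conjc y.
Proof. by rewrite conjcD; congr (_ + _); case: y => a b /=. Qed.

Definition conjs (u : seqs) : seqs := fun k => conjc (u (- k)).

(* The Fourier coefficients of [u^a (conj u)^b]. *)
Definition pw (u : seqs) a b : seqs := iter b (cconv (conjs u)) (iter a (cconv u) (@delta0 R)).

Lemma hle_conjs u M : hle u M -> hle (conjs u) M.
Proof. exact: hle_conj. Qed.

Lemma hle_conjsB u v D : hle (fun j => u j - v j) D -> hle (fun j => conjs u j - conjs v j) D.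
Proof. by move/(hle_conj wN); apply: hle_ext => j; rewrite /conjs conjcB. Qed.

Definition W0 := 1 + w 0.
Let W00 : 0 <= W0. Proof. exact: addr_ge0. Qed.

Lemma hle_iter u (x : seqs) M A n : hle u M -> hle x A -> hle (iter n (cconv u) x) (A * (Cc * M) ^+ n).
Proof.
move=> hu hx; elim: n => [|n ih]; first by rewrite expr0 mulr1.
apply: hle_le (hle_cconv w1 c1 wD hu ih); rewrite exprS; apply: ler_eq; ring.
Qed.

Lemma hle_pw u M a b : hle u M -> hle (pw u a b) (W0 * (Cc * M) ^+ (a + b)).
Proof.
move=> hu; rewrite exprD mulrA; apply: hle_iter (hle_conjs hu) _.
exact: hle_iter hu (hle_delta0 w1).
Qed.

Lemma hle_iter_lip u v (x y : seqs) M D (A : R) B n : hle u M -> hle v M -> hle (fun j => u j - v j) D ->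
  hle x A -> hle y A -> hle (fun j => x j - y j) B ->
  hle (fun j => iter n (cconv u) x j - iter n (cconv v) y j)
    (B * (Cc * M) ^+ n + A * (n%:R * (Cc * M) ^+ n.-1 * (Cc * D))).
Proof.
move=> hu hv hD hx hy hB; elim: n => [|n ih]; first by rewrite expr0 !mulr1 !mul0r mulr0 addr0.
have hxn := hle_iter n hu hx; have hyn := hle_iter n hv hy.
have e j : iter n.+1 (cconv u) x j - iter n.+1 (cconv v) y j =
    cconv (fun j => u j - v j) (iter n (cconv u) x) j + cconv v (fun j => iter n (cconv u) x j - iter n (cconv v) y j) j.
  rewrite /= -(cconvBl j hu hv hxn) -(cconvBr j hv hxn hyn); ring.
have h1 := hle_cconv w1 c1 wD hD hxn; have h2 := hle_cconv w1 c1 wD hv ih.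
apply: hle_ext e _; apply: hle_le (hleD w1 h1 h2).
apply: ler_eq => /=.
rewrite -[n.+1%:R]natr1 exprS; case: n {ih hxn hyn h1 h2} => [|n] /=; last rewrite exprS; ring.
Qed.

Lemma hle_pw_lip u v M D a b : hle u M -> hle v M -> hle (fun j => u j - v j) D ->
  hle (fun j => pw u a b j - pw v a b j) (W0 * ((a + b)%:R * (Cc * M) ^+ (a + b).-1 * (Cc * D))).
Proof.
move=> hu hv hD.
have hd0 := hle_delta0 w1 (w := w).
have h0 : hle (fun j => delta0 R j - delta0 R j) 0 by move=> g tg s us; rewrite big1// => j _; rewrite subrr cabs0 mulr0.
have h1 := hle_iter_lip a hu hv hD hd0 hd0 h0.
have := hle_iter_lip b (hle_conjs hu) (hle_conjs hv) (hle_conjsB hD) (hle_iter a hu hd0) (hle_iter a hv hd0) h1.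
apply: hle_le; apply: ler_eq.
rewrite /W0 natrD; case: a {h1} => [|a] /=; first by rewrite add0n; ring.
rewrite ?addSn /= [in RHS]exprD; case: b => [|b] /=; first by rewrite !expr0; ring.
by rewrite ?addnS /= !exprS; ring.
Qed.

Variables (d : nat) (K : 'M[int]_(d, 2)) (om : 'rV[R]_d).
Notation Z := 'rV[int]_d.
Notation pi := (momentum K).

Section Op.
Variable (V : Z -> R[i]) (A : R).
Hypothesis hV : sumle (fun l => cabs (V l) * w (pi l)) A.

(** The Fourier coefficients of [V(omega t + K x) u(x)]; see [torus_Vop]. *)
Definition Vop t (u : seqs) : seqs := fun k => csum (fun l => V l * expi (t * idot l om) * u (k - pi l)).

Lemma Vop_hle t u M : hle u M -> hle (Vop t u) (2 * c * A * M).
Proof.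
move=> hu; have M0 := hle_ge0 hu.
apply: (hle_csum w1 (a := fun l => (2 * c * M) * (cabs (V l) * w (pi l)))); last first.
  by rewrite [X in sumle _ X]mulrAC; apply: (sumleZ _ hV); rewrite !mulr_ge0.
move=> l; apply: hle_le (hleZ (V l * expi (t * idot l om)) (hle_shift w1 c1 wD (pi l) hu)).
by rewrite cabsM cabs_expi mulr1; apply: ler_eq; ring.
Qed.

Lemma Vop_summ t u M k : hle u M -> summ (fun l => V l * expi (t * idot l om) * u (k - pi l)).
Proof.
move=> hu; have M0 := hle_ge0 hu.
apply: (summ_le (sumleZ M0 hV)) => l; rewrite cabsM cabsM cabs_expi mulr1 mulrC.
rewrite mulrCA; apply: le_trans (_ : cabs (u (k - pi l)) * cabs (V l) <= _).
  by [].
rewrite mulrC; apply: ler_wpM2l; first exact: cabs_ge0.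
by apply: le_trans (hle_term _ hu) _; rewrite ler_peMr.
Qed.

Lemma VopB t u v M N k : hle u M -> hle v N -> Vop t u k - Vop t v k = Vop t (fun j => u j - v j) k.
Proof.
move=> hu hv; rewrite /Vop -(csumB (Vop_summ t k hu) (Vop_summ t k hv)).
by apply: eq_csum => l; rewrite mulrBr.
Qed.

Lemma Vop_lip t u v M N D : hle u M -> hle v N -> hle (fun j => u j - v j) D ->
  hle (fun k => Vop t u k - Vop t v k) (2 * c * A * D).
Proof. by move=> hu hv hD; apply: hle_ext (Vop_hle t hD) => k; exact: (VopB t k hu hv). Qed.

Lemma Vop_cont t u M k (e : R) : hle u M -> 0 < e ->
  \forall s \near t, cabs (Vop s u k - Vop t u k) <= e.
Proof.
move=> hu e0; have s0 := Vop_summ 0 k hu.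
have sm : summ (fun l => V l * u (k - pi l)).
  by case: s0 => B hB; apply: (summ_le hB) => l; rewrite mul0r expi0 mulr1.
have := csum_phase_cont (fun l => idot l om) t sm e0; apply: filterS => s.
by rewrite /Vop; under eq_csum do rewrite mulrAC; under [in X in _ - X]eq_csum do rewrite mulrAC.
Qed.
End Op.

Section G.
Variable (Q : Z -> nat -> nat -> R[i]) (rho A : R).
Hypothesis rho0 : 0 < rho.
Hypothesis hQ : sumle (fun x : Z * nat * nat =>
  cabs (Q x.1.1 x.1.2 x.2) * w (pi x.1.1) * rho ^+ (x.1.2 + x.2)) A.

(** The Fourier coefficients of the power series with coefficients [Q] in [u] and its conjugate, at
    the angle [omega t + K x]; see [torus_Gop]. *)
Definition Gop t (u : seqs) : seqs := fun k => csum (fun x : Z * nat * nat =>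
  Q x.1.1 x.1.2 x.2 * expi (t * idot x.1.1 om) * pw u x.1.2 x.2 (k - pi x.1.1)).

Let hterm t (v : seqs) B l a b : hle v B ->
  hle (fun k => Q l a b * expi (t * idot l om) * v (k - pi l)) (2 * c * (cabs (Q l a b) * w (pi l)) * B).
Proof.
move=> hv; apply: hle_le (hleZ (Q l a b * expi (t * idot l om)) (hle_shift w1 c1 wD (pi l) hv)).
by rewrite cabsM cabs_expi mulr1; apply: ler_eq; ring.
Qed.

(** Relative to the radius [rho], a term of degree [n] gains the factor [(Cc * M / rho) ^+ n], at
    most its [m]-th power when [n >= m]. *)
Lemma Gop_hle m t u M : (forall l a b, (a + b < m)%N -> Q l a b = 0) ->
  hle u M -> Cc * M <= rho -> hle (Gop t u) (2 * c * W0 * A * (Cc * M / rho) ^+ m).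
Proof.
move=> Qm hu Mr; have M0 := hle_ge0 hu; set r := Cc * M / rho.
have r0 : 0 <= r by rewrite divr_ge0 ?mulr_ge0// ltW.
have r1 : r <= 1 by rewrite ler_pdivrMr// mul1r.
apply: (hle_csum w1 (a := fun x : Z * nat * nat => (2 * c * W0 * r ^+ m) *
   (cabs (Q x.1.1 x.1.2 x.2) * w (pi x.1.1) * rho ^+ (x.1.2 + x.2)))); last first.
  by rewrite [X in sumle _ X]mulrAC; apply: (sumleZ _ hQ); rewrite !mulr_ge0 ?exprn_ge0.
move=> [[l a] b] /=; have [ab|ab] := ltnP (a + b) m.
  rewrite Qm//; apply: hle_ext (hle0 w _) => [k|]; first by rewrite !mul0r.
  by rewrite cabs0 !mul0r mulr0.
apply: hle_le (hterm t l a b (hle_pw a b hu)).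
have -> : (Cc * M) ^+ (a + b) = r ^+ (a + b) * rho ^+ (a + b).
  by rewrite -exprMn /r divfK// gt_eqF.
have rm : r ^+ (a + b) <= r ^+ m by rewrite ler_wiXn2l.
have := ler_wpM2l (_ : 0 <= 2 * c * (cabs (Q l a b) * w (pi l)) * W0 * rho ^+ (a + b)) rm.
rewrite !mulr_ge0 ?cabs_ge0 ?exprn_ge0 ?(ltW rho0)// => /(_ isT).
set X := r ^+ (a + b); set Y := r ^+ m; set S := rho ^+ _; move=> h.
rewrite (_ : _ * (W0 * _) = 2 * c * (cabs (Q l a b) * w (pi l)) * W0 * S * X); last by ring.
by apply: le_trans h _; apply: ler_eq; ring.
Qed.

Lemma Gop_summ t u M k : hle u M -> Cc * M <= rho -> summ (fun z : Z * nat * nat =>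
    Q z.1.1 z.1.2 z.2 * expi (t * idot z.1.1 om) * pw u z.1.2 z.2 (k - pi z.1.1)).
Proof.
move=> hy Nr; have N0 := hle_ge0 hy; apply: (summ_le (sumleZ (_ : 0 <= W0) hQ)) => // -[[l a] b] /=.
have -> : W0 * (cabs (Q l a b) * w (pi l) * rho ^+ (a + b)) =
  cabs (Q l a b) * (W0 * (w (pi l) * rho ^+ (a + b))) by ring.
rewrite cabsM cabsM cabs_expi mulr1; apply: ler_wpM2l; first exact: cabs_ge0.
apply: le_trans (hle_term (k - pi l) (hle_pw a b hy)) _; apply: ler_wpM2l => //.
apply: (@le_trans _ _ (rho ^+ (a + b))); last by rewrite ler_peMl ?exprn_ge0 ?(ltW rho0).
by rewrite lerXn2r ?nnegrE ?mulr_ge0 ?(ltW rho0).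
Qed.

(** The derivative of a term of degree [n] brings a factor [n], paid by staying at half the radius:
    [n <= 2 ^ n]. *)
Lemma Gop_lip t u v M D : hle u M -> hle v M -> hle (fun j => u j - v j) D -> 2 * (Cc * M) <= rho ->
  hle (fun k => Gop t u k - Gop t v k) (2 * c * W0 * A * (2 * Cc / rho * D)).
Proof.
move=> hu hv hD Mr; have M0 := hle_ge0 hu; have D0 := hle_ge0 hD.
have CM0 : 0 <= Cc * M by rewrite mulr_ge0.
have Mr1 : Cc * M <= rho by lra.
have e k : Gop t u k - Gop t v k = csum (fun x : Z * nat * nat =>
  Q x.1.1 x.1.2 x.2 * expi (t * idot x.1.1 om) *
    (pw u x.1.2 x.2 (k - pi x.1.1) - pw v x.1.2 x.2 (k - pi x.1.1))).
  rewrite /Gop -(csumB (Gop_summ t k hu Mr1) (Gop_summ t k hv Mr1)).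
  by apply: eq_csum => x; rewrite mulrBr.
apply: hle_ext e _.
apply: (hle_csum w1 (a := fun x : Z * nat * nat => (2 * c * W0 * (2 * Cc / rho * D)) *
   (cabs (Q x.1.1 x.1.2 x.2) * w (pi x.1.1) * rho ^+ (x.1.2 + x.2)))); last first.
  by rewrite [X in sumle _ X]mulrAC; apply: (sumleZ _ hQ); rewrite !mulr_ge0 ?invr_ge0 ?(ltW rho0).
move=> [[l a] b] /=; apply: hle_le (hterm t l a b (hle_pw_lip a b hu hv hD)).
have key n : n%:R * (Cc * M) ^+ n.-1 <= 2 / rho * rho ^+ n.
  case: n => [|n]; first by rewrite mul0r mulr_ge0// ?divr_ge0 ?exprn_ge0// ltW.
  have h1 : (Cc * M) ^+ n <= (rho / 2) ^+ n.
    by rewrite lerXn2r ?nnegrE ?divr_ge0 ?(ltW rho0)// ler_pdivlMr// mulrC.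
  have h2 : n.+1%:R <= 2 * 2 ^+ n :> R by rewrite -exprS -natrX ler_nat ltnW// ltn_expl.
  apply: le_trans (ler_pM _ _ h2 h1) _; rewrite ?exprn_ge0//.
  have r1 : rho != 0 by rewrite gt_eqF.
  rewrite exprS expr_div_n; have p2 : (2 : R) ^+ n != 0 by rewrite expf_neq0.
  by move: (2 ^+ n) (rho ^+ n) p2 => x y x0; apply: ler_eq; field; apply/andP.
have := key (a + b)%N; move: ((a + b)%:R * _) (rho ^+ (a + b)) => X Y h.
rewrite (_ : _ * (W0 * _) = 2 * c * (cabs (Q l a b) * w (pi l)) * W0 * (Cc * D) * X); last by ring.
apply: le_trans (ler_wpM2l _ h) _.
  by rewrite !mulr_ge0 ?cabs_ge0.
by apply: ler_eq; field; rewrite gt_eqF.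
Qed.

Lemma Gop_cont t u M k (e : R) : hle u M -> Cc * M <= rho -> 0 < e ->
  \forall s \near t, cabs (Gop s u k - Gop t u k) <= e.
Proof.
move=> hu Mr e0; have [B hB] := Gop_summ 0 k hu Mr.
have sm : summ (fun x : Z * nat * nat => Q x.1.1 x.1.2 x.2 * pw u x.1.2 x.2 (k - pi x.1.1)).
  by apply: (summ_le hB) => x; rewrite mul0r expi0 mulr1.
have := csum_phase_cont (fun x : Z * nat * nat => idot x.1.1 om) t sm e0; apply: filterS => s.
by rewrite /Gop; under eq_csum do rewrite mulrAC; under [in X in _ - X]eq_csum do rewrite mulrAC.
Qed.
End G.
End Nonlinear.

(** * The forcing term on Fourier coefficients *)

Section TorusAlgebra.
Variable R : realType.
Notation J := 'rV[int]_2.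
Notation seqs := (J -> R[i]).
Implicit Types (u v : seqs) (x : 'rV[R]_2) (j k m : J).

Lemma torus_summ u x : summ u -> summ (fun j => u j * expi (idot j x)).
Proof. by case=> M h; apply: (summ_le h) => j; rewrite cabsM cabs_expi mulr1. Qed.

Lemma torus_cconv u v x : summ u -> summ v ->
  torus_fun (cconv u v) x = torus_fun u x * torus_fun v x.
Proof.
move=> hu hv; have hu' := torus_summ x hu; have hv' := torus_summ x hv.
pose F (z : J * J) := (u z.1 * expi (idot z.1 x)) * (v z.2 * expi (idot z.2 x)).
have sF : summ F := summM hu' hv'.
pose h (z : J * J) := (z.1 - z.2, z.2); pose h' (z : J * J) := (z.1 + z.2, z.2).
have hK : cancel h h' by move=> [a b]; rewrite /h /h' /= subrK.
have hK' : cancel h' h by move=> [a b]; rewrite /h /h' /= addrK.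
have s1 : summ (fun z => F (h z)) := summ_inj (can_inj hK) sF.
rewrite -(csumM hu' hv') -/F -(csum_reindex hK hK' sF) -(csum_pair s1).
apply: eq_csum => k; rewrite /F /= -csumZr.
  apply: eq_csum => j; rewrite mulrACA -expiD -idotD subrK //.
have [A hA] := hu; have [B hB] := hv; apply: (summ_le (sumleZ (sumle_ge0 hA) hB)) => j.
by rewrite cabsM ler_wpM2r ?cabs_ge0//; exact: (sumle_term _ hA).
Qed.

Lemma torus_conjs u x : summ u -> torus_fun (conjs u) x = conjc (torus_fun u x).
Proof.
move=> hu; rewrite /torus_fun -csum_conj; last exact: torus_summ.
have s1 : summ (fun j => conjc (u j * expi (idot j x))).
  by case: (torus_summ x hu) => M h; apply: (summ_le h) => j; rewrite cabs_conj.
rewrite -(csum_reindex (@opprK _) (@opprK _) s1); apply: eq_csum => j.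
rewrite /conjs conjcM -expiN; congr (_ * expi _).
by rewrite /idot -sumrN; apply: eq_bigr => i _; rewrite mxE mulrNz mulNr opprK.
Qed.

Lemma torus_delta0 x : torus_fun (@delta0 R) x = 1.
Proof.
rewrite /torus_fun (csum1 (i0 := 0)) => [|i /negbTE i0]; last by rewrite /delta0 i0 mul0r.
by rewrite /delta0 eqxx mul1r idot0l expi0.
Qed.

Lemma torus_shift u m x : summ u ->
  torus_fun (fun k => u (k - m)) x = expi (idot m x) * torus_fun u x.
Proof.
move=> hu; have hu' := torus_summ x hu; rewrite -csumZ//.
rewrite -(csum_reindex (subrK m) (addrK m) (summZ _ hu')).
by apply: eq_csum => k; rewrite mulrCA -expiD -idotD [m + _]addrC subrK.
Qed.

Lemma torus_csum_shift (I : choiceType) (c : I -> R[i]) (m : I -> J) (v : I -> seqs)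
    (B : I -> R) A x :
  (forall i, sumle (fun j => cabs (v i j)) (B i)) -> sumle (fun i => cabs (c i) * B i) A ->
  torus_fun (fun k => csum (fun i => c i * v i (k - m i))) x =
  csum (fun i => c i * expi (idot (m i) x) * torus_fun (v i) x).
Proof.
move=> hB hA.
have s1 : summ (fun z : I * J => c z.1 * v z.1 (z.2 - m z.1) * expi (idot z.2 x)).
  exists A; apply: (@sumle_pair _ _ _ _ (fun i => cabs (c i) * B i)) => // i.
  apply: sumle_le (sumleZ (cabs_ge0 (c i)) (sumle_inj (subIr (m i)) (hB i))) _ (lexx _) => j /=.
  by rewrite !cabsM cabs_expi mulr1.
have [N hN] := s1.
transitivity (csum (fun i => csum (fun k => c i * v i (k - m i) * expi (idot k x)))).
  rewrite (csum_exchange s1); apply: eq_csum => k; rewrite -csumZr//.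
  exists N; have := sumle_pairl k (sumle_sw hN) => /sumle_le; apply => // i /=.
  by rewrite [leRHS]cabsM cabs_expi mulr1.
apply: eq_csum => i; have hv : summ (v i) by exists (B i).
rewrite -mulrA -(torus_shift (m i) x hv) -csumZ; last first.
  by apply: torus_summ; apply: summ_inj hv; exact: subIr.
by apply: eq_csum => k; rewrite mulrA.
Qed.
End TorusAlgebra.

(** * Differentiation of power series term by term *)

Section PowerSeries.
Variable R : realType.
Implicit Types (a h z : R[i]) (r dl M : R) (n : nat).

(** Cauchy estimates for a monomial, obtained algebraically: [dl] is a lower bound for the room
    between [|a|] and [r]. In the common induction the second-order remainder uses the first-order
    one. *)
Lemma power_remainder a h dl r n : 0 < dl -> cabs a + dl <= r -> cabs h <= dl ->
  [/\ n%:R * cabs a ^+ n.-1 * dl <= r ^+ n,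
      cabs ((h + a) ^+ n - a ^+ n) <= (cabs h / dl) * r ^+ n &
      cabs ((h + a) ^+ n - a ^+ n - h * (n%:R * a ^+ n.-1)) <= (cabs h / dl) ^+ 2 * r ^+ n].
Proof.
move=> d0 ar hd; have a0 := cabs_ge0 a; have h0 := cabs_ge0 h.
have r0 : 0 <= r by lra.
have har : cabs (h + a) <= r by apply: le_trans (cabsD _ _) _; lra.
elim: n => [|n [ih1 ih2 ih3]].
  rewrite !expr0 !mulr1 !mul0r subrr mulr0 subrr cabs0; split=> //; last exact: sqr_ge0.
  by rewrite divr_ge0// ltW.
have rn : 0 <= r ^+ n by rewrite exprn_ge0.
have an : cabs a ^+ n <= r ^+ n by rewrite lerXn2r ?nnegrE//; lra.
have hn : cabs (h + a) ^+ n <= r ^+ n by rewrite lerXn2r ?nnegrE ?cabs_ge0.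
have nE : n%:R * a ^+ n.-1 * a = n%:R * a ^+ n by case: n {ih1 ih2 ih3 rn an hn} => [|n]; rewrite ?mul0r// -mulrA -exprSr.
have nE' : n%:R * cabs a ^+ n.-1 * cabs a = n%:R * cabs a ^+ n.
  by case: n {ih1 ih2 ih3 rn an hn nE} => [|n]; rewrite ?mul0r// -mulrA -exprSr.
have e2 : cabs h = cabs h / dl * dl by rewrite divfK// gt_eqF.
have q0 : 0 <= cabs h / dl by rewrite divr_ge0// ltW.
move: (cabs h / dl) e2 q0 ih2 ih3 => q e2 q0 ih2 ih3; rewrite exprS /=; split.
- rewrite -natr1 mulrDl mul1r -nE' mulrDl [_ * _ * cabs a * dl]mulrAC.
  apply: le_trans (_ : r ^+ n * cabs a + r ^+ n * dl <= _).
    by apply: lerD; apply: ler_wpM2r => //; exact: ltW.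
  by rewrite -mulrDr mulrC ler_wpM2r.
- rewrite [(h + a) ^+ n.+1]exprS [a ^+ n.+1]exprS.
  rewrite (_ : _ - _ = a * ((h + a) ^+ n - a ^+ n) + h * (h + a) ^+ n); last by ring.
  apply: le_trans (cabsD _ _) _; rewrite !cabsM cabsX.
  apply: le_trans (_ : cabs a * (q * r ^+ n) + cabs h * r ^+ n <= _).
    by apply: lerD; apply: ler_wpM2l.
  have := ler_wpM2r rn (ler_wpM2l q0 ar); rewrite {1}e2; lra.
- rewrite -natr1 [(h + a) ^+ n.+1]exprS [a ^+ n.+1]exprS.
  rewrite (_ : _ - _ - _ = a * ((h + a) ^+ n - a ^+ n - h * (n%:R * a ^+ n.-1)) + h * ((h + a) ^+ n - a ^+ n)); last first.
    rewrite [(n%:R + 1) * _]mulrDl -nE; ring.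
  apply: le_trans (cabsD _ _) _; rewrite [cabs (a * _)]cabsM [cabs (h * _)]cabsM.
  apply: le_trans (_ : cabs a * (q ^+ 2 * r ^+ n) + cabs h * (q * r ^+ n) <= _).
    by apply: lerD; apply: ler_wpM2l.
  have := ler_wpM2r rn (ler_wpM2l (sqr_ge0 q) ar); rewrite {1}e2 expr2; lra.
Qed.

Lemma power_series_deriv_summ (I : choiceType) (c : I -> R[i]) (n : I -> nat) r M a :
  sumle (fun i => cabs (c i) * r ^+ n i) M -> cabs a < r ->
  summ (fun i => c i * ((n i)%:R * a ^+ (n i).-1)).
Proof.
move=> hM ar; have d0 : 0 < r - cabs a by rewrite subr_gt0.
apply: (summ_le (sumleZ (_ : 0 <= (r - cabs a)^-1) hM)) => [|i]; first by rewrite invr_ge0 ltW.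
have [||h1 _ _] := @power_remainder a 0 (r - cabs a) r (n i) d0.
- by rewrite subrKC.
- by rewrite cabs0 ltW.
rewrite [leRHS]mulrCA [leLHS]cabsM; apply: ler_wpM2l; first exact: cabs_ge0.
by rewrite [leLHS]cabsM cabsX cabs_nat [leRHS]mulrC ler_pdivlMr.
Qed.

Lemma power_series_derive1 (I : choiceType) (c : I -> R[i]) (n : I -> nat) r M a :
  sumle (fun i => cabs (c i) * r ^+ n i) M -> cabs a < r ->
  derive1 (fun z : R[i]^o => csum (fun i => c i * z ^+ n i) : R[i]^o) a =
  csum (fun i => c i * ((n i)%:R * a ^+ (n i).-1)).
Proof.
move=> hM ar; have M0 := sumle_ge0 hM; have a0 := cabs_ge0 a.
have r0 : 0 < r by lra.
pose dl := r - cabs a; have d0 : 0 < dl by rewrite subr_gt0.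
have adr : cabs a + dl <= r by rewrite /dl; lra.
have sf z : cabs z <= r -> summ (fun i => c i * z ^+ n i).
  move=> zr; apply: (summ_le hM) => i; rewrite cabsM cabsX ler_wpM2l ?cabs_ge0//.
  by rewrite lerXn2r ?nnegrE ?cabs_ge0// ltW.
have sd := power_series_deriv_summ hM ar.
rewrite /derive1; apply: cvg_lim => //.
apply/cvgrPdist_le => /= e e0.
have e1 : 0 < complex.Re e by case: e e0 => er ei; rewrite ltcE /= => /andP[].
have eE : e = (complex.Re e)%:C by case: e e0 {e1} => er ei; rewrite ltcE /= => /andP[/eqP -> _].
pose b := Num.min dl (complex.Re e * dl ^+ 2 / (M + 1)).
have M1 : 0 < M + 1 by lra.
have b0 : 0 < b by rewrite lt_min d0 divr_gt0// mulr_gt0// exprn_gt0.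
near=> h.
have h0 : h != 0 by near: h; exact: (@nbhs_dnbhs_neq R[i]^o).
have hb : cabs h <= b.
  have : `|h| <= b%:C by near: h; apply: (@dnbhs0_le _ R[i]^o); rewrite ltcR.
  by rewrite normCE lecR.
have hdl : cabs h <= dl by apply: le_trans hb _; rewrite ge_min lexx.
rewrite normCE eE lecR.
have hc0 : 0 < cabs h by rewrite cabs_gt0.
rewrite -(ler_pM2l hc0) -cabsM mulrBr.
rewrite (_ : h * (h^-1 *: _) = csum (fun i => c i * (h + a) ^+ n i) - csum (fun i => c i * a ^+ n i)); last first.
  by rewrite /GRing.scale /= mulrA divff// mul1r.
have sha : summ (fun i => c i * (h + a) ^+ n i).
  by apply: sf; apply: le_trans (cabsD _ _) _; lra.
have sa : summ (fun i => c i * a ^+ n i) by apply: sf; lra.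
rewrite cabsBC -(csumB sha sa) -(csumZ _ sd) -(csumB (summB sha sa) (summZ _ sd)).
apply: le_trans (_ : (cabs h / dl) ^+ 2 * M <= _).
  apply: csum_le; apply: sumle_le (sumleZ (sqr_ge0 (cabs h / dl)) hM) _ (lexx _) => i.
  have [_ _ h3] := @power_remainder a h dl r (n i) d0 adr hdl.
  rewrite [h * (c i * _)]mulrCA -mulrBr -mulrBr [leLHS]cabsM [leRHS]mulrCA.
  apply: ler_wpM2l => //; exact: cabs_ge0.
have hb2 : cabs h <= complex.Re e * dl ^+ 2 / (M + 1) by apply: le_trans hb _; rewrite ge_min lexx orbT.
move: hb2; rewrite ler_pdivlMr// => hb2; rewrite expr_div_n mulrAC ler_pdivrMr ?exprn_gt0//.
rewrite expr2 -!mulrA ler_wpM2l ?(ltW hc0)//; apply: le_trans hb2.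
by rewrite ler_wpM2l ?(ltW hc0)//; lra.
Unshelve. all: by end_near.
Qed.

Lemma csum_extend (I L : choiceType) (h : L -> I) (h' : I -> L) (f : I -> R[i]) :
  cancel h h' -> (forall i, h (h' i) <> i -> f i = 0) -> summ f ->
  csum (fun j => f (h j)) = csum f.
Proof.
move=> hK f0 sf; symmetry; apply: hassum_csum => e e0.
have sfh : summ (fun j => f (h j)) := summ_inj (can_inj hK) sf.
have [t ut ht] := csumP sfh e0; exists (map h t); first by rewrite map_inj_uniq//; exact: can_inj hK.
move=> s us ts.
pose s' := [seq j <- undup (map h' s) | h j \in s].
have us' : uniq s' by rewrite filter_uniq// undup_uniq.
have -> : \sum_(i <- s) f i = \sum_(j <- s') f (h j).
  rewrite -(big_map h predT f) (bigID (fun i => h (h' i) == i)) /= [X in _ + X]big1 ?addr0 => [|i]; last first.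
    by move/eqP/f0.
  rewrite -big_filter; apply: perm_big; apply: uniq_perm.
  - exact: filter_uniq.
  - by rewrite map_inj_uniq//; exact: can_inj hK.
  move=> i; rewrite mem_filter; apply/andP/mapP.
    move=> [/eqP ii is_]; exists (h' i) => //; rewrite mem_filter ii is_ mem_undup; exact: map_f.
  by move=> [j]; rewrite mem_filter => /andP[hj _] ->; rewrite hK eqxx.
apply: ht => // j jt; rewrite mem_filter mem_undup (ts (h j) (map_f _ jt)) -{1}(hK j).
by apply: map_f; exact: ts (map_f _ jt).
Qed.
End PowerSeries.

(** * The forcing term as a series in the Fourier coefficients *)

Section Forcing.
Variable R : realType.
Notation J := 'rV[int]_2.
Notation seqs := (J -> R[i]).
Variables (w : J -> R) (c : R).
Hypotheses (w1 : forall j, 1 <= w j) (c1 : 1 <= c).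
Hypothesis wD : forall a b, w (a + b) <= c * (w a + w b).
Hypothesis wN : forall a, w (- a) = w a.
Variables (d : nat) (K : 'M[int]_(d, 2)) (om : 'rV[R]_d).
Notation Z := 'rV[int]_d.
Notation pi := (momentum K).
Notation hle := (hle w).
Implicit Types (u : seqs) (t M : R) (x : 'rV[R]_2) (l : Z).

Lemma idot_Kapp l t x : idot l (t *: om + Kapp K x) = t * idot l om + idot (pi l) x.
Proof.
rewrite /idot; under eq_bigr do rewrite mxE mulrDr mxE.
rewrite big_split /= mulr_sumr; congr (_ + _); first by apply: eq_bigr => i _; rewrite mulrCA.
under eq_bigr do rewrite /Kapp mxE mulr_sumr.
rewrite exchange_big /=; apply: eq_bigr => i _; rewrite mxE rmorph_sum mulr_suml.
by apply: eq_bigr => j _; rewrite !mxE rmorphM /= mulrCA mulrC.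
Qed.

Lemma torus_pw u M a b x : hle u M ->
  torus_fun (pw u a b) x = torus_fun u x ^+ a * conjc (torus_fun u x) ^+ b.
Proof.
move=> hu.
have it v (y : seqs) B n A : hle v B -> hle y A -> torus_fun (iter n (cconv v) y) x = torus_fun v x ^+ n * torus_fun y x.
  move=> hv hy; elim: n => [|n ih]; first by rewrite expr0 mul1r.
  rewrite /= torus_cconv ?ih ?exprS ?mulrA//; first exact: hle_summ hv.
  by apply: hle_summ; exact: (hle_iter w1 c1 wD n hv hy).
have hd := hle_delta0 w1 (w := w).
rewrite /pw (it _ _ _ _ _ (hle_conjs wN hu) (hle_iter w1 c1 wD a hu hd)).
rewrite (it _ _ _ _ _ hu hd) torus_delta0 mulr1 mulrC torus_conjs//.
exact: hle_summ hu.
Qed.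

Lemma torus_Vop (V : Z -> R[i]) A t u M x : sumle (fun l => cabs (V l) * w (pi l)) A ->
  hle u M -> torus_fun (Vop K om V t u) x = potential V (t *: om + Kapp K x) * torus_fun u x.
Proof.
move=> hV hu; rewrite /Vop.
have hA : sumle (fun l => cabs (V l)) A.
  by apply: sumle_le hV _ (lexx _) => l; rewrite ler_peMr ?cabs_ge0.
rewrite (@torus_csum_shift _ _ _ pi (fun=> u) (fun=> M) (A * M)).
- rewrite csumZr; last first.
    by exists A; apply: sumle_le hA _ (lexx _) => l; rewrite !cabsM !cabs_expi !mulr1.
  congr (_ * _); apply: eq_csum => l; by rewrite -mulrA -expiD idot_Kapp.
- by move=> _; exact: hle_l1 hu.
- rewrite mulrC; apply: sumle_le (sumleZ (hle_ge0 hu) hA) _ (lexx _) => l.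
  by rewrite cabsM cabs_expi mulr1 mulrC.
Qed.

Lemma torus_Gop (Q : Z -> nat -> nat -> R[i]) rho A t u M x : 0 < rho ->
  sumle (fun x : Z * nat * nat => cabs (Q x.1.1 x.1.2 x.2) * w (pi x.1.1) * rho ^+ (x.1.2 + x.2)) A ->
  hle u M -> Cc c * M <= rho ->
  torus_fun (Gop K om Q t u) x = csum (fun z : Z * nat * nat =>
    Q z.1.1 z.1.2 z.2 * expi (idot z.1.1 (t *: om + Kapp K x)) * torus_fun u x ^+ z.1.2 *
      conjc (torus_fun u x) ^+ z.2).
Proof.
move=> r0 hQ hu Mr; have M0 := hle_ge0 hu.
have c0 : 0 <= Cc c by apply: le_trans (Cc_ge1 c1).
have W : 0 <= W0 w by rewrite /W0; apply: addr_ge0 => //; apply: le_trans (w1 0).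
rewrite /Gop (@torus_csum_shift _ _ _ (fun z : Z * nat * nat => pi z.1.1) (fun z => pw u z.1.2 z.2)
  (fun z => W0 w * (Cc c * M) ^+ (z.1.2 + z.2)) (W0 w * A)).
- apply: eq_csum => z; rewrite (torus_pw _ _ _ hu) idot_Kapp expiD; ring.
- move=> z; exact: hle_l1 (hle_pw w1 c1 wD wN z.1.2 z.2 hu).
- apply: sumle_le (sumleZ W hQ) _ (lexx _) => z.
  rewrite cabsM cabs_expi mulr1 mulrCA ler_wpM2l// -mulrA ler_wpM2l ?cabs_ge0//.
  apply: (@le_trans _ _ (rho ^+ (z.1.2 + z.2))); last by rewrite ler_peMl ?exprn_ge0 ?(ltW r0).
  by rewrite lerXn2r ?nnegrE ?mulr_ge0 ?(ltW r0).
Qed.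

Variables (P : Z -> nat -> nat -> R[i]) (r0 B : R).
Hypothesis hB : sumle (fun k : Z * nat * nat => cabs (P k.1.1 k.1.2 k.2) * r0 ^+ (k.1.2 + k.2)) B.

(** The coefficients of the derivative of [P] in [y2], reindexed by the degree after
    differentiation. *)
Definition dcoef : Z -> nat -> nat -> R[i] := fun l a b => b.+1%:R * P l a b.+1.

Lemma dPfunE (phi : 'rV[R]_d) (y : R[i]) : cabs y < r0 ->
  dPfun P phi y (conjc y) = csum (fun z : Z * nat * nat =>
    dcoef z.1.1 z.1.2 z.2 * expi (idot z.1.1 phi) * y ^+ z.1.2 * conjc y ^+ z.2).
Proof.
move=> yr; have r00 : 0 < r0 by apply: le_lt_trans yr; exact: cabs_ge0.
pose cf (k : Z * nat * nat) := P k.1.1 k.1.2 k.2 * expi (idot k.1.1 phi) * y ^+ k.1.2.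
have hcf : sumle (fun k => cabs (cf k) * r0 ^+ k.2) B.
  apply: sumle_le hB _ (lexx _) => k; rewrite /cf !cabsM cabs_expi mulr1 -mulrA exprD cabsX.
  rewrite ler_wpM2l ?cabs_ge0// ler_wpM2r ?exprn_ge0 ?(ltW r00)//.
  by rewrite lerXn2r ?nnegrE ?cabs_ge0 ?(ltW r00)// ltW.
have yr' : cabs (conjc y) < r0 by rewrite cabs_conj.
rewrite /dPfun /Defs.Pfun (power_series_derive1 hcf yr').
(* The terms of degree 0 in [y2], outside the range of the shift, vanish after differentiation. *)
pose h (z : Z * nat * nat) := (z.1, z.2.+1); pose h' (z : Z * nat * nat) := (z.1, z.2.-1).
rewrite -(@csum_extend _ _ _ h h').
- by apply: eq_csum => z; rewrite /cf /dcoef /=; ring.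
- by case.
- by case=> -[l a] [|b] // _; rewrite mul0r mulr0.
- exact: power_series_deriv_summ hcf yr'.
Qed.

Variable V : Z -> R[i].

Lemma forcingE A rho A' t u M x : 0 < rho ->
  sumle (fun l => cabs (V l) * w (pi l)) A ->
  sumle (fun x : Z * nat * nat => cabs (dcoef x.1.1 x.1.2 x.2) * w (pi x.1.1) * rho ^+ (x.1.2 + x.2)) A' ->
  hle u M -> Cc c * M <= rho -> M < r0 ->
  forcing K V P om t u x = torus_fun (fun k => Vop K om V t u k + Gop K om dcoef t u k) x.
Proof.
move=> rho0 hV hQ hu Mr Mr0.
have sV := hle_summ (Vop_hle w1 c1 wD om hV t hu).
have sG := hle_summ (Gop_hle w1 c1 wD wN om rho0 hQ (m := 0) t (fun l a b h => False_ind _ (elimF idP erefl h)) hu Mr).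
transitivity (torus_fun (Vop K om V t u) x + torus_fun (Gop K om dcoef t u) x).
  rewrite /forcing (torus_Vop _ _ hV hu) (torus_Gop _ _ rho0 hQ hu Mr) dPfunE//.
  apply: le_lt_trans Mr0; apply: csum_le; apply: sumle_le (hle_l1 hu) _ (lexx _) => j.
  by rewrite cabsM cabs_expi mulr1.
rewrite /torus_fun -(csumD (torus_summ x sV) (torus_summ x sG)).
by apply: eq_csum => k; rewrite mulrDl.
Qed.
End Forcing.

(** * Fourier coefficients as integrals over the square *)

Section Fourier.
Variable R : realType.
Notation J := 'rV[int]_2.
Notation mu1 := (@lebesgue_measure R).
Notation mu := (@lebesgue_measure R \x @lebesgue_measure R)%E.
Notation Q := (`[0 : R, 2 * pi] `*` `[0 : R, 2 * pi]).
Implicit Types (m : int) (j : J).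

Lemma idotNl n (l : 'rV[int]_n) (x : 'rV[R]_n) : idot (- l) x = - idot l x.
Proof. by rewrite /idot -sumrN; apply: eq_bigr => i _; rewrite mxE mulrNz mulNr. Qed.

Lemma expi_period m : expi (m%:~R * (2 * pi) : R) = 1.
Proof.
have e1 : expi (2 * pi : R) = 1.
  by rewrite /expi (_ : 2 * pi = pi *+ 2) ?cos2pi ?sin2pi// mulrC mulr_natr.
have en n : expi (n%:R * (2 * pi) : R) = 1.
  by elim: n => [|n ih]; rewrite ?mul0r ?expi0// -natr1 mulrDl mul1r expiD ih e1 mul1r.
case: m => n; first exact: en.
by rewrite NegzE mulrNz mulNr expiN en /= oppr0.
Qed.

Lemma Re_expiZ (z : R[i]) (a : R) : complex.Re (z * expi a) = complex.Re z * cos a - complex.Im z * sin a.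
Proof. by case: z. Qed.

Lemma Im_expiZ (z : R[i]) (a : R) : complex.Im (z * expi a) = complex.Re z * sin a + complex.Im z * cos a.
Proof. by case: z. Qed.

Lemma integral_cos m (ph : R) :
  (\int[mu1]_(y in `[0%R, (2 * pi)%R]) (cos (m%:~R * y + ph))%:E =
   (if m == 0 then 2 * pi * cos ph else 0)%:E)%E.
Proof.
have pi0 : 0 < 2 * pi :> R by rewrite mulr_gt0// pi_gt0.
have [->|m0] := eqVneq m 0.
  under eq_integral do rewrite mul0r add0r.
  by rewrite integral_cst//= lebesgue_measure_itv /= lte_fin pi0 oppr0 adde0 -EFinM mulrC.
have mR : (m%:~R : R) != 0 by rewrite intr_eq0.
pose F (y : R) : R := m%:~R^-1 * sin (m%:~R * y + ph).
have dF (y : R) : is_derive y 1 F (cos (m%:~R * y + ph)).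
  apply: is_derive_eq.
  by rewrite addr0 /GRing.scale /= mulr1 mulrCA mulVf// mulr1.
have cF (y : R) : {for y, continuous F}.
  by apply: differentiable_continuous; apply/derivable1_diffP; case: (dF y).
rewrite (@continuous_FTC2 _ _ F)//.
- rewrite /F mulr0 add0r -EFinB -mulrBr.
  have := expi_period m => /eqP; rewrite eq_complex /= => /andP[/eqP c1 /eqP s0].
  by rewrite sinD c1 s0 mul0r mul1r add0r subrr mulr0.
- apply: continuous_subspaceT => y.
  apply: (@continuous_comp _ _ _ (fun y : R => m%:~R * y + ph) cos); last exact: continuous_cos.
  apply: continuousD; last exact: cvg_cst.
  by apply: continuousM; [exact: cvg_cst|exact: cvg_id].
- split; first by move=> y _; case: (dF y).
  + by apply: cvg_at_right_filter; exact: cF.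
  + by apply: cvg_at_left_filter; exact: cF.
- by move=> y _; rewrite derive1E; apply: derive_val.
Qed.

Lemma measurable_Q : measurable Q.
Proof. exact: measurableX. Qed.

Lemma mu_Q : mu Q = ((2 * pi) ^+ 2)%:E.
Proof.
have pi0 : 0 < 2 * pi :> R by rewrite mulr_gt0// pi_gt0.
have e : mu1 `[0, 2 * pi]%classic = (2 * pi)%:E.
  by rewrite lebesgue_measure_itv /= lte_fin pi0 oppr0 adde0.
by rewrite product_measure1E//= e -EFinM expr2.
Qed.

Lemma measurable_cos2 (a b ph : R) (D : set (R * R)) :
  measurable_fun D (fun x : R * R => cos (a * x.1 + b * x.2 + ph)).
Proof.
apply: (@measurableT_comp _ _ _ _ _ _ cos); first exact: continuous_measurable_fun (@continuous_cos R).
apply: measurable_funD; last exact: measurable_cst.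
apply: measurable_funD; (apply: measurable_funM; first exact: measurable_cst).
  exact: measurable_funTS measurable_fst.
exact: measurable_funTS measurable_snd.
Qed.

Lemma bounded_integrable_Q (f : R * R -> R) B : measurable_fun Q f ->
  (forall x, `|f x| <= B) -> mu.-integrable Q (EFin \o f).
Proof.
move=> mf fB; apply: measurable_bounded_integrable => //.
- exact: measurable_Q.
- have : (mu Q < +oo)%E by rewrite mu_Q ltry.
  exact.
- by exists B; split; rewrite ?num_real// => x Bx y _; apply: le_trans (fB y) (ltW Bx).
Qed.

Lemma Rintegral_cos2 m1 m2 (ph : R) :
  \int[mu]_(x in Q) cos (m1%:~R * x.1 + m2%:~R * x.2 + ph) =
  if (m1 == 0) && (m2 == 0) then (2 * pi) ^+ 2 * cos ph else 0.
Proof.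
set f := fun x : R * R => cos (m1%:~R * x.1 + m2%:~R * x.2 + ph).
have If : mu.-integrable setT ((EFin \o f) \_ Q).
  apply/(integrable_mkcond (mu := mu) _ measurable_Q).
  by apply: (@bounded_integrable_Q f 1) => [|x]; [exact: measurable_cos2|rewrite ler_norml cos_geN1 cos_le1].
rewrite /Rintegral integral_mkcond -(integral12_prod_meas1 If) /fubini_F.
have inner x : (\int[mu1]_y ((EFin \o f) \_ Q) (x, y) =
   ((fun x => (if m2 == 0 then 2 * pi * cos (m1%:~R * x + ph) else 0)%:E) \_ (`[0%R, (2 * pi)%R] : set R)) x)%E.
  rewrite [RHS]patchE; case: ifPn => xQ.
    rewrite -(integral_cos m2 (m1%:~R * x + ph)) [RHS]integral_mkcond; congr (integral _ _ _); apply/funext => y.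
    rewrite !patchE in_setX /= xQ /=; case: ifP => // _.
    by rewrite /f /=; congr (cos _)%:E; ring.
  rewrite (eq_integral (fun=> 0%E)) ?integral0// => y _.
  by rewrite patchE in_setX /= (negbTE xQ).
under eq_integral do rewrite inner.
rewrite -integral_mkcond; case: (m2 == 0); rewrite ?andbF ?andbT; last by rewrite integral0.
under eq_integral do rewrite EFinM.
rewrite integralZl//=.
  by rewrite integral_cos; case: eqP => _; rewrite -EFinM /=; [ring|rewrite mulr0].
apply: (@measurable_bounded_integrable _ _ _ mu1 (fun y : R => cos (m1%:~R * y + ph))) => //.
- by rewrite /= lebesgue_measure_itv; case: ifP => _ //; rewrite /= ltry.
- apply: measurable_funTS; apply: continuous_measurable_fun => y.
  apply: (@continuous_comp _ _ _ (fun y : R => m1%:~R * y + ph) cos); last exact: continuous_cos.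
  apply: continuousD; last exact: cvg_cst.
  by apply: continuousM; [exact: cvg_cst|exact: cvg_id].
- exists 1; split; rewrite ?num_real// => x Bx y _ /=; apply: le_trans (ltW Bx).
  by rewrite ler_norml cos_geN1 cos_le1.
Qed.

(** Measurability of [F] is not assumed: it comes from approximants of precision [1/(n+1)], and
    integrability from a single bounded approximant. *)
Lemma Rintegral_uniform (F : R * R -> R) (I : R) :
  (forall e : R, 0 < e -> exists2 G : R * R -> R,
     [/\ measurable_fun Q G, (exists B, forall x, `|G x| <= B) & \int[mu]_(x in Q) G x = I] &
     forall x, `|F x - G x| <= e) ->
  \int[mu]_(x in Q) F x = I.
Proof.
move=> h.
have mF : measurable_fun Q F.
  have /choice[G hG] : forall n : nat, exists G : R * R -> R, measurable_fun Q G /\ forall x, `|F x - G x| <= n.+1%:R^-1.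
    move=> n; have [|G [mG _ _] FG] := h n.+1%:R^-1; first by rewrite invr_gt0.
    by exists G.
  apply/measurable_EFinP; apply: (@emeasurable_fun_cvg _ _ _ _ (fun n x => (G n x)%:E)).
    by move=> n; apply/measurable_EFinP; case: (hG n).
  move=> x _; apply: cvg_EFin; first by near=> n.
  apply/cvgrPdist_le => e e0; near=> n; rewrite /=.
  have [_ hn] := hG n; apply: le_trans (hn x) _.
  by apply: ltW; near: n; exact: (near_infty_natSinv_lt (PosNum e0)).
have [|G1 [mG1 [B1 hB1] _] FG1] := h 1; first by [].
have iF : mu.-integrable Q (EFin \o F).
  apply: (@bounded_integrable_Q F (B1 + 1)) => // x.
  rewrite -(subrK (G1 x) (F x)) addrC; apply: le_trans (ler_normD _ _) _; exact: lerD.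
apply/eqP; rewrite -subr_eq0 -normr_eq0 -[X in X == 0]normr_id; apply/eqP.
suff : `|\int[mu]_(x in Q) F x - I| <= 0 by rewrite normr_le0 normr_id => /eqP ->; rewrite normr0.
apply/ler_addgt0Pr => e e0; rewrite add0r.
have P0 : 0 < (2 * pi) ^+ 2 :> R by rewrite exprn_gt0// mulr_gt0// pi_gt0.
have [|G [mG [B hB] <-] FG] := h (e / (2 * pi) ^+ 2); first by rewrite divr_gt0.
have iG := bounded_integrable_Q mG hB.
rewrite -RintegralB//; last exact: measurable_Q.
have mQ := measurable_Q.
have iB : mu.-integrable Q (EFin \o (fun x => F x - G x)).
  by apply: (@bounded_integrable_Q _ (e / (2 * pi) ^+ 2)) => //; exact: measurable_funB.
apply: (@le_trans _ _ (\int[mu]_(x in Q) `|F x - G x|)); first by apply: le_normr_Rintegral; [exact: measurable_Q|exact: iB].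
apply: (@le_trans _ _ (\int[mu]_(x in Q) (e / (2 * pi) ^+ 2))).
  apply: le_Rintegral => // [|].
  - apply: (@bounded_integrable_Q _ (e / (2 * pi) ^+ 2)) => [|x]; last by rewrite normr_id.
    by apply: measurableT_comp => //; exact: measurable_funB.
  - apply: (@bounded_integrable_Q _ (e / (2 * pi) ^+ 2)) => [|x]; first exact: measurable_cst.
    by rewrite ger0_norm// divr_ge0 ?ltW.
have fQ : fine (mu Q) = (2 * pi) ^+ 2 by rewrite mu_Q.
by rewrite Rintegral_cst// [fine _]fQ divfK// gt_eqF.
Unshelve. all: by end_near.
Qed.

Lemma Rintegral_sum (I : Type) (s : seq I) (f : I -> R * R -> R) (B v : I -> R) :
  (forall i, measurable_fun Q (f i)) -> (forall i x, `|f i x| <= B i) ->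
  (forall i, \int[mu]_(x in Q) f i x = v i) ->
  [/\ measurable_fun Q (fun x => \sum_(i <- s) f i x),
      forall x, `|\sum_(i <- s) f i x| <= \sum_(i <- s) B i &
      \int[mu]_(x in Q) (\sum_(i <- s) f i x) = \sum_(i <- s) v i].
Proof.
move=> mf fB fv; elim: s => [|i s [ih1 ih2 ih3]].
  split.
  - rewrite (_ : (fun x => _) = cst 0); last by apply/funext => x; rewrite big_nil.
    exact: measurable_cst.
  - by move=> x; rewrite !big_nil normr0.
  - under eq_Rintegral do rewrite big_nil.
    by rewrite Rintegral_cst ?mul0r ?big_nil//; exact: measurable_Q.
split.
- rewrite (_ : (fun x => _) = f i \+ (fun x => \sum_(i <- s) f i x)); last by apply/funext => x; rewrite big_cons.
  exact: measurable_funD.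
- by move=> x; rewrite !big_cons; apply: le_trans (ler_normD _ _) (lerD _ _).
- under eq_Rintegral do rewrite big_cons.
  rewrite RintegralD ?ih3 ?fv ?big_cons//; first exact: measurable_Q.
    exact: (bounded_integrable_Q (mf i) (fB i)).
  exact: (bounded_integrable_Q ih1 ih2).
Qed.

Lemma idot_row2 j (x : R * R) : idot j (row2 x) = (j 0 0)%:~R * x.1 + (j 0 1)%:~R * x.2.
Proof. by rewrite /idot big_ord_recl big_ord1 !mxE /=; do 2 f_equal; congr (_%:~R); congr (j _ _); exact: val_inj. Qed.

Lemma Rintegral_mode (z : R[i]) j :
  let P := (2 * pi) ^+ 2 in let f x := z * expi (idot j (row2 x)) in
  [/\ measurable_fun Q (fun x => complex.Re (f x)), measurable_fun Q (fun x => complex.Im (f x)),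
    \int[mu]_(x in Q) complex.Re (f x) = (if j == 0 then P * complex.Re z else 0) &
    \int[mu]_(x in Q) complex.Im (f x) = (if j == 0 then P * complex.Im z else 0)].
Proof.
move=> P f.
have mQ := measurable_Q.
pose ps (x : R * R) := (j 0 0)%:~R * x.1 + (j 0 1)%:~R * x.2.
have jE : (j == 0) = (j 0 0 == 0) && (j 0 1 == 0).
  apply/eqP/andP => [->|[/eqP a /eqP b]]; first by rewrite !mxE.
  by apply/rowP => -[[|[|//]] h]; rewrite mxE; [rewrite -a|rewrite -b]; congr (j _ _); exact: val_inj.
(* The sine is written as a cosine of phase [- pi / 2], so that one integral formula serves for both
   parts. *)
pose C (x : R * R) := cos (ps x + 0); pose S (x : R * R) := cos (ps x + (- (pi / 2))).
have mC : measurable_fun Q C by exact: measurable_cos2.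
have mS : measurable_fun Q S by exact: measurable_cos2.
have b1 (a : R) : `|cos a| <= 1 by rewrite ler_norml cos_geN1 cos_le1.
have iC : mu.-integrable Q (EFin \o C) by apply: (bounded_integrable_Q (B := 1)) => // x; exact: b1.
have iS : mu.-integrable Q (EFin \o S) by apply: (bounded_integrable_Q (B := 1)) => // x; exact: b1.
have vC : \int[mu]_(x in Q) C x = if j == 0 then P else 0.
  by rewrite /C /ps Rintegral_cos2 jE cos0 mulr1.
have vS : \int[mu]_(x in Q) S x = 0.
  by rewrite /S /ps Rintegral_cos2 cosN cos_pihalf mulr0 if_same.
have sE x : sin (ps x) = S x by rewrite /S cosBpihalf.
have cE x : cos (ps x) = C x by rewrite /C addr0.
have fR : (fun x => complex.Re (f x)) = (fun x => complex.Re z * C x - complex.Im z * S x).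
  by apply/funext => x; rewrite /f Re_expiZ idot_row2 -/(ps x) sE cE.
have fI : (fun x => complex.Im (f x)) = (fun x => complex.Re z * S x + complex.Im z * C x).
  by apply/funext => x; rewrite /f Im_expiZ idot_row2 -/(ps x) sE cE.
have mZ (a : R) g : measurable_fun Q g -> measurable_fun Q (fun x => a * g x).
  by move=> mg; apply: measurable_funM => //; exact: measurable_cst.
have iZ (a : R) (ph : R) : mu.-integrable Q (EFin \o (fun x => a * cos (ps x + ph))).
  apply: (bounded_integrable_Q (B := `|a|)); first by apply: mZ; exact: measurable_cos2.
  by move=> x; rewrite normrM ler_piMr.
split.
- by rewrite fR; apply: measurable_funB; apply: mZ.
- by rewrite fI; apply: measurable_funD; apply: mZ.
- rewrite fR RintegralB//; try exact: iZ.
  by rewrite !RintegralZl// vC vS mulr0 subr0; case: ifP; rewrite ?mulr0// mulrC.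
- rewrite fI RintegralD//; try exact: iZ.
  by rewrite !RintegralZl// vC vS mulr0 add0r; case: ifP; rewrite ?mulr0// mulrC.
Qed.

(** Partial sums converge uniformly. Once the finite set contains [j], every approximant has the
    same coefficient, as the mode [j] alone survives the integration. *)
Lemma fourier_coef_torus (g : J -> R[i]) j : summ g -> fourier_coef (torus_fun g) j = g j.
Proof.
move=> sg; have [M hM] := sg.
have P0 : 0 < (2 * pi) ^+ 2 :> R by rewrite exprn_gt0// mulr_gt0// pi_gt0.
pose f k (x : R * R) := g k * expi (idot (k - j) (row2 x)).
have approx (e : R) : 0 < e -> exists s : seq J, [/\ uniq s, j \in s & forall x : R * R,
    cabs (torus_fun g (row2 x) * expi (- idot j (row2 x)) - \sum_(k <- s) f k x) <= e].
  move=> e0; have [s0 us0 h0] := sumle_tail (fun k => cabs_ge0 (g k)) hM e0.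
  have [s [us ss js]] := uniq_cover s0 [:: j]; exists s; split => //; first by apply: js; rewrite inE.
  move=> x.
  have e1 : torus_fun g (row2 x) * expi (- idot j (row2 x)) = csum (fun k => f k x).
    rewrite -csumZr; last exact: torus_summ.
    by apply: eq_csum => k; rewrite -mulrA -expiD /f idotD idotNl.
  have s1 : summ (fun k => f k x) by exists M; apply: sumle_le hM _ (lexx _) => k; rewrite cabsM cabs_expi mulr1.
  pose f' k := if k \in s then f k x else 0.
  have s2 : summ f' by apply: (summ_fin us) => k; rewrite /f' => /negbTE ->.
  have e2 : \sum_(k <- s) f k x = csum f'.
    rewrite (csum_fin us) => [|k]; last by rewrite /f' => /negbTE ->.
    by rewrite big_seq [RHS]big_seq; apply: eq_bigr => k ks; rewrite /f' ks.
  rewrite e1 e2 -csumB//; apply: csum_le => t ut.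
  apply: le_trans (h0 [seq k <- t | k \notin s] _ _); last 2 first.
  - exact: filter_uniq.
  - by move=> k; rewrite mem_filter => /andP[ks _]; apply: contra ks; exact: ss.
  rewrite big_filter [leRHS]big_mkcond; apply: ler_sum => k _; rewrite /f'.
  by case: (k \in s); rewrite ?subrr ?cabs0//= subr0 cabsM cabs_expi mulr1.
have sumif (s : seq J) (F : J -> R) : uniq s -> j \in s ->
    \sum_(k <- s) (if k - j == 0 then F k else 0) = F j.
  move=> us js; rewrite (bigD1_seq j)//= subrr eqxx big1 ?addr0// => k kj.
  by rewrite subr_eq0 (negbTE kj).
have bRe k x : `|complex.Re (f k x)| <= cabs (g k).
  by apply: le_trans (cabs_Re _) _; rewrite cabsM cabs_expi mulr1.
have bIm k x : `|complex.Im (f k x)| <= cabs (g k).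
  by apply: le_trans (cabs_Im _) _; rewrite cabsM cabs_expi mulr1.
have RS (s : seq J) (F : J -> R[i]) : complex.Re (\sum_(k <- s) F k) = \sum_(k <- s) complex.Re (F k).
  by elim: s => [|k s ih]; rewrite ?big_nil// !big_cons -ih; case: (F k) (\sum_(k <- s) _) => a b [c d].
have IS (s : seq J) (F : J -> R[i]) : complex.Im (\sum_(k <- s) F k) = \sum_(k <- s) complex.Im (F k).
  by elim: s => [|k s ih]; rewrite ?big_nil// !big_cons -ih; case: (F k) (\sum_(k <- s) _) => a b [c d].
have RB (x y : R[i]) : complex.Re x - complex.Re y = complex.Re (x - y) by case: x y => a b [].
have IB (x y : R[i]) : complex.Im x - complex.Im y = complex.Im (x - y) by case: x y => a b [].
rewrite /fourier_coef /= (@Rintegral_uniform _ ((2 * pi) ^+ 2 * complex.Re (g j))); last first.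
  move=> e e0; have [s [us js hs]] := approx e e0.
  exists (fun x => \sum_(k <- s) complex.Re (f k x)); last first.
    by move=> x; rewrite -RS RB; apply: le_trans (cabs_Re _) (hs x).
  have [h1 h2 h3] := Rintegral_sum s (v := fun k => if k - j == 0 then (2 * pi) ^+ 2 * complex.Re (g k) else 0) (fun k => let: And4 a _ _ _ := Rintegral_mode (g k) (k - j) in a)
     bRe (fun k => let: And4 _ _ a _ := Rintegral_mode (g k) (k - j) in a).
  by split=> //; [exists (\sum_(k <- s) cabs (g k))|rewrite h3 (sumif s (fun k => (2 * pi) ^+ 2 * complex.Re (g k)))].
rewrite (@Rintegral_uniform _ ((2 * pi) ^+ 2 * complex.Im (g j))); last first.
  move=> e e0; have [s [us js hs]] := approx e e0.
  exists (fun x => \sum_(k <- s) complex.Im (f k x)); last first.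
    by move=> x; rewrite -IS IB; apply: le_trans (cabs_Im _) (hs x).
  have [h1 h2 h3] := Rintegral_sum s (v := fun k => if k - j == 0 then (2 * pi) ^+ 2 * complex.Im (g k) else 0) (fun k => let: And4 _ a _ _ := Rintegral_mode (g k) (k - j) in a)
     bIm (fun k => let: And4 _ _ _ a := Rintegral_mode (g k) (k - j) in a).
  by split=> //; [exists (\sum_(k <- s) cabs (g k))|rewrite h3 (sumif s (fun k => (2 * pi) ^+ 2 * complex.Im (g k)))].
move: P0; set P := (2 * pi) ^+ 2 => P0; have Pn : P != 0 by rewrite gt_eqF.
case: (g j) => a b /=; apply/eqP; rewrite eq_complex /= !mul0r subr0 addr0.
by rewrite ![_^-1 * (_ * _)]mulKf// !eqxx.
Qed.
End Fourier.

(** * Uniqueness of Fourier coefficients *)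

Section Uniqueness.
Variable R : realType.

Lemma idotDr n (l : 'rV[int]_n) (x y : 'rV[R]_n) : idot l (x + y) = idot l x + idot l y.
Proof. by rewrite /idot -big_split; apply: eq_bigr => i _; rewrite mxE mulrDr. Qed.

Lemma expi_pi : expi (pi : R) = -1.
Proof. by rewrite /expi cospi sinpi; apply/eqP; rewrite eq_complex /= oppr0 !eqxx. Qed.

Lemma half_turn n (l : 'rV[int]_n) : l != 0 -> exists x : 'rV[R]_n, expi (idot l x) = -1.
Proof.
move=> l0; pose N : R := \sum_i (l 0 i)%:~R ^+ 2.
have [i li] : exists i, l 0 i != 0.
  by apply/existsP; apply: contraNT l0 => /existsPn h; apply/eqP/rowP => i;
    rewrite mxE; apply/eqP; rewrite -[_ == _]negbK h.
have N0 : 0 < N.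
  rewrite /N (bigD1 i)//= ltr_pwDl//; last by apply: sumr_ge0 => j _; exact: sqr_ge0.
  by rewrite exprn_even_gt0//= intr_eq0.
exists (\row_i (pi / N * (l 0 i)%:~R)).
rewrite /idot (_ : \sum__ _ = pi) ?expi_pi//.
under eq_bigr do rewrite mxE mulrCA -expr2.
by rewrite -mulr_sumr -/N divfK// gt_eqF.
Qed.

(** No integration: averaging the function with its translate by half a turn of the relative mode
    [m i] multiplies the coefficients by factors [fac] of modulus at most 1, equal to 1 at [i0] and
    to 0 at [i]. Finitely many averages remove every mode of [s] except [i0], and the tail stays
    below [e]. *)
Lemma fourier_unique n (I : choiceType) (iota : I -> 'rV[int]_n) (c : I -> R[i]) :
  injective iota -> summ c ->
  (forall x, csum (fun i => c i * expi (idot (iota i) x)) = 0) -> forall i, c i = 0.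
Proof.
move=> inj sc hc i0; have [M hM] := sc.
apply: cabs_small => e e0.
have [s0 us0 h0] := sumle_tail (fun i => cabs_ge0 (c i)) hM e0.
have [s [us ss is0]] := uniq_cover s0 [:: i0].
pose m i := iota i - iota i0.
have /choice[ps hps] : forall i, exists x : 'rV[R]_n, i != i0 -> expi (idot (m i) x) = -1.
  move=> i; have [->|ii] := eqVneq i i0; first by exists 0.
  have [|x hx] := @half_turn n (m i); last by exists x.
  by rewrite subr_eq0; apply: contra ii => /eqP/inj ->.
pose fac i (x : 'rV[R]_n) := (1 + expi (idot (m i) x)) / 2.
have fac1 i x : cabs (fac i x) <= 1.
  rewrite cabsM cabsV (cabs_nat R 2) ler_pdivrMr// mul1r.
  by apply: le_trans (cabsD _ _) _; rewrite cabs1 cabs_expi.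
have prod1 i (L : seq 'rV[R]_n) : cabs (\prod_(x <- L) fac i x) <= 1.
  elim: L => [|x L ih]; first by rewrite big_nil cabs1.
  by rewrite big_cons cabsM mulr_ile1// cabs_ge0.
have sm L x : summ (fun i => c i * expi (idot (m i) x) * \prod_(y <- L) fac i y).
  by apply: (summ_le hM) => i; rewrite cabsM cabsM cabs_expi mulr1 ler_piMr ?cabs_ge0.
have key (L : seq 'rV[R]_n) x : csum (fun i => c i * expi (idot (m i) x) * \prod_(y <- L) fac i y) = 0.
  elim: L x => [|y L ih] x.
    under eq_csum do rewrite big_nil mulr1 idotD idotNl expiD mulrA.
    rewrite csumZr ?hc ?mul0r//; apply: (summ_le hM) => i; by rewrite cabsM cabs_expi mulr1.
  have e1 i : c i * expi (idot (m i) x) * \prod_(z <- y :: L) fac i z =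
     2^-1 * (c i * expi (idot (m i) x) * \prod_(z <- L) fac i z + c i * expi (idot (m i) (x + y)) * \prod_(z <- L) fac i z).
    rewrite big_cons idotDr expiD /fac; ring.
  by rewrite (eq_csum e1) csumZ ?csumD ?ih ?addr0 ?mulr0//; exact: summD.
pose L := [seq ps i | i <- s & i != i0].
pose f i := c i * expi (idot (m i) 0) * \prod_(y <- L) fac i y.
have f0 i : i \in s -> i != i0 -> f i = 0.
  move=> is_ ii; rewrite /f (_ : \prod_(_ <- _) _ = 0) ?mulr0//.
  have : ps i \in L by apply: map_f; rewrite mem_filter ii.
  elim: L {f} => [//|x L ih]; rewrite inE big_cons => /orP[/eqP <-|/ih ->]; last by rewrite mulr0.
  by rewrite /fac hps// subrr mul0r mul0r.
have fi0 : f i0 = c i0.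
  have m0 : m i0 = 0 by rewrite /m subrr.
  rewrite /f m0 idot0l expi0 mulr1 big1 ?mulr1// => x _.
  by rewrite /fac m0 idot0l expi0 divff.
pose f' i := if i \in s then f i else 0.
have s2 : summ f' by apply: (summ_fin us) => i; rewrite /f' => /negbTE ->.
have e2 : csum f' = c i0.
  rewrite (csum1 (i0 := i0)) => [|i ii]; first by rewrite /f' is0 ?inE// fi0.
  by rewrite /f'; case: ifP => // is_; exact: f0.
have := key L 0; rewrite -/f => e1; rewrite -e2 -[csum f']subr0 -e1 -csumB//; last exact: sm.
apply: csum_le => t ut.
apply: le_trans (h0 [seq k <- t | k \notin s] _ _); last 2 first.
- exact: filter_uniq.
- by move=> k; rewrite mem_filter => /andP[ks _]; apply: contra ks; exact: ss.
rewrite big_filter [leRHS]big_mkcond; apply: ler_sum => k _; rewrite /f'.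
case: (k \in s); rewrite ?subrr ?cabs0//= sub0r cabsN /f cabsM cabsM cabs_expi mulr1.
by rewrite ler_piMr ?cabs_ge0.
Qed.

Lemma potential_hermitian d (V : 'rV[int]_d -> R[i]) : summ V ->
  (forall phi, complex.Im (potential V phi) = 0) -> forall l, conjc (V l) = V (- l).
Proof.
move=> sV hV l; have [M hM] := sV.
pose W l := conjc (V (- l)).
have sW : summ W.
  by exists M; have := sumle_inj (@oppr_inj _) hM => /sumle_le; apply => // k /=; rewrite /W cabs_conj.
have e : forall k, V k - W k = 0.
  apply: (@fourier_unique d _ id (fun k => V k - W k)) => // [|x]; first exact: summB.
  have s1 : summ (fun k => V k * expi (idot k x)).
    by apply: (summ_le hM) => k; rewrite cabsM cabs_expi mulr1.
  have s2 : summ (fun k => W k * expi (idot k x)).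
    by case: sW => N hN; apply: (summ_le hN) => k; rewrite cabsM cabs_expi mulr1.
  under eq_csum do rewrite mulrBl.
  rewrite csumB//; apply/eqP; rewrite subr_eq0; apply/eqP.
  have r0 : csum (fun k => V k * expi (idot k x)) = conjc (csum (fun k => V k * expi (idot k x))).
    have := hV x; rewrite /potential; case: (csum _) => a b /= ->; by rewrite oppr0.
  rewrite r0 -csum_conj//.
  have s3 : summ (fun k => conjc (V k * expi (idot k x))).
    by case: s1 => N hN; apply: (summ_le hN) => k; rewrite cabs_conj.
  rewrite -(csum_reindex (@opprK _) (@opprK _) s3); apply: eq_csum => k.
  by rewrite conjcM /W idotNl -expiN opprK.
by have /eqP := e (- l); rewrite subr_eq0 /W opprK => /eqP ->.
Qed.

(** For [y1] and [y2] on a circle of radius [rho], the series becomes trigonometric in [d + 2]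
    variables, and the gauge invariance multiplies each mode by the phase of its charge [ch].
    Uniqueness of coefficients applies to the difference of the two series. *)
Lemma gauge_coef d (P : 'rV[int]_d -> nat -> nat -> R[i]) (r0 M : R) : 0 < r0 ->
  sumle (fun k : 'rV[int]_d * nat * nat => cabs (P k.1.1 k.1.2 k.2) * r0 ^+ (k.1.2 + k.2)) M ->
  (forall phi y1 y2 (t : R), cabs y1 < r0 -> cabs y2 < r0 ->
     Defs.Pfun P (phi + const_mx t) (expi t * y1) (expi (- t) * y2) = Defs.Pfun P phi y1 y2) ->
  forall (l : 'rV[int]_d) (d1 d2 : nat), (\sum_i l 0 i) + d1%:Z - d2%:Z <> 0 -> P l d1 d2 = 0.
Proof.
move=> r00 hM hg l d1 d2; set q := _ - _ => q0.
have qR : (q%:~R : R) != 0 by rewrite intr_eq0; apply/eqP.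
(* This time turns the charge [q] into half a turn, so that the factor of the coefficient in
   question is [-2]. *)
pose t : R := pi / q%:~R.
pose rho := r0 / 2.
have rho0 : 0 < rho by rewrite divr_gt0.
have rr : rho < r0 by rewrite /rho; lra.
pose ch (k : 'rV[int]_d * nat * nat) : R := ((\sum_i k.1.1 0 i) + k.1.2%:Z - k.2%:Z)%:~R.
pose io (k : 'rV[int]_d * nat * nat) : 'rV[int]_(d + 2) :=
  row_mx k.1.1 (\row_(i < 2) if val i == 0%N then k.1.2%:Z else k.2%:Z).
have ioI : injective io.
  move=> [[k a] b] [[k' a'] b'] /eq_row_mx /= [-> /rowP h].
  by have := h 0; have := h 1; rewrite !mxE /= => -[->] [->].
pose c k := P k.1.1 k.1.2 k.2 * (rho ^+ (k.1.2 + k.2))%:C * (expi (t * ch k) - 1).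
have sc0 : summ (fun k : 'rV[int]_d * nat * nat => P k.1.1 k.1.2 k.2 * (rho ^+ (k.1.2 + k.2))%:C).
  apply: (summ_le hM) => k; rewrite cabsM cabs_real ger0_norm ?exprn_ge0 ?(ltW rho0)//.
  by rewrite ler_wpM2l ?cabs_ge0// lerXn2r ?nnegrE ?(ltW rho0) ?(ltW r00)// ltW.
have sc : summ c.
  have [N hN] := sc0; apply: (summ_le (sumleZ (_ : 0 <= 2) hN)) => // k.
  rewrite /c [leLHS]cabsM mulrC ler_wpM2r ?cabs_ge0//.
  by apply: le_trans (cabsB _ _) _; rewrite cabs_expi cabs1.
suff : c (l, d1, d2) = 0.
  rewrite /c /= /ch /= -/q /t divfK// expi_pi => /eqP.
  rewrite !mulf_eq0 -orbA => /or3P[/eqP//| |].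
  - by rewrite (_ : 0 = (0 : R)%:C)// (inj_eq (@complexI _)) expf_eq0 (gt_eqF rho0) andbF.
  - by rewrite -opprD oppr_eq0 -(natrD _ 1 1) pnatr_eq0.
apply: (fourier_unique ioI sc) => x.
pose phi : 'rV[R]_d := lsubmx x; pose al : R := rsubmx x 0 0; pose be : R := rsubmx x 0 1.
have xE k : idot (io k) x = idot k.1.1 phi + (k.1.2%:R * al + k.2%:R * be).
  rewrite /idot big_split_ord /=; congr (_ + _).
    by apply: eq_bigr => i _; rewrite row_mxEl !mxE.
  rewrite big_ord_recl big_ord1 !row_mxEr !mxE /= /al /be !mxE.
  by congr (_ * x 0 _ + _ * x 0 _); apply: val_inj.
have term k : P k.1.1 k.1.2 k.2 * expi (idot k.1.1 phi) * (rho%:C * expi al) ^+ k.1.2 * (rho%:C * expi be) ^+ k.2 =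
    P k.1.1 k.1.2 k.2 * (rho ^+ (k.1.2 + k.2))%:C * expi (idot (io k) x).
  have ex (a : R) n : expi a ^+ n = expi (n%:R * a).
    by elim: n => [|n ih]; rewrite ?mul0r ?expi0// exprS ih -natr1 mulrDl mul1r addrC expiD.
  have rX n : (rho ^+ n)%:C = rho%:C ^+ n.
    by elim: n => [//|n ih]; rewrite !exprS rmorphM /= ih.
  rewrite rX [rho%:C ^+ (_ + _)]exprD xE !expiD !exprMn !ex; ring.
have term2 k : P k.1.1 k.1.2 k.2 * expi (idot k.1.1 (phi + const_mx t)) * (expi t * (rho%:C * expi al)) ^+ k.1.2 *
    (expi (- t) * (rho%:C * expi be)) ^+ k.2 =
    P k.1.1 k.1.2 k.2 * (rho ^+ (k.1.2 + k.2))%:C * expi (idot (io k) x) * expi (t * ch k).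
  rewrite -term [(expi t * _) ^+ _]exprMn [(expi (- t) * _) ^+ _]exprMn idotDr expiD.
  have ex (a : R) n : expi a ^+ n = expi (n%:R * a).
    by elim: n => [|n ih]; rewrite ?mul0r ?expi0// exprS ih -natr1 mulrDl mul1r addrC expiD.
  have -> : idot k.1.1 (const_mx t) = t * (\sum_i k.1.1 0 i)%:~R.
    rewrite rmorph_sum mulr_sumr; apply: eq_bigr => i _; by rewrite mxE mulrC.
  have -> : expi (t * ch k) = expi (t * (\sum_i k.1.1 0 i)%:~R) * expi (k.1.2%:R * t) * expi (k.2%:R * - t).
    rewrite -!expiD; congr expi; rewrite /ch intrB intrD -!pmulrn; ring.
  rewrite !ex; ring.
have yr (a : R) : cabs (rho%:C * expi a) < r0.
  by rewrite cabsM cabs_expi mulr1 cabs_real ger0_norm// ltW.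
have := hg phi (rho%:C * expi al) (rho%:C * expi be) t (yr al) (yr be).
rewrite /Defs.Pfun (eq_csum term) (eq_csum term2) => /eqP; rewrite -subr_eq0.
have [N hN] := sc0.
rewrite -csumB; first last.
- by apply: (summ_le hN) => k; rewrite [leLHS]cabsM cabs_expi mulr1.
- by apply: (summ_le hN) => k; rewrite [leLHS]cabsM cabs_expi mulr1 [leLHS]cabsM cabs_expi mulr1.
move=> /eqP e; rewrite -[RHS]e; apply: eq_csum => k; rewrite /c; ring.
Qed.
End Uniqueness.

(** * Differential equations in sequence spaces *)

Section Derivatives.
Variable R : realType.
Implicit Types (t s a b e : R).

(** Differentiability as a linear error bound avoids the division by [s - t], and the bounds add up
    under sums and products. *)
Definition rder (f : R -> R) t (v : R) := forall e, 0 < e ->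
  \forall s \near t, `|f s - f t - (s - t) * v| <= e * `|s - t|.

Lemma rderP (f : R -> R) t v : rder f t v <-> is_derive t 1 f v.
Proof.
split=> [h|df].
  have cv : h^-1 *: (f (h *: (1 : R) + t) - f t) @[h --> 0^'] --> v.
    apply/cvgrPdist_le => e e0; have [d /= d0 hd] := (nbhs_ballP _ _).1 (h e e0).
    near=> x; have x0 : x != 0 by near: x; exact: nbhs_dnbhs_neq.
    have xd : `|x| < d by near: x; exact: dnbhs0_lt.
    have : ball t d (x + t) by rewrite /ball /= opprD addrCA subrr addr0 normrN.
    move/hd; rewrite addrK /GRing.scale /= mulr1 => hx.
    rewrite -(ler_pM2l (_ : 0 < `|x|)) ?normr_gt0// -normrM mulrBr mulrA divff// mul1r distrC.
    by rewrite [leRHS]mulrC.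
  apply: DeriveDef; first by apply/cvg_ex; exists v.
  exact: cvg_lim cv.
move=> e e0; have /cvgrPdist_le/(_ e e0) := ex_derive (is_derive := df).
rewrite [lim _](_ : _ = v); last exact: derive_val.
rewrite near_withinE => /nbhs_ballP[d /= d0 hd].
apply/nbhs_ballP; exists d => //= s st.
have [->|st0] := eqVneq s t; first by rewrite !subrr mul0r subrr normr0 mulr0.
have : ball (0 : R) d (s - t) by move: st; rewrite /ball /= sub0r normrN distrC.
move/hd; rewrite subr_eq0 => /(_ st0) /=; rewrite /GRing.scale /= mulr1 subrK => hx.
rewrite -(ler_pM2l (_ : 0 < `|s - t|)) in hx; last by rewrite normr_gt0 subr_eq0.
rewrite -normrM mulrBr mulrA divff ?mul1r ?subr_eq0// in hx.
by rewrite distrC [leRHS]mulrC.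
Unshelve. all: by end_near.
Qed.

Definition cder (f : R -> R[i]) t (v : R[i]) := forall e, 0 < e ->
  \forall s \near t, cabs (f s - f t - (s - t)%:C * v) <= e * `|s - t|.

Lemma cderP (f : R -> R[i]) t v : cder f t v <-> is_cderive f t v.
Proof.
have ReE s : complex.Re (f s - f t - (s - t)%:C * v) =
    complex.Re (f s) - complex.Re (f t) - (s - t) * complex.Re v.
  by move: (f s) (f t) (v) => [a b] [c d] [x y] /=; rewrite mul0r subr0.
have ImE s : complex.Im (f s - f t - (s - t)%:C * v) =
    complex.Im (f s) - complex.Im (f t) - (s - t) * complex.Im v.
  by move: (f s) (f t) (v) => [a b] [c d] [x y] /=; rewrite mul0r addr0.
split=> [h|[/rderP h1 /rderP h2] e e0].
  split; apply/rderP => e /h; apply: filterS => s; apply: le_trans.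
    by rewrite -ReE cabs_Re.
  by rewrite -ImE cabs_Im.
have e2 : 0 < e / 2 by rewrite divr_gt0.
near=> s; apply: le_trans (cabs_le_ReIm _) _; rewrite ReE ImE [e]splitr [leRHS]mulrDl.
by apply: lerD; near: s; [exact: h1|exact: h2].
Unshelve. all: by end_near.
Qed.

Lemma cder_cont (f : R -> R[i]) t v : cder f t v -> forall e, 0 < e ->
  \forall s \near t, cabs (f s - f t) <= e.
Proof.
move=> h e e0; pose K := 1 + cabs v; have K0 : 0 < K by rewrite /K ltr_pwDl// cabs_ge0.
have h1 := h 1 ltr01; near=> s.
have st : `|s - t| <= e / K.
  near: s; apply: filterS (nbhsx_ballx t (e / K) (divr_gt0 e0 K0)) => s.
  by rewrite /ball /= distrC => /ltW.
rewrite -[f s - f t](subrK ((s - t)%:C * v)); apply: le_trans (cabsD _ _) _.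
apply: (@le_trans _ _ (1 * `|s - t| + `|s - t| * cabs v)).
  by apply: lerD; [near: s|rewrite cabsM cabs_real].
by move: st; rewrite ler_pdivlMr// /K; lra.
Unshelve. all: by end_near.
Qed.

Lemma cder_cst (z : R[i]) t : cder (fun=> z) t 0.
Proof. by move=> e e0; near=> s; rewrite mulr0 subrr subr0 cabs0 mulr_ge0// ltW.
Unshelve. all: by end_near. Qed.

Lemma cderD f g t u v : cder f t u -> cder g t v -> cder (fun s => f s + g s) t (u + v).
Proof.
move=> hf hg e e0; have e2 : 0 < e / 2 by rewrite divr_gt0.
near=> s; rewrite (_ : _ - _ = (f s - f t - (s - t)%:C * u) + (g s - g t - (s - t)%:C * v)); last by ring.
apply: le_trans (cabsD _ _) _; rewrite [e]splitr mulrDl.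
by apply: lerD; near: s; [exact: hf|exact: hg].
Unshelve. all: by end_near.
Qed.

Lemma cderM f g t u v : cder f t u -> cder g t v -> cder (fun s => f s * g s) t (u * g t + f t * v).
Proof.
move=> hf hg e e0.
pose A := cabs (g t) + 1; pose B := cabs (f t) + 1; pose D := cabs u + 1.
have A0 : 0 < A by rewrite ltr_wpDl// cabs_ge0.
have B0 : 0 < B by rewrite ltr_wpDl// cabs_ge0.
have D0 : 0 < D by rewrite ltr_wpDl// cabs_ge0.
have e3 : 0 < e / 3 by rewrite divr_gt0.
have h1 := hf _ (divr_gt0 e3 A0); have h2 := hg _ (divr_gt0 e3 B0).
have h3 := cder_cont hg (divr_gt0 e3 D0); have h4 := cder_cont hg (@ltr01 R).
near=> s.
rewrite (_ : _ - _ = (f s - f t - (s - t)%:C * u) * g s + f t * (g s - g t - (s - t)%:C * v)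
  + (s - t)%:C * u * (g s - g t)); last by ring.
apply: le_trans (cabsD _ _) _.
have -> : e = e / 3 + e / 3 + e / 3 by field.
rewrite [leRHS]mulrDl [(_ + _) * `|_|]mulrDl; apply: lerD; first (apply: le_trans (cabsD _ _) _; apply: lerD).
- rewrite cabsM; apply: (@le_trans _ _ ((e / 3 / A * `|s - t|) * A)).
    apply: ler_pM; rewrite ?cabs_ge0//; first by near: s.
    rewrite -[g s](subrK (g t)) addrC; apply: le_trans (cabsD _ _) _; rewrite lerD2l; by near: s.
  by rewrite mulrAC divfK ?gt_eqF.
- rewrite cabsM; apply: (@le_trans _ _ (B * (e / 3 / B * `|s - t|))).
    apply: ler_pM; rewrite ?cabs_ge0//; first by rewrite lerDl.
    by near: s.
  by rewrite mulrA [B * _]mulrC divfK ?gt_eqF.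
- rewrite cabsM [cabs (_ * u)]cabsM cabs_real -mulrA mulrC ler_wpM2r//.
  apply: (@le_trans _ _ (D * (e / 3 / D))).
    apply: ler_pM; rewrite ?cabs_ge0//; first by rewrite lerDl.
    by near: s.
  by rewrite mulrC divfK ?gt_eqF.
Unshelve. all: by end_near.
Qed.

Lemma cderZ (z : R[i]) f t u : cder f t u -> cder (fun s => z * f s) t (z * u).
Proof. by move=> h; have := cderM (cder_cst z t) h; rewrite mul0r add0r. Qed.

Lemma cderN f t u : cder f t u -> cder (fun s => - f s) t (- u).
Proof.
move=> h e /h; apply: filterS => s; apply: le_trans.
by rewrite -cabsN; apply: ler_eq; congr cabs; ring.
Qed.

Lemma cderB f g t u v : cder f t u -> cder g t v -> cder (fun s => f s - g s) t (u - v).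
Proof. by move=> hf /cderN hg; exact: cderD. Qed.

Lemma cder_ext f g t u : (forall s, f s = g s) -> cder g t u -> cder f t u.
Proof. by move=> e h d /h; apply: filterS => s; rewrite !e. Qed.

Lemma cder_expi (th : R) t : cder (fun s => expi (th * s)) t ((0 +i* th) * expi (th * t)).
Proof.
apply/cderP; split => /=.
  rewrite (_ : _ - _ = (- sin (th * t)) * th); last by ring.
  apply: is_derive_eq; first by rewrite /GRing.scale /=; ring.
rewrite (_ : _ + _ = (cos (th * t)) * th); last by ring.
by apply: is_derive_eq; rewrite /GRing.scale /=; ring.
Qed.

(** The increment is multiplied by the unit number [ze] that makes it real and positive; the real
    mean value theorem then applies to the real part. *)
Lemma cder_MVT (f : R -> R[i]) (g : R -> R[i]) a b B : a <= b ->
  (forall t, a <= t <= b -> cder f t (g t)) -> (forall t, a <= t <= b -> cabs (g t) <= B) ->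
  cabs (f b - f a) <= B * (b - a).
Proof.
move=> ab hf hg; have B0 : 0 <= B by apply: le_trans (hg a _); rewrite ?cabs_ge0 ?lexx.
have [->|z0] := eqVneq (f b - f a) 0; first by rewrite cabs0 mulr_ge0// subr_ge0.
set z := f b - f a in z0 *; pose ze := conjc z / (cabs z)%:C.
have cz : 0 < cabs z by rewrite cabs_gt0.
have cz' : (cabs z)%:C != 0 :> R[i] by rewrite (_ : 0 = (0 : R)%:C)// (inj_eq (@complexI _)) gt_eqF.
have ze1 : cabs ze = 1 by rewrite cabsM cabsV cabs_conj cabs_real ger0_norm ?divff ?gt_eqF// ltW.
have zez : ze * z = (cabs z)%:C by rewrite mulrAC [_ * z]mulrC mulJc expr2 rmorphM /= mulfK.
pose ph t := complex.Re (ze * f t).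
have dph t : a <= t <= b -> is_derive t 1 ph (complex.Re (ze * g t)).
  by move=> /hf/(cderZ ze)/cderP[].
have [||c cab e] := @MVT_segment R ph (fun t => complex.Re (ze * g t)) a b ab.
- by move=> x /[!in_itv]/= /andP[x1 x2]; apply: dph; rewrite !ltW.
- apply: derivable_within_continuous => x /[!in_itv]/= xab; by case: (dph x xab).
have e2 : ph b - ph a = cabs z.
  by rewrite -[RHS]/(complex.Re (cabs z)%:C) -zez /z mulrBr /ph; case: (ze * f b) (ze * f a) => ? ? [].
rewrite -e2 e ler_wpM2r ?subr_ge0//; apply: le_trans (ler_norm _) _; apply: le_trans (cabs_Re _) _.
by rewrite cabsM ze1 mul1r; apply: hg; move: cab; rewrite in_itv.
Qed.

Lemma csum_cder (I : choiceType) (f g : R -> I -> R[i]) (m : I -> R) M t r : 0 < r ->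
  summ (f t) ->
  (forall i s, `|s - t| <= r -> cder (f ^~ i) s (g s i)) ->
  (forall i s, `|s - t| <= r -> cabs (g s i) <= m i) -> sumle m M ->
  cder (fun s => csum (f s)) t (csum (g t)).
Proof.
move=> r0 st hf hg hm e e0.
have m0 i : 0 <= m i by apply: le_trans (hg i t _); rewrite ?cabs_ge0// subrr normr0 ltW.
have mv i s : `|s - t| <= r -> cabs (f s i - f t i) <= m i * `|s - t|.
  move=> sr; have [ts|ts] := leP t s.
    rewrite ger0_norm ?subr_ge0//; apply: (@cder_MVT (f ^~ i) (g ^~ i) _ _ _ ts) => x /andP[tx xs].
      by apply: hf; apply: le_trans sr; rewrite !ger0_norm ?subr_ge0// lerD2r.
    by apply: hg; apply: le_trans sr; rewrite !ger0_norm ?subr_ge0// lerD2r.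
  rewrite ltr0_norm ?subr_lt0// opprB cabsBC.
  apply: (@cder_MVT (f ^~ i) (g ^~ i) _ _ _ (ltW ts)) => x /andP[sx xt].
    by apply: hf; apply: le_trans sr; rewrite !ler0_norm ?subr_le0 ?(ltW ts)// !opprB lerD2l lerN2.
  by apply: hg; apply: le_trans sr; rewrite !ler0_norm ?subr_le0 ?(ltW ts)// !opprB lerD2l lerN2.
have sg : summ (g t) by apply: (summ_le hm) => i; apply: hg; rewrite subrr normr0 ltW.
pose q s i := if `|s - t| <= r then (s - t)^-1%:C * (f s i - f t i - (s - t)%:C * g t i) else 0.
have qb s i : cabs (q s i) <= 2 * m i.
  rewrite /q; case: ifP => sr; last by rewrite cabs0 mulr_ge0.
  have [->|st0] := eqVneq s t; first by rewrite subrr invr0 mul0r cabs0 mulr_ge0.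
  have p0 : 0 < `|s - t| by rewrite normr_gt0 subr_eq0.
  rewrite cabsM cabs_real normfV mulrC ler_pdivrMr//.
  apply: le_trans (cabsB _ _) _; rewrite cabsM cabs_real.
  have := mv i s sr; have := ler_wpM2l (ltW p0) (hg i t _); rewrite subrr normr0 => /(_ (ltW r0)); lra.
have hq i d : 0 < d -> \forall s \near t, cabs (q s i - 0) <= d.
  move=> d0; have h := hf i t _ d d0; rewrite subrr normr0 in h.
  near=> s; rewrite subr0 /q; case: ifP => sr; last by rewrite cabs0 ltW.
  have [->|st0] := eqVneq s t; first by rewrite subrr invr0 mul0r cabs0 ltW.
  have p0 : 0 < `|s - t| by rewrite normr_gt0 subr_eq0.
  rewrite cabsM cabs_real normfV mulrC ler_pdivrMr//; near: s; exact: h (ltW r0).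
have key := @csum_tannery R R (nbhs t) _ I q (fun=> 0) _ _ qb (sumleZ (_ : 0 <= 2) hm) hq _ e e0.
have s0 : summ (fun _ : I => 0 : R[i]) by exists 0 => s _; rewrite big1// => i _; rewrite cabs0.
near=> s.
have sr : `|s - t| <= r.
  near: s; apply: filterS (nbhsx_ballx t r r0) => s; by rewrite /ball /= distrC => /ltW.
have [->|st0] := eqVneq s t; first by rewrite !subrr mul0r subrr cabs0 normr0 mulr0.
have p0 : 0 < `|s - t| by rewrite normr_gt0 subr_eq0.
have sd : summ (fun i => f s i - f t i).
  by apply: (summ_le (sumleZ (ltW p0) hm)) => i; rewrite mulrC mv.
have ss : summ (f s).
  have := summD sd st; case=> N hN; exists N; apply: sumle_le hN _ (lexx _) => i; by rewrite subrK.
have k1 : cabs (csum (q s) - csum (fun _ : I => 0 : R[i])) <= e by near: s; exact: key.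
rewrite csum0 subr0 in k1.
have -> : csum (f s) - csum (f t) - (s - t)%:C * csum (g t) = (s - t)%:C * csum (q s).
  have sq : summ (q s) by apply: (summ_le (sumleZ (_ : 0 <= 2) hm)).
  rewrite -csumB// -csumZ// -csumB//; last exact: summZ.
  rewrite -csumZ//; apply: eq_csum => i; rewrite /q sr mulrA -rmorphM /= divff ?mul1r//.
  by rewrite subr_eq0.
by rewrite cabsM cabs_real mulrC ler_wpM2r.
Unshelve. all: by end_near.
Qed.

Notation mu := (@lebesgue_measure R).

Lemma primitive (f : R -> R) : continuous f -> exists F : R -> R, F 0 = 0 /\
  forall t, is_derive t 1 F (f t).
Proof.
move=> cf.
have intf a b : mu.-integrable [set` Interval (BRight a) (BRight b)] (EFin \o f).
  apply: (@integrableS _ _ _ mu `[a, b]) => //; first exact: subset_itv_oc_cc.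
  apply: continuous_compact_integrable; first exact: segment_compact.
  exact: continuous_subspaceT.
(* The integrals start at [- N], to the left of both [0] and [t]; their difference does not depend
   on [N], and a fixed [N] serves a whole neighbourhood of [t]. *)
pose D N t : R := \int[mu]_(x in [set` Interval (BRight (- N)) (BRight t)]) f x -
  \int[mu]_(x in [set` Interval (BRight (- N)) (BRight 0)]) f x.
have DN (N N' t : R) : N <= N' -> 0 <= N -> `|t| <= N -> D N' t = D N t.
  move=> NN N0 tN; rewrite /D.
  have h (x : R) : - N <= x -> \int[mu]_(x in [set` Interval (BRight (- N)) (BRight x)]) f x =
    \int[mu]_(x in [set` Interval (BRight (- N')) (BRight x)]) f x -
    \int[mu]_(x in [set` Interval (BRight (- N')) (BRight (- N))]) f x.
    by move=> Nx; rewrite Rintegral_itvB//= ?bnd_simp ?lerN2//; exact: intf.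
  rewrite (h t) ?(h 0); [ring| |]; first by rewrite oppr_le0.
  by move: tN; rewrite ler_norml => /andP[].
exists (fun t => D (`|t| + 1) t); split; first by rewrite /D subrr.
move=> t; apply: (@near_eq_is_derive _ _ _ (D (`|t| + 2))).
  near=> s; have st : `|t - s| < 1 by near: s; exact: (nbhsx_ballx t 1 ltr01).
  have : `|s| <= `|t| + `|t - s|.
    by rewrite -{1}(subKr t s); apply: le_trans (ler_normB _ _) _.
  move=> h; apply: DN; [lra|exact: addr_ge0|by rewrite lerDl].
have tN : - (`|t| + 2) < t by have := ler_norm (- t); rewrite normrN; lra.
have [|||dF Fv] := @continuous_FTC1 R f (BRight (- (`|t| + 2))) t (t + 1) _ (intf _ _).
- by rewrite ltrDl.
- exact: tN.
- exact: cf.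
have : is_derive t 1 (fun x => \int[mu]_(x in [set` Interval (BRight (- (`|t| + 2))) (BRight x)]) f x) (f t).
  by apply: DeriveDef; [exact: dF|rewrite -derive1E].
move=> h; rewrite -[f t]subr0; exact: is_deriveB.
Unshelve. all: by end_near.
Qed.

Lemma cprimitive (f : R -> R[i]) :
  (forall t e, 0 < e -> \forall s \near t, cabs (f s - f t) <= e) ->
  exists F : R -> R[i], F 0 = 0 /\ forall t, cder F t (f t).
Proof.
move=> cf.
have [|F [F0 dF]] := @primitive (fun t => complex.Re (f t)).
  move=> t; apply/cvgrPdist_le => e e0; have := cf t e e0; apply: filterS => s.
  by rewrite distrC; apply: le_trans; apply: le_trans (cabs_Re _); case: (f s) (f t) => ? ? [].
have [|G [G0 dG]] := @primitive (fun t => complex.Im (f t)).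
  move=> t; apply/cvgrPdist_le => e e0; have := cf t e e0; apply: filterS => s.
  by rewrite distrC; apply: le_trans; apply: le_trans (cabs_Im _); case: (f s) (f t) => ? ? [].
exists (fun t => F t +i* G t); split; first by rewrite F0 G0.
by move=> t; apply/cderP; split => /=; [exact: dF|exact: dG].
Qed.
End Derivatives.

(** * Mean value estimates in the norm and the Picard iteration *)

Section Picard.
Variable R : realType.
Notation J := 'rV[int]_2.
Notation seqs := (J -> R[i]).
Variables (w : J -> R).
Hypothesis w1 : forall j, 1 <= w j.
Notation hle := (hle w).
Implicit Types (t s e : R).

Let w0 j : 0 <= w j. Proof. exact: le_trans (w1 j). Qed.

Lemma cder_sum (I : Type) (r : seq I) (f : R -> I -> R[i]) (g : I -> R[i]) t :
  (forall i, cder (f ^~ i) t (g i)) -> cder (fun s => \sum_(i <- r) f s i) t (\sum_(i <- r) g i).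
Proof.
move=> h; elim: r => [|i r ih].
  by rewrite big_nil; apply: cder_ext (@cder_cst _ 0 t) => s; rewrite big_nil.
by rewrite big_cons; apply: cder_ext (cderD (h i) ih) => s; rewrite big_cons.
Qed.

(** Only the coefficients are differentiated. For one test function and finitely many sites the
    weighted sum of increments is the real part of a scalar function [ph], and the mean value
    theorem is applied to [Psi - Re ph]. *)
Lemma hle_MVT (f g : R -> seqs) (psi Psi : R -> R) a b : a <= b ->
  (forall t, a <= t <= b -> forall k, cder (f ^~ k) t (g t k)) ->
  (forall t, a <= t <= b -> hle (g t) (psi t)) ->
  (forall t, a <= t <= b -> is_derive t 1 Psi (psi t)) ->
  hle (fun k => f b k - f a k) (Psi b - Psi a).
Proof.
move=> ab df hg dPsi h th r ur.
pose z j := f b j - f a j.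
pose ze j : R[i] := if z j == 0 then 0 else conjc (z j) / (cabs (z j))%:C.
have zE j : ze j * z j = (cabs (z j))%:C.
  rewrite /ze; have [->|z0] := eqVneq (z j) 0; first by rewrite mul0r cabs0.
  have cz' : (cabs (z j))%:C != 0 :> R[i].
    by rewrite (_ : 0 = (0 : R)%:C)// (inj_eq (@complexI _)) cabs_eq0P.
  by rewrite mulrAC [_ * z j]mulrC mulJc expr2 rmorphM /= mulfK.
have ze1 j : cabs (ze j) <= 1.
  rewrite /ze; have [_|z0] := eqVneq (z j) 0; first by rewrite cabs0.
  by rewrite cabsM cabsV cabs_conj cabs_real ger0_norm ?cabs_ge0// divff// cabs_eq0P.
pose c j : R[i] := (1 + w j * h j)%:C * ze j.
have c1 j : cabs (c j) <= 1 + w j * h j.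
  have h0 := test_ge0 w1 j th.
  by rewrite cabsM cabs_real ger0_norm// ler_piMr.
pose ph t := \sum_(j <- r) c j * f t j.
have dph t : a <= t <= b -> cder ph t (\sum_(j <- r) c j * g t j).
  by move=> tab; apply: (@cder_sum _ r (fun s j => c j * f s j)) => j; apply: cderZ; exact: df.
have phE : complex.Re (ph b) - complex.Re (ph a) = \sum_(j <- r) (1 + w j * h j) * cabs (z j).
  rewrite (_ : _ - _ = complex.Re (ph b - ph a)); last by case: (ph b) (ph a) => ? ? [].
  rewrite (_ : ph b - ph a = (\sum_(j <- r) (1 + w j * h j) * cabs (z j))%:C) // rmorph_sum /= -sumrB.
  by apply: eq_bigr => j _; rewrite -mulrBr -/(z j) -mulrA zE rmorphM.
rewrite -phE -lerBlDr -subr_ge0.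
have dd t : a <= t <= b -> is_derive t 1 (fun t => Psi t - complex.Re (ph t))
    (psi t - complex.Re (\sum_(j <- r) c j * g t j)).
  by move=> tab; have [d1 _] := (cderP _ _ _).1 (dph t tab); apply: is_deriveB; exact: dPsi.
have [||c' cab e] := @MVT_segment R (fun t => Psi t - complex.Re (ph t))
  (fun t => psi t - complex.Re (\sum_(j <- r) c j * g t j)) a b ab.
- by move=> x /[!in_itv]/= /andP[x1 x2]; apply: dd; rewrite !ltW.
- by apply: derivable_within_continuous => x /[!in_itv]/= xab; case: (dd x xab).
have tab : a <= c' <= b by move: cab; rewrite in_itv.
have : 0 <= (psi c' - complex.Re (\sum_(j <- r) c j * g c' j)) * (b - a).
  rewrite mulr_ge0 ?subr_ge0//; apply: le_trans (ler_norm _) _; apply: le_trans (cabs_Re _) _.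
  apply: le_trans (cabs_sum _ _) _; apply: le_trans (hg _ tab h th r ur).
  by apply: ler_sum => j _; rewrite cabsM ler_wpM2r ?cabs_ge0.
rewrite -e; lra.
Qed.

Lemma hle_MVT_lin (f g : R -> seqs) a b B : a <= b ->
  (forall t, a <= t <= b -> forall k, cder (f ^~ k) t (g t k)) ->
  (forall t, a <= t <= b -> hle (g t) B) -> hle (fun k => f b k - f a k) (B * (b - a)).
Proof.
move=> ab df hg; rewrite mulrBr; apply: (hle_MVT (Psi := fun t => B * t) (psi := fun=> B) ab df hg).
by move=> t _; apply: is_derive_eq; rewrite /GRing.scale /= mulr1.
Qed.

Lemma hle_zero (u : seqs) : (forall e, 0 < e -> hle u e) -> forall k, u k = 0.
Proof. by move=> h k; apply: cabs_small => e /h/(hle_term k). Qed.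

Variables (F : R -> seqs -> seqs) (L B : R).
Hypothesis L0 : 0 < L.
Hypothesis FB : forall t u M, hle u M -> hle (F t u) B.
Hypothesis FL : forall t u v M N D, hle u M -> hle v N -> hle (fun k => u k - v k) D ->
  hle (fun k => F t u k - F t v k) (L * D).
Hypothesis FC : forall t u M k e, hle u M -> 0 < e -> \forall s \near t, cabs (F s u k - F t u k) <= e.
Variables (a0 : seqs) (M0 : R).
Hypothesis ha0 : hle a0 M0.

Let B0 : 0 <= B. Proof. exact: hle_ge0 (FB 0 ha0). Qed.

Definition curve (a : R -> seqs) := a 0 = a0 /\
  forall s t, hle (fun k => a s k - a t k) (B * `|s - t|).

Lemma curve_hle a t : curve a -> hle (a t) (M0 + B * `|t|).
Proof.
move=> [a00 la]; apply: hle_ext (hleD w1 ha0 (_ : hle (fun k => a t k - a 0 k) _)) => [j|].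
  by rewrite a00 addrC subrK.
by rewrite -{2}[t]subr0.
Qed.

Lemma curve_cont a t k e : curve a -> 0 < e -> \forall s \near t, cabs (F s (a s) k - F t (a t) k) <= e.
Proof.
move=> ca e0; have [_ la] := ca; have e2 : 0 < e / 2 by rewrite divr_gt0.
have LB : 0 < L * B + 1 by rewrite ltr_wpDl// mulr_ge0// ltW.
have hc := @FC t _ _ k _ (curve_hle t ca) e2.
near=> s; rewrite -(subrK (F s (a t) k) (F s (a s) k)) -addrA; apply: le_trans (cabsD _ _) _.
rewrite [e]splitr; apply: lerD; last by near: s.
apply: le_trans (hle_term k (FL s (curve_hle s ca) (curve_hle t ca) (la s t))) _.
have st : `|s - t| <= e / 2 / (L * B + 1).
  near: s; apply: filterS (nbhsx_ballx t _ (divr_gt0 e2 LB)) => s.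
  by rewrite /ball /= distrC => /ltW.
by move: st; rewrite ler_pdivlMr// mulrDr mulr1 mulrA; have := normr_ge0 (s - t); lra.
Unshelve. all: by end_near.
Qed.

Lemma curve_step a : curve a -> exists a', curve a' /\ forall t k, cder (a' ^~ k) t (F t (a t) k).
Proof.
move=> ca.
have /choice[P hP] : forall k, exists P : R -> R[i], P 0 = 0 /\ forall t, cder P t (F t (a t) k).
  by move=> k; apply: cprimitive => t e e0; exact: curve_cont.
have dP t k : cder (fun s => a0 k + P k s) t (F t (a t) k).
  have [_ h] := hP k; rewrite -[F t _ _]add0r; exact: cderD (@cder_cst _ _ _) (h t).
exists (fun t k => a0 k + P k t); split=> //; split.
  by apply/funext => k; have [-> _] := hP k; rewrite addr0.
move=> s t; wlog st : s t / t <= s => [h|].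
  have [/h//|/ltW/h] := leP t s; rewrite distrC => hh.
  exact: (hleBC w1 hh).
rewrite ger0_norm ?subr_ge0//.
by apply: (@hle_MVT_lin (fun t k => a0 k + P k t) (fun t => F t (a t)) _ _ _ st) => x _; [move=> k; exact: dP|exact: FB (curve_hle x ca)].
Qed.

(** Bielecki's weight: the integral of [L * K * exp (2 * L * s)] is [K / 2] times the same
    exponential up to a constant, so the iteration contracts by 2 on the whole line at once. *)
Lemma curve_contract x y X Y K : curve x -> curve y -> X 0 = Y 0 ->
  (forall t k, cder (X ^~ k) t (F t (x t) k)) -> (forall t k, cder (Y ^~ k) t (F t (y t) k)) ->
  (forall t, hle (fun k => x t k - y t k) (K * expR (2 * L * `|t|))) ->
  forall t, hle (fun k => X t k - Y t k) (K / 2 * expR (2 * L * `|t|)).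
Proof.
move=> cx cy XY dX dY h t.
have K0 : 0 <= K by have := hle_ge0 (h 0); rewrite normr0 mulr0 expR0 mulr1.
have dXY s k : cder (fun s => X s k - Y s k) s (F s (x s) k - F s (y s) k) by exact: cderB.
have hF s : hle (fun k => F s (x s) k - F s (y s) k) (L * (K * expR (2 * L * `|s|))).
  exact: FL (curve_hle s cx) (curve_hle s cy) (h s).
have L1 : L != 0 by rewrite gt_eqF.
have [t0|t0] := leP 0 t.
  apply: (@hle_ext _ _ _ (fun k => (X t k - Y t k) - (X 0 k - Y 0 k))) => [k|]; first by rewrite XY subrr subr0.
  apply: hle_le (@hle_MVT (fun s k => X s k - Y s k) (fun s k => F s (x s) k - F s (y s) k)
    (fun s => L * (K * expR (2 * L * s))) (fun s => K / 2 * expR (2 * L * s)) 0 t t0 _ _ _).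
  - by rewrite ger0_norm// lerBlDr lerDl mulr0 expR0 mulr1 divr_ge0.
  - by move=> s _ k; exact: dXY.
  - by move=> s /andP[s0 _]; have := hF s; rewrite ger0_norm.
  - by move=> s _; apply: is_derive_eq; rewrite /GRing.scale /=; field.
apply: (@hle_ext _ _ _ (fun k => - ((X 0 k - Y 0 k) - (X t k - Y t k)))) => [k|].
  by rewrite XY subrr sub0r opprK.
suff hh : hle (fun k => (X 0 k - Y 0 k) - (X t k - Y t k)) (K / 2 * expR (2 * L * `|t|)) by exact: hleN hh.
apply: hle_le (@hle_MVT (fun s k => X s k - Y s k) (fun s k => F s (x s) k - F s (y s) k)
  (fun s => L * (K * expR (2 * L * - s))) (fun s => - (K / 2 * expR (2 * L * - s))) t 0 (ltW t0) _ _ _).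
- by rewrite ltr0_norm// opprK addrC lerBlDr lerDl oppr0 mulr0 expR0 mulr1 divr_ge0.
- by move=> s _ k; exact: dXY.
- by move=> s /andP[_ s0]; have := hF s; rewrite ler0_norm.
- by move=> s _; apply: is_derive_eq; rewrite /GRing.scale /=; field.
Qed.

(** The field is continuous in time only coefficientwise, hence the primitives of [curve_step] are
    taken coefficient by coefficient. The limit is a fixed point because its image is compared with
    the next iterate. *)
Theorem picard : exists a, curve a /\ forall t k, cder (a ^~ k) t (F t (a t) k).
Proof.
have /choice[st hst] : forall a, exists a', curve a ->
    curve a' /\ forall t k, cder (a' ^~ k) t (F t (a t) k).
  move=> a; case: (pselect (curve a)) => [/curve_step[a' h]|na]; first by exists a'.
  by exists a.
pose A n := iter n st (fun=> a0).
have cA n : curve (A n).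
  elim: n => [|n ih]; last by have [] := hst _ ih.
  split=> // s t; apply: hle_ext (hle0 w _) => [k|]; first by rewrite subrr.
  by rewrite mulr_ge0.
have dA n t k : cder (A n.+1 ^~ k) t (F t (A n t) k) by have [_ h] := hst _ (cA n); exact: h.
pose K := B / L; have K0 : 0 <= K by rewrite divr_ge0// ltW.
have e1 t : 1 <= expR (2 * L * `|t|).
  by rewrite -[1](@expR0 R) ler_expR !mulr_ge0// ltW.
have hA n t : hle (fun k => A n.+1 t k - A n t k) (K / 2 ^+ n * expR (2 * L * `|t|)).
  elim: n t => [|n ih] t.
    have := (cA 1%N).2 t 0; rewrite (cA 1%N).1 => hh; apply: hle_le hh.
    have h := expR_ge1Dx (2 * L * `|t|).
    rewrite subr0 expr0 divr1 /K [leRHS]mulrAC ler_pdivlMr// -[B * _ * L]mulrA; apply: ler_wpM2l => //.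
    rewrite [_ * L]mulrC.
    by have := normr_ge0 t; have := mulr_ge0 (ltW L0) (normr_ge0 t); lra.
  have := curve_contract (cA n.+1) (cA n) _ (dA n.+1) (dA n) ih t.
  by rewrite exprSr invfM mulrA; apply; rewrite (cA n.+2).1 (cA n.+1).1.
have sA n t : sumle (fun m : nat => K / 2 ^+ (n + m) * expR (2 * L * `|t|)) (K / 2 ^+ n * 2 * expR (2 * L * `|t|)).
  have := @sumle_geometric_nat R 2^-1 _ _; rewrite invr_ge0 ler0n invf_lt1 ?ltr1n// => /(_ isT isT) h.
  have K2 : 0 <= K / 2 ^+ n * expR (2 * L * `|t|) by rewrite mulr_ge0 ?expR_ge0// divr_ge0// exprn_ge0.
  apply: sumle_le (sumleZ K2 h) _ _ => [m|].
    by rewrite exprD invfM exprVn; apply: ler_eq; ring.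
  by apply: ler_eq; field; rewrite expf_neq0.
pose a t : seqs := fun k => a0 k + csum (fun n : nat => A n.+1 t k - A n t k).
have aA n t : hle (fun k => a t k - A n t k) (K / 2 ^+ n * 2 * expR (2 * L * `|t|)).
  apply: hle_ext (hle_csum w1 (fun m => hA (n + m)%N t) (sA n t)) => k.
  have sk : summ (fun m : nat => A m.+1 t k - A m t k).
    by apply: (summ_le (sA 0%N t)) => m; exact: (hle_term k (hA m t)).
  rewrite /a (csum_nat_split n sk) addrA; have -> : a0 k + \sum_(i < n) (A i.+1 t k - A i t k) = A n t k.
    elim: n => [|n ih]; first by rewrite big_ord0 addr0.
    by rewrite big_ord_recr /= addrA ih addrC subrK.
  by rewrite addrAC subrr add0r.
have small t e : 0 < e -> exists n, K / 2 ^+ n * 2 * expR (2 * L * `|t|) <= e.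
  move=> e0; have E0 := expR_gt0 (2 * L * `|t|).
  pose x := K * 2 * expR (2 * L * `|t|) / e.
  have [n hn] : exists n : nat, x <= n%:R.
    by exists (Num.bound x); apply: ltW; exact: archi_boundP (divr_ge0 (mulr_ge0 (mulr_ge0 _ _) (ltW E0)) (ltW e0)).
  exists n; have n2 : n%:R <= 2 ^+ n :> R by rewrite -natrX ler_nat ltnW// ltn_expl.
  rewrite (_ : _ * expR _ = x * e / 2 ^+ n).
    by rewrite ler_pdivrMr ?exprn_gt0// mulrC ler_wpM2l ?(ltW e0)//; exact: le_trans n2.
  by rewrite /x; field; rewrite expf_neq0//= gt_eqF.
have ca : curve a.
  split.
    apply/funext => k; rewrite /a (csum1 (i0 := 0%N)) => [|i _]; rewrite (cA _.+1).1 (cA _).1 ?subrr//.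
    by rewrite addr0.
  move=> s t; apply: hle_limit => // r ur e e0; have e2 : 0 < e / 2 by rewrite divr_gt0.
  have [n1 h1] := small s _ e2; have [n2 h2] := small t _ e2.
  pose n := maxn n1 n2.
  exists (fun k => A n s k - A n t k); first exact: (cA n).2.
  have mono m (x : R) : (m <= n)%N -> K / 2 ^+ n * 2 * expR (2 * L * `|x|) <= K / 2 ^+ m * 2 * expR (2 * L * `|x|).
    move=> mn; rewrite !ler_wpM2r ?expR_ge0// ler_wpM2l// lef_pV2 ?posrE ?exprn_gt0//.
    by rewrite ler_eXn2l ?ltr1n.
  move=> j _; rewrite (_ : _ - _ = (a s j - A n s j) - (a t j - A n t j)); last by ring.
  apply: le_trans (cabsB _ _) _; rewrite [e]splitr; apply: lerD.
    by apply: le_trans (hle_term j (aA n s)) _; apply: le_trans h1; apply: mono; exact: leq_maxl.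
  by apply: le_trans (hle_term j (aA n t)) _; apply: le_trans h2; apply: mono; exact: leq_maxr.
have [ca' da'] := hst _ ca.
suff e : st a = a by exists a; split=> // t k; have := da' t k; rewrite e.
apply/funext => t; apply/funext => k; apply/eqP; rewrite -subr_eq0; apply/eqP; move: k.
apply: hle_zero => e e0; have [n hn] := small t e e0; apply: hle_le hn _.
have h1 := curve_contract ca (cA n) (etrans ca'.1 (esym (cA n.+1).1)) da' (dA n) (aA n) t.
have h2 := hleD w1 h1 (hleBC w1 (aA n.+1 t)).
apply: (hle_le _ (hle_ext _ h2)) => [|j]; last by ring.
rewrite exprSr invfM; apply: ler_eq; field; by rewrite expf_neq0.
Qed.
End Picard.

(** * Oscillating bilinear sums *)

Section Bilinear.
Variable R : realType.
Notation J := 'rV[int]_2.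
Notation seqs := (J -> R[i]).
Variables (w : J -> R) (c : R).
Hypotheses (w1 : forall j, 1 <= w j) (c1 : 1 <= c).
Hypothesis wD : forall a b, w (a + b) <= c * (w a + w b).
Hypothesis wN : forall a, w (- a) = w a.
Notation Cc := (Cc c).
Notation hle := (hle w).

Let c0 : 0 <= c. Proof. exact: le_trans c1. Qed.
Let Cc0 : 0 <= Cc. Proof. exact: le_trans (Cc_ge1 c1). Qed.
Let w0 j : 0 <= w j. Proof. exact: le_trans (w1 j). Qed.

Lemma hle_conv_family (F : J -> J -> R[i]) (u v : seqs) A B : hle u A -> hle v B ->
  (forall k j, cabs (F k j) <= cabs (u (k - j)) * cabs (v j)) ->
  hle (fun k => csum (F k)) (Cc * (A * B)).
Proof.
move=> hu hv hF g tg; have g0 j := test_ge0 w1 j tg.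
have h := cconv_sumle w1 c1 wD hu hv tg.
have h' : sumle (fun x : J * J => cabs ((1 + w x.1 * g x.1)%:C * F x.1 x.2)) (Cc * (A * B)).
  apply: sumle_le h _ (lexx _) => x.
  by rewrite cabsM cabs_real ger0_norm// ler_wpM2l.
have := sumle_csum (F := fun k j => (1 + w k * g k)%:C * F k j) h'.
move/sumle_le; apply => // k; rewrite csumZ.
  by rewrite cabsM cabs_real ger0_norm.
apply: (summ_le (g := fun j => A * cabs (v j)) (M := A * B)).
  exact: sumleZ (hle_ge0 hu) (hle_l1 hv).
move=> j; apply: le_trans (hF k j) _; apply: ler_wpM2r; first exact: cabs_ge0.
exact: hle_term hu.
Qed.

Variables (I : choiceType) (p q : I -> J).
Implicit Types (x y : I -> seqs) (cf : I -> J -> J -> R[i]) (gam : I -> R).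

(** The coefficient depends on the output [k] and on the inner site [j] too, so this is not a plain
    convolution; the shifts [p] and [q] carry the momenta of the Fourier modes. *)
Definition bil cf x y : seqs := fun k => csum (fun z : I * J =>
  cf z.1 k z.2 * (x z.1 (k - p z.1 - z.2) * y z.1 (z.2 - q z.1))).

Definition coef_le cf G := exists2 gam : I -> R, (forall i k j, cabs (cf i k j) <= gam i) &
  sumle (fun i => gam i * (w (p i) * w (q i))) G.

Lemma coef_le_ge0 cf G : coef_le cf G -> 0 <= G.
Proof. by case=> gam _ /sumle_ge0. Qed.

Lemma bil_summ cf G x y X Y k : coef_le cf G -> (forall i, hle (x i) X) -> (forall i, hle (y i) Y) ->
  0 <= X -> 0 <= Y -> summ (fun z : I * J => cf z.1 k z.2 * (x z.1 (k - p z.1 - z.2) * y z.1 (z.2 - q z.1))).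
Proof.
move=> [gam hg hG] hx hy X0 Y0; exists (X * Y * G).
have g0 i : 0 <= gam i by apply: le_trans (hg i 0 0); exact: cabs_ge0.
apply: (@sumle_pair _ _ _ _ (fun i => (X * Y) * (gam i * (w (p i) * w (q i))))).
- by move=> z; exact: cabs_ge0.
- move=> i /=; have := sumleZ (mulr_ge0 (g0 i) X0) (sumle_inj (subIr (q i)) (hle_l1 (hy i))).
  move/sumle_le; apply => [j|] /=.
    rewrite !cabsM -mulrA; apply: ler_pM; rewrite ?mulr_ge0 ?cabs_ge0 ?hg//.
    by rewrite ler_wpM2r ?cabs_ge0//; exact: hle_term (hx i).
  have W1 : 1 <= w (p i) * w (q i) by rewrite -[1]mulr1 ler_pM.
  have := ler_wpM2l (mulr_ge0 (mulr_ge0 (g0 i) X0) Y0) W1; rewrite mulr1; move/le_trans; apply.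
  by apply: ler_eq; ring.
- by apply: sumleZ => //; exact: mulr_ge0.
Qed.

Definition Cb : R := Cc * (2 * c) ^+ 2.
Lemma Cb_ge0 : 0 <= Cb. Proof. by rewrite mulr_ge0// exprn_ge0// mulr_ge0. Qed.

Lemma hle_bil cf G x y X Y : coef_le cf G -> (forall i, hle (x i) X) -> (forall i, hle (y i) Y) ->
  0 <= X -> 0 <= Y -> hle (bil cf x y) (Cb * G * (X * Y)).
Proof.
move=> hc hx hy X0 Y0; have [gam hg hG] := hc.
have g0 i : 0 <= gam i by apply: le_trans (hg i 0 0); exact: cabs_ge0.
apply: (@hle_ext _ _ _ (fun k => csum (fun i => csum (fun j => cf i k j * (x i (k - p i - j) * y i (j - q i)))))).
  by move=> k; rewrite (csum_pair (bil_summ k hc hx hy X0 Y0)).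
apply: (hle_csum w1 (a := fun i => (Cb * (X * Y)) * (gam i * (w (p i) * w (q i))))); last first.
  by rewrite [X in sumle _ X]mulrAC; apply: sumleZ => //; rewrite !mulr_ge0 ?Cb_ge0.
move=> i.
have h1 := hleZ (gam i)%:C (hle_shift w1 c1 wD (p i) (hx i)).
have h2 := hle_shift w1 c1 wD (q i) (hy i).
apply: hle_le (hle_conv_family h1 h2 _) => [|k j].
  by rewrite cabs_real ger0_norm//; apply: ler_eq; rewrite /Cb; ring.
rewrite !cabsM cabs_real ger0_norm// mulrA ler_wpM2r ?cabs_ge0//.
rewrite (_ : k - p i - j = k - j - p i); last by rewrite addrAC.
by rewrite ler_wpM2r ?cabs_ge0.
Qed.

Lemma bil_diff cf G x y x' y' X D k : coef_le cf G ->
  (forall i, hle (x i) X) -> (forall i, hle (y i) X) ->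
  (forall i, hle (x' i) X) -> (forall i, hle (y' i) X) -> 0 <= X -> 0 <= D ->
  (forall i, hle (fun j => x i j - x' i j) D) -> (forall i, hle (fun j => y i j - y' i j) D) ->
  bil cf x y k - bil cf x' y' k =
  bil cf (fun i j => x i j - x' i j) y k + bil cf x' (fun i j => y i j - y' i j) k.
Proof.
move=> hc hx hy hx' hy' X0 D0 hdx hdy.
rewrite /bil -(csumB (bil_summ k hc hx hy X0 X0) (bil_summ k hc hx' hy' X0 X0)).
rewrite -(csumD (bil_summ k hc hdx hy D0 X0) (bil_summ k hc hx' hdy X0 D0)).
by apply: eq_csum => z; ring.
Qed.

Lemma hle_bil_diff cf G x y x' y' X D : coef_le cf G ->
  (forall i, hle (x i) X) -> (forall i, hle (y i) X) ->
  (forall i, hle (x' i) X) -> (forall i, hle (y' i) X) -> 0 <= X -> 0 <= D ->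
  (forall i, hle (fun j => x i j - x' i j) D) -> (forall i, hle (fun j => y i j - y' i j) D) ->
  hle (fun k => bil cf x y k - bil cf x' y' k) (2 * Cb * G * (X * D)).
Proof.
move=> hc hx hy hx' hy' X0 D0 hdx hdy.
apply: hle_ext (fun k => bil_diff k hc hx hy hx' hy' X0 D0 hdx hdy) _.
apply: hle_le (hleD w1 (hle_bil hc hdx hy D0 X0) (hle_bil hc hx' hdy X0 D0)).
by apply: ler_eq; ring.
Qed.

Variables (th : I -> J -> J -> R).

Definition osc cf t : I -> J -> J -> R[i] := fun i k j => cf i k j * expi (t * th i k j).

Lemma osc_coef_le cf G t : coef_le cf G -> coef_le (osc cf t) G.
Proof. by case=> gam hg hG; exists gam => // i k j; rewrite cabsM cabs_expi mulr1. Qed.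

(* [cf / (i th)] *)
Definition divided cf : I -> J -> J -> R[i] := fun i k j => cf i k j * (0 +i* - (th i k j)^-1).

(** With frozen arguments only the phases depend on time; their derivative restores the factor
    removed by [divided], and where the phase vanishes so does the coefficient. *)
Lemma bil_cder cf G G' x y X t k : coef_le cf G -> coef_le (divided cf) G' ->
  (forall i k j, cf i k j = 0 \/ th i k j != 0) ->
  (forall i, hle (x i) X) -> (forall i, hle (y i) X) -> 0 <= X ->
  cder (fun s => bil (osc (divided cf) s) x y k) t (bil (osc cf t) x y k).
Proof.
move=> hc hd hth hx hy X0.
have [M hM] := bil_summ k hc hx hy X0 X0.
apply: (@csum_cder R _ (fun s (z : I * J) => osc (divided cf) s z.1 k z.2 * (x z.1 (k - p z.1 - z.2) * y z.1 (z.2 - q z.1)))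
  (fun s (z : I * J) => osc cf s z.1 k z.2 * (x z.1 (k - p z.1 - z.2) * y z.1 (z.2 - q z.1))) _ M t 1 ltr01 _ _ _ hM).
- exact: (bil_summ k (osc_coef_le t hd) hx hy X0 X0).
- move=> [i j] s _ /=; set v := x i _ * _; rewrite /osc /divided.
  apply: (@cder_ext _ _ (fun s => (cf i k j * (0 +i* - (th i k j)^-1) * v) * expi (th i k j * s))) => [r|].
    by rewrite (mulrC r); ring.
  have := cderZ (cf i k j * (0 +i* - (th i k j)^-1) * v) (cder_expi (th i k j) s).
  rewrite (_ : _ * (_ * expi _) = cf i k j * expi (s * th i k j) * v) //.
  rewrite (mulrC s); have [->|t0] := hth i k j; first by rewrite !mul0r.
  have e1 : (0 +i* - (th i k j)^-1) * (0 +i* th i k j) = 1 :> R[i].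
    by apply/eqP; rewrite eq_complex /= !mul0r mulr0 sub0r addr0 mulNr opprK mulVf// !eqxx.
  rewrite (_ : _ * _ * v * _ = cf i k j * expi (th i k j * s) * v * ((0 +i* - (th i k j)^-1) * (0 +i* th i k j))); last by ring.
  by rewrite e1 mulr1.
- by move=> [i j] s _ /=; rewrite /osc !cabsM cabs_expi mulr1.
Qed.
End Bilinear.

Section Chop.
Variable R : realType.
Notation J := 'rV[int]_2.
Variable (w : J -> R).
Hypothesis w1 : forall j, 1 <= w j.

(** Bounds proportional to the length add up over pieces of length at most 1, so an estimate valid
    on short intervals holds with the same rate on long ones. *)
Lemma hle_chop (Y : R -> J -> R[i]) a b C : a <= b -> 0 <= C ->
  (forall s t, a <= s <= b -> a <= t <= b -> s <= t <= s + 1 -> hle w (fun k => Y t k - Y s k) (C * (t - s))) ->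
  hle w (fun k => Y b k - Y a k) (C * (b - a)).
Proof.
move=> ab C0 h.
have : forall n b', a <= b' <= b -> b' <= a + n%:R -> hle w (fun k => Y b' k - Y a k) (C * (b' - a)).
  elim=> [|n ih] b' /andP[ab' bb'] bn.
    have -> : b' = a by apply/eqP; rewrite eq_le ab' andbT; rewrite addr0 in bn.
    by apply: hle_ext (hle0 w _) => [k|]; rewrite subrr ?mulr0.
  have [bn'|bn'] := leP b' (a + n%:R); first by apply: ih; rewrite ?ab'.
  have nn : 0 <= n%:R :> R by [].
  have h1 : hle w (fun k => Y (a + n%:R) k - Y a k) (C * (a + n%:R - a)).
    by apply: ih; rewrite ?lexx// lerDl nn /=; apply: le_trans (ltW bn') bb'.
  have h2 : hle w (fun k => Y b' k - Y (a + n%:R) k) (C * (b' - (a + n%:R))).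
    apply: h; rewrite ?ab' ?bb' ?lerDl ?nn ?(ltW bn') //=; first by apply: le_trans (ltW bn') bb'.
    by move: bn; rewrite -natr1 addrA.
  apply: (hle_le _ (hle_ext _ (hleD w1 h2 h1))) => [|k]; last by ring.
  by rewrite -mulrDr; apply: ler_wpM2l => //; lra.
have b0 : 0 <= b - a by rewrite subr_ge0.
move=> /(_ (Num.bound (b - a)) b); apply; first by rewrite ab lexx.
by have := archi_boundP b0; lra.
Qed.
End Chop.

(** * The quadratic correction *)

Section NormalForm.
Variable R : realType.
Notation J := 'rV[int]_2.
Notation seqs := (J -> R[i]).
Variables (w : J -> R) (c : R).
Hypotheses (w1 : forall j, 1 <= w j) (c1 : 1 <= c).
Hypothesis wD : forall a b, w (a + b) <= c * (w a + w b).
Hypothesis wN : forall a, w (- a) = w a.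
Notation hle := (hle w).

Definition conj_if (s : bool) (u : seqs) : seqs := if s then conjs u else u.

Lemma hle_conj_if s u M : hle u M -> hle (conj_if s u) M.
Proof. by case: s => //; exact: hle_conjs. Qed.

Lemma conj_ifB s u v k : conj_if s u k - conj_if s v k = conj_if s (fun j => u j - v j) k.
Proof. by case: s => //=; rewrite /conjs conjcB. Qed.

Lemma hle_conj_ifB s u v D : hle (fun j => u j - v j) D ->
  hle (fun j => conj_if s u j - conj_if s v j) D.
Proof. by move=> h; apply: hle_ext (conj_ifB s u v) _; exact: hle_conj_if. Qed.

Variables (I : choiceType) (p q : I -> J) (th : I -> J -> J -> R) .
Variables (cf : I -> J -> J -> R[i]) (s1 s2 : I -> bool) (G G' : R).
Hypotheses (hG : coef_le w p q cf G) (hG' : coef_le w p q (divided th cf) G').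
Hypothesis hth : forall i k j, cf i k j = 0 \/ th i k j != 0.
Variables (z h : R -> seqs) (a b rho H E : R).
Hypotheses (ab : a <= b) (H0 : 0 <= H) (E0 : 0 <= E).
Hypothesis dz : forall t, a <= t <= b -> forall k, cder (z ^~ k) t (h t k).
Hypothesis hz : forall t, a <= t <= b -> hle (z t) rho.
Hypothesis hh : forall t, a <= t <= b -> hle (h t) H.

Notation Bt cf t u := (bil p q (osc th cf t) (fun i => conj_if (s1 i) u) (fun i => conj_if (s2 i) u)).
Hypothesis hE : forall t, a <= t <= b -> hle (fun k => h t k - Bt cf t (z t) k) E.

Definition corrected t : seqs := fun k => z t k - Bt (divided th cf) t (z t) k.

(* On a short interval [s, t], the argument of the divided sum is frozen at its value at [s]:
   its time derivative is then the undivided sum up to [|z t - z s|], and no derivative of the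
   sum along [z] is needed. *)
Lemma corrected_drift :
  hle (fun k => corrected b k - corrected a k) ((E + 2 * Cb c * (G + G') * (rho * H)) * (b - a)).
Proof.
have r0 : 0 <= rho by apply: (hle_ge0 (hz (t := a) _)); rewrite lexx.
have CB0 := Cb_ge0 c1; have G0 := coef_le_ge0 hG; have G0' := coef_le_ge0 hG'.
apply: hle_chop => //.
  apply: addr_ge0 => //; apply: mulr_ge0; last exact: mulr_ge0.
  by apply: mulr_ge0; [exact: mulr_ge0|exact: addr_ge0].
move=> s t /andP[as_ sb] /andP[at_ tb] /andP[st ts1].
have mv x : s <= x <= t -> hle (fun k => z x k - z s k) (H * (x - s)).
  move=> /andP[sx xt]; apply: (@hle_MVT_lin _ _ w1 z h _ _ _ sx) => y /andP[sy yx].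
    by apply: dz; apply/andP; split; lra.
  by apply: hh; apply/andP; split; lra.
have inab x : s <= x <= t -> a <= x <= b by move=> /andP[? ?]; apply/andP; split; lra.
have hs : hle (z s) rho by apply: hz; rewrite as_ sb.
have ht : hle (z t) rho by apply: hz; rewrite at_ tb.
have hci u (si : I -> bool) : hle u rho -> forall i, hle (conj_if (si i) u) rho by move=> hu i; exact: hle_conj_if.
pose f x : seqs := fun k => z x k - Bt (divided th cf) x (z s) k.
have hf : hle (fun k => f t k - f s k) ((E + 2 * Cb c * G * (rho * H)) * (t - s)).
  apply: (@hle_MVT_lin _ _ w1 f (fun x k => h x k - Bt cf x (z s) k) _ _ _ st) => x xst.
    by move=> k; apply: cderB; [exact: dz (inab x xst) k|exact: (bil_cder w1 x k hG hG' hth (hci _ s1 hs) (hci _ s2 hs) r0)].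
  have xs : 0 <= x - s by move: xst => /andP[? _]; rewrite subr_ge0.
  have hx := hz (inab x xst).
  have D0 : 0 <= H * (x - s) by rewrite mulr_ge0.
  have hd := hle_bil_diff w1 c1 wD (osc_coef_le th x hG) (hci _ s1 hx) (hci _ s2 hx)
    (hci _ s1 hs) (hci _ s2 hs) r0 D0 (fun i => hle_conj_ifB (s1 i) (mv x xst)) (fun i => hle_conj_ifB (s2 i) (mv x xst)).
  apply: (hle_le _ (hle_ext _ (hleD w1 (hE (inab x xst)) hd))) => [|k]; last by ring.
  rewrite lerD2l; apply: ler_wpM2l; first by apply: mulr_ge0 => //; exact: mulr_ge0.
  apply: ler_wpM2l => //; rewrite -[leRHS]mulr1; apply: ler_wpM2l => //.
  by move: xst => /andP[? ?]; lra.
have ts0 : 0 <= t - s by rewrite subr_ge0.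
have D0 : 0 <= H * (t - s) by rewrite mulr_ge0.
have hst : s <= t <= t by rewrite st lexx.
(* Unfreezing the argument at [t] costs an amount proportional to [t - s], and so adds up over the
   pieces. *)
have hd := hle_bil_diff w1 c1 wD (osc_coef_le th t hG') (hci _ s1 ht) (hci _ s2 ht)
  (hci _ s1 hs) (hci _ s2 hs) r0 D0 (fun i => hle_conj_ifB (s1 i) (mv t hst)) (fun i => hle_conj_ifB (s2 i) (mv t hst)).
apply: (hle_le _ (hle_ext _ (hleB w1 hf hd))) => [|k].
  by apply: ler_eq; ring.
by rewrite /corrected /f; ring.
Qed.
End NormalForm.

(** * Conjugation of the linear part *)

Section Conjugation.
Variable R : realType.
Notation J := 'rV[int]_2.
Notation seqs := (J -> R[i]).
Variables (w : J -> R) (c : R).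
Hypotheses (w1 : forall j, 1 <= w j) (c1 : 1 <= c).
Hypothesis wD : forall a b, w (a + b) <= c * (w a + w b).
Hypothesis wN : forall a, w (- a) = w a.
Notation hle := (hle w).
Variables (d : nat) (K : 'M[int]_(d, 2)) (om : 'rV[R]_d).
Hypothesis om1 : forall i, `|om 0 i| <= 1.
Notation Z := 'rV[int]_d.
Notation pi := (momentum K).
Notation symb := (Z -> J -> R[i]).
Implicit Types (U W : symb) (u v : seqs) (t : R) (k n j : J) (l m : Z).

Let c0 : 0 <= c. Proof. exact: le_trans c1. Qed.
Let w0 j : 0 <= w j. Proof. exact: le_trans (w1 j). Qed.

Lemma imaginaryE (x : R) : 0 +i* x = (0 +i* 1) * x%:C :> R[i].
Proof. by apply/eqP; rewrite eq_complex /= !mul0r mulr0 subrr add0r mul1r !eqxx. Qed.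

Lemma imaginary_sqr : (0 +i* 1) * (0 +i* 1) = -1 :> R[i].
Proof. by apply/eqP; rewrite eq_complex /= !mul0r !mulr0 mul1r sub0r addr0 oppr0 !eqxx. Qed.

Definition lop U t u : seqs := fun k => csum (fun l => U l (k - pi l) * expi (t * idot l om) * u (k - pi l)).

Definition sym_le U (g : Z -> R) := forall l j, cabs (U l j) <= g l.

(** The symbol of the operator conjugated by [conjs], which reverses both the mode and the site; see
    [lop_conjs]. *)
Definition csym U : symb := fun l j => conjc (U (- l) (- j)).

Definition sprod U W : symb := fun m j => csum (fun l => U (m - l) (j + pi l) * W l j).

Lemma sym_le_ge0 U g l : sym_le U g -> 0 <= g l.
Proof. by move=> h; apply: le_trans (h l 0); exact: cabs_ge0. Qed.

Lemma sumle_w (g : Z -> R) G : (forall l, 0 <= g l) -> sumle (fun l => g l * w (pi l)) G -> sumle g G.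
Proof. by move=> g0 h; apply: sumle_le h _ (lexx _) => l; rewrite ler_peMr. Qed.

Lemma lop_hle U g G t u M : sym_le U g -> sumle (fun l => g l * w (pi l)) G -> hle u M ->
  hle (lop U t u) (2 * c * G * M).
Proof.
move=> hU hG hu; have M0 := hle_ge0 hu.
apply: (hle_csum w1 (a := fun l => (2 * c * M) * (g l * w (pi l)))); last first.
  by rewrite [X in sumle _ X]mulrAC; apply: (sumleZ _ hG); rewrite !mulr_ge0.
move=> l; have hv : hle (fun j => U l j * expi (t * idot l om) * u j) (g l * M).
  apply: hle_le (_ : cabs (g l)%:C * M <= _) (hle_solid w1 _ (hleZ (g l)%:C hu)).
    by rewrite cabs_real ger0_norm//; exact: sym_le_ge0 hU.
  move=> j; rewrite [leLHS]cabsM [leRHS]cabsM ler_wpM2r ?cabs_ge0// cabsM cabs_expi mulr1 cabs_real.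
  by apply: le_trans (hU l j) (ler_norm _).
apply: hle_le (hle_shift w1 c1 wD (pi l) hv).
by apply: ler_eq; ring.
Qed.

Lemma lop_summ U g G t u M k : sym_le U g -> sumle g G -> hle u M ->
  summ (fun l => U l (k - pi l) * expi (t * idot l om) * u (k - pi l)).
Proof.
move=> hU hG hu; have M0 := hle_ge0 hu.
apply: (summ_le (sumleZ M0 hG)) => l; rewrite !cabsM cabs_expi mulr1 mulrC.
by apply: ler_pM; rewrite ?cabs_ge0 ?hU//; exact: hle_term hu.
Qed.

Lemma lop_comp U W g G g' G' t u M : sym_le U g -> sumle g G -> sym_le W g' -> sumle g' G' ->
  hle u M -> lop U t (lop W t u) = lop (sprod U W) t u.
Proof.
move=> hU hG hW hG' hu; apply/funext => n; have M0 := hle_ge0 hu.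
have G0' := sumle_ge0 hG'; have g0 l := sym_le_ge0 l hU; have g0' l := sym_le_ge0 l hW.
pose F (z : Z * Z) := U z.1 (n - pi z.1) * expi (t * idot z.1 om) *
  (W z.2 (n - pi z.1 - pi z.2) * expi (t * idot z.2 om) * u (n - pi z.1 - pi z.2)).
have sF : summ F.
  exists (G * (G' * M)); apply: (@sumle_pair _ _ _ _ (fun l => g l * (G' * M))) => [z|l|].
  - exact: cabs_ge0.
  - have := sumleZ (mulr_ge0 (g0 l) M0) hG'; rewrite (_ : _ * M * G' = g l * (G' * M)); last by ring.
    move/sumle_le; apply => // m; rewrite /F /= !cabsM !cabs_expi !mulr1 -mulrA.
    apply: ler_pM; rewrite ?mulr_ge0 ?cabs_ge0// mulrC.
    by apply: ler_pM; rewrite ?cabs_ge0//; exact: hle_term hu.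
  - rewrite [X in sumle _ X]mulrC.
    by apply: sumle_le (sumleZ (mulr_ge0 G0' M0) hG) _ (lexx _) => l; rewrite mulrC.
pose h (z : Z * Z) := (z.1 - z.2, z.2); pose h' (z : Z * Z) := (z.1 + z.2, z.2).
have hK : cancel h h' by move=> [a b]; rewrite /h /h' /= subrK.
have hK' : cancel h' h by move=> [a b]; rewrite /h /h' /= addrK.
have s1 : summ (fun z => F (h z)) := summ_inj (can_inj hK) sF.
transitivity (csum F).
  rewrite -(csum_pair sF) /lop; apply: eq_csum => l; rewrite /F /= csumZ//.
  exact: (lop_summ _ _ hW hG' hu).
rewrite -(csum_reindex hK hK' sF) -(csum_pair s1) /lop; apply: eq_csum => m.
rewrite /F /h /= /sprod -mulrA mulrC -csumZ; last first.
  apply: (summ_le (sumleZ (_ : 0 <= G) hG')) => [|l]; first exact: sumle_ge0 hG.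
  by rewrite cabsM; apply: ler_pM; rewrite ?cabs_ge0//; apply: le_trans (hU _ _) (sumle_term _ hG).
apply: eq_csum => l.
have e : n - pi (m - l) - pi l = n - pi m by rewrite momentumD momentumN opprB addrA addrAC addrK.
have e2 : n - pi (m - l) = n - pi m + pi l by rewrite momentumD momentumN opprB addrA addrAC.
rewrite e e2 (_ : idot m om = idot (m - l) om + idot l om); last by rewrite -idotD subrK.
by rewrite mulrDr expiD; ring.
Qed.

Lemma lop_delta U t u : (forall l j, U l j = (l == 0)%:R) -> lop U t u = u.
Proof.
move=> hU; apply/funext => k; rewrite /lop (csum1 (i0 := 0)) => [|l l0].
  by rewrite hU eqxx idot0l mulr0 expi0 momentum0 subr0 !mul1r.
by rewrite hU (negbTE l0) !mul0r.
Qed.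

Lemma csym_le U g : (forall l, g (- l) = g l) -> sym_le U g -> sym_le (csym U) g.
Proof. by move=> gN hU l j; rewrite /csym cabs_conj -gN. Qed.

Lemma lop_conjs U g G t u M : sym_le U g -> sumle g G -> hle u M ->
  conjs (lop U t u) = lop (csym U) t (conjs u).
Proof.
move=> hU hG hu; apply/funext => k; rewrite /conjs /lop -csum_conj; last exact: (lop_summ _ _ hU hG hu).
have s1 : summ (fun l => conjc (U l (- k - pi l) * expi (t * idot l om) * u (- k - pi l))).
  by have [N hN] := lop_summ t (- k) hU hG hu; apply: (summ_le hN) => l; rewrite cabs_conj.
rewrite -(csum_reindex (@opprK _) (@opprK _) s1); apply: eq_csum => l.
rewrite !conjcM /csym -expiN idotNl mulrN opprK momentumN opprK.
by rewrite (_ : - k + pi l = - (k - pi l))// opprB addrC.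
Qed.

Section Equation.
Variables (V : Z -> R[i]) (AV : R) (W : symb) (g : Z -> R) (G G2 : R) (lam : J -> R).
Hypothesis hV : sumle (fun l => cabs (V l) * w (pi l)) AV.
Hypotheses (hW : sym_le W g) (hG : sumle g G).
Hypothesis hG2 : sumle (fun l => g l * (n1 l).+1%:R ^+ 2) G2.
Hypothesis Weq : forall l j, (idot l om + (sq2 j)%:~R)%:C * W l j + sprod W (fun l _ => V l) l j =
  (lam (j + pi l))%:C * W l j.

Let V1 : sumle (fun l => cabs (V l)) AV.
Proof. by apply: sumle_w hV => l; exact: cabs_ge0. Qed.

Lemma idot_le_n1 l : `|idot l om| <= (n1 l)%:R.
Proof.
rewrite /idot /n1 natr_sum; apply: le_trans (ler_norm_sum _ _ _) _; apply: ler_sum => i _.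
rewrite normrM -[leRHS]mulr1; apply: ler_pM => //.
by rewrite natr_absz intr_norm.
Qed.

Lemma sq2_shift_le k l : `|(sq2 (k - pi l))%:~R : R| <= ((n1 k + mom_bound K) * (n1 l).+1)%:R ^+ 2.
Proof.
rewrite -intr_norm -natr_absz -natrX ler_nat sq2_dot.
apply: leq_trans (absz_dot2 _ _) _; rewrite -mulnn leq_mul//.
all: apply: leq_trans (n1D _ _) _; rewrite n1N mulnS mulnDl.
all: have := n1_momentum K l; move: (n1 (pi l)) (mom_bound K) (n1 l) (n1 k) => a b e f; nia.
Qed.

(** By [Weq] the derivative of the phases in [lop W], the free frequencies and [V] add up to
    multiplication by [lam k], which the prefactor cancels. Termwise differentiation brings down
    [|k - pi l|^2], hence the second moment of [g] in [hG2]. *)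
Lemma conjugated_cder (u Gn : R -> seqs) t M k :
  (forall s, `|s - t| <= 1 -> hle (u s) M) -> (forall s, `|s - t| <= 1 -> hle (Gn s) M) ->
  (forall s, `|s - t| <= 1 -> forall n, cder (u ^~ n) s
     ((0 +i* 1) * ((sq2 n)%:~R%:C * u s n + Vop K om V s (u s) n + Gn s n))) ->
  cder (fun s => expi (- (lam k * s)) * lop W s (u s) k) t
    ((0 +i* 1) * (expi (- (lam k * t)) * lop W t (Gn t) k)).
Proof.
move=> hu hGn du; set ii : R[i] := 0 +i* 1.
have t1 : `|t - t| <= 1 by rewrite subrr normr0.
have M0 := hle_ge0 (hu t t1); have AV0 := sumle_ge0 V1.
have g0 l := sym_le_ge0 l hW.
have hVs s : `|s - t| <= 1 -> hle (Vop K om V s (u s)) (2 * c * AV * M).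
  by move=> st; exact: (Vop_hle w1 c1 wD om hV s (hu s st)).
pose f s l := W l (k - pi l) * expi (s * idot l om) * u s (k - pi l).
pose f' s l := ii * ((idot l om + (sq2 (k - pi l))%:~R)%:C * W l (k - pi l) * expi (s * idot l om) * u s (k - pi l)
  + (W l (k - pi l) * expi (s * idot l om) * Vop K om V s (u s) (k - pi l)
   + W l (k - pi l) * expi (s * idot l om) * Gn s (k - pi l))).
pose Ck : R := (1 + (n1 k + mom_bound K)%:R ^+ 2) * M + (2 * c * AV * M + M).
have Ck0 : 0 <= Ck by rewrite addr_ge0 ?mulr_ge0 ?addr_ge0 ?exprn_ge0 ?mulr_ge0.
have df l s : `|s - t| <= 1 -> cder (f ^~ l) s (f' s l).
  move=> st; have h1 := cderZ (W l (k - pi l)) (cder_expi (idot l om) s).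
  have := cderM h1 (du s st (k - pi l)).
  move/(@cder_ext _ (f ^~ l)); rewrite (_ : _ + _ = f' s l); last first.
    rewrite imaginaryE -/ii /f' (mulrC s) (rmorphD (real_complex R)) /=; ring.
  by apply => r; rewrite /f (mulrC r).
have bf l s : `|s - t| <= 1 -> cabs (f' s l) <= Ck * (g l * (n1 l).+1%:R ^+ 2).
  move=> st; rewrite /f' cabsM cabs_i mul1r.
  have N1 : 1 <= (n1 l).+1%:R ^+ 2 :> R by rewrite exprn_ege1// ler1n.
  have b0 (x : R[i]) X : cabs x <= X -> cabs (W l (k - pi l) * expi (s * idot l om) * x) <= g l * X.
    by move=> hx; rewrite !cabsM cabs_expi mulr1; apply: ler_pM; rewrite ?cabs_ge0.
  have b1 := b0 _ _ (hle_term (k - pi l) (hu s st)).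
  have b2 := b0 _ _ (hle_term (k - pi l) (hVs s st)).
  have b3 := b0 _ _ (hle_term (k - pi l) (hGn s st)).
  apply: le_trans (cabsD _ _) _.
  have h2 : cabs (W l (k - pi l) * expi (s * idot l om) * Vop K om V s (u s) (k - pi l) +
    W l (k - pi l) * expi (s * idot l om) * Gn s (k - pi l)) <= g l * (2 * c * AV * M) + g l * M.
    by apply: le_trans (cabsD _ _) (lerD b2 b3).
  have h1 : cabs ((idot l om + (sq2 (k - pi l))%:~R)%:C * W l (k - pi l) * expi (s * idot l om) * u s (k - pi l))
     <= (1 + (n1 k + mom_bound K)%:R ^+ 2) * (n1 l).+1%:R ^+ 2 * (g l * M).
    rewrite -2!mulrA [leLHS]cabsM [W _ _ * _]mulrA; apply: ler_pM; rewrite ?cabs_ge0// cabs_real.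
    apply: le_trans (ler_normD _ _) _; rewrite mulrDl mul1r -exprMn -natrM.
    apply: lerD; last exact: sq2_shift_le.
    apply: le_trans (idot_le_n1 l) _; rewrite -natrX ler_nat expnS expn1.
    by apply: leq_trans (leqnSn _) _; exact: leq_pmulr.
  apply: le_trans (lerD h1 h2) _.
  have := ler_wpM2l (_ : 0 <= g l * (2 * c * AV * M + M)) N1.
  rewrite mulr_ge0 ?addr_ge0 ?mulr_ge0// => /(_ isT); rewrite mulr1 mulrDr /Ck.
  move: (_ ^+ 2) ((n1 l).+1%:R ^+ 2) => x y h; lra.
have sf : summ (f t) := lop_summ t k hW hG (hu t t1).
have db : cder (fun s => lop W s (u s) k) t (csum (f' t)).
  exact: (csum_cder ltr01 sf df bf (sumleZ Ck0 hG2)).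
have sf' : summ (f' t) by apply: (summ_le (sumleZ Ck0 hG2)) => l; exact: bf.
have sV := lop_summ t k hW hG (hVs t t1); have sG := lop_summ t k hW hG (hGn t t1).
have e1 : csum (f' t) = ii * ((lam k)%:C * lop W t (u t) k + lop W t (Gn t) k).
  have sD : summ (fun l => (idot l om + (sq2 (k - pi l))%:~R)%:C * W l (k - pi l) * expi (t * idot l om) * u t (k - pi l)).
    have := summB (summZ (- ii) sf') (summD sV sG); case=> N hN; exists N.
    apply: sumle_le hN _ (lexx _) => l; rewrite /f' mulrA.
    by rewrite mulNr imaginary_sqr opprK mul1r addrK.
  have -> : csum (f' t) = ii * (csum (fun l => (idot l om + (sq2 (k - pi l))%:~R)%:C * W l (k - pi l) * expi (t * idot l om) * u t (k - pi l))
      + (lop W t (lop (fun l _ => V l) t (u t)) k + lop W t (Gn t) k)).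
    rewrite /f' csumZ; last exact: (summD sD (summD sV sG)).
    by congr (_ * _); rewrite csumD ?csumD//; exact: summD.
  rewrite (lop_comp _ hW hG (fun l _ => lexx (cabs (V l))) V1 (hu t t1)) addrA; congr (_ * (_ + _)).
  have -> : lop (sprod W (fun l _ => V l)) t (u t) k = csum (fun l => (lam k)%:C * (W l (k - pi l) * expi (t * idot l om) * u t (k - pi l)) -
      (idot l om + (sq2 (k - pi l))%:~R)%:C * W l (k - pi l) * expi (t * idot l om) * u t (k - pi l)).
    apply: eq_csum => l; have := Weq l (k - pi l); rewrite subrK => h.
    have -> : sprod W (fun l _ => V l) l (k - pi l) = (lam k)%:C * W l (k - pi l) -
      (idot l om + (sq2 (k - pi l))%:~R)%:C * W l (k - pi l) by rewrite -h addrAC subrr add0r.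
    ring.
  rewrite csumB//; last exact: summZ.
  by rewrite csumZ// addrC subrK.
rewrite e1 in db.
have de : cder (fun s => expi (- (lam k * s))) t (- (ii * (lam k)%:C) * expi (- (lam k * t))).
  have := cder_expi (- lam k) t; rewrite mulNr => h.
  apply: (@cder_ext _ _ (fun s => expi (- lam k * s))) => [s|]; first by rewrite mulNr.
  by move: h; rewrite imaginaryE rmorphN mulrN.
have := cderM de db; rewrite (_ : _ + _ = ii * (expi (- (lam k * t)) * lop W t (Gn t) k)) //.
ring.
Qed.
End Equation.
End Conjugation.

(** * The quadratic terms in the reduced coordinates *)

Section Quadratic.
Variable R : realType.
Notation J := 'rV[int]_2.
Notation seqs := (J -> R[i]).
Variables (w : J -> R) (c : R).
Hypotheses (w1 : forall j, 1 <= w j) (c1 : 1 <= c).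
Hypothesis wD : forall a b, w (a + b) <= c * (w a + w b).
Hypothesis wN : forall a, w (- a) = w a.
Notation hle := (hle w).
Variables (d : nat) (K : 'M[int]_(d, 2)) (om : 'rV[R]_d).
Notation Z := 'rV[int]_d.
Notation pi := (momentum K).
Notation symb := (Z -> J -> R[i]).
Implicit Types (u z : seqs) (a b : nat) (t : R) (k n j : J) (l m : Z).

Let c0 : 0 <= c. Proof. exact: le_trans c1. Qed.
Let w0 j : 0 <= w j. Proof. exact: le_trans (w1 j). Qed.

Lemma cconv_delta0 u : cconv u (@delta0 R) = u.
Proof.
apply/funext => k; rewrite /cconv (csum1 (i0 := 0)) => [|j /negbTE j0]; rewrite /delta0 ?j0 ?mulr0//.
by rewrite eqxx mulr1 subr0.
Qed.

(** Among the three quadratic monomials, the first factor is conjugated as soon as [b > 0], the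
    second one only when [a = 0]. *)
Lemma pw_quadratic u a b : (a + b = 2)%N ->
  pw u a b = cconv (conj_if (0 < b)%N u) (conj_if (a == 0%N) u).
Proof.
case: a => [|[|[|a]]]; case: b => [|[|[|b]]]; rewrite ?addSn ?addnS //= => _;
  by rewrite /pw /= cconv_delta0.
Qed.

Variables (U W : symb) (g : Z -> R) (lam : J -> R) (Q : Z -> nat -> nat -> R[i]).
Variables (tau : nat) (Gp A2 G : R).
Hypotheses (hU : sym_le U g) (hW : sym_le W g) (gN : forall l, g (- l) = g l).

Definition phi l : R := w (pi l) * (n1 l).+1%:R ^+ tau.

Definition Qdeg2 : Z -> nat -> nat -> R[i] := fun l a b => if (a + b == 2)%N then Q l a b else 0.

Hypothesis hg : sumle (fun l => g l * phi l) Gp.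
Hypothesis hQ2 : sumle (fun x : Z * nat * nat => cabs (Qdeg2 x.1.1 x.1.2 x.2) * phi x.1.1) A2.

(** An index consists of the mode of [W], the mode and the two degrees of a monomial of [Q], and the
    modes of the two copies of [U] substituted into it. *)
Notation I := (Z * ((Z * nat * nat) * (Z * Z)))%type.
Implicit Types (i : I).

Definition conj1 i : bool := (0 < i.2.1.2)%N.
Definition conj2 i : bool := i.2.1.1.2 == 0%N.
Definition pos1 i : J := pi i.1 + pi i.2.1.1.1 + pi i.2.2.1.
Definition pos2 i : J := pi i.2.2.2.
Definition total i : Z := i.1 + i.2.1.1.1 + i.2.2.1 + i.2.2.2.
Definition Us (s : bool) : symb := if s then csym U else U.
Definition lams (s : bool) n : R := if s then - lam (- n) else lam n.

Definition qcoef i k j : R[i] := (0 +i* 1) * (W i.1 (k - pi i.1) * Qdeg2 i.2.1.1.1 i.2.1.1.2 i.2.1.2 *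
  Us (conj1 i) i.2.2.1 (k - pos1 i - j) * Us (conj2 i) i.2.2.2 (j - pos2 i)).

Definition qphase i k j : R := idot (total i) om - lam k + lams (conj1 i) (k - pos1 i - j)
  + lams (conj2 i) (j - pos2 i).

Definition qgam i : R := g i.1 * cabs (Qdeg2 i.2.1.1.1 i.2.1.1.2 i.2.1.2) * g i.2.2.1 * g i.2.2.2.

Let g0 l : 0 <= g l. Proof. exact: sym_le_ge0 hU. Qed.

Lemma phi_ge1 l : 1 <= phi l.
Proof. by rewrite -[1]mulr1 ler_pM// exprn_ege1// ler1n. Qed.

Lemma w_le_phi l : w (pi l) <= phi l.
Proof. by rewrite /phi ler_peMr// exprn_ege1// ler1n. Qed.

Lemma sumle_gw : sumle (fun l => g l * w (pi l)) Gp.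
Proof. by apply: sumle_le hg _ (lexx _) => l; rewrite ler_wpM2l ?w_le_phi. Qed.

Lemma sumle_g : sumle g Gp.
Proof. by apply: sumle_w sumle_gw. Qed.

Lemma Us_le s : sym_le (Us s) g.
Proof. by case: s => //; exact: csym_le. Qed.

Lemma qcoef_le_gam i k j : cabs (qcoef i k j) <= qgam i.
Proof.
rewrite /qcoef /qgam cabsM cabs_i mul1r !cabsM.
by do 2 (apply: ler_pM; rewrite ?mulr_ge0 ?cabs_ge0 ?Us_le//); rewrite ler_wpM2r ?cabs_ge0.
Qed.

(** The weights are submultiplicative, and so is the loss [(n1 + 1) ^+ tau] of the divisors; the sum
    therefore factors over the four modes, each carrying its own [phi]. *)
Lemma qgam_sumle : sumle (fun i => qgam i * (w (pos1 i) * w (pos2 i)) * (n1 (total i)).+1%:R ^+ tau)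
  ((2 * c) ^+ 2 * (Gp * (A2 * (Gp * Gp)))).
Proof.
have f0 l : 0 <= g l * phi l by rewrite mulr_ge0//; exact: le_trans (phi_ge1 l).
have q0 (x : Z * nat * nat) : 0 <= cabs (Qdeg2 x.1.1 x.1.2 x.2) * phi x.1.1.
  by rewrite mulr_ge0 ?cabs_ge0//; exact: le_trans (phi_ge1 _).
have h1 := sumleM f0 f0 hg hg.
have h2 := sumleM q0 (fun y : Z * Z => mulr_ge0 (f0 y.1) (f0 y.2)) hQ2 h1.
have h3 := sumleM f0 (fun y : (Z * nat * nat) * (Z * Z) => mulr_ge0 (q0 y.1) (mulr_ge0 (f0 y.2.1) (f0 y.2.2))) hg h2.
have C2 : 0 <= (2 * c) ^+ 2 by rewrite exprn_ge0// mulr_ge0.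
apply: sumle_le (sumleZ C2 h3) _ (lexx _) => -[l [[[l' a] b] [m1 m2]]].
rewrite /qgam /pos1 /pos2 /total /phi /=.
have W3 : w (pi l + pi l' + pi m1) <= (2 * c) ^+ 2 * (w (pi l) * w (pi l') * w (pi m1)).
  apply: le_trans (weight_shift w1 c1 wD _ _) _; rewrite expr2.
  have := ler_wpM2l (_ : 0 <= 2 * c * w (pi m1)) (weight_shift w1 c1 wD (pi l) (pi l')).
  by rewrite !mulr_ge0// => /(_ isT)/le_trans; apply; apply: ler_eq; ring.
have N4 : (n1 (l + l' + m1 + m2)).+1%:R ^+ tau <=
    (n1 l).+1%:R ^+ tau * (n1 l').+1%:R ^+ tau * (n1 m1).+1%:R ^+ tau * (n1 m2).+1%:R ^+ tau :> R.
  rewrite -!exprMn -!natrM lerXn2r ?nnegrE// ler_nat.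
  have := n1D (l + l' + m1) m2; have := n1D (l + l') m1; have := n1D l l'.
  move: (n1 (l + l' + m1 + m2)) (n1 (l + l' + m1)) (n1 (l + l')) (n1 l) (n1 l') (n1 m1) (n1 m2) => x y z' e f h r.
  move=> p1 p2 p3; apply: (@leq_trans (e + f + h + r).+1); first lia.
  by nia.
set q := cabs _; set gg := g l * q * g m1 * g m2.
have gg0 : 0 <= gg by rewrite /gg !mulr_ge0 ?cabs_ge0.
have := ler_wpM2l gg0 (ler_pM _ _ (ler_wpM2r (w0 (pi m2)) W3) N4).
rewrite mulr_ge0 ?exprn_ge0// => /(_ isT isT); rewrite mulrA => h; apply: le_trans h _.
by apply: ler_eq; rewrite /gg; ring.
Qed.

Lemma qcoef_coef_le : coef_le w pos1 pos2 qcoef ((2 * c) ^+ 2 * (Gp * (A2 * (Gp * Gp)))).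
Proof.
exists qgam; first exact: qcoef_le_gam.
apply: sumle_le qgam_sumle _ (lexx _) => i; apply: ler_peMr; last by rewrite exprn_ege1// ler1n.
by rewrite !mulr_ge0 ?cabs_ge0.
Qed.

Section Divisors.
Variable gam1 : R.
Hypothesis gam10 : 0 < gam1.
Hypothesis nonres : forall l j1 j2 j3 (s1 s2 s3 : int), l != 0 -> `|s1| <= 1 -> `|s2| <= 1 -> `|s3| <= 1 ->
  gam1 * ((n1 l).+1%:R ^+ tau)^-1 <=
  `|idot l om + s1%:~R * lam j1 + s2%:~R * lam j2 + s3%:~R * lam j3|.
Hypotheses (suppU : forall l j, \sum_i l 0 i <> 0 -> U l j = 0)
  (suppW : forall l j, \sum_i l 0 i <> 0 -> W l j = 0).
Hypothesis suppQ : forall l a b, (\sum_i l 0 i) + a%:Z - b.+1%:Z <> 0 -> Q l a b = 0.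

Lemma qphase_lower i k j :
  qcoef i k j = 0 \/ gam1 * ((n1 (total i)).+1%:R ^+ tau)^-1 <= `|qphase i k j|.
Proof.
have [q0|q0] := eqVneq (qcoef i k j) 0; [by left|right].
have sU s l n : Us s l n != 0 -> \sum_i l 0 i = 0.
  move=> h; apply/eqP; apply: contraNT h => /eqP h; apply/eqP; case: s => /=; last exact: suppU.
  rewrite /csym suppU ?conjc0// => e; apply: h; apply/eqP; rewrite -oppr_eq0 -sumrN; apply/eqP.
  by rewrite -[RHS]e; apply: eq_bigr => r _; rewrite mxE.
have /and4P[hw hq h1 h2] : [&& W i.1 (k - pi i.1) != 0, Qdeg2 i.2.1.1.1 i.2.1.1.2 i.2.1.2 != 0,
    Us (conj1 i) i.2.2.1 (k - pos1 i - j) != 0 & Us (conj2 i) i.2.2.2 (j - pos2 i) != 0].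
  by move: q0; rewrite /qcoef mulf_eq0 negb_or => /andP[_]; rewrite !mulf_eq0 !negb_or -!andbA.
(* The modes of [U] and [W] have zero sum, so [total i] has the sum of the mode of [Q], namely
   [b + 1 - a = 3 - 2 a], an odd number. *)
have L0 : total i != 0.
  apply/eqP => L0; have : \sum_r total i 0 r = 0 by rewrite L0 big1// => r _; rewrite mxE.
  rewrite /total; under eq_bigr do rewrite !mxE; rewrite !big_split /=.
  rewrite (sU _ _ _ h1) (sU _ _ _ h2) !addr0.
  have -> : \sum_r i.1 0 r = 0.
    by apply/eqP; apply: contraNT hw => /eqP h; apply/eqP; exact: suppW.
  move: hq; rewrite /Qdeg2 add0r; case: (eqVneq (i.2.1.1.2 + i.2.1.2)%N 2%N) => [ab hq hl|_]; last by rewrite eqxx.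
  move: hq => /eqP; apply; apply: suppQ; rewrite hl add0r; move: ab.
  move: (i.2.1.1.2) (i.2.1.2) => a b; lia.
pose sg (s : bool) : int := if s then -1 else 1.
have sg1 s : `|sg s| <= 1 by case: s.
have lE s n : lams s n = (sg s)%:~R * lam (if s then - n else n) by case: s; rewrite /= ?mulN1r ?mul1r.
have := nonres k (if conj1 i then - (k - pos1 i - j) else k - pos1 i - j)
  (if conj2 i then - (j - pos2 i) else j - pos2 i) L0 (_ : `|-1 : int| <= 1) (sg1 (conj1 i)) (sg1 (conj2 i)).
by move=> /(_ isT)/le_trans; apply; rewrite /qphase !lE mulN1r.
Qed.

Lemma qphase_neq0 i k j : qcoef i k j = 0 \/ qphase i k j != 0.
Proof.
have [|h] := qphase_lower i k j; [by left|right]; rewrite -normr_gt0; apply: lt_le_trans h.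
by rewrite mulr_gt0// invr_gt0 exprn_gt0.
Qed.

Lemma qcoef_divided_le :
  coef_le w pos1 pos2 (divided qphase qcoef) (gam1^-1 * ((2 * c) ^+ 2 * (Gp * (A2 * (Gp * Gp))))).
Proof.
have q0 i : 0 <= qgam i by rewrite /qgam !mulr_ge0 ?cabs_ge0.
exists (fun i => gam1^-1 * (qgam i * (n1 (total i)).+1%:R ^+ tau)) => [i k j|]; last first.
  have G0 : 0 <= gam1^-1 by rewrite invr_ge0 ltW.
  apply: sumle_le (sumleZ G0 qgam_sumle) _ (lexx _) => i.
  by apply: ler_eq; ring.
rewrite /divided; have [->|h] := qphase_lower i k j.
  rewrite mul0r cabs0 mulr_ge0 ?invr_ge0 ?(ltW gam10)// mulr_ge0// exprn_ge0//.
rewrite cabsM (_ : cabs (0 +i* _) = `|qphase i k j|^-1); last first.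
  by rewrite imaginaryE cabsM cabs_i mul1r cabs_real normrN normfV.
rewrite mulrCA; apply: ler_pM; rewrite ?cabs_ge0 ?invr_ge0 ?qcoef_le_gam//.
have N0 : 0 < (n1 (total i)).+1%:R ^+ tau :> R by rewrite exprn_gt0.
rewrite -[X in _ <= X]invrK lef_pV2 ?posrE ?invr_gt0 ?mulr_gt0 ?invr_gt0//.
  by rewrite invfM invrK.
by apply: lt_le_trans h; rewrite mulr_gt0 ?invr_gt0.
Qed.
End Divisors.

Variables (rho AQ : R).
Hypothesis rho0 : 0 < rho.
Hypothesis hQ : sumle (fun x : Z * nat * nat =>
  cabs (Qdeg2 x.1.1 x.1.2 x.2) * w (pi x.1.1) * rho ^+ (x.1.2 + x.2)) AQ.

(** With [u] expanded through [U] in terms of [z], all time dependence is collected into the phase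
    of each index; the rest is a rearrangement of one absolutely convergent sum. *)
Lemma quadratic_flat z t M k (u := lop K om U t (fun n => expi (lam n * t) * z n)) N :
  hle z M -> hle u N -> Cc c * N <= rho ->
  (0 +i* 1) * (expi (- (lam k * t)) * lop K om W t (Gop K om Qdeg2 t u) k) =
  bil pos1 pos2 (osc qphase qcoef t) (fun i => conj_if (conj1 i) z) (fun i => conj_if (conj2 i) z) k.
Proof.
move=> hz hu Nr; set v : seqs := fun n => expi (lam n * t) * z n in u hu *.
have hb : hle v M by apply: hle_solid hz => // j; rewrite cabsM cabs_expi mul1r.
have M0 := hle_ge0 hz.
have hcz s : hle (conj_if s z) M by exact: hle_conj_if.
have hcb s : hle (conj_if s v) M by exact: hle_conj_if.
have hcu s : hle (conj_if s u) N by exact: hle_conj_if.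
have cbE s n : conj_if s v n = expi (t * lams s n) * conj_if s z n.
  case: s; rewrite /= /conjs /v ?[t * _]mulrC//.
  by rewrite conjcM -expiN mulNr.
have cuE s : conj_if s u = lop K om (Us s) t (conj_if s v).
  by case: s => //=; rewrite (lop_conjs K om t hU sumle_g hb).
have sm := bil_summ w1 k (osc_coef_le qphase t qcoef_coef_le) (fun i => hcz (conj1 i)) (fun i => hcz (conj2 i)) M0 M0.
pose A0 := (0 +i* 1) * expi (- (lam k * t)) : R[i].
pose Al l := A0 * (W l (k - pi l) * expi (t * idot l om)).
pose Bx (x : Z * nat * nat) := Qdeg2 x.1.1 x.1.2 x.2 * expi (t * idot x.1.1 om).
pose X s m n := Us s m (n - pi m) * expi (t * idot m om) * conj_if s v (n - pi m).
pose T (y : I * J) := Al y.1.1 * Bx y.1.2.1 * (X (conj1 y.1) y.1.2.2.1 (k - pi y.1.1 - pi y.1.2.1.1.1 - y.2) *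
   X (conj2 y.1) y.1.2.2.2 y.2).
have TE y : osc qphase qcoef t y.1 k y.2 * (conj_if (conj1 y.1) z (k - pos1 y.1 - y.2) *
    conj_if (conj2 y.1) z (y.2 - pos2 y.1)) = T y.
  case: y => -[l [[[l' a'] b'] [m1 m2]]] j; set i := (l, _); rewrite /T /X /Al /A0 /Bx /= !cbE.
  have -> : k - pi l - pi l' - j - pi m1 = k - pos1 i - j.
    by rewrite /pos1 /= !opprD !addrA [LHS]addrAC.
  rewrite -/(pos2 i) /osc /qcoef /qphase /=.
  have -> : t * (idot (total i) om - lam k + lams (conj1 i) (k - pos1 i - j) + lams (conj2 i) (j - pos2 i)) =
    t * idot l om + t * idot l' om + t * idot m1 om + t * idot m2 om + - (lam k * t) +
    t * lams (conj1 i) (k - pos1 i - j) + t * lams (conj2 i) (j - pos2 i).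
    by rewrite /total /= !idotD; ring.
  rewrite !expiD; ring.
have sT : summ T by case: sm => B hB; exists B; apply: sumle_le hB _ (lexx _) => y; rewrite TE.
have [B hB] := sT.
rewrite /bil (eq_csum TE) -(csum_pair sT).
pose T' i := csum (fun j => T (i, j)).
have sT' : summ T' by exists B; exact: (sumle_csum (F := fun i j => T (i, j)) hB).
rewrite -/T' -(csum_pair sT').
have hQ' := Gop_summ w1 c1 wD wN om rho0 hQ t _ hu Nr.
have hG2 : hle (Gop K om Qdeg2 t u) (2 * c * W0 w * AQ * (Cc c * N / rho) ^+ 0).
  by apply: (Gop_hle w1 c1 wD wN om rho0 hQ t) => // l a b'.
rewrite /lop mulrA -/A0 -csumZ; last exact: (lop_summ K om t k hW sumle_g hG2).
apply: eq_csum => l; rewrite mulrA -/(Al l) /Gop -csumZ; last exact: hQ'.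
rewrite -(csum_pair (summ_pairl l sT')); apply: eq_csum => x; rewrite -/(Bx x).
rewrite /T' (csum_exchange (F := fun y : (Z * Z) * J => T ((l, (x, y.1)), y.2))); last first.
  apply: (summ_inj (h := fun y : (Z * Z) * J => ((l, (x, y.1)), y.2)) (f := T)) => //.
  by move=> [y j] [y' j'] [-> ->].
set n := k - pi l - pi x.1.1.
have [ab|ab] := eqVneq (x.1.2 + x.2)%N 2; last first.
  have B0 : Bx x = 0 by rewrite /Bx /Qdeg2 (negbTE ab) mul0r.
  rewrite [LHS](_ : _ = 0); last by rewrite B0 mul0r mulr0.
  rewrite -[LHS](csum0 R J); apply: eq_csum => j; rewrite -[LHS](csum0 R (Z * Z)%type).
  by apply: eq_csum => y; rewrite /T /= B0 mulr0 mul0r.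
rewrite (pw_quadratic u ab) /cconv mulrA -csumZ; last exact: (cconv_summ n (hcu _) (hcu _)).
apply: eq_csum => j; rewrite {1}[conj_if _ u]cuE {1}[conj_if _ u]cuE /lop.
have s1 := lop_summ K om t (n - j) (Us_le (0 < x.2)%N) sumle_g (hcb (0 < x.2)%N).
have s2 := lop_summ K om t j (Us_le (x.1.2 == 0%N)) sumle_g (hcb (x.1.2 == 0%N)).
by rewrite -(csumM s1 s2) -csumZ//; exact: (summM s1 s2).
Qed.
End Quadratic.

(** * Existence and uniqueness *)

Section Evolution.
Variable R : realType.
Notation J := 'rV[int]_2.
Notation seqs := (J -> R[i]).
Variables (w : J -> R) (c : R).
Hypotheses (w1 : forall j, 1 <= w j) (c1 : 1 <= c).
Hypothesis wD : forall a b, w (a + b) <= c * (w a + w b).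
Hypothesis wN : forall a, w (- a) = w a.
Notation hle := (hle w).
Notation Cc := (Cc c).
Variables (d : nat) (K : 'M[int]_(d, 2)) (om : 'rV[R]_d).
Notation Z := 'rV[int]_d.
Notation pi := (momentum K).
Implicit Types (u v : seqs) (t s e M : R) (k j : J).

Let c0 : 0 <= c. Proof. exact: le_trans c1. Qed.
Let Cc0 : 0 <= Cc. Proof. exact: le_trans (Cc_ge1 c1). Qed.
Let w0 j : 0 <= w j. Proof. exact: le_trans (w1 j). Qed.
Let W00 : 0 <= W0 w. Proof. exact: addr_ge0. Qed.

Lemma hle_closed u M : (forall e, 0 < e -> hle u (M + e)) -> hle u M.
Proof. by move=> h g tg s us; apply/ler_addgt0Pr => e e0; exact: h. Qed.

Definition phase_flow t u : seqs := fun k => expi ((sq2 k)%:~R * t) * u k.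

Lemma hle_phase_flow t u M : hle u M -> hle (phase_flow t u) M.
Proof. by apply: hle_solid => // j; rewrite cabsM cabs_expi mul1r. Qed.

Lemma phase_flowK t u : phase_flow (- t) (phase_flow t u) = u.
Proof. by apply/funext => k; rewrite /phase_flow mulrA mulrN expiNK mul1r. Qed.

(** The free flow is continuous strongly but not in operator norm: a finite set of sites, depending
    on [u], is treated by the Lipschitz bound on phases, and the tail is counted twice. *)
Lemma phase_flow_cont t u M e : hle u M -> 0 < e -> \forall s \near t, hle (fun k => phase_flow s u k - phase_flow t u k) e.
Proof.
move=> hu e0; have e4 : 0 < e / 4 by rewrite divr_gt0.
have [S uS hS] := hle_tail w1 hu e4.
pose C : R := \sum_(j <- S) (1 + w j) * (2 * (`|(sq2 j)%:~R| * cabs (u j))).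
have C0 : 0 <= C by apply: sumr_ge0 => j _; rewrite !mulr_ge0 ?cabs_ge0// addr_ge0.
have C1 : 0 < 2 * (C + 1) by rewrite mulr_gt0// ltr_wpDl.
near=> s.
have st : `|s - t| <= e / (2 * (C + 1)).
  near: s; apply: filterS (nbhsx_ballx t _ (divr_gt0 e0 C1)) => s.
  by rewrite /ball /= distrC => /ltW.
pose u1 j := if j \in S then 0 else u j.
pose D j := phase_flow s u j - phase_flow t u j.
have h1 : hle (fun j => if j \in S then D j else 0) (e / 2).
  apply: hle_le (hle_finite w1 D uS).
  apply: (@le_trans _ _ (C * `|s - t|)).
    rewrite /C mulr_suml; apply: ler_sum => j _; rewrite -mulrA ler_wpM2l ?addr_ge0//.
    rewrite /D /phase_flow -mulrBl cabsM.
    have := ler_wpM2r (cabs_ge0 (u j)) (expi_lip ((sq2 j)%:~R * s) ((sq2 j)%:~R * t)).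
    rewrite -mulrBr normrM => /le_trans; apply; apply: ler_eq; ring.
  move: st; rewrite ler_pdivlMr// => st; have := normr_ge0 (s - t); lra.
have h2 := hleD w1 h1 (hleB w1 (hle_phase_flow s hS) (hle_phase_flow t hS)).
apply: (hle_le _ (hle_ext _ h2)) => [|j]; first by lra.
by rewrite /D /phase_flow; case: (j \in S); rewrite ?mulr0 ?subrr ?addr0 ?add0r.
Unshelve. all: by end_near.
Qed.

Variables (V : Z -> R[i]) (AV : R) (Q : Z -> nat -> nat -> R[i]) (rho A : R).
Hypothesis hV : sumle (fun l => cabs (V l) * w (pi l)) AV.
Hypothesis rho0 : 0 < rho.
Hypothesis hQ : sumle (fun x : Z * nat * nat =>
  cabs (Q x.1.1 x.1.2 x.2) * w (pi x.1.1) * rho ^+ (x.1.2 + x.2)) A.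

Let AV0 : 0 <= AV. Proof. exact: sumle_ge0 hV. Qed.
Let A0 : 0 <= A. Proof. exact: sumle_ge0 hQ. Qed.

Definition Nop t u : seqs := fun k => Vop K om V t u k + Gop K om Q t u k.

Lemma Nop_hle t u M : hle u M -> Cc * M <= rho -> hle (Nop t u) (2 * c * AV * M + 2 * c * W0 w * A).
Proof.
move=> hu Mr; apply: hleD (Vop_hle w1 c1 wD om hV t hu) _ => //.
have := Gop_hle w1 c1 wD wN om rho0 hQ (m := 0) t _ hu Mr.
by rewrite expr0 mulr1; apply => l a b.
Qed.

Definition LN : R := 2 * c * AV + 2 * c * W0 w * A * (2 * Cc / rho).

Lemma LN_ge0 : 0 <= LN.
Proof.
have r0 : 0 <= rho^-1 by rewrite invr_ge0 ltW.
rewrite /LN; apply: addr_ge0; first by rewrite !mulr_ge0.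
by apply: mulr_ge0; [rewrite !mulr_ge0|apply: mulr_ge0 => //; apply: mulr_ge0].
Qed.

Lemma Nop_lip t u v M D : hle u M -> hle v M -> hle (fun j => u j - v j) D -> 2 * (Cc * M) <= rho ->
  hle (fun k => Nop t u k - Nop t v k) (LN * D).
Proof.
move=> hu hv hD Mr.
have h1 := Vop_lip w1 c1 wD om hV t hu hv hD; have h2 := Gop_lip w1 c1 wD wN om rho0 hQ t hu hv hD Mr.
apply: (hle_le _ (hle_ext _ (hleD w1 h1 h2))) => [|k]; last by rewrite /Nop; ring.
by rewrite /LN; apply: ler_eq; ring.
Qed.

Lemma Nop_cont t u M k e : hle u M -> Cc * M <= rho -> 0 < e ->
  \forall s \near t, cabs (Nop s u k - Nop t u k) <= e.
Proof.
move=> hu Mr e0; have e2 : 0 < e / 2 by rewrite divr_gt0.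
have h1 := Vop_cont w1 om hV t k hu e2; have h2 := Gop_cont w1 c1 wD wN om rho0 hQ t k hu Mr e2.
near=> s; rewrite (_ : _ - _ = (Vop K om V s u k - Vop K om V t u k) + (Gop K om Q s u k - Gop K om Q t u k)); last first.
  by rewrite /Nop; ring.
by apply: le_trans (cabsD _ _) _; rewrite [e]splitr; apply: lerD; near: s.
Unshelve. all: by end_near.
Qed.

Section Cauchy.
Variables (r : R) (u0 : seqs) (M0 : R).
Hypotheses (r0 : 0 < r) (hr : 2 * (Cc * r) <= rho) (hu0 : hle u0 M0).

Let hr1 : Cc * r <= rho.
Proof. by apply: le_trans hr; have := mulr_ge0 Cc0 (ltW r0); lra. Qed.

(** The retraction makes the nonlinear part bounded and Lipschitz on the whole space, so the curve
    is global. Inside the ball of radius [r] it satisfies the original equation. *)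
Lemma evolution : exists u : R -> seqs, [/\ u 0 = u0,
  forall t, exists M, forall s, `|s - t| <= 1 -> hle (u s) M,
  forall t e, 0 < e -> \forall s \near t, hle (fun k => u s k - u t k) e &
  forall t k, cder (u ^~ k) t ((0 +i* 1) * ((sq2 k)%:~R%:C * u t k + Nop t (retract w r (u t)) k))].
Proof.
(* Interaction picture: the free phases are factored out, so that no unbounded term is left in the
   field. *)
pose F t a : seqs := fun k => (0 +i* 1) * phase_flow (- t) (Nop t (retract w r (phase_flow t a))) k.
have hret t a M : hle a M -> hle (retract w r (phase_flow t a)) r.
  by move=> ha; exact: (retract_hle r0 (hle_phase_flow t ha)).
have hF t a M : hle a M -> hle (F t a) (2 * c * AV * r + 2 * c * W0 w * A).
  move=> ha; have := hleZ (0 +i* 1) (hle_phase_flow (- t) (Nop_hle t (hret t a M ha) hr1)).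
  by rewrite cabs_i mul1r; apply.
(* The 2 is the Lipschitz constant of the retraction; the 1 only makes the constant positive. *)
have hFL t a b M N D : hle a M -> hle b N -> hle (fun k => a k - b k) D ->
    hle (fun k => F t a k - F t b k) ((2 * LN + 1) * D).
  move=> ha hb hD; have D0 := hle_ge0 hD.
  have h1 : hle (fun k => phase_flow t a k - phase_flow t b k) D.
    by apply: hle_ext (hle_phase_flow t hD) => k; rewrite /phase_flow mulrBr.
  have h2 := Nop_lip t (hret t a M ha) (hret t b N hb) (retract_lip w1 r0 (hle_phase_flow t ha) (hle_phase_flow t hb) h1) hr.
  have := hleZ (0 +i* 1) (hle_phase_flow (- t) h2); rewrite cabs_i mul1r => h3.
  apply: (hle_le _ (hle_ext _ h3)) => [|k]; last by rewrite /F /phase_flow; ring.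
  by move: (LN) => x; lra.
have hFC t a M k e : hle a M -> 0 < e -> \forall s \near t, cabs (F s a k - F t a k) <= e.
  move=> ha e0; have e3 : 0 < e / 3 by rewrite divr_gt0.
  set B : R := 2 * c * AV * r + 2 * c * W0 w * A.
  have LN1 : 0 < 2 * LN + 1 by rewrite ltr_wpDl// mulr_ge0// LN_ge0.
  have n1 := phase_flow_cont t ha (divr_gt0 e3 LN1).
  have n2 := Nop_cont t k (hret t a M ha) hr1 e3.
  have hN := Nop_hle t (hret t a M ha) hr1.
  have n3 : \forall s \near t, cabs (expi ((sq2 k)%:~R * - s) - expi ((sq2 k)%:~R * - t)) * B <= e / 3.
    have B0 : 0 <= B := hle_ge0 hN.
    pose C : R := 2 * `|(sq2 k)%:~R| * B + 1.
    have C0 : 0 < C by rewrite ltr_wpDl// !mulr_ge0.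
    apply: filterS (nbhsx_ballx t _ (divr_gt0 e3 C0)) => s; rewrite /ball /= distrC => /ltW.
    rewrite ler_pdivlMr// => h; apply: le_trans (ler_wpM2r B0 (expi_lip _ _)) _.
    rewrite -mulrBr normrM opprK [- s + t]addrC (distrC t s).
    by move: h; rewrite /C; have := normr_ge0 (s - t); lra.
  near=> s.
  have h3 : cabs (expi ((sq2 k)%:~R * - s) - expi ((sq2 k)%:~R * - t)) * B <= e / 3 by near: s.
  rewrite /F -mulrBr cabsM cabs_i mul1r /phase_flow.
  set xs := Nop s (retract w r (phase_flow s a)) k; set xt := Nop t (retract w r (phase_flow t a)) k.
  pose xm := Nop s (retract w r (phase_flow t a)) k.
  rewrite (_ : _ - _ = expi ((sq2 k)%:~R * - s) * (xs - xm) + expi ((sq2 k)%:~R * - s) * (xm - xt)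
    + (expi ((sq2 k)%:~R * - s) - expi ((sq2 k)%:~R * - t)) * xt); last by ring.
  have -> : e = e / 3 + e / 3 + e / 3 by field.
  apply: le_trans (cabsD _ _) _; apply: lerD; first (apply: le_trans (cabsD _ _) _; apply: lerD).
  - rewrite cabsM cabs_expi mul1r.
    have hd : hle (fun k => phase_flow s a k - phase_flow t a k) (e / 3 / (2 * LN + 1)) by near: s.
    have h2 := Nop_lip s (hret s a M ha) (hret t a M ha) (retract_lip w1 r0 (hle_phase_flow s ha) (hle_phase_flow t ha) hd) hr.
    apply: le_trans (hle_term k h2) _; rewrite mulrA (mulrC LN) mulrA ler_pdivrMr//.
    by move: (LN) => x; move: e3; lra.
  - by rewrite cabsM cabs_expi mul1r /xm /xt; clear xs xt xm; near: s.
  - rewrite cabsM; apply: le_trans h3.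
    by apply: ler_wpM2l; [exact: cabs_ge0|exact: (hle_term k hN)].
have L0 : 0 < 2 * LN + 1 by rewrite ltr_wpDl// mulr_ge0// LN_ge0.
have [a [ca da]] := @picard R w w1 F _ _ L0 hF hFL hFC u0 M0 hu0.
have ha t := curve_hle w1 hu0 t ca.
have B0 : 0 <= 2 * c * AV * r + 2 * c * W0 w * A := hle_ge0 (hF 0 _ _ hu0).
exists (fun t => phase_flow t (a t)); split.
- by rewrite ca.1; apply/funext => k; rewrite /phase_flow mulr0 expi0 mul1r.
- move=> t; exists (M0 + (2 * c * AV * r + 2 * c * W0 w * A) * (`|t| + 1)) => s st.
  apply: hle_le (hle_phase_flow s (ha s)); rewrite lerD2l ler_wpM2l//.
  by rewrite -(subrK t s) addrC; apply: le_trans (ler_normD _ _) _; rewrite lerD2l.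
- move=> t e e0; have e2 : 0 < e / 2 by rewrite divr_gt0.
  have n1 := phase_flow_cont t (ha t) e2.
  set B : R := _ + _ in ca B0; have B1 : 0 < B + 1 by rewrite ltr_wpDl.
  near=> s; have st : `|s - t| <= e / 2 / (B + 1).
    near: s; apply: filterS (nbhsx_ballx t _ (divr_gt0 e2 B1)) => s.
    by rewrite /ball /= distrC => /ltW.
  have h1 : hle (fun k => phase_flow s (a t) k - phase_flow t (a t) k) (e / 2) by near: s.
  have h2 := hle_phase_flow s (ca.2 s t).
  apply: (hle_le _ (hle_ext _ (hleD w1 h2 h1))) => [|k]; last by rewrite /phase_flow; ring.
  by move: st; rewrite ler_pdivlMr// => st; have := normr_ge0 (s - t); lra.
- move=> t k; have := cderM (cder_expi (sq2 k)%:~R t) (da t k).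
  rewrite (_ : _ + _ = (0 +i* 1) * ((sq2 k)%:~R%:C * phase_flow t (a t) k + Nop t (retract w r (phase_flow t (a t))) k)) //.
  rewrite [RHS]mulrDr imaginaryE.
  have -> : expi ((sq2 k)%:~R * t) * F t (a t) k = (0 +i* 1) * Nop t (retract w r (phase_flow t (a t))) k.
    rewrite /F; move: (Nop t _) => N; rewrite /phase_flow mulrCA; congr (_ * _).
    by rewrite mulrA mulrN expiKN mul1r.
  by congr (_ + _); rewrite /phase_flow; ring.
Unshelve. all: by end_near.
Qed.
End Cauchy.

(** Any uniform bound on [D] over the interval can be halved, because [D] vanishes at [t0] and
    [L * dl <= 1/2]; iteration gives zero. *)
Lemma local_unique (D D' : R -> seqs) t0 dl L S0 : 0 < dl -> 0 <= L -> L * dl <= 2^-1 ->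
  (forall s, `|s - t0| <= dl -> forall k, cder (D ^~ k) s (D' s k)) ->
  (forall s, `|s - t0| <= dl -> hle (D s) S0) ->
  (forall s S, `|s - t0| <= dl -> hle (D s) S -> hle (D' s) (L * S)) ->
  (forall k, D t0 k = 0) -> forall s, `|s - t0| <= dl -> forall k, D s k = 0.
Proof.
move=> dl0 L0 Ld dD hD hD' D0.
have step S : (forall s, `|s - t0| <= dl -> hle (D s) S) -> forall s, `|s - t0| <= dl -> hle (D s) (S / 2).
  move=> h s sd; have S1 : 0 <= S by apply: hle_ge0 (h s sd).
  have le2 x : 0 <= x -> x <= dl -> L * S * x <= S / 2.
    move=> x0 xd; have := ler_wpM2l S1 (le_trans (ler_wpM2l L0 xd) Ld).
    by rewrite mulrA [S * L]mulrC.
  have [ts|ts] := leP t0 s.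
    have inn x : t0 <= x <= s -> `|x - t0| <= dl.
      move=> /andP[tx xs]; apply: le_trans sd; rewrite !ger0_norm ?subr_ge0//; last by lra.
    have := hle_MVT_lin w1 ts (fun x xts => dD x (inn x xts)) (fun x xts => hD' x S (inn x xts) (h x (inn x xts))).
    move=> h1; apply: (hle_le _ (hle_ext _ h1)) => [|k]; last by rewrite D0 subr0.
    by apply: le2; [rewrite subr_ge0|move: sd; rewrite ger0_norm ?subr_ge0].
  have inn x : s <= x <= t0 -> `|x - t0| <= dl.
    move=> /andP[tx xs]; apply: le_trans sd; rewrite !ler0_norm ?subr_le0 ?(ltW ts)//; lra.
  have := hle_MVT_lin w1 (ltW ts) (fun x xts => dD x (inn x xts)) (fun x xts => hD' x S (inn x xts) (h x (inn x xts))).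
  move=> h1; apply: (hle_le _ (hle_ext _ (hleBC w1 h1))) => [|k]; last by rewrite D0 subr0.
  by apply: le2; [rewrite subr_ge0 ltW|move: sd; rewrite ltr0_norm ?subr_lt0// opprB].
have all n : forall s, `|s - t0| <= dl -> hle (D s) (S0 * 2^-1 ^+ n).
  elim: n => [|n ih]; first by rewrite expr0 mulr1.
  by rewrite exprSr mulrA; exact: step.
move=> s sd; apply: (@hle_zero _ w) => e e0; have [n hn] := half_small S0 e0.
exact: hle_le hn (all n s sd).
Qed.

Lemma real_induction (P : R -> Prop) T : 0 <= T ->
  (forall t, 0 <= t <= T -> (forall s, 0 <= s < t -> P s) -> P t) ->
  (forall t, 0 <= t < T -> (forall s, 0 <= s <= t -> P s) ->
     exists2 e, 0 < e & forall s, t <= s <= t + e -> s <= T -> P s) ->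
  forall t, 0 <= t <= T -> P t.
Proof.
move=> T0 hc ho.
pose S := [set t | 0 <= t <= T /\ forall s, 0 <= s <= t -> P s].
have S0 : S 0.
  split; first by rewrite lexx.
  move=> s /andP[s0 s1]; apply: hc => [|r /andP[r0 rs]]; first by rewrite s0 (le_trans s1).
  by have := lt_le_trans rs s1; rewrite ltNge r0.
have hs : has_sup S by split; [exists 0|exists T => x [/andP[]]].
set m := sup S.
have m0 : 0 <= m by apply: sup_upper_bound.
have mT : m <= T by apply: ge_sup; [exists 0|move=> x [/andP[]]].
have lt_m s : 0 <= s < m -> P s.
  move=> /andP[s0 sm]; have e0 : 0 < m - s by rewrite subr_gt0.
  have [x [_ hx] xs] := sup_adherent e0 hs; apply: hx; rewrite s0 /=.
  by move: xs; rewrite -/m subKr => /ltW.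
have Pm : P m by apply: hc => //; rewrite m0.
have Sm s : 0 <= s <= m -> P s.
  by move=> /andP[s0]; rewrite le_eqVlt => /orP[/eqP -> //|sm]; apply: lt_m; rewrite s0.
move=> t /andP[t0 tT]; have [tm|mt] := leP t m; first by apply: Sm; rewrite t0.
have mT' : m < T by apply: lt_le_trans tT.
have [|e e0 he] := ho m _ Sm; first by rewrite m0.
pose x := Num.min (m + e) T.
have xm : m < x by rewrite lt_min mT' ltrDl e0.
have : S x.
  split; first by rewrite (le_trans m0 (ltW xm)) ge_min lexx orbT.
  move=> s /andP[s0 sx]; have [sm|ms] := leP s m; first by apply: Sm; rewrite s0.
  move: sx; rewrite le_min => /andP[s1 s2]; apply: he => //; by rewrite (ltW ms).
by move/(sup_upper_bound hs); rewrite -/m leNgt xm.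
Qed.
End Evolution.

(** * The normal form estimate *)

Section Apriori.
Variable R : realType.
Notation J := 'rV[int]_2.
Notation seqs := (J -> R[i]).
Variables (w : J -> R) (c : R).
Hypotheses (w1 : forall j, 1 <= w j) (c1 : 1 <= c).
Hypothesis wD : forall a b, w (a + b) <= c * (w a + w b).
Hypothesis wN : forall a, w (- a) = w a.
Notation hle := (hle w).
Notation Cc := (Cc c).
Variables (d : nat) (K : 'M[int]_(d, 2)).
Notation Z := 'rV[int]_d.
Notation pi := (momentum K).
Notation symb := (Z -> J -> R[i]).
Implicit Types (u v : seqs) (t s e M : R) (k j : J).

Let c0 : 0 <= c. Proof. exact: le_trans c1. Qed.
Let Cc0 : 0 <= Cc. Proof. exact: le_trans (Cc_ge1 c1). Qed.
Let w0 j : 0 <= w j. Proof. exact: le_trans (w1 j). Qed.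
Let W00 : 0 <= W0 w. Proof. exact: addr_ge0. Qed.

Lemma lop_near_id (om : 'rV[R]_d) (U : symb) g G g' G' t u M : sym_le U g -> sumle g G ->
  sym_le (fun l j => U l j - (l == 0)%:R) g' -> sumle (fun l => g' l * w (pi l)) G' ->
  2 * c * G' <= 10^-1 -> hle u M -> hle (lop K om U t u) (11 / 10 * M).
Proof.
move=> hU hG hU' hG' G1 hu; have M0 := hle_ge0 hu.
have g0' l := sym_le_ge0 l hU'.
have e k : lop K om U t u k = u k + lop K om (fun l j => U l j - (l == 0)%:R) t u k.
  rewrite -{2}(@lop_delta R d K om (fun l _ => (l == 0)%:R) t u (fun _ _ => erefl)).
  have sU := lop_summ K om t k hU hG hu.
  have sU' := lop_summ K om t k hU' (sumle_w w1 g0' hG') hu.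
  have sd : summ (fun l : Z => (l == 0)%:R * expi (t * idot l om) * u (k - pi l)).
    apply: (summ_fin (t := [:: 0])) => // l; rewrite inE => /negbTE ->; by rewrite !mul0r.
  by rewrite /lop -csumD//; apply: eq_csum => l; ring.
apply: hle_ext e _; apply: hle_le (hleD w1 hu (lop_hle w1 c1 wD om t hU' hG' hu)).
have := ler_wpM2r M0 G1; lra.
Qed.

Variables (Q : Z -> nat -> nat -> R[i]) (rho A : R).
Hypothesis rho0 : 0 < rho.
Hypothesis hQ : sumle (fun x : Z * nat * nat =>
  cabs (Q x.1.1 x.1.2 x.2) * w (pi x.1.1) * rho ^+ (x.1.2 + x.2)) A.
Hypothesis Qlow : forall l a b, (a + b < 2)%N -> Q l a b = 0.
Variables (V : Z -> R[i]) (AV : R).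
Hypothesis hV : sumle (fun l => cabs (V l) * w (pi l)) AV.
Variables (tau : nat) (g g' : Z -> R) (Gp G1 G2 A2 gam1 : R).
Hypotheses (gN : forall l, g (- l) = g l) (gam10 : 0 < gam1).
Hypothesis hg : sumle (fun l => g l * phi w K tau l) Gp.
Hypothesis hg2 : sumle (fun l => g l * (n1 l).+1%:R ^+ 2) G2.
Hypotheses (hg' : sumle (fun l => g' l * w (pi l)) G1) (G1s : 2 * c * G1 <= 10^-1).
Hypothesis hQ2 : sumle (fun x : Z * nat * nat => cabs (Qdeg2 Q x.1.1 x.1.2 x.2) * phi w K tau x.1.1) A2.
Hypothesis suppQ : forall (l : Z) (a b : nat), (\sum_i l 0 i) + a%:Z - b.+1%:Z <> 0 -> Q l a b = 0.

Let A0 : 0 <= A. Proof. exact: sumle_ge0 hQ. Qed.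
Let AV0 : 0 <= AV. Proof. exact: sumle_ge0 hV. Qed.

(** These constants refer to a solution below [4 r]: [Kz m * r ^+ m] bounds the part of degree at
    least [m] of the field in the reduced coordinates, where the solution is below [5 r]; [Kb]
    bounds the quadratic coefficients, and the 25 in [Kcorr] is the square of 5. *)
Definition Kz (m : nat) : R := 2 * c * Gp * (2 * c * W0 w * A * (4 * Cc / rho) ^+ m).
Definition Kb : R := (2 * c) ^+ 2 * (Gp * (A2 * (Gp * Gp))).
Definition Kdrift : R := Kz 3 + 2 * Cb c * (Kb + gam1^-1 * Kb) * (5 * Kz 2).
Definition Kcorr : R := Cb c * (gam1^-1 * Kb) * 25.

Definition Qdeg3 : Z -> nat -> nat -> R[i] := fun l a b => if (a + b == 2)%N then 0 else Q l a b.

Let hQsub (Q' : Z -> nat -> nat -> R[i]) : (forall l a b, cabs (Q' l a b) <= cabs (Q l a b)) ->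
  sumle (fun x : Z * nat * nat => cabs (Q' x.1.1 x.1.2 x.2) * w (pi x.1.1) * rho ^+ (x.1.2 + x.2)) A.
Proof.
move=> h; apply: sumle_le hQ _ (lexx _) => x; rewrite -!mulrA ler_wpM2r//.
by rewrite mulr_ge0// exprn_ge0// ltW.
Qed.

Let hQdeg2 : sumle (fun x : Z * nat * nat =>
  cabs (Qdeg2 Q x.1.1 x.1.2 x.2) * w (pi x.1.1) * rho ^+ (x.1.2 + x.2)) A.
Proof. by apply: hQsub => l a b; rewrite /Qdeg2; case: eqP => // _; rewrite cabs0 cabs_ge0. Qed.

Let hQdeg3 : sumle (fun x : Z * nat * nat =>
  cabs (Qdeg3 x.1.1 x.1.2 x.2) * w (pi x.1.1) * rho ^+ (x.1.2 + x.2)) A.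
Proof. by apply: hQsub => l a b; rewrite /Qdeg3; case: eqP => // _; rewrite cabs0 cabs_ge0. Qed.

Lemma Kz_ge0 (m : nat) : 0 <= Gp -> 0 <= Kz m.
Proof.
move=> G0; have r0 : 0 <= rho^-1 by rewrite invr_ge0 ltW.
by rewrite /Kz mulr_ge0//; [rewrite !mulr_ge0|rewrite mulr_ge0 ?exprn_ge0 ?mulr_ge0// !mulr_ge0].
Qed.

Section Frequency.
Variables (om : 'rV[R]_d) (U W : symb) (lam : J -> R).
Hypothesis om1 : forall i, `|om 0 i| <= 1.
Hypotheses (hU : sym_le U g) (hW : sym_le W g).
Hypotheses (hU' : sym_le (fun l j => U l j - (l == 0)%:R) g') (hW' : sym_le (fun l j => W l j - (l == 0)%:R) g').
Hypothesis UW : forall l j, sprod K U W l j = (l == 0)%:R.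
Hypothesis Weq : forall l j, (idot l om + (sq2 j)%:~R)%:C * W l j + sprod K W (fun l _ => V l) l j =
  (lam (j + pi l))%:C * W l j.
Hypothesis nonres : forall l j1 j2 j3 (s1 s2 s3 : int), l != 0 -> `|s1| <= 1 -> `|s2| <= 1 -> `|s3| <= 1 ->
  gam1 * ((n1 l).+1%:R ^+ tau)^-1 <=
  `|idot l om + s1%:~R * lam j1 + s2%:~R * lam j2 + s3%:~R * lam j3|.
Hypotheses (suppU : forall (l : Z) j, \sum_i l 0 i <> 0 -> U l j = 0)
  (suppW : forall (l : Z) j, \sum_i l 0 i <> 0 -> W l j = 0).

Variables (r : R) (u : R -> seqs).
Hypotheses (r0 : 0 < r) (hr : 2 * (Cc * (4 * r)) <= rho).
Hypothesis ubound : forall t, exists M, forall s, `|s - t| <= 1 -> hle (u s) M.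
Hypothesis du : forall t k, cder (u ^~ k) t
  ((0 +i* 1) * ((sq2 k)%:~R%:C * u t k + Nop K om V Q t (retract w (4 * r) (u t)) k)).
Hypothesis u00 : hle (u 0) r.

Let g0 l : 0 <= g l. Proof. exact: sym_le_ge0 hU. Qed.
Let hgw : sumle (fun l => g l * w (pi l)) Gp. Proof. exact: (sumle_gw w1 hU hg). Qed.
Let hg1 : sumle g Gp. Proof. exact: (sumle_g w1 hU hg). Qed.
Let Gp0 : 0 <= Gp. Proof. exact: sumle_ge0 hg. Qed.
Let A20 : 0 <= A2. Proof. exact: sumle_ge0 hQ2. Qed.
Let hr1 : Cc * (4 * r) <= rho.
Proof. by apply: le_trans hr; have := mulr_ge0 Cc0 (mulr_ge0 (ler0n R 4) (ltW r0)); lra. Qed.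
Let r4 : 0 < 4 * r. Proof. by rewrite mulr_gt0. Qed.

(** The linear transformation and its inverse enlarge norms by at most [11/10], and the correction
    is at most [r / 10]. What remains is the drift of the corrected variable, at most
    [Kdrift * r ^+ 3 * T <= r / 10]. *)
Lemma apriori T : (forall s, `|s| <= T -> hle (u s) (4 * r)) ->
  Kdrift * r ^+ 2 * T <= 10^-1 -> Kcorr * r <= 10^-1 ->
  forall s, `|s| <= T -> hle (u s) (2 * r).
Proof.
move=> h4 hT hc.
(* The effect of the retraction is put into the nonlinear part, so that the linear part is exact at
   all times; as long as [u] stays below [4 r], this is [Gop] itself ([GnE]). *)
pose Gn s : seqs := fun k => Nop K om V Q s (retract w (4 * r) (u s)) k - Vop K om V s (u s) k.
pose z s : seqs := fun k => expi (- (lam k * s)) * lop K om W s (u s) k.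
pose h s : seqs := fun k => (0 +i* 1) * (expi (- (lam k * s)) * lop K om W s (Gn s) k).
have dz s k : cder (z ^~ k) s (h s k).
  have [M hM] := ubound s; pose M' := M + (2 * c * AV * (4 * r) + 2 * c * W0 w * A + 2 * c * AV * M).
  have M0 : 0 <= M by apply: hle_ge0 (hM s _); rewrite subrr normr0.
  have hN x : `|x - s| <= 1 -> hle (Gn x) (2 * c * AV * (4 * r) + 2 * c * W0 w * A + 2 * c * AV * M).
    move=> xs; apply: hleB => //; last exact: (Vop_hle w1 c1 wD om hV x (hM x xs)).
    exact: (Nop_hle w1 c1 wD wN om hV rho0 hQ x (retract_hle r4 (hM x xs)) hr1).
  have N0 : 0 <= 2 * c * AV * (4 * r) + 2 * c * W0 w * A + 2 * c * AV * M by apply: hle_ge0 (hN s _); rewrite subrr normr0.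
  apply: (conjugated_cder w1 c1 wD om1 hV hW hg1 hg2 Weq (u := u) (Gn := Gn) (M := M')) => x xs.
  - by apply: hle_le (hM x xs); rewrite lerDl.
  - by apply: hle_le (hN x xs); rewrite lerDr.
  - move=> n; have := du x n; rewrite (_ : _ * (_ + Nop _ _ _ _ _ _ _) = (0 +i* 1) * ((sq2 n)%:~R%:C * u x n + Vop K om V x (u x) n + Gn x n)) //.
    by rewrite /Gn; ring.
have zE s k : expi (lam k * s) * z s k = lop K om W s (u s) k by rewrite /z mulrA expiKN mul1r.
have uE s : u s = lop K om U s (fun n => expi (lam n * s) * z s n).
  have [M hM] := ubound s; have hus : hle (u s) M by apply: hM; rewrite subrr normr0.
  have -> : (fun n => expi (lam n * s) * z s n) = lop K om W s (u s) by apply/funext => n; exact: zE.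
  by rewrite (lop_comp K om s hU hg1 hW hg1 hus) (lop_delta K om s (u s) UW).
have hz s M : hle (u s) M -> hle (z s) (11 / 10 * M).
  move=> hu; apply: hle_solid (lop_near_id om s hW hg1 hW' hg' G1s hu) => // k.
  by rewrite cabsM cabs_expi mul1r.
have hback s M : hle (z s) M -> hle (u s) (11 / 10 * M).
  move=> hzs; rewrite (uE s); apply: (lop_near_id om s hU hg1 hU' hg' G1s).
  by apply: hle_solid hzs => // k; rewrite cabsM cabs_expi mul1r.
have GnE s : `|s| <= T -> Gn s = Gop K om Q s (u s).
  move=> sT; apply/funext => k; rewrite /Gn.
  have -> : retract w (4 * r) (u s) = u s.
    by apply/funext => j; exact: (retract_id r4 (h4 s sT) (lexx _)).
  by rewrite /Nop addrAC subrr add0r.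
have expo (m : nat) : (Cc * (4 * r) / rho) ^+ m = (4 * Cc / rho) ^+ m * r ^+ m.
  by rewrite -exprMn; congr (_ ^+ _); ring.
have hosc (s : R) (v : seqs) M : hle v M ->
    hle (fun k => (0 +i* 1) * (expi (- (lam k * s)) * lop K om W s v k)) (2 * c * Gp * M).
  move=> hv; apply: hle_solid (lop_hle w1 c1 wD om s hW hgw hv) => // k.
  by rewrite cabsM cabs_i mul1r cabsM cabs_expi mul1r.
have hh s : `|s| <= T -> hle (h s) (Kz 2 * r ^+ 2).
  move=> sT; rewrite /h GnE//.
  have := hosc s _ _ (Gop_hle w1 c1 wD wN om rho0 hQ s (m := 2) Qlow (h4 s sT) hr1).
  by apply: hle_le; rewrite expo /Kz; apply: ler_eq; ring.
have z5 s : `|s| <= T -> hle (z s) (5 * r).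
  by move=> sT; apply: hle_le (hz s _ (h4 s sT)); move: r0; lra.
pose cf := qcoef K U W Q; pose th := qphase K om lam.
have hG : coef_le w (pos1 K) (pos2 K) cf Kb := qcoef_coef_le w1 c1 wD hU hW gN hg hQ2.
have hG' : coef_le w (pos1 K) (pos2 K) (divided th cf) (gam1^-1 * Kb).
  exact: (qcoef_divided_le w1 c1 wD hU hW gN hg hQ2 gam10 nonres suppU suppW suppQ).
have hth i k j : cf i k j = 0 \/ th i k j != 0.
  exact: (qphase_neq0 c1 K gam10 nonres suppU suppW suppQ).
have hE s : `|s| <= T -> hle (fun k => h s k - bil (pos1 K) (pos2 K) (osc th cf s)
    (fun i => conj_if (conj1 i) (z s)) (fun i => conj_if (conj2 i) (z s)) k) (Kz 3 * r ^+ 3).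
  move=> sT.
  have h2 := Gop_hle w1 c1 wD wN om rho0 hQdeg2 s (m := 0) (fun l a b h => False_ind _ (elimF idP erefl h)) (h4 s sT) hr1.
  have l3 l a b : (a + b < 3)%N -> Qdeg3 l a b = 0.
    rewrite /Qdeg3; case: eqP => // /eqP/negbTE ab2; rewrite ltnS leq_eqVlt ab2; exact: Qlow.
  have h3 := Gop_hle w1 c1 wD wN om rho0 hQdeg3 s (m := 3) l3 (h4 s sT) hr1.
  have GE : Gop K om Q s (u s) = fun k => Gop K om (Qdeg2 Q) s (u s) k + Gop K om Qdeg3 s (u s) k.
    apply/funext => k; rewrite /Gop -csumD.
    - apply: eq_csum => x; rewrite /Qdeg2 /Qdeg3; case: ifP => _; ring.
    - exact: (Gop_summ w1 c1 wD wN om rho0 hQdeg2 s k (h4 s sT) hr1).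
    - exact: (Gop_summ w1 c1 wD wN om rho0 hQdeg3 s k (h4 s sT) hr1).
  have hle3 := hosc s _ _ h3.
  apply: (hle_le _ (hle_ext _ hle3)) => [|k].
    by rewrite expo /Kz; apply: ler_eq; ring.
  have u4 : hle (lop K om U s (fun n => expi (lam n * s) * z s n)) (4 * r) by rewrite -uE; exact: h4.
  have qf := quadratic_flat w1 c1 wD wN hU hW gN hg hQ2 rho0 hQdeg2 k (z5 s sT) u4 hr1.
  rewrite -uE in qf; rewrite -[X in _ - X]qf /h GnE// -mulrBr -mulrBr; congr (_ * (_ * _)); rewrite GE.
  have s2 := lop_summ K om s k hW hg1 h2; have s3 := lop_summ K om s k hW hg1 h3.
  rewrite /lop -csumB//; last first.
    have [N hN] := summD s2 s3; exists N; apply: sumle_le hN _ (lexx _) => l; by rewrite mulrDr.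
  by apply: eq_csum => l; rewrite mulrDr addrC addKr.
pose Y := corrected (pos1 K) (pos2 K) th cf (@conj1 d) (@conj2 d) z.
pose B s := bil (pos1 K) (pos2 K) (osc th (divided th cf) s) (fun i => conj_if (conj1 i) (z s)) (fun i => conj_if (conj2 i) (z s)).
have YE s k : Y s k = z s k - B s k by [].
have r2 : 0 <= r ^+ 2 by exact: sqr_ge0. have r3 : 0 <= r ^+ 3 by rewrite exprn_ge0 ?ltW.
have H0 : 0 <= Kz 2 * r ^+ 2 by rewrite mulr_ge0 ?Kz_ge0.
have E0 : 0 <= Kz 3 * r ^+ 3 by rewrite mulr_ge0 ?Kz_ge0.
have drift a b : a <= b -> (forall x, a <= x <= b -> `|x| <= T) ->
    hle (fun k => Y b k - Y a k) (Kdrift * r ^+ 3 * (b - a)).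
  move=> ab inT.
  have := corrected_drift w1 c1 wD wN hG hG' hth ab H0 E0 (fun t _ k => dz t k)
    (fun t tab => z5 t (inT t tab)) (fun t tab => hh t (inT t tab)) (fun t tab => hE t (inT t tab)).
  apply: hle_le; apply: ler_eq; rewrite /Kdrift; ring.
have hB s : `|s| <= T -> hle (B s) (r / 10).
  move=> sT; have z0 : 0 <= 5 * r by rewrite mulr_ge0 ?ltW.
  have := hle_bil w1 c1 wD (osc_coef_le th s hG') (fun i => hle_conj_if wN (conj1 i) (z5 s sT))
    (fun i => hle_conj_if wN (conj2 i) (z5 s sT)) z0 z0.
  apply: hle_le; have := ler_wpM2r (ltW r0) hc; rewrite /Kcorr; lra.
move=> s sT; have T0 : `|0 : R| <= T by rewrite normr0 (le_trans (normr_ge0 s)).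
have hdr : hle (fun k => Y s k - Y 0 k) (r / 10).
  have fin x : 0 <= x -> x <= T -> Kdrift * r ^+ 3 * x <= r / 10.
    move=> x0 xT; have Kd0 : 0 <= Kdrift.
      have CB := Cb_ge0 c1; have Kb0 := coef_le_ge0 hG; have Kb0' := coef_le_ge0 hG'.
      rewrite /Kdrift; apply: addr_ge0; first exact: Kz_ge0.
      by apply: mulr_ge0; [apply: mulr_ge0; [exact: mulr_ge0|exact: addr_ge0]|apply: mulr_ge0 => //; exact: Kz_ge0].
    have := ler_wpM2r (ltW r0) hT; have := ler_wpM2l (mulr_ge0 Kd0 r3) xT; rewrite (exprSr r 2); lra.
  have [s0|s0] := leP 0 s.
    apply: hle_le (drift 0 s s0 _); last first.
      by move=> x /andP[x0 xs]; apply: le_trans sT; rewrite !ger0_norm.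
    by rewrite subr0; apply: fin => //; apply: le_trans sT; exact: ler_norm.
  apply: (hleBC w1); apply: hle_le (drift s 0 (ltW s0) _); last first.
    by move=> x /andP[xs x0]; apply: le_trans sT; rewrite !ler0_norm ?(ltW s0)// lerN2.
  rewrite sub0r; apply: fin; first by rewrite oppr_ge0 ltW.
  by apply: le_trans sT; rewrite ltr0_norm.
have hz0 := hz 0 _ u00.
(* Drift, initial value with its correction, and final correction: [7/5 r] in all. The return to [u]
   multiplies this by [11/10], which stays below [2 r]. *)
have hzs : hle (z s) (r / 10 + (11 / 10 * r + r / 10) + r / 10).
  have := hleD w1 (hleD w1 hdr (hleB w1 hz0 (hB 0 T0))) (hB s sT).
  by apply: hle_ext => k; rewrite !YE; ring.
by apply: hle_le (hback s _ hzs); move: r0; lra.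
Qed.
End Frequency.
End Apriori.

(** * Continuity argument and uniqueness *)

Section Continuation.
Variable R : realType.
Notation J := 'rV[int]_2.
Notation seqs := (J -> R[i]).
Variables (w : J -> R) (c : R).
Hypotheses (w1 : forall j, 1 <= w j) (c1 : 1 <= c).
Hypothesis wD : forall a b, w (a + b) <= c * (w a + w b).
Hypothesis wN : forall a, w (- a) = w a.
Notation hle := (hle w).
Notation Cc := (Cc c).
Variables (d : nat) (K : 'M[int]_(d, 2)) (om : 'rV[R]_d).
Notation Z := 'rV[int]_d.
Notation pi := (momentum K).
Implicit Types (t s e M : R) (k j : J).

(** The bound [2 r] passes to limits in time, and by continuity it can only degrade to [4 r] a
    little further on, where [step] restores it. Both directions of time are treated together. *)
Lemma bootstrap (u : R -> seqs) r T : 0 < r -> 0 <= T ->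
  (forall t e, 0 < e -> \forall s \near t, hle (fun k => u s k - u t k) e) ->
  (forall T', T' <= T -> (forall s, `|s| <= T' -> hle (u s) (4 * r)) ->
     forall s, `|s| <= T' -> hle (u s) (2 * r)) ->
  hle (u 0) r -> forall s, `|s| <= T -> hle (u s) (2 * r).
Proof.
move=> r0 T0 cu step u00.
have cont t e : 0 < e -> exists2 dl, 0 < dl & forall s, `|s - t| <= dl -> hle (fun k => u s k - u t k) e.
  move=> e0; have /nbhs_ballP[x /= x0 hx] := cu t e e0; exists (x / 2); first by rewrite divr_gt0.
  by move=> s st; apply: hx; rewrite /ball /= distrC; apply: le_lt_trans st _; lra.
suff h t : 0 <= t <= T -> hle (u t) (2 * r) /\ hle (u (- t)) (2 * r).
  move=> s sT; have [|h1 h2] := h `|s|; first by rewrite normr_ge0.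
  by have [s0|s0] := leP 0 s; [rewrite -(ger0_norm s0)|rewrite -(opprK s) -(ltr0_norm s0)].
apply: (real_induction T0 (P := fun t => hle (u t) (2 * r) /\ hle (u (- t)) (2 * r))).
- move=> x /andP[x0 xT] hx; move: x0; rewrite le_eqVlt => /orP[/eqP <-|x0].
    by rewrite oppr0; split; apply: hle_le u00; lra.
  split; apply: hle_closed => e e0.
    have [dl d0 hd] := cont x e e0; pose s := Num.max 0 (x - dl).
    have sx : 0 <= s < x by rewrite le_max lexx /= gt_max x0 ltrBlDr ltrDl.
    have sd : `|s - x| <= dl.
      rewrite ler0_norm ?subr_le0 ?(ltW (andP sx).2)// opprB lerBlDr addrC -lerBlDr.
      by rewrite le_max lexx orbT.
    apply: hle_ext (hleD w1 (hx s sx).1 (hleBC w1 (hd s sd))) => k; ring.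
  have [dl d0 hd] := cont (- x) e e0; pose s := Num.max 0 (x - dl).
  have sx : 0 <= s < x by rewrite le_max lexx /= gt_max x0 ltrBlDr ltrDl.
  have sd : `|- s - - x| <= dl.
    rewrite opprK addrC ger0_norm ?subr_ge0 ?(ltW (andP sx).2)// lerBlDr addrC -lerBlDr.
    by rewrite le_max lexx orbT.
  apply: hle_ext (hleD w1 (hx s sx).2 (hleBC w1 (hd _ sd))) => k; ring.
move=> x /andP[x0 xT] hx; have r2 : 0 < 2 * r by rewrite mulr_gt0.
have [d1 d10 hd1] := cont x _ r2; have [d2 d20 hd2] := cont (- x) _ r2.
exists (Num.min d1 d2); first by rewrite lt_min d10.
move=> s /andP[xs sx] sT.
have s0 : 0 <= s by apply: le_trans xs.
have small y : `|y| <= s -> hle (u y) (4 * r).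
  move=> ys; have [yx|yx] := leP `|y| x.
    apply: hle_le (_ : 2 * r <= _) _; first by lra.
    have [|h1 h2] := hx `|y|; first by rewrite normr_ge0.
    by have [y0|y0] := leP 0 y; [rewrite -(ger0_norm y0)|rewrite -(opprK y) -(ltr0_norm y0)].
  have dy : `|y| - x <= Num.min d1 d2 by rewrite lerBlDl; apply: le_trans sx.
  move: dy; rewrite le_min => /andP[dy1 dy2].
  have [|h1 h2] := hx x; first by rewrite x0 lexx.
  have -> : 4 * r = 2 * r + 2 * r by ring.
  have [y0|y0] := leP 0 y.
    rewrite ger0_norm// in yx dy1; apply: hle_ext (hleD w1 h1 (hd1 y _)) => [k|]; first by ring.
    by rewrite ger0_norm// subr_ge0 ltW.
  rewrite ltr0_norm// in yx dy2; apply: hle_ext (hleD w1 h2 (hd2 y _)) => [k|]; first by ring.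
  by rewrite opprK ler0_norm; lra.
have := step s sT small; move=> h; split; apply: h; first by rewrite ger0_norm.
by rewrite normrN ger0_norm.
Qed.

Variables (V : Z -> R[i]) (AV : R) (Q : Z -> nat -> nat -> R[i]) (rho A : R).
Hypothesis hV : sumle (fun l => cabs (V l) * w (pi l)) AV.
Hypothesis rho0 : 0 < rho.
Hypothesis hQ : sumle (fun x : Z * nat * nat =>
  cabs (Q x.1.1 x.1.2 x.2) * w (pi x.1.1) * rho ^+ (x.1.2 + x.2)) A.

(** Of the competitor only continuity is known. Near a time of agreement it therefore stays below
    [4 r], where the field is Lipschitz and [local_unique] applies; continuity closes the set of
    times of agreement. *)
Lemma unique_solution (u v : R -> seqs) r T : 0 < r -> 2 * (Cc * (4 * r)) <= rho ->
  (forall t e, `|t| <= T -> 0 < e -> exists2 dl, 0 < dl & forall s, `|s - t| <= dl -> `|s| <= T ->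
     hle (fun k => u s k - u t k) e) ->
  (forall t e, `|t| <= T -> 0 < e -> exists2 dl, 0 < dl & forall s, `|s - t| <= dl -> `|s| <= T ->
     hle (fun k => v s k - v t k) e) ->
  (forall t, `|t| <= T -> hle (u t) (2 * r)) ->
  (forall t, `|t| < T -> forall k, cder (u ^~ k) t ((0 +i* 1) * ((sq2 k)%:~R%:C * u t k + Nop K om V Q t (u t) k))) ->
  (forall t, `|t| < T -> hle (v t) (4 * r) ->
     forall k, cder (v ^~ k) t ((0 +i* 1) * ((sq2 k)%:~R%:C * v t k + Nop K om V Q t (v t) k))) ->
  v 0 = u 0 -> forall t, `|t| <= T -> v t = u t.
Proof.
move=> r0 hr cu cv u2 du dv v0.
have loc t0 : `|t0| < T -> (forall k, v t0 k = u t0 k) ->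
    exists2 dl, 0 < dl & forall s, `|s - t0| <= dl -> forall k, v s k = u s k.
  move=> tT vt; have [d1 d10 hd1] := cv t0 r (ltW tT) r0.
  have LN0 := LN_ge0 w1 c1 hV rho0 hQ; set L := LN w c AV rho A in LN0.
  have L1 : 0 < 2 * (L + 1) by rewrite mulr_gt0// ltr_wpDl.
  (* Three requirements: [v] stays within [r] of its value at [t0], the time stays inside the open
     interval where the equation holds, and [L * dl <= 1/2]. *)
  pose dl := Num.min (Num.min d1 ((T - `|t0|) / 2)) (2 * (L + 1))^-1.
  have dl0 : 0 < dl by rewrite !lt_min d10 invr_gt0 L1 divr_gt0 ?subr_gt0.
  exists dl => // s sd.
  have inT x : `|x - t0| <= dl -> `|x| < T.
    rewrite !le_min => /andP[/andP[_ h] _].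
    have : `|x| <= `|x - t0| + `|t0| by rewrite -{1}(subrK t0 x); exact: ler_normD.
    by move: tT h; lra.
  have v4 x : `|x - t0| <= dl -> hle (v x) (4 * r).
    move=> xd; have xd1 : `|x - t0| <= d1 by move: xd; rewrite !le_min => /andP[/andP[]].
    have h := hleD w1 (u2 t0 (ltW tT)) (hd1 x xd1 (ltW (inT x xd))).
    apply: (hle_le _ (hle_ext _ h)) => [|k]; first by lra.
    by rewrite -vt addrC subrK.
  have u4 x : `|x - t0| <= dl -> hle (u x) (4 * r).
    by move=> xd; apply: hle_le (u2 x (ltW (inT x xd))); lra.
  (* The free flow is removed from the difference, so that its derivative no longer contains the
     unbounded frequencies. *)
  pose D x : seqs := phase_flow (- x) (fun k => v x k - u x k).
  pose D' x : seqs := fun k => (0 +i* 1) * phase_flow (- x) (fun k => Nop K om V Q x (v x) k - Nop K om V Q x (u x) k) k.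
  suff h : forall x, `|x - t0| <= dl -> forall k, D x k = 0.
    move=> k; have := congr1 (fun f : seqs => f k) (phase_flowK (- s) (fun k => v s k - u s k)).
    rewrite opprK -/(D s) /phase_flow (h s sd) mulr0 => /esym/eqP; by rewrite subr_eq0 => /eqP.
  apply: (local_unique w1 (D := D) (D' := D') (t0 := t0) (dl := dl) (L := L) (S0 := 8 * r)) => //.
  - have : dl <= (2 * (L + 1))^-1 by rewrite ge_min lexx orbT.
    move/(ler_wpM2l LN0)/le_trans; apply; rewrite ler_pdivrMr//; lra.
  - move=> x xd k.
    have h3 := cderM (cder_expi (- (sq2 k)%:~R) x) (cderB (dv x (inT x xd) (v4 x xd) k) (du x (inT x xd) k)).
    apply: (@cder_ext _ _ (fun s => expi (- (sq2 k)%:~R * s) * (v s k - u s k))) => [y|].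
      by rewrite /D /phase_flow mulrN mulNr.
    move: h3; set lhs := _ + _; suff -> : lhs = D' x k by [].
    rewrite /lhs /D' /phase_flow (imaginaryE (- (sq2 k)%:~R)) rmorphN [in RHS]mulrN -[in RHS]mulNr; ring.
  - move=> x xd; have := hle_phase_flow w1 (- x) (hleB w1 (v4 x xd) (u4 x xd)).
    by apply: hle_le; lra.
  - move=> x S xd hS.
    have h1 : hle (fun k => v x k - u x k) S.
      have := hle_phase_flow w1 x hS; rewrite /D.
      by have := phase_flowK (- x) (fun k => v x k - u x k); rewrite opprK => ->.
    have := hleZ (0 +i* 1) (hle_phase_flow w1 (- x) (Nop_lip w1 c1 wD wN om hV rho0 hQ x (v4 x xd) (u4 x xd) h1 hr)).
    by rewrite cabs_i mul1r.
  - by move=> k; rewrite /D /phase_flow vt subrr mulr0.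
have [T0|T0] := ltP T 0.
  by move=> t; rewrite leNgt (lt_le_trans T0).
have clo (sg : bool) x : 0 < x -> x <= T -> (forall s, 0 <= s < x -> forall k, v ((-1) ^+ sg * s) k = u ((-1) ^+ sg * s) k) ->
    forall k, v ((-1) ^+ sg * x) k = u ((-1) ^+ sg * x) k.
  move=> x0 xT hx k; have nx (y : R) : `|(-1) ^+ sg * y| = `|y| by rewrite normrM normrX normrN1 expr1n mul1r.
  have xT' : `|(-1) ^+ sg * x| <= T by rewrite nx ger0_norm// ltW.
  apply/eqP; rewrite -subr_eq0; apply/eqP/cabs_small => e e0.
  have e2 : 0 < e / 2 by rewrite divr_gt0.
  have [d1 d10 hd1] := cu _ _ xT' e2; have [d2 d20 hd2] := cv _ _ xT' e2.
  pose dl := Num.min d1 d2; have dl0 : 0 < dl by rewrite lt_min d10.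
  pose s := Num.max 0 (x - dl).
  have sx : 0 <= s < x by rewrite le_max lexx /= gt_max x0 ltrBlDr ltrDl.
  have /andP[s0 sx'] := sx.
  have sd : `|(-1) ^+ sg * s - (-1) ^+ sg * x| <= dl.
    rewrite -mulrBr nx ler0_norm ?subr_le0 ?(ltW sx')// opprB lerBlDr addrC -lerBlDr.
    by rewrite le_max lexx orbT.
  have sT : `|(-1) ^+ sg * s| <= T by rewrite nx ger0_norm//; apply: le_trans xT; exact: ltW.
  move: sd; rewrite le_min => /andP[sd1 sd2].
  have h1 := hle_term k (hd1 _ sd1 sT); have h2 := hle_term k (hd2 _ sd2 sT).
  rewrite (hx s sx k) in h2.
  rewrite (_ : _ - _ = (u ((-1) ^+ sg * s) k - u ((-1) ^+ sg * x) k) - (u ((-1) ^+ sg * s) k - v ((-1) ^+ sg * x) k)); last by ring.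
  by apply: le_trans (cabsB _ _) _; rewrite [e]splitr; apply: lerD.
suff h t : 0 <= t <= T -> (forall k, v t k = u t k) /\ (forall k, v (- t) k = u (- t) k).
  move=> t tT; apply/funext => k; have [|h1 h2] := h `|t|; first by rewrite normr_ge0.
  by have [t0|t0] := leP 0 t; [rewrite -(ger0_norm t0)|rewrite -(opprK t) -(ltr0_norm t0)].
apply: (real_induction T0 (P := fun t => (forall k, v t k = u t k) /\ (forall k, v (- t) k = u (- t) k))).
- move=> x /andP[x0 xT] hx; move: x0; rewrite le_eqVlt => /orP[/eqP <-|x0].
    by rewrite oppr0 v0.
  split.
    have := @clo false x x0 xT; rewrite expr0 mul1r; apply => s sx; rewrite mul1r; exact: (hx s sx).1.
  have := @clo true x x0 xT; rewrite expr1 mulN1r; apply => s sx; rewrite mulN1r; exact: (hx s sx).2.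
move=> x /andP[x0 xT] hx; have [|hx1 hx2] := hx x; first by rewrite x0 lexx.
have [|d1 d10 h1] := loc x _ hx1; first by rewrite ger0_norm.
have [|d2 d20 h2] := loc (- x) _ hx2; first by rewrite normrN ger0_norm.
exists (Num.min d1 d2); first by rewrite lt_min d10.
move=> s /andP[xs sx] sT.
have sd : `|s - x| <= Num.min d1 d2 by rewrite ger0_norm ?subr_ge0// lerBlDl.
move: sd; rewrite le_min => /andP[sd1 sd2]; split; first exact: h1.
by apply: h2; rewrite opprK addrC -opprB normrN.
Qed.
End Continuation.

(** * From cut-off curves to solutions in the sense of the statement *)

Section Solutions.
Variable R : realType.
Notation J := 'rV[int]_2.
Notation seqs := (J -> R[i]).
Variables (p : R).
Hypothesis p0 : 0 < p.
Notation w := (wt p).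
Notation c := (wc p).
Notation hle := (hle w).
Notation Cc := (Cc c).
Implicit Types (t s e M : R) (k j : J).

Let w1 := wt_ge1 p0.
Let c1 := wc_ge1 p0.
Let wD := wtD p0.
Let wN := wtN p.
Let c0 : 0 <= c. Proof. exact: le_trans c1. Qed.
Let Cc0 : 0 <= Cc. Proof. exact: le_trans (Cc_ge1 c1). Qed.

Lemma hp_norm_ge0 (u : seqs) : (0 <= hp_norm p u)%E.
Proof.
by rewrite /hp_norm adde_ge0 ?poweR_ge0//; apply: esum_ge0 => j _; rewrite lee_fin cabs_ge0.
Qed.

Lemma hp_norm_cvg (F : set_system R) {FF : Filter F} (f : R -> seqs) :
  (forall e, 0 < e -> \forall s \near F, hle (f s) e) -> hp_norm p (f s) @[s --> F] --> (0 : \bar R)%E.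
Proof.
move=> h; have le s e : hle (f s) e -> (hp_norm p (f s) <= e%:E)%E by move/(hle_hp_norm p0).
have fin s e : hle (f s) e -> hp_norm p (f s) \is a fin_num.
  by move/le => h1; rewrite ge0_fin_numE ?hp_norm_ge0//; apply: le_lt_trans h1 (ltry e).
apply/fine_cvgP; split; first by apply: filterS (h 1 ltr01) => s; exact: fin.
apply/cvgrPdist_le => e e0; apply: filterS (h e e0) => s hs /=.
rewrite sub0r normrN ger0_norm; last by apply: fine_ge0; exact: hp_norm_ge0.
by rewrite -lee_fin fineK; [exact: le|exact: fin hs].
Qed.

Lemma cvg_hp_norm (F : set_system R) {FF : Filter F} (f : R -> seqs) :
  hp_norm p (f s) @[s --> F] --> (0 : \bar R)%E ->
  forall e, 0 < e -> \forall s \near F, hle (f s) e.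
Proof.
move=> /fine_cvgP[h1 /cvgrPdist_le h2] e e0; have h3 := h2 e e0; apply: filterS2 h1 h3 => s fs /=.
rewrite sub0r normrN => hs; apply/(hle_hp_norm p0); rewrite -(fineK fs) lee_fin.
exact: le_trans (ler_norm _) hs.
Qed.

Variables (d : nat) (K : 'M[int]_(d, 2)) (om : 'rV[R]_d).
Notation Z := 'rV[int]_d.
Notation pi := (momentum K).
Variables (P : Z -> nat -> nat -> R[i]) (r0 B : R).
Hypothesis hB : sumle (fun k : Z * nat * nat => cabs (P k.1.1 k.1.2 k.2) * r0 ^+ (k.1.2 + k.2)) B.
Variables (V : Z -> R[i]) (AV rho A : R).
Hypothesis hV : sumle (fun l => cabs (V l) * w (pi l)) AV.
Hypothesis rho0 : 0 < rho.
Hypothesis hQ : sumle (fun x : Z * nat * nat =>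
  cabs (dcoef P x.1.1 x.1.2 x.2) * w (pi x.1.1) * rho ^+ (x.1.2 + x.2)) A.

Lemma fourier_forcing t (u : seqs) M k : hle u M -> Cc * M <= rho -> M < r0 ->
  fourier_coef (forcing K V P om t u) k = Nop K om V (dcoef P) t u k.
Proof.
move=> hu Mr Mr0.
have -> : forcing K V P om t u = torus_fun (Nop K om V (dcoef P) t u).
  by apply/funext => x; rewrite (forcingE w1 c1 wD wN om hB t x rho0 hV hQ hu Mr Mr0).
rewrite fourier_coef_torus//; exact: (hle_summ (Nop_hle w1 c1 wD wN om hV rho0 hQ t hu Mr)).
Qed.

Lemma enorm_sq2 j : enorm R j ^+ 2 = (sq2 j)%:~R.
Proof.
rewrite enorm_sqr big_ord_recl big_ord1 /sq2 intrD !rmorphXn /=.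
by congr ((j _ _)%:~R ^+ 2 + (j _ _)%:~R ^+ 2); exact: val_inj.
Qed.

(** The bootstrap keeps the cut-off curve below [2 r], so the retraction at [4 r] is inactive and
    the curve solves the true equation. *)
Lemma solution_exists (r T : R) : 0 < r -> 0 <= T -> 2 * (Cc * (4 * r)) <= rho -> 4 * r < r0 ->
  (forall u : R -> seqs, (forall t, exists M, forall s, `|s - t| <= 1 -> hle (u s) M) ->
     (forall t k, cder (u ^~ k) t
        ((0 +i* 1) * ((sq2 k)%:~R%:C * u t k + Nop K om V (dcoef P) t (retract w (4 * r) (u t)) k))) ->
     hle (u 0) r -> forall T', T' <= T -> (forall s, `|s| <= T' -> hle (u s) (4 * r)) ->
     forall s, `|s| <= T' -> hle (u s) (2 * r)) ->
  forall u0 : seqs, (hp_norm p u0 <= r%:E)%E -> exists u : R -> seqs,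
    [/\ is_solution K V P r0 p om T u, u 0 = u0,
        (forall v, is_solution K V P r0 p om T v -> v 0 = u0 -> forall t, `|t| <= T -> v t = u t) &
        forall t, `|t| <= T -> (hp_norm p (u t) <= (2 * r)%:E)%E].
Proof.
move=> rp T0 hr r4 hap u0 /(hle_hp_norm p0) hu0.
have r40 : 0 < 4 * r by rewrite mulr_gt0.
have [u [u00 ub uc du]] := evolution w1 c1 wD wN om hV rho0 hQ r40 hr hu0.
have hu00 : hle (u 0) r by rewrite u00.
have bd := bootstrap w1 rp T0 uc (hap u ub du hu00) hu00.
have bd4 t : `|t| <= T -> hle (u t) (4 * r) by move/bd; apply: hle_le; lra.
have CC : Cc * (4 * r) <= rho by apply: le_trans hr; have := mulr_ge0 Cc0 (ltW r40); lra.
have du' t : `|t| <= T -> forall k, cder (u ^~ k) t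
    ((0 +i* 1) * ((sq2 k)%:~R%:C * u t k + Nop K om V (dcoef P) t (u t) k)).
  move=> tT k; have := du t k; have -> // : retract w (4 * r) (u t) = u t.
  by apply/funext => j; exact: (retract_id r40 (bd4 t tT) (lexx _)).
exists u; split => //.
- split.
  + by move=> t tT; apply: le_lt_trans (ltry (2 * r)); apply/(hle_hp_norm p0); exact: bd.
  + move=> t tT; apply: hp_norm_cvg => e e0; rewrite near_withinE.
    by apply: filterS (uc t e e0) => s hs _.
  + move=> t x tT; apply: le_lt_trans r4; apply: csum_le.
    apply: sumle_le (hle_l1 (bd4 t tT)) _ (lexx _) => j; by rewrite cabsM cabs_expi mulr1.
  + move=> t tT k; exists ((0 +i* 1) * ((sq2 k)%:~R%:C * u t k + Nop K om V (dcoef P) t (u t) k)).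
      by apply/cderP; exact: du' (ltW tT) k.
    rewrite (fourier_forcing t k (bd4 t (ltW tT)) CC r4) enorm_sq2 mulrA imaginary_sqr.
    by rewrite mulN1r -addrA addNr.
- move=> v sv v0; apply: (unique_solution w1 c1 wD wN (K := K) (om := om) hV rho0 hQ rp hr).
  + move=> t e _ e0; have /nbhs_ballP[x /= x0 hx] := uc t e e0; exists (x / 2); first by rewrite divr_gt0.
    by move=> s st _; apply: hx; rewrite /ball /= distrC; apply: le_lt_trans st _; lra.
  + move=> t e tT e0; have := cvg_hp_norm (sol_continuous sv tT) e0.
    rewrite near_withinE => h1; have [x /= x0 hx] := (nbhs_ballP _ _).1 (h1 _); exists (x / 2); first by rewrite divr_gt0.
    by move=> s st sT; apply: hx => //; rewrite /ball /= distrC; apply: le_lt_trans st _; lra.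
  + exact: bd.
  + by move=> t tT k; exact: du' (ltW tT) k.
  + move=> t tT hv k; have [x hx] := sol_equation sv tT k.
    rewrite (fourier_forcing t k hv CC r4) enorm_sq2 -addrA => e.
    have -> : (0 +i* 1) * ((sq2 k)%:~R%:C * v t k + Nop K om V (dcoef P) t (v t) k) = x.
      move: e => /eqP; rewrite addrC addr_eq0 => /eqP ->.
      by rewrite mulrN mulrA imaginary_sqr mulN1r opprK.
    exact/cderP.
  + by rewrite v0.
- by move=> t tT; apply/(hle_hp_norm p0); exact: bd.
Qed.
End Solutions.

(** * Quantitative form of the hypotheses on [V] and [P] *)

Section Thresholds.
Variable R : realType.
Variables (d : nat).
Notation Z := 'rV[int]_d.

Lemma esum_sumle (I : choiceType) (g : I -> R) : (forall i, 0 <= g i) ->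
  (\esum_(i in [set: I]) (g i)%:E < +oo)%E -> exists M, sumle g M.
Proof.
move=> g0 h; exists (fine (\esum_(i in [set: I]) (g i)%:E)%E); apply/(sumle_esum _ g0).
by rewrite fineK// ge0_fin_numE//; apply: esum_ge0 => i _; rewrite lee_fin.
Qed.

(** [n1 l] is at most [d] times the Euclidean norm, so the decay rate per unit of [n1] is
    [a / d]. *)
Lemma expR_enorm (a : R) (l : Z) : 0 < a -> (0 < d)%N ->
  expR (- (a * enorm R l)) <= expR (- (a / d%:R)) ^+ n1 l.
Proof.
move=> a0 d0; rewrite -expRM_natl ler_expR mulrN lerN2 mulrA ler_pdivrMr ?ltr0n//.
by rewrite mulrC -mulrA [_ * d%:R]mulrC ler_wpM2l ?(ltW a0)// n1_le_enorm.
Qed.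

Lemma V_norm_coef (a q N : R) (V : Z -> R[i]) l : 0 <= q -> 0 <= N -> (V_norm a q V <= N%:E)%E ->
  cabs (V l) <= N * expR (- (a * enorm R l)).
Proof.
move=> q0 N0; rewrite /V_norm.
set g := fun l : Z => expR (2 * a * enorm R l) * cabs (V l) ^+ 2 * japanese R l `^ (2 * q).
have g0 k : 0 <= g k by rewrite !mulr_ge0 ?expR_ge0 ?sqr_ge0 ?powR_ge0.
set S := esum _ _ => h.
have S0 : (0 <= S)%E by apply: esum_ge0 => k _; rewrite lee_fin; exact: g0.
have Sfin : S \is a fin_num.
  rewrite ge0_fin_numE// ltey; apply/eqP => Se; move: h; rewrite Se poweRyr ?invr_eq0 ?pnatr_eq0//.
move: h; rewrite -(fineK Sfin) poweR_EFin lee_fin powR12_sqrt ?fine_ge0// => h.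
have hS : sumle g (N ^+ 2).
  apply/(sumle_esum _ g0); rewrite -/S -(fineK Sfin) lee_fin -(sqr_sqrtr (fine_ge0 S0)).
  by rewrite lerXn2r ?nnegrE ?sqrtr_ge0.
have := sumle_term l hS; rewrite /g => hl.
have j1 : 1 <= japanese R l `^ (2 * q).
  by rewrite -[leLHS](powRr0 (japanese R l)) ler_powR ?japanese_ge1// mulr_ge0.
have e2 : expR (2 * a * enorm R l) * cabs (V l) ^+ 2 = (expR (a * enorm R l) * cabs (V l)) ^+ 2.
  by rewrite exprMn -expRM_natl mulrA.
rewrite e2 in hl; have h2 : expR (a * enorm R l) * cabs (V l) <= N.
  rewrite -(@ler_pXn2r _ 2)// ?nnegrE ?mulr_ge0 ?expR_ge0 ?cabs_ge0//.
  by apply: le_trans hl; rewrite ler_peMr ?sqr_ge0.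
by rewrite expRN ler_pdivlMr ?expR_gt0// mulrC.
Qed.

(** The rate is split into three factors [y] with [x <= y ^+ 3]: one absorbs the weight of the
    momentum, one the power [tau], and one is left for the summation. *)
Lemma weighted_geometric (p : R) (K : 'M[int]_(d, 2)) (x : R) (tau : nat) : 0 < p -> 0 < x -> x < 1 ->
  exists S, [/\ 0 <= S, sumle (fun l => x ^+ n1 l * phi (wt p) K tau l) S &
    forall l, phi (wt p) K tau l * x ^+ n1 l <= S].
Proof.
move=> p0 x0 x1; pose y := 1 - (1 - x) / 3.
have y0 : 0 < y by rewrite /y; lra.
have y1 : y < 1 by rewrite /y; lra.
have xy : x <= y ^+ 3.
  have := @bernoulli_le R ((1 - x) / 3) 3; rewrite -/y; have -> : 1 - 3%:R * ((1 - x) / 3) = x by field.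
  by apply; apply/andP; split; lra.
have [C1 [C10 h1]] := wt_momentum p0 K y0 y1; have [C2 [C20 h2]] := @poly_bounded R tau y y0 y1.
have ph0 l : 0 <= phi (wt p) K tau l by apply: le_trans (phi_ge1 (wt_ge1 p0) K tau l).
have bd l : phi (wt p) K tau l * x ^+ n1 l <= C1 * C2 * y ^+ n1 l.
  have : x ^+ n1 l <= (y ^+ 3) ^+ n1 l by rewrite lerXn2r ?nnegrE ?exprn_ge0 ?(ltW x0) ?(ltW y0).
  move/(ler_wpM2l (ph0 l))/le_trans; apply; rewrite -exprM mulnC exprM /phi.
  have := ler_pM _ _ (h1 l) (h2 (n1 l)); rewrite !mulr_ge0 ?exprn_ge0 ?(ltW y0)//; last first.
    by apply: le_trans (wt_ge1 p0 _).
  move=> /(_ isT isT)/(ler_wpM2r (exprn_ge0 (n1 l) (ltW y0))); apply: le_trans.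
  by apply: ler_eq; ring.
have G := @sumle_geometric R d y (ltW y0) y1; have C0 : 0 <= C1 * C2 by rewrite mulr_ge0.
exists (C1 * C2 * (2 / (1 - y)) ^+ d + C1 * C2); split.
- by rewrite addr_ge0// mulr_ge0// exprn_ge0// divr_ge0//; lra.
- apply: sumle_le (sumleZ C0 G) _ _ => [l|]; first by rewrite mulrC bd.
  by rewrite lerDl.
- move=> l; apply: le_trans (bd l) _; apply: (@le_trans _ _ (C1 * C2)).
    by rewrite ler_piMr// exprn_ile1// ltW.
  by rewrite lerDr mulr_ge0// exprn_ge0// divr_ge0//; lra.
Qed.
End Thresholds.

Theorem theorem1p4 (R : realType) (d : nat) (hd : (0 < d)%N)
  (K : 'M[int]_(d, 2))
  (hK : \rank (map_mx intr K : 'M[rat]_(d, 2)) = minn d 2)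
  (a q p : R) (ha : 0 < a) (hq : d%:R / 2 < q) (hp : 0 < p)
  (r0 : R) (P : 'rV[int]_d -> nat -> nat -> R[i]) (hP : hypP a r0 P) :
  exists gamma_star eps_star C : R,
    [/\ 0 < gamma_star, 0 < eps_star, 0 < C &
    forall gamma : R, 0 < gamma < gamma_star ->
    forall V : 'rV[int]_d -> R[i], hypV K a q V ->
    ((gamma^-1)%:E * V_norm a q V < eps_star%:E)%E ->
    exists (good : set (d.-tuple (measurableTypeR R))) (r_star T_star : R),
      [/\ measurable good,
          good `<=` @cube R d,
          (lebesgue_tuple (@cube R d `\` good) <= (C * gamma)%:E)%E,
          0 < r_star /\ 0 < T_star &
      forall omega, good omega ->
      forall r : R, 0 < r < r_star ->
      forall u0 : 'rV[int]_2 -> R[i], (hp_norm p u0 <= r%:E)%E ->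
      exists u : R -> 'rV[int]_2 -> R[i],
        let T := T_star / r ^+ 2 in
        let sol := is_solution K V P r0 p (tuple_row omega) T in
        [/\ sol u, u 0 = u0,
            (forall v, sol v -> v 0 = u0 ->
               forall t, `|t| <= T -> v t = u t) &
            forall t, `|t| <= T -> (hp_norm p (u t) <= (2 * r)%:E)%E]]].
Proof.
set ka := expR (- (a / d%:R)).
have ka0 : 0 < ka by rewrite expR_gt0.
have ka1 : ka < 1 by rewrite expR_lt1 oppr_lt0 divr_gt0// ltr0n.
have r00 := hypP_radius hP.
have w1 := wt_ge1 hp; have c1 := wc_ge1 hp; have wD := wtD hp; have wN := @wtN R p.
set w := wt p in w1 wD wN; set c := wc p in c1 wD.
have c0 : 0 <= c by apply: le_trans c1.
have E1 (l : 'rV[int]_d) : 1 <= expR (a * enorm R l).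
  by rewrite -[leLHS](@expR0 R) ler_expR mulr_ge0 ?(ltW ha)// enorm_ge0.
have [M hM] : exists M, sumle (fun k : 'rV[int]_d * nat * nat =>
    cabs (P k.1.1 k.1.2 k.2) * expR (a * enorm R k.1.1) * r0 ^+ (k.1.2 + k.2)) M.
  apply: esum_sumle (hypP_summable hP) => k.
  by rewrite mulr_ge0 ?exprn_ge0 ?(ltW r00)// mulr_ge0 ?cabs_ge0 ?expR_ge0.
have hM' : sumle (fun k : 'rV[int]_d * nat * nat => cabs (P k.1.1 k.1.2 k.2) * r0 ^+ (k.1.2 + k.2)) M.
  apply: sumle_le hM _ (lexx _) => k; rewrite ler_wpM2r ?exprn_ge0 ?(ltW r00)//.
  by rewrite ler_peMr ?cabs_ge0.
pose qw := (1 + ka) / 2.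
have qw0 : 0 < qw by rewrite /qw; lra.
have qw1 : qw < 1 by rewrite /qw; lra.
have kq : ka < qw by rewrite /qw; lra.
have [S1 [S10 hS1 _]] := weighted_geometric K 0 hp qw0 qw1.
have S1p : 0 < 20 * c * (S1 + 1) by rewrite !mulr_gt0 ?(lt_le_trans ltr01 c1)// ltr_wpDl.
(* With this closeness the transformation and its inverse differ from the identity by at most [1/10]
   in norm ([G1s]). *)
pose eps1 := (20 * c * (S1 + 1))^-1.
have eps10 : 0 < eps1 by rewrite invr_gt0.
have [eps0 [C [tau [eps00 C0 hred]]]] := linear_reduction K ka0 kq qw1 eps10.
(* Below [gamma = 1] the reduction applies as it stands; the 1 added to [C] only makes the constant
   positive. *)
exists 1, eps0, (C + 1); split=> //; first by rewrite ltr_wpDl.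
move=> gamma /andP[g0 g1] V hV hVn.
have N0 : 0 <= gamma * eps0 by rewrite mulr_ge0 ?ltW.
have hVc l : cabs (V l) <= gamma * eps0 * ka ^+ n1 l.
  have q0 : 0 <= q by apply: le_trans (ltW hq); rewrite divr_ge0.
  apply: le_trans (V_norm_coef l q0 N0 (_ : (V_norm a q V <= _)%E)) _.
    by move: hVn; rewrite lte_pdivrMl// -EFinM => /ltW.
  by rewrite ler_wpM2l// expR_enorm.
have sV : summ V by apply: (summ_le (sumleZ N0 (@sumle_geometric R d ka (ltW ka0) ka1))) => l; exact: hVc.
have suppV (l : 'rV[int]_d) : \sum_i l 0 i <> 0 -> V l = 0 by move=> hl; apply: (hypV_supp hV); right.
have [good [mg gc gm [gam1 [lam [U [W [gam10 sU sW bUW [UW _ _ hgood]]]]]]]] :=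
  hred gamma V g0 (ltW g1) hVc (potential_hermitian sV (hypV_real hV)) suppV.
have [Sk [Sk0 hSk bSk]] := weighted_geometric K tau hp ka0 ka1.
have [Sq [Sq0 hSq _]] := weighted_geometric K tau hp qw0 qw1.
have [Sp [Sp0 hSp _]] := weighted_geometric K 2 hp qw0 qw1.
have ph1 (t : nat) (l : 'rV[int]_d) := phi_ge1 w1 K t l.
have wph (t : nat) (l : 'rV[int]_d) := w_le_phi w1 K t l.
have hVw : sumle (fun l => cabs (V l) * w (momentum K l)) (gamma * eps0 * Sk).
  apply: sumle_le (sumleZ N0 hSk) _ (lexx _) => l; rewrite mulrA; apply: ler_pM; rewrite ?cabs_ge0//.
  by apply: le_trans (w1 _).
(* Half of the radius pays for the factor [b + 1] of the derivative in [y2], since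
   [b + 1 <= 2 ^ (m + b)]. *)
pose Q := dcoef P; pose rho := r0 / 2.
have rho0 : 0 < rho by rewrite divr_gt0.
pose A := Sk * (M / r0).
have hQphi : sumle (fun x : 'rV[int]_d * nat * nat =>
    cabs (Q x.1.1 x.1.2 x.2) * phi w K tau x.1.1 * rho ^+ (x.1.2 + x.2)) A.
  pose h (x : 'rV[int]_d * nat * nat) := (x.1, x.2.+1).
  have hi : injective h by move=> [y b] [y' b'] [-> ->].
  have S0' : 0 <= Sk / r0 by rewrite divr_ge0// ltW.
  rewrite /A (_ : Sk * (M / r0) = Sk / r0 * M); last by ring.
  apply: sumle_le (sumleZ S0' (sumle_inj hi hM)) _ (lexx _) => -[[l m] b] /=.
  have phE : phi w K tau l <= Sk * expR (a * enorm R l).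
    have := le_trans (ler_wpM2l (le_trans ler01 (ph1 tau l)) (expR_enorm l ha hd)) (bSk l).
    by rewrite expRN ler_pdivrMr ?expR_gt0.
  have bb : b.+1%:R * rho ^+ (m + b) <= r0 ^+ (m + b).
    have b2 : b.+1%:R <= 2 ^+ (m + b) :> R.
      rewrite -natrX ler_nat; apply: leq_trans (ltn_expl b (ltnSn 1)) _.
      by rewrite leq_exp2l// leq_addl.
    have := ler_wpM2r (exprn_ge0 (m + b) (ltW rho0)) b2; rewrite -exprMn.
    by rewrite (_ : 2 * rho = r0)// /rho mulrC divfK.
  rewrite /Q /dcoef cabsM cabs_nat addnS exprSr.
  have h1 := ler_pM (le_trans ler01 (ph1 tau l)) (mulr_ge0 (ler0n R b.+1) (exprn_ge0 (m + b) (ltW rho0))) phE bb.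
  have := ler_wpM2l (cabs_ge0 (P l m b.+1)) h1.
  have r0n : r0 != 0 by rewrite gt_eqF.
  rewrite (_ : Sk / r0 * _ = cabs (P l m b.+1) * (Sk * expR (a * enorm R l) * r0 ^+ (m + b))); last by field.
  by apply: le_trans; apply: ler_eq; ring.
have rhok n : 0 <= rho ^+ n by rewrite exprn_ge0 ?ltW.
have hQ : sumle (fun x : 'rV[int]_d * nat * nat =>
    cabs (Q x.1.1 x.1.2 x.2) * w (momentum K x.1.1) * rho ^+ (x.1.2 + x.2)) A.
  by apply: sumle_le hQphi _ (lexx _) => x; rewrite ler_wpM2r// ler_wpM2l ?cabs_ge0.
have hQ2 : sumle (fun x : 'rV[int]_d * nat * nat => cabs (Qdeg2 Q x.1.1 x.1.2 x.2) * phi w K tau x.1.1) (rho ^- 2 * A).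
  have r2 : 0 <= rho ^- 2 by rewrite invr_ge0.
  apply: sumle_le (sumleZ r2 hQphi) _ (lexx _) => x; rewrite /Qdeg2; case: eqP => [->|_].
    by rewrite [leRHS]mulrC mulfK// expf_neq0// gt_eqF.
  by rewrite cabs0 mul0r mulr_ge0// mulr_ge0// mulr_ge0 ?cabs_ge0// (le_trans ler01).
have Qlow l m b : (m + b < 2)%N -> Q l m b = 0.
  by move=> mb; rewrite /Q /dcoef (hypP_order hP) ?mulr0// addnS.
have suppQ (l : 'rV[int]_d) (m b : nat) : (\sum_i l 0 i) + m%:Z - b.+1%:Z <> 0 -> Q l m b = 0.
  by move=> h; rewrite /Q /dcoef (gauge_coef r00 hM' (hypP_gauge hP)) ?mulr0.
have e1p : 0 <= 1 + eps1 by rewrite addr_ge0 ?ltW.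
pose g (l : 'rV[int]_d) := (1 + eps1) * qw ^+ n1 l.
pose g' (l : 'rV[int]_d) := eps1 * qw ^+ n1 l.
have gN l : g (- l) = g l by rewrite /g n1N.
have hg : sumle (fun l => g l * phi w K tau l) ((1 + eps1) * Sq).
  by apply: sumle_le (sumleZ e1p hSq) _ (lexx _) => l; rewrite /g -[leLHS]mulrA lexx.
have qn l : 0 <= qw ^+ n1 (l : 'rV[int]_d) by rewrite exprn_ge0 ?ltW.
have hg2 : sumle (fun l => g l * (n1 l).+1%:R ^+ 2) ((1 + eps1) * Sp).
  apply: sumle_le (sumleZ e1p hSp) _ (lexx _) => l; rewrite /g [leRHS]mulrA; apply: ler_wpM2l; first exact: mulr_ge0.
  by rewrite /phi ler_peMl// exprn_ge0.
have hg' : sumle (fun l => g' l * w (momentum K l)) (eps1 * S1).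
  apply: sumle_le (sumleZ (ltW eps10) hS1) _ (lexx _) => l; rewrite /g' [leRHS]mulrA; apply: ler_wpM2l; last exact: wph.
  by apply: mulr_ge0 => //; exact: ltW.
have G1s : 2 * c * (eps1 * S1) <= 10^-1.
  rewrite /eps1 [_^-1 * S1]mulrC mulrA ler_pdivrMr//.
  clear -c0; lra.
pose Kd := Kdrift w c rho A ((1 + eps1) * Sq) (rho ^- 2 * A) gam1.
pose Kc := Kcorr c ((1 + eps1) * Sq) (rho ^- 2 * A) gam1.
have Kdp : 0 < 10 * (`|Kd| + 1) by rewrite mulr_gt0// ltr_wpDl.
have Kcp : 0 < 10 * (`|Kc| + 1) by rewrite mulr_gt0// ltr_wpDl.
have Cc0 : 0 <= Cc c by apply: le_trans (Cc_ge1 c1).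
have Ccp : 0 < 8 * Cc c + 1 by rewrite ltr_wpDl// mulr_ge0.
(* This makes the drift over the time [T_star / r ^+ 2] at most [r / 10]; in [r_star] the three
   bounds keep [4 r] inside the convergence radius with the margin of [Nop_lip], inside the domain
   of [P], and the correction below [r / 10]. *)
pose T_star := (10 * (`|Kd| + 1))^-1.
pose r_star := Num.min (Num.min (rho / (8 * Cc c + 1)) (r0 / 8)) (10 * (`|Kc| + 1))^-1.
have Ts0 : 0 < T_star by rewrite invr_gt0.
exists good, r_star, T_star; split=> //.
- by apply: le_trans gm _; rewrite lee_fin ler_wpM2r ?(ltW g0)// lerDl.
- by split=> //; rewrite !lt_min !divr_gt0//= invr_gt0.
move=> omega hom r /andP[rp rs] u0 hu0.
have [Weq nonres] := hgood omega hom.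
have rr : [/\ r * (8 * Cc c + 1) < rho, r < r0 / 8 & r * (10 * (`|Kc| + 1)) < 1].
  by move: rs; rewrite !lt_min => /andP[/andP[h1 ->] h2]; rewrite -ltr_pdivlMr// h1 -ltr_pdivlMr// mul1r.
have [hr1 hr2 hr3] := rr.
have T0 : 0 <= T_star / r ^+ 2 by rewrite divr_ge0 ?sqr_ge0// ltW.
have hr : 2 * (Cc c * (4 * r)) <= rho.
  by clear -hr1 rp; lra.
have r4 : 4 * r < r0 by clear -hr2 rp; lra.
set om := tuple_row omega.
have om1 i : `|om 0 i| <= 1.
  by rewrite /om /tuple_row mxE ler_norml; have := gc _ hom i.
pose Uo l j := U l (j, om); pose Wo l j := W l (j, om).
have near_sym (X : 'rV[int]_d -> 'rV[int]_2 -> R[i]) : (forall l j, cabs (X l j - (l == 0)%:R) <= eps1 * qw ^+ n1 l) -> sym_le X g.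
  move=> h l j; rewrite -(subrK (l == 0)%:R (X l j)); apply: le_trans (cabsD _ _) _.
  rewrite /g mulrDl mul1r addrC; apply: lerD; last exact: h.
  by case: eqP => [->|_]; rewrite ?n1_0 ?expr0 ?cabs1 ?cabs0.
have hU' : sym_le (fun l j => Uo l j - (l == 0)%:R) g' by move=> l j; exact: (bUW l (j, om)).1.
have hW' : sym_le (fun l j => Wo l j - (l == 0)%:R) g' by move=> l j; exact: (bUW l (j, om)).2.
apply: (solution_exists hp (K := K) (om := om) hM' hVw rho0 hQ rp T0 hr r4) => // u ub du hu T' T'T h4 s sT.
have T'0 : 0 <= T' by apply: le_trans sT.
apply: (apriori w1 c1 wD wN rho0 hQ Qlow hVw gN gam10 hg hg2 hg' G1s hQ2 suppQ (om := om) (U := Uo) (W := Wo)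
  (lam := fun j => lam (j, om)) om1 (near_sym _ hU') (near_sym _ hW') hU' hW' _ _ _ _ _ rp hr ub du hu h4 _ _ sT).
- by move=> l j; exact: (UW l (j, om)).
- by move=> l j; exact: (Weq l j).
- by move=> l j1 j2 j3 s1 s2 s3; exact: (nonres l j1 j2 j3 s1 s2 s3).
- by move=> l j; exact: (sU l (j, om)).
- by move=> l j; exact: (sW l (j, om)).
- rewrite -/Kd; have r2 : 0 < r ^+ 2 by rewrite exprn_gt0.
  have h1 : r ^+ 2 * T' <= T_star by rewrite mulrC -ler_pdivlMr.
  apply: le_trans (_ : `|Kd| * T_star <= _).
    rewrite -mulrA; apply: le_trans (ler_wpM2r (mulr_ge0 (ltW r2) T'0) (ler_norm Kd)) _.
    by rewrite ler_wpM2l.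
  by rewrite /T_star ler_pdivrMr//; have K0 := normr_ge0 Kd; clear -K0; lra.
- rewrite -/Kc; have K1 := ler_wpM2r (ltW rp) (ler_norm Kc); clear -K1 hr3 rp; lra.
Qed.
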